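(* There is an absolute constant $c$ such that the following holds. Suppose $f\in\mathbb{C}[x,y]$ is neither additive nor multiplicative. Then for all $\varepsilon>0$ there exists $C$ such that for all finite $A,B\subseteq\mathbb{C}$ with $|A|\geq|B|\geq|A|^{\varepsilon}\geq C$, we have $$|f(A,B)|\geq|A|^{1+2^{-c\varepsilon^{-1}}}.$$
   Context: A polynomial $f\in\mathbb{C}[x,y]$ is additive if $f(x,y)=g(h(x)+k(y))$ for some $g,h,k\in\mathbb{C}[t]$, and multiplicative if $f(x,y)=g(h(x)\cdot k(y))$ for some $g,h,k\in\mathbb{C}[t]$. For sets $A,B$, $f(A,B):=\{f(a,b):a\in A,\ b\in B\}$. *)

(* Defs.v *)
From HB Require Import structures.
From mathcomp Require Import all_boot all_order all_algebra finmap complex.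
From mathcomp Require Import reals exp.

Set Implicit Arguments.
Unset Strict Implicit.
Unset Printing Implicit Defensive.

Import GRing.Theory.
Local Open Scope ring_scope.
Local Open Scope fset_scope.

(* Bivariate polynomials follow polyXY: x is the outer variable 'X and y is the
   inner variable 'Y = 'X%:P, so that h^:P is h(x), k%:P is k(y), f.[a, b] is
   f(a, b), and g^:P \Po q is g(q(x, y)). *)

Definition additive_poly (F : fieldType) (f : {poly {poly F}}) : Prop :=
  exists g h k : {poly F}, f = g^:P \Po (h^:P + k%:P).

Definition multiplicative_poly (F : fieldType) (f : {poly {poly F}}) : Prop :=
  exists g h k : {poly F}, f = g^:P \Po (h^:P * k%:P).

Definition poly_image (F : fieldType) (f : {poly {poly F}})
    (A B : {fset F}) : {fset F} :=
  [fset f.[a, b] | a in A, b in B].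

(* Main.v *)
(* If |f(A,B)| <= K|A| with K a small power of |B|, a contradiction is reached in one of two ways.

   Affine case: h' f_y/f_x is affine in h(x), with coefficients in C(y) that are linearly
   independent over C. After normalization and pigeonholing, f(x,b) is a fixed
   polynomial of g_b(h(x)) for a family of affine maps g_b, so many g_b send a set of size n into
   a set of size O(Kn). The convolution powers of the family act on the indicator function with
   slowly growing L^2 norms; a conjugate of some g_b^-1 g_b' by further words is a translation,
   which gives many almost-periods, and an energy estimate for the scalings multiplies their
   number by a power of |B| at each backward step, until it exceeds n.

   General case: for almost all c there is a point xi with f_x(xi,c) = 0 <> f_y(xi,c) at which,
   for almost all b, the quotient f_y(.,b)/f_x(.,b) is not a function of f(.,c). Following paths
   f(x_i,b_i) = f(x_(i+1),c_(i+1)) near critical points, where speeds blow up, shows that a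
   nondegenerate system of such path equations has boundedly many solutions. On the other hand, a
   covering of A by cells of neighbouring points, whose images are close to one another in
   f(A,B), produces too many walks of this kind. *)
Require Import Defs.
From HB Require Import structures.
From mathcomp Require Import all_boot all_order all_algebra all_field complex.
From mathcomp Require Import boolp reals.
From mathcomp Require classical_sets cardinality set_interval filter ereal measure lebesgue_measure.
From mathcomp Require Import ring lra zify.

Set Implicit Arguments.
Unset Strict Implicit.
Unset Printing Implicit Defensive.

Import Order.TTheory GRing.Theory Num.Theory.
Local Open Scope ring_scope.

(** * Quantifier elimination and isolated zeros *)

(** The split into two cases reflects a dichotomy for vector fields. Each $b$ carries the field
    $(f_y/f_x)(\cdot,b)\,\partial_x$, and path systems can degenerate when such fields are pulled
    back along $f(\cdot,c)$. If this happens at all critical points, the fields lie in a Lie algebra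
    of rational fields of bounded degree; comparing degrees in brackets leaves dimension one, where
    $f$ is additive or multiplicative, or the two-dimensional affine algebra. In the general case
    $n+1$ unknown letters are pinned down by $n+1$ paths of the same word. Unrelated starting points
    would allow $|f(A,B)|^{n+1}$ systems of final values and make the count void; starting points
    taken in one cell leave a single factor $|f(A,B)|$ and small losses. The exponent
    $2^{-c/\varepsilon}$ is dictated by the affine case: each backward step squares the available
    correlation, and a number of steps proportional to $1/\varepsilon$ is required. The general case
    loses only a cubic polynomial in $1/\varepsilon$. *)

Definition ocons (I T : Type) (x : T) (v : I -> T) (o : option I) : T :=
  if o is Some i then v i else x.

Definition scons (I J T : Type) (v : I -> T) (w : J -> T) (o : I + J) : T :=
  match o with inl i => v i | inr j => w j end.

Inductive polyfun (F : comNzRingType) (I : Type) : ((I -> F) -> F) -> Prop :=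
| PFconst c : polyfun (fun _ => c)
| PFvar i : polyfun (fun v => v i)
| PFadd p q : polyfun p -> polyfun q -> polyfun (fun v => p v + q v)
| PFmul p q : polyfun p -> polyfun q -> polyfun (fun v => p v * q v).

(** First-order formulas in the language of rings, represented by the predicates that they define,
    so that conditions on paths and derivatives need no separate syntax. Valuations are indexed by
    an arbitrary type, to which a quantifier adds the point [None]. *)
Inductive definable (F : comNzRingType) :
    forall I : Type, ((I -> F) -> Prop) -> Prop :=
| DFeq0 I (p : (I -> F) -> F) : polyfun p -> definable (fun v => p v = 0)
| DFand I (P Q : (I -> F) -> Prop) :
    definable P -> definable Q -> definable (fun v => P v /\ Q v)
| DFnot I (P : (I -> F) -> Prop) : definable P -> definable (fun v => ~ P v)
| DFex I (P : (option I -> F) -> Prop) :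
    definable P -> definable (fun v => exists x, P (ocons x v)).

Section PolyFun.
Variable F : comNzRingType.

Lemma polyfun_opp I (p : (I -> F) -> F) : polyfun p -> polyfun (fun v => - p v).
Proof.
move=> hp; have -> : (fun v => - p v) = (fun v => -1 * p v).
  by apply: funext => v; rewrite mulN1r.
by apply: PFmul => //; apply: PFconst.
Qed.

Lemma polyfun_sub I (p q : (I -> F) -> F) :
  polyfun p -> polyfun q -> polyfun (fun v => p v - q v).
Proof. by move=> hp hq; apply: PFadd => //; apply: polyfun_opp. Qed.

Lemma polyfun_exp I (p : (I -> F) -> F) n :
  polyfun p -> polyfun (fun v => p v ^+ n).
Proof.
move=> hp; elim: n => [|n IH]; first exact: (PFconst _ 1).
have -> : (fun v => p v ^+ n.+1) = (fun v => p v * p v ^+ n).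
  by apply: funext => v; rewrite exprS.
exact: PFmul.
Qed.

Lemma polyfun_sum I (J : Type) (r : seq J) (Q : pred J) (p : J -> (I -> F) -> F) :
  (forall j, polyfun (p j)) -> polyfun (fun v => \sum_(j <- r | Q j) p j v).
Proof.
move=> hp; elim: r => [|j r IH].
  have -> : (fun v => \sum_(j <- [::] | Q j) p j v) = fun _ => 0.
    by apply: funext => v; rewrite big_nil.
  exact: PFconst.
case Qj : (Q j).
  have -> : (fun v => \sum_(j0 <- j :: r | Q j0) p j0 v) =
      (fun v => p j v + \sum_(j <- r | Q j) p j v).
    by apply: funext => v; rewrite big_cons Qj.
  exact: PFadd.
have -> // : (fun v => \sum_(j0 <- j :: r | Q j0) p j0 v) =
    (fun v => \sum_(j <- r | Q j) p j v).
by apply: funext => v; rewrite big_cons Qj.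
Qed.

Lemma polyfun_horner I (q : {poly F}) (p : (I -> F) -> F) :
  polyfun p -> polyfun (fun v => q.[p v]).
Proof.
move=> hp; have -> : (fun v => q.[p v]) =
    (fun v => \sum_(i < size q) q`_i * p v ^+ i).
  by apply: funext => v; rewrite horner_coef.
apply: polyfun_sum => i; apply: PFmul; [exact: PFconst|exact: polyfun_exp].
Qed.

Lemma polyfun_horner2 I (f : {poly {poly F}}) (p q : (I -> F) -> F) :
  polyfun p -> polyfun q -> polyfun (fun v => f.[(p v)%:P].[q v]).
Proof.
move=> hp hq; have -> : (fun v => f.[(p v)%:P].[q v]) =
    (fun v => \sum_(i < size f) (f`_i).[q v] * p v ^+ i).
  apply: funext => v; rewrite (horner_coef f) horner_sum.
  by apply: eq_bigr => i _; rewrite hornerM -rmorphXn hornerC.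
apply: polyfun_sum => i; apply: PFmul; [exact: polyfun_horner|exact: polyfun_exp].
Qed.

Lemma polyfun_comp I J (p : (I -> F) -> F) (phi : I -> (J -> F) -> F) :
  polyfun p -> (forall i, polyfun (phi i)) -> polyfun (fun v => p (phi ^~ v)).
Proof.
move=> hp hphi; elim: p / hp => [c|i|p q _ hp _ hq|p q _ hp _ hq] //=.
- exact: PFconst.
- exact: PFadd.
- exact: PFmul.
Qed.

Lemma definable_ext I (P Q : (I -> F) -> Prop) :
  definable P -> (forall v, P v <-> Q v) -> definable Q.
Proof. by move=> hP hPQ; have <- : P = Q by apply: funext => v; apply: propext. Qed.

Lemma definable_comp I (P : (I -> F) -> Prop) : definable P ->
  forall J (phi : I -> (J -> F) -> F), (forall i, polyfun (phi i)) ->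
  definable (fun v => P (phi ^~ v)).
Proof.
elim=> {I P} [I p hp|I P Q _ hP _ hQ|I P _ hP|I P _ hP] J phi hphi.
- by apply: (DFeq0 (p := fun v => p (phi ^~ v))); apply: polyfun_comp.
- by apply: DFand; [apply: hP|apply: hQ].
- by apply: DFnot; apply: hP.
pose psi (o : option I) (v : option J -> F) : F :=
  if o is Some i then phi i (fun j => v (Some j)) else v None.
have hpsi o : polyfun (psi o).
  case: o => [i|]; last exact: PFvar.
  by apply: (polyfun_comp (p := phi i)) => // j; apply: PFvar.
apply: definable_ext (DFex (hP _ psi hpsi)) _ => v.
have E x : (psi^~ (ocons x v)) = ocons x (phi ^~ v) by apply: funext => -[].
by split=> -[x]; exists x; rewrite ?E // -E.
Qed.

Lemma definable_reindex I J (P : (I -> F) -> Prop) (g : I -> J) :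
  definable P -> definable (fun v : J -> F => P (v \o g)).
Proof.
by move=> hP; apply: (definable_comp hP (phi := fun i v => v (g i))) => i;
  apply: PFvar.
Qed.

Lemma definable_or I (P Q : (I -> F) -> Prop) :
  definable P -> definable Q -> definable (fun v => P v \/ Q v).
Proof.
move=> hP hQ; apply: definable_ext (DFnot (DFand (DFnot hP) (DFnot hQ))) _ => v.
by split; [move/not_andP => [/contrapT|/contrapT]; tauto|tauto].
Qed.

Lemma definable_imp I (P Q : (I -> F) -> Prop) :
  definable P -> definable Q -> definable (fun v => P v -> Q v).
Proof.
move=> hP hQ; apply: definable_ext (definable_or (DFnot hP) hQ) _ => v.
by split; [tauto|move=> h; case: (EM (P v)); tauto].
Qed.

Lemma definable_eq I (p q : (I -> F) -> F) :
  polyfun p -> polyfun q -> definable (fun v => p v = q v).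
Proof.
move=> hp hq; apply: definable_ext (DFeq0 (polyfun_sub hp hq)) _ => v.
by split => /eqP; [rewrite subr_eq0 => /eqP|move=> /eqP ->; rewrite subrr].
Qed.

Lemma definable_const I (Q : Prop) : definable (fun _ : I -> F => Q).
Proof.
case: (EM Q) => hQ.
  apply: definable_ext (DFeq0 (PFconst I (0 : F))) _ => v; split=> //.
apply: definable_ext (DFnot (DFeq0 (PFconst I (0 : F)))) _ => v; split=> //.
Qed.

Lemma definable_alln I (J : finType) (P : J -> (I -> F) -> Prop) :
  (forall j, definable (P j)) -> definable (fun v => forall j, P j v).
Proof.
move=> hP.
suff h (s : seq J) : definable (fun v => forall j, j \in s -> P j v).
  by apply: definable_ext (h (enum J)) _ => v; split=> h' j; [apply: h'; rewrite mem_enum|].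
elim: s => [|j s IH].
  by apply: definable_ext (definable_const I True) _ => v; split.
apply: definable_ext (DFand (hP j) IH) _ => v; split.
  by move=> [h1 h2] i; rewrite inE => /orP[/eqP ->|/h2].
by move=> h; split=> [|i hi]; apply: h; rewrite inE ?eqxx ?hi ?orbT.
Qed.

Lemma definable_exs_ord I m (P : (I + 'I_m -> F) -> Prop) :
  definable P -> definable (fun v => exists w, P (scons v w)).
Proof.
elim: m I P => [|m IH] I P hP.
  have h0 : forall j : 'I_0, False by case.
  pose phi (o : I + 'I_0) (v : I -> F) : F :=
    match o with inl i => v i | inr j => False_rect _ (h0 j) end.
  have hphi o : polyfun (phi o) by case: o => [i|[]//]; apply: PFvar.
  apply: definable_ext (definable_comp hP hphi) _ => v.
  have E w : phi^~ v = scons v w by apply: funext => -[|[]].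
  split=> [h|[w]]; last by rewrite -(E w).
  by exists (fun=> 0); rewrite -E.
pose g (o : I + 'I_m.+1) : option I + 'I_m :=
  match o with
  | inl i => inl (Some i)
  | inr j => if unlift ord0 j is Some j' then inr j' else inl None
  end.
apply: definable_ext (DFex (IH _ _ (definable_reindex g hP))) _ => v.
split=> [[x [w h]]|[w h]].
  exists (fun j => if unlift ord0 j is Some j' then w j' else x).
  suff -> : scons v (fun j => if unlift ord0 j is Some j' then w j' else x) =
    scons (ocons x v) w \o g by [].
  by apply: funext => -[i|j] //=; case: unliftP.
exists (w ord0), (fun j : 'I_m => w (lift ord0 j)).
suff -> : scons (ocons (w ord0) v) (fun j : 'I_m => w (lift ord0 j)) \o g = scons v w by [].
by apply: funext => -[i|j] //=; case: unliftP => [j' ->|->].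
Qed.

Lemma definable_exs I (J : finType) (P : (I + J -> F) -> Prop) :
  definable P -> definable (fun v => exists w, P (scons v w)).
Proof.
move=> hP.
pose g (o : I + J) : I + 'I_#|J| :=
  match o with inl i => inl i | inr j => inr (enum_rank j) end.
apply: definable_ext (definable_exs_ord (definable_reindex g hP)) _ => v.
split=> -[w h].
  exists (fun j => w (enum_rank j)).
  suff -> : scons v (fun j => w (enum_rank j)) = scons v w \o g by [].
  by apply: funext => -[].
exists (fun j => w (enum_val j)).
suff -> : scons v (fun j => w (enum_val j)) \o g = scons v w by [].
by apply: funext => -[i|j] //=; rewrite enum_rankK.
Qed.

Lemma definable_alls I (J : finType) (P : (I + J -> F) -> Prop) :
  definable P -> definable (fun v => forall w, P (scons v w)).
Proof.
move=> hP; apply: definable_ext (DFnot (definable_exs (DFnot hP))) _ => v.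
split; first by move=> h x; apply: contrapT => hx; apply: h; exists x.
by move=> h [x]; apply.
Qed.

End PolyFun.

(** Strong minimality with an explicit size: over an algebraically closed field a definable subset
    of the line is finite or cofinite, and [N] can be chosen independently of the parameters. *)
Definition fincofin (T : eqType) (N : nat) (P : T -> Prop) : Prop :=
  exists s : seq T, (size s <= N)%N /\
    ((forall x, P x -> x \in s) \/ (forall x, ~ P x -> x \in s)).

Lemma fincofin_not (T : eqType) N (P : T -> Prop) :
  fincofin N P -> fincofin N (fun x => ~ P x).
Proof.
move=> [s [hs [h|h]]]; exists s; split=> //; [right|left] => x; last exact: h.
by move/contrapT/h.
Qed.

Lemma fincofin_and (T : eqType) N M (P Q : T -> Prop) :
  fincofin N P -> fincofin M Q -> fincofin (N + M) (fun x => P x /\ Q x).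
Proof.
move=> [s [hs hP]] [t [ht hQ]]; exists (s ++ t).
split; first by rewrite size_cat leq_add.
case: hP => [hP|hP]; first by left=> x [/hP hx _]; rewrite mem_cat hx.
case: hQ => [hQ|hQ]; first by left=> x [_ /hQ hx]; rewrite mem_cat hx orbT.
right=> x /not_andP[/hP|/hQ] hx; rewrite mem_cat hx ?orbT //.
Qed.

Lemma fincofin_ext (T : eqType) N (P Q : T -> Prop) :
  fincofin N P -> (forall x, P x <-> Q x) -> fincofin N Q.
Proof. by move=> h hPQ; have <- : P = Q by apply: funext => x; apply: propext. Qed.

Section ClosedQE.
Import ClosedFieldQE.
Variable F : closedFieldType.

Lemma polyfun_term I (p : (I -> F) -> F) (n : I -> nat) : polyfun p ->
  exists2 t : GRing.term F, GRing.rterm t &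
    forall e : seq F, GRing.eval e t = p (fun i => e`_(n i)).
Proof.
elim=> [c|i|p1 p2 _ [t1 r1 h1] _ [t2 r2 h2]|p1 p2 _ [t1 r1 h1] _ [t2 r2 h2]].
- by exists (GRing.Const c).
- by exists (GRing.Var _ (n i)).
- exists (GRing.Add t1 t2) => [|e] /=; [by rewrite r1|by rewrite h1 h2].
- exists (GRing.Mul t1 t2) => [|e] /=; [by rewrite r1|by rewrite h1 h2].
Qed.

Lemma definable_formula I (P : (I -> F) -> Prop) : definable P ->
  forall (n : I -> nat) N, (forall i, (n i < N)%N) ->
  exists2 phi : GRing.formula F, GRing.rformula phi &
    forall e : seq F, GRing.holds e phi <-> P (fun i => e`_(n i)).
Proof.
elim=> {I P} [I p hp|I P Q _ hP _ hQ|I P _ hP|I P _ hP] n N hN.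
- have [t rt ht] := polyfun_term n hp.
  exists (GRing.Equal t (GRing.Const 0)) => [|e] /=; first by rewrite rt.
  by rewrite ht.
- have [s rs hs] := hP n N hN; have [t rt ht] := hQ n N hN.
  exists (GRing.And s t) => [|e] /=; first by rewrite rs.
  by rewrite hs ht.
- have [s rs hs] := hP n N hN; exists (GRing.Not s) => [//|e] /=.
  by rewrite hs.
(* [N] exceeds every index of a free variable, so it can name the bound one. *)
pose m (o : option I) := if o is Some i then n i else N.
have hm o : (m o < N.+1)%N by case: o => [i|] /=; [rewrite ltnS ltnW|rewrite ltnSn].
have [s rs hs] := hP m N.+1 hm; exists (GRing.Exists N s) => [//|e] /=.
have E x : (fun i => (set_nth 0 e N x)`_(m i)) = ocons x (fun i => e`_(n i)).
  apply: funext => -[i|] /=; rewrite nth_set_nth /= ?eqxx //.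
  by rewrite (ltn_eqF (hN i)).
by split=> -[x]; [move/hs|move=> h]; exists x; rewrite -?E // hs E.
Qed.

Lemma qf_fincofin (phi : GRing.formula F) (i : nat) :
  GRing.qf_form phi -> GRing.rformula phi ->
  exists N, forall e, fincofin N (fun x => GRing.holds (set_nth 0 e i x) phi).
Proof.
have term_fc (t : GRing.term F) : GRing.rterm t ->
    exists N, forall e, fincofin N (fun x => GRing.eval (set_nth 0 e i x) t = 0).
  (* [abstrX] views the term as a polynomial in the variable [i] with terms as coefficients; its
     length bounds the number of roots in all environments at once. *)
  move=> rt; exists (size (abstrX i t)) => e.
  set p := eval_poly e (abstrX i t).
  have sp : (size p <= size (abstrX i t))%N.
    rewrite /p; elim: (abstrX i t) => [|c q IH] /=; first by rewrite size_poly0.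
    rewrite size_MXaddC; by case: ifP.
  have hp x : p.[x] = GRing.eval (set_nth 0 e i x) t by rewrite /p abstrXP.
  have [p0|p0] := eqVneq p 0.
    exists [::]; split=> //; right=> x []; rewrite -hp p0 horner0 //.
  have [r hr] := closed_field_poly_normal p.
  exists r; split.
    apply: leq_trans sp; rewrite hr size_scale ?lead_coef_eq0 //.
    by rewrite size_prod_XsubC.
  left=> x; rewrite -hp => px.
  have : root p x by apply/rootP.
  rewrite hr rootZ ?lead_coef_eq0 // root_prod_XsubC //.
elim: phi => //=.
- move=> b _ _; exists 0%N => e; exists [::]; split=> //.
  by case: b; [right|left].
- move=> t1 t2 _ /andP[r1 r2].
  have [N hN] := term_fc (GRing.Add t1 (GRing.Opp t2)) (introT andP (conj r1 r2)).
  exists N => e; apply: fincofin_ext (hN e) _ => x /=.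
  by split=> /eqP; [rewrite subr_eq0 => /eqP|move=> /eqP ->; rewrite subrr].
- move=> f1 IH1 f2 IH2 /andP[q1 q2] /andP[r1 r2].
  have [N hN] := IH1 q1 r1; have [M hM] := IH2 q2 r2.
  by exists (N + M)%N => e; apply: fincofin_and.
- move=> f1 IH1 f2 IH2 /andP[q1 q2] /andP[r1 r2].
  have [N hN] := IH1 q1 r1; have [M hM] := IH2 q2 r2.
  exists (N + M)%N => e.
  apply: fincofin_ext (fincofin_not (fincofin_and (fincofin_not (hN e))
    (fincofin_not (hM e)))) _ => x.
  by split; [move/not_andP => [/contrapT|/contrapT]; tauto|tauto].
- move=> f1 IH1 f2 IH2 /andP[q1 q2] /andP[r1 r2].
  have [N hN] := IH1 q1 r1; have [M hM] := IH2 q2 r2.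
  exists (N + M)%N => e.
  apply: fincofin_ext (fincofin_not (fincofin_and (hN e)
    (fincofin_not (hM e)))) _ => x.
  split; first by move/not_andP => [|/contrapT]; tauto.
  by move=> h [/h].
- move=> f1 IH1 q1 r1; have [N hN] := IH1 q1 r1.
  by exists N => e; apply: fincofin_not.
Qed.

(** Quantifier elimination leaves Boolean combinations of equations in one variable whose degrees do
    not depend on the parameters. *)
Lemma definable_fincofin (I : finType) (P : (option I -> F) -> Prop) :
  definable P -> exists N, forall v, fincofin N (fun x => P (ocons x v)).
Proof.
move=> hP.
pose n (o : option I) := if o is Some i then nat_of_ord (enum_rank i) else #|I|.
have hn o : (n o < #|I|.+1)%N.
  by case: o => [i|] /=; [rewrite ltnS ltnW|rewrite ltnSn].
have [phi rphi hphi] := definable_formula hP hn.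
set psi := GRing.quantifier_elim (@ex_elim F) phi.
have /andP[qpsi rpsi] : GRing.qf_form psi && GRing.rformula psi.
  exact: (GRing.quantifier_elim_wf (@wf_ex_elim F)).
have [N hN] := qf_fincofin #|I| qpsi rpsi.
exists N => v; pose e := [seq v i | i <- enum I].
apply: fincofin_ext (hN e) _ => x.
have E : (fun i => (set_nth 0 e #|I| x)`_(n i)) = ocons x v.
  apply: funext => -[i|] /=; rewrite nth_set_nth /= ?eqxx //.
  rewrite (ltn_eqF (ltn_ord _)) (nth_map i) ?nth_enum_rank //.
  by rewrite -cardE ltn_ord.
rewrite -E -hphi.
have ax := GRing.quantifier_elim_rformP (@wf_ex_elim F)
  (holds_ex_elim (@solve_monicpoly F)) (set_nth 0 e #|I| x) rphi.
split=> [/(GRing.qf_evalP _ qpsi) h|/ax h]; first exact/ax.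
exact/(GRing.qf_evalP _ qpsi).
Qed.

End ClosedQE.

(** * Isolated solutions of definable systems over the complex numbers *)

Section Isolation.
Import classical_sets cardinality set_interval ereal measure lebesgue_measure.

Section Cabs.
Variable R : rcfType.
Local Notation C := R[i].
Local Open Scope complex_scope.

(** The norm of [R[i]] takes its values in [R[i]]; the real-valued modulus gives access to the total
    order of [R]. *)
Definition cabs (z : C) : R := complex.Re `|z|.

Lemma cabsE z : `|z| = (cabs z)%:C.
Proof. by rewrite /cabs normc_def. Qed.

Lemma cabs_ge0 z : 0 <= cabs z.
Proof. by rewrite -ler0c -cabsE. Qed.

Lemma cabs0 : cabs 0 = 0.
Proof. by rewrite /cabs normr0. Qed.

Lemma cabs1 : cabs 1 = 1.
Proof. by rewrite /cabs normr1. Qed.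

Lemma cabsM x y : cabs (x * y) = cabs x * cabs y.
Proof. by apply: complexI; rewrite -cabsE normrM !cabsE rmorphM. Qed.

Lemma cabsX x n : cabs (x ^+ n) = cabs x ^+ n.
Proof. by elim: n => [|n IH]; rewrite ?expr0 ?cabs1 // !exprS cabsM IH. Qed.

Lemma cabsD x y : cabs (x + y) <= cabs x + cabs y.
Proof. by rewrite -lecR rmorphD -!cabsE ler_normD. Qed.

Lemma cabsN x : cabs (- x) = cabs x.
Proof. by rewrite /cabs normrN. Qed.

Lemma cabsB x y : cabs (x - y) = cabs (y - x).
Proof. by rewrite -cabsN opprB. Qed.

Lemma cabsV x : cabs x^-1 = (cabs x)^-1.
Proof. by apply: complexI; rewrite -cabsE normfV cabsE fmorphV. Qed.

Lemma cabs_eq0 x : (cabs x == 0) = (x == 0).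
Proof. by rewrite -(inj_eq (@complexI R)) -cabsE /= normr_eq0. Qed.

Lemma cabs_gt0 x : (0 < cabs x) = (x != 0).
Proof. by rewrite lt_neqAle cabs_ge0 andbT eq_sym cabs_eq0. Qed.

Lemma cabs_tri z x y : cabs (x - y) <= cabs (x - z) + cabs (z - y).
Proof. by apply: le_trans (cabsD _ _); rewrite addrA subrK. Qed.

Lemma cabs_real (x : R) : cabs x%:C = `|x|.
Proof.
by apply: complexI; rewrite -cabsE normc_def /= expr0n addr0 sqrtr_sqr.
Qed.

Lemma cabs_sum (I : Type) (r : seq I) (P : pred I) (f : I -> C) :
  cabs (\sum_(i <- r | P i) f i) <= \sum_(i <- r | P i) cabs (f i).
Proof.
elim/big_rec2: _ => [|i y x _ h]; first by rewrite cabs0.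
by apply: le_trans (cabsD _ _) _; rewrite lerD2l.
Qed.

Lemma cabs_dist x y : cabs x - cabs y <= cabs (x - y).
Proof. by rewrite lerBlDr -{1}(subrK y x) cabsD. Qed.

Lemma cabs_ReIm z : cabs z <= `|complex.Re z| + `|complex.Im z|.
Proof.
rewrite {1}[z]complexE; apply: le_trans (cabsD _ _) _.
rewrite cabs_real cabsM cabs_real.
have -> : cabs 'i%C = 1.
  by apply: complexI; rewrite -cabsE normc_def /= expr0n expr1n add0r sqrtr1.
by rewrite mul1r.
Qed.

End Cabs.

Section Iso.
Variable R : realType.
Local Notation C := R[i].
Local Open Scope complex_scope.

(** Such an injection, completed on [s] by positions in the list, would make the real line countable
    and hence of Lebesgue measure zero, while the unit interval has measure 1. *)
Lemma complex_uncountable (T : countType) (s : seq C) (phi : C -> T) :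
  ~ (forall x y, x \notin s -> y \notin s -> phi x = phi y -> x = y).
Proof.
move=> inj.
pose psi (x : R) : T + nat :=
  if x%:C \in s then inr (index x%:C s) else inl (phi x%:C).
have psi_inj : injective psi.
  move=> x y; rewrite /psi; case: ifPn => hx; case: ifPn => hy //.
    by case=> h; apply: complexI; rewrite -(nth_index 0 hx) h nth_index.
  by case=> /(inj _ _ hx hy)/complexI.
have /countable_lebesgue_measure0 h : countable [set: R].
  apply/countable_injP; exists (fun x => pickle (psi x)).
  by move=> x y _ _ /(pcan_inj pickleK)/psi_inj.
have : (lebesgue_measure (`[0%R, 1%R]%classic : set R) <= 0)%E.
  rewrite -h; apply: le_measure; rewrite ?inE //.
by rewrite lebesgue_measure_itv /= lte_fin ltr01 oppr0 adde0 lee_fin ler10.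
Qed.

Definition isolated (I J : Type) (P : (I + J -> C) -> Prop) (v : I -> C)
    (w : J -> C) : Prop :=
  exists2 eps : R, 0 < eps &
    forall w', P (scons v w') -> (forall j, cabs (w' j - w j) < eps) -> w' = w.

Lemma rat_approx (x eps : R) : 0 < eps -> exists q : rat, `|x - ratr q| < eps.
Proof.
move=> e0; have [q] := @rat_in_itvoo R (x - eps) (x + eps) ltac:(lra).
rewrite in_itv /= => /andP[h1 h2]; exists q; rewrite ltr_norml; apply/andP; split; lra.
Qed.

(* Isolated points form a countable set, so no coordinate projection is
   cofinite; by quantifier elimination the projections are uniformly finite. *)
Lemma isolated_bounded (I J : finType) (P : (I + J -> C) -> Prop) :
  definable P -> exists N, forall v,
    (forall w, P (scons v w) -> isolated P v w) ->
    forall (T : finType) (g : T -> J -> C), injective g ->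
      (forall t, P (scons v (g t))) -> (#|T| <= N)%N.
Proof.
move=> hP.
pose g0 (o : I + J) : option I + J :=
  match o with inl i => inl (Some i) | inr j => inr j end.
have hQ j : definable (fun v : option I -> C =>
    exists w, P (scons v w \o g0) /\ w j = v None).
  apply: definable_ext (definable_exs (DFand (definable_reindex g0 hP)
    (definable_eq (PFvar _ (inr j)) (PFvar _ (inl None))))) _ => v; split=> //.
have E x v w : scons (ocons x v) w \o g0 = scons v w.
  by apply: funext => -[].
have /choice[N hN] : forall j, exists N, forall v,
    fincofin N (fun x : C => exists w, P (scons v w) /\ w j = x).
  move=> j.
  have [N hN] := definable_fincofin (hQ j); exists N => v.
  by apply: fincofin_ext (hN v) _ => x; split=> -[w w1]; exists w; move: w1; rewrite E.
pose M := \max_j N j.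
exists (M.+1 ^ #|J|)%N => v iso T g ginj hg.
(* A rational centre and a rational radius that single out each solution: the data [phi w] determine
   [w] among the solutions, which are therefore countable in number. *)
have /choice[phi hphi] : forall w : J -> C, exists t : {ffun J -> rat * rat} * rat,
    P (scons v w) -> (forall w', P (scons v w') ->
    (forall j, `|complex.Re (w' j) - ratr (t.1 j).1| + `|complex.Im (w' j) - ratr (t.1 j).2| < ratr t.2) ->
    w' = w) /\
    (forall j, `|complex.Re (w j) - ratr (t.1 j).1| + `|complex.Im (w j) - ratr (t.1 j).2| < ratr t.2).
  move=> w; case: (EM (P (scons v w))) => [Pw|nP]; last by exists ([ffun=> (0, 0)], 0).
  have [e e0 he] := iso w Pw.
  have [r] := @rat_in_itvoo R 0 (e / 2) ltac:(lra).
  rewrite in_itv /= => /andP[r0 r1].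
  have r2 : 0 < ratr r / 2 :> R by lra.
  have /choice[q hq] : forall j, exists q : rat * rat,
      `|complex.Re (w j) - ratr q.1| < ratr r / 2 /\ `|complex.Im (w j) - ratr q.2| < ratr r / 2.
    move=> j; have [q1 h1] := rat_approx (complex.Re (w j)) r2.
    by have [q2 h2] := rat_approx (complex.Im (w j)) r2; exists (q1, q2).
  exists ([ffun j => q j], r) => _; split=> [w' Pw' hw'|j] /=; last first.
    by rewrite ffunE; have [] := hq j; lra.
  apply: he => // j; apply: le_lt_trans (cabs_ReIm _) _.
  rewrite !raddfB /=; have := hw' j; rewrite /= ffunE; have [h1 h2] := hq j => h3.
  have d1 := ler_distD (ratr (q j).1) (complex.Re (w' j)) (complex.Re (w j)).
  have d2 := ler_distD (ratr (q j).2) (complex.Im (w' j)) (complex.Im (w j)).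
  rewrite (distrC (ratr (q j).1)) in d1; rewrite (distrC (ratr (q j).2)) in d2.
  lra.
have fin j : exists s : seq C, (size s <= M)%N /\ forall w, P (scons v w) -> w j \in s.
  have [s [hs [h|h]]] := hN j v.
    exists s; split; first exact: leq_trans hs (leq_bigmax j).
    by move=> w Pw; apply: h; exists w.
  (* If the projection to the coordinate [j] were cofinite, choosing a solution above each value
     would inject almost all complex numbers into a countable type. *)
  exfalso.
  have /choice[W hW] : forall x, exists w : J -> C, x \notin s -> P (scons v w) /\ w j = x.
    move=> x; case: (boolP (x \in s)) => [|hx]; first by exists (fun=> 0).
    have : ~ ~ (exists w, P (scons v w) /\ w j = x) by move=> /h; apply/negP.
    by move/contrapT => [w hw]; exists w.
  apply: (@complex_uncountable _ s (phi \o W)) => x y hx hy /= exy.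
  have [Px <-] := hW x hx; have [Py <-] := hW y hy.
  have [hx1 hx2] := hphi _ Px; have [hy1 hy2] := hphi _ Py.
  by rewrite (hx1 (W y)) // exy.
have /choice[s hs] := fin.
pose h (t : T) : {ffun J -> 'I_M.+1} := [ffun j => inord (index (g t j) (s j))].
have hinj : injective h.
  move=> t1 t2 e; apply: ginj; apply: funext => j.
  move/ffunP/(_ j): e; rewrite !ffunE => /(congr1 val).
  have [szj memj] := hs j.
  rewrite /= !inordK ?ltnS.
  - by move=> e; rewrite -(nth_index 0 (memj _ (hg t1))) e nth_index // memj.
  - by apply: leq_trans szj; apply: ltnW; rewrite index_mem memj.
  - by apply: leq_trans szj; apply: ltnW; rewrite index_mem memj.
by have := leq_card h hinj; rewrite card_ffun card_ord.
Qed.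

End Iso.

End Isolation.

Lemma injective_left_inverse (F : fieldType) (J J' : finType) (l : J' -> J -> F) :
  (forall u : J -> F, (forall j', \sum_j l j' j * u j = 0) -> forall j, u j = 0) ->
  exists B : J -> J' -> F,
    forall (u : J -> F) j, u j = \sum_j' B j j' * \sum_i l j' i * u i.
Proof.
move=> inj.
pose A : 'M[F]_(#|J|, #|J'|) := \matrix_(i, j) l (enum_val j) (enum_val i).
have Afree : row_free A.
  rewrite -kermx_eq0; apply/rowV0P => v /sub_kermxP vA.
  apply/rowP => i; rewrite mxE.
  rewrite -[v 0 i]/(v 0 i) -(enum_valK i).
  apply: (inj (fun j => v 0 (enum_rank j))) => j'.
  move/matrixP/(_ 0 (enum_rank j')): vA; rewrite !mxE; apply: etrans; symmetry.
  rewrite (reindex_onto enum_rank enum_val) /=; last by move=> i0 _; rewrite enum_valK.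
  rewrite (eq_bigl predT) => [|j]; last by rewrite enum_rankK eqxx.
  by apply: eq_bigr => j _; rewrite !mxE !enum_rankK mulrC.
exists (fun j j' => pinvmx A (enum_rank j') (enum_rank j)) => u j.
pose v : 'rV[F]_#|J| := \row_i u (enum_val i).
have : v *m A *m pinvmx A = v by rewrite -mulmxA mulmxVp // mulmx1.
move/matrixP/(_ 0 (enum_rank j)); rewrite !mxE enum_rankK => <-.
rewrite (reindex_onto enum_rank enum_val) /=; last by move=> i0 _; rewrite enum_valK.
rewrite (eq_bigl predT) => [|j']; last by rewrite enum_rankK eqxx.
apply: eq_bigr => j' _; rewrite mulrC; congr (_ * _).
rewrite mxE (reindex_onto enum_rank enum_val) /=; last by move=> i0 _; rewrite enum_valK.
rewrite (eq_bigl predT) => [|j0]; last by rewrite enum_rankK eqxx.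
by apply: eq_bigr => i _; rewrite !mxE !enum_rankK mulrC.
Qed.

Section Diff.
Variables (R : realType) (J : finType).
Local Notation C := R[i].
Implicit Types (p q : (J -> C) -> C) (w : J -> C) (l : J -> C).

(** First-order expansion of [p] at [w] with gradient [l]. The error is measured by any [d] that
    bounds all increments, which keeps sums, products and polynomial substitutions elementary. *)
Definition diffat p w l : Prop :=
  exists K : R, forall w' (d : R), d <= 1 -> (forall j, cabs (w' j - w j) <= d) ->
    cabs (p w' - p w - \sum_j l j * (w' j - w j)) <= K * d ^+ 2.

Lemma diffat_ext p w l l' : diffat p w l -> l =1 l' -> diffat p w l'.
Proof. by move=> h /funext <-. Qed.

Lemma diffat_const c w : diffat (fun=> c) w (fun=> 0).
Proof.
exists 0 => w' d _ _; rewrite subrr big1 ?subr0 ?cabs0 ?mul0r // => j _.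
by rewrite mul0r.
Qed.

Lemma diffat_var i w : diffat (fun v => v i) w (fun j => (j == i)%:R).
Proof.
exists 0 => w' d _ _; rewrite (bigD1 i) //= eqxx mul1r big1 ?addr0 ?subrr ?cabs0 ?mul0r //.
by move=> j /negPf ->; rewrite mul0r.
Qed.

Lemma diffat_add p q w l m : diffat p w l -> diffat q w m ->
  diffat (fun v => p v + q v) w (fun j => l j + m j).
Proof.
move=> [K hK] [L hL]; exists (K + L) => w' d d1 hd.
have -> : \sum_j (l j + m j) * (w' j - w j) =
    \sum_j l j * (w' j - w j) + \sum_j m j * (w' j - w j).
  by rewrite -big_split; apply: eq_bigr => j _; rewrite mulrDl.
have := hK w' d d1 hd; have := hL w' d d1 hd.
set s := \sum_j _; set t := \sum_j _ => h1 h2.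
have -> : p w' + q w' - (p w + q w) - (t + s) = (p w' - p w - t) + (q w' - q w - s).
  by ring.
by apply: le_trans (cabsD _ _) _; rewrite mulrDl lerD.
Qed.

Lemma diffat_mul p q w l m : diffat p w l -> diffat q w m ->
  diffat (fun v => p v * q v) w (fun j => l j * q w + p w * m j).
Proof.
move=> [K hK] [L hL].
pose sl := \sum_j cabs (l j); pose sm := \sum_j cabs (m j).
exists (cabs (q w) * `|K| + cabs (p w) * `|L| + (sl + `|K|) * (sm + `|L|)) => w' d d1 hd.
have -> : \sum_j (l j * q w + p w * m j) * (w' j - w j) =
    q w * (\sum_j l j * (w' j - w j)) + p w * (\sum_j m j * (w' j - w j)).
  by rewrite !mulr_sumr -big_split; apply: eq_bigr => j _ /=; ring.
have := hK w' d d1 hd; have := hL w' d d1 hd.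
have lin (n : J -> C) : cabs (\sum_j n j * (w' j - w j)) <= (\sum_j cabs (n j)) * d.
  apply: le_trans (cabs_sum _ _ _) _; rewrite mulr_suml; apply: ler_sum => j _.
  by rewrite cabsM ler_wpM2l ?cabs_ge0.
have := lin l; have := lin m; rewrite -/sl -/sm.
set s := \sum_j m j * _; set t := \sum_j l j * _ => hs ht h1 h2.
have [sl0 sm0] : 0 <= sl /\ 0 <= sm by split; apply: sumr_ge0 => j _; apply: cabs_ge0.
(* Without coordinates nothing forces [d] to be nonnegative, so the bounds linear in [d] are
   available only when [J] is inhabited. *)
have [/card0_eq J0|] := eqVneq #|J| 0%N; last first.
  rewrite -lt0n => /card_gt0P[j0 _].
  have d0 : 0 <= d by apply: le_trans (hd j0); apply: cabs_ge0.
  have dd : d ^+ 2 <= d by rewrite expr2 ler_piMl.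
  have E : p w' * q w' - p w * q w - (q w * t + p w * s) =
     q w * (p w' - p w - t) + p w * (q w' - q w - s) +
     (t + (p w' - p w - t)) * (s + (q w' - q w - s)) by ring.
  rewrite E; apply: le_trans (cabsD _ _) _; rewrite !mulrDl lerD //.
    apply: le_trans (cabsD _ _) _; rewrite !cabsM -!mulrA lerD // ler_wpM2l ?cabs_ge0 //.
      by apply: le_trans h2 _; rewrite ler_wpM2r ?sqr_ge0 // ler_norm.
    by apply: le_trans h1 _; rewrite ler_wpM2r ?sqr_ge0 // ler_norm.
  rewrite -!mulrDl cabsM.
  have -> : (sl + `|K|) * (sm + `|L|) * d ^+ 2 = ((sl + `|K|) * d) * ((sm + `|L|) * d) by ring.
  apply: ler_pM; rewrite ?cabs_ge0 //; apply: le_trans (cabsD _ _) _; rewrite mulrDl lerD //.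
    by apply: le_trans h2 (le_trans (ler_wpM2r (sqr_ge0 _) (ler_norm _)) _); rewrite ler_wpM2l.
  by apply: le_trans h1 (le_trans (ler_wpM2r (sqr_ge0 _) (ler_norm _)) _); rewrite ler_wpM2l.
have ew : w' = w by apply: funext => j; have := J0 j.
have E : p w' * q w' - p w * q w - (q w * t + p w * s) = 0.
  have -> : t = 0 by rewrite /t big1 // => j; have := J0 j.
  have -> : s = 0 by rewrite /s big1 // => j; have := J0 j.
  by rewrite ew; ring.
by rewrite E cabs0 mulr_ge0 ?sqr_ge0 // !addr_ge0 // mulr_ge0 ?cabs_ge0 ?addr_ge0.
Qed.

Lemma diffat_horner (f : {poly C}) p w l : diffat p w l ->
  diffat (fun v => f.[p v]) w (fun j => f^`().[p w] * l j).
Proof.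
move=> hp; elim/poly_ind: f => [|f c IH].
  rewrite (_ : (fun v => _) = fun=> 0); last by apply: funext => v; rewrite horner0.
  apply: diffat_ext (diffat_const _ _) _ => j; by rewrite deriv0 horner0 mul0r.
rewrite (_ : (fun v => _) = fun v => f.[p v] * p v + c); last first.
  by apply: funext => v; rewrite !hornerE.
apply: diffat_ext (diffat_add (diffat_mul IH hp) (diffat_const c w)) _ => j.
by rewrite derivD derivM derivX derivC !hornerE; ring.
Qed.

Lemma diffat_horner2 (f : {poly {poly C}}) p q w l m :
  diffat p w l -> diffat q w m ->
  diffat (fun v => f.[(p v)%:P].[q v]) w
    (fun j => f^`().[(p w)%:P].[q w] * l j + (map_poly deriv f).[(p w)%:P].[q w] * m j).
Proof.
move=> hp hq; elim/poly_ind: f => [|f c IH].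
  rewrite (_ : (fun v => _) = fun=> 0); last by apply: funext => v; rewrite !horner0.
  by apply: diffat_ext (diffat_const _ _) _ => j; rewrite deriv0 map_poly0 !horner0 !mul0r addr0.
rewrite (_ : (fun v => _) = fun v => f.[(p v)%:P].[q v] * p v + c.[q v]); last first.
  by apply: funext => v; rewrite !hornerE.
apply: diffat_ext (diffat_add (diffat_mul IH hp) (diffat_horner c hq)) _ => j.
have -> : map_poly deriv (f * 'X + c%:P) = map_poly deriv f * 'X + (c^`())%:P.
  apply/polyP => i; rewrite coef_map_id0 ?deriv0 // !coefD !coefMX !coefC.
  by rewrite coef_map_id0 ?deriv0 //; case: i => [|i] /=; rewrite ?derivD ?deriv0 ?addr0 ?add0r.
rewrite derivD derivM derivX derivC addr0 mulr1.
rewrite !hornerD !hornerM !hornerX !hornerC.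
move: (f^`().[_].[_]) (f.[_].[_]) ((map_poly deriv f).[_].[_]) (c^`().[_]) => a1 a2 a3 a4.
by ring.
Qed.

(** Quantitative inverse function theorem: a left inverse of the Jacobian turns the second-order
    error into [d <= M * d ^+ 2] for the distance [d] to another solution, which is impossible for
    [0 < d <= (M + 1)^-1]. More equations than unknowns are allowed. *)
Lemma diffat_isolated (I J' : finType) (P : (I + J -> C) -> Prop) (v : I -> C)
    (E : J' -> (J -> C) -> C) (w : J -> C) (l : J' -> J -> C) :
  (forall w', P (scons v w') -> forall j', E j' w' = 0) ->
  (forall j', E j' w = 0) ->
  (forall j', diffat (E j') w (l j')) ->
  (forall u : J -> C, (forall j', \sum_j l j' j * u j = 0) -> forall j, u j = 0) ->
  isolated P v w.
Proof.
move=> hP Ew hd /injective_left_inverse[B hB].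
have /choice[K hK] := hd.
pose M := \sum_j \sum_j' cabs (B j j') * `|K j'|.
have M0 : 0 <= M.
  by apply: sumr_ge0 => j _; apply: sumr_ge0 => j' _; rewrite mulr_ge0 ?cabs_ge0.
exists ((M + 1)^-1); first by rewrite invr_gt0 ltr_wpDl.
move=> w' Pw' hw'; apply: funext => j1; apply/eqP; rewrite -subr_eq0 -cabs_eq0.
pose d := \big[Order.max/0]_j cabs (w' j - w j).
have hdj j : cabs (w' j - w j) <= d by apply: le_bigmax.
have d0 : 0 <= d by apply: le_trans (hdj j1); apply: cabs_ge0.
have dM : d <= (M + 1)^-1.
  apply: bigmax_le => [|j _]; first by rewrite invr_ge0 addr_ge0.
  exact: ltW.
have d1 : d <= 1 by apply: le_trans dM _; rewrite invf_le1 ?ltr_wpDl // lerDr.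
have key j : cabs (w' j - w j) <= M * d ^+ 2.
  rewrite (hB (fun i => w' i - w i) j); apply: le_trans (cabs_sum _ _ _) _.
  rewrite /M (bigD1 j) //= mulrDl ler_wpDr //.
    rewrite mulr_ge0 ?sqr_ge0 //; apply: sumr_ge0 => i _.
    by apply: sumr_ge0 => j' _; rewrite mulr_ge0 ?cabs_ge0.
  rewrite mulr_suml; apply: ler_sum => j' _; rewrite cabsM -mulrA.
  rewrite ler_wpM2l ?cabs_ge0 //.
  have := hK j' w' d d1 hdj; rewrite (hP _ Pw') Ew subrr sub0r cabsN => h.
  by apply: le_trans h _; rewrite ler_wpM2r ?sqr_ge0 // ler_norm.
have : d <= M * d ^+ 2 by apply: bigmax_le => //; rewrite mulr_ge0 ?sqr_ge0.
have [dpos|dneg] := ltP 0 d; last first.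
  by move=> _; rewrite eq_le cabs_ge0 andbT (le_trans (hdj j1)).
rewrite expr2 mulrA ler_pMl // => h1.
have : M * d < 1.
  have h2 : d * (M + 1) <= 1 by rewrite -ler_pdivlMr ?mul1r // ltr_wpDl.
  by nra.
by rewrite ltNge h1.
Qed.

End Diff.

(** * Germs along an ultrafilter *)

Section Germs_of_functions.
Import classical_sets filter.

Section PolyBounds.
Variable R : realType.
Local Notation C := R[i].

Lemma horner_bound (q : {poly C}) (B : R) :
  exists2 K : R, 0 <= K & forall x, cabs x <= B -> cabs q.[x] <= K.
Proof.
elim/poly_ind: q => [|q c [K K0 hK]].
  by exists 0 => // x _; rewrite horner0 cabs0.
exists (K * `|B| + cabs c); first by rewrite addr_ge0 ?mulr_ge0 ?cabs_ge0.
move=> x hx; rewrite !(hornerD, hornerM, hornerX, hornerC); apply: le_trans (cabsD _ _) _; rewrite lerD2r cabsM.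
by apply: ler_pM; rewrite ?cabs_ge0 ?hK // (le_trans hx) // ler_norm.
Qed.

Lemma horner_lipschitz (q : {poly C}) (B : R) :
  exists2 K : R, 0 <= K & forall x y, cabs x <= B -> cabs y <= B ->
    cabs (q.[x] - q.[y]) <= K * cabs (x - y).
Proof.
elim/poly_ind: q => [|q c [K K0 hK]].
  by exists 0 => // x y _ _; rewrite !horner0 subrr cabs0 mul0r.
have [L L0 hL] := horner_bound q B.
exists (K * `|B| + L); first by rewrite addr_ge0 ?mulr_ge0.
move=> x y hx hy; rewrite !(hornerD, hornerM, hornerX, hornerC).
have -> : q.[x] * x + c - (q.[y] * y + c) = (q.[x] - q.[y]) * x + q.[y] * (x - y) by ring.
apply: le_trans (cabsD _ _) _; rewrite !cabsM [leRHS]mulrDl lerD //.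
  rewrite -mulrA [`|B| * _]mulrC mulrA; apply: ler_pM; rewrite ?cabs_ge0 ?hK //.
  by rewrite (le_trans hx) // ler_norm.
by rewrite ler_wpM2r ?cabs_ge0 ?hL.
Qed.

Lemma horner_taylor2 (q : {poly C}) (B : R) :
  exists2 K : R, 0 <= K & forall x y, cabs x <= B -> cabs y <= B ->
    cabs (q.[x] - q.[y] - q^`().[y] * (x - y)) <= K * cabs (x - y) ^+ 2.
Proof.
elim/poly_ind: q => [|q c [K K0 hK]].
  by exists 0 => // x y _ _; rewrite deriv0 !horner0 !(subrr, mul0r, subr0) cabs0.
have [L L0 hL] := horner_lipschitz q B.
exists (K * `|B| + L); first by rewrite addr_ge0 ?mulr_ge0.
move=> x y hx hy; rewrite derivD derivM derivX derivC addr0 mulr1 !(hornerD, hornerM, hornerX, hornerC).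
have -> : q.[x] * x + c - (q.[y] * y + c) - (q^`().[y] * y + q.[y]) * (x - y) =
   (q.[x] - q.[y] - q^`().[y] * (x - y)) * y + (q.[x] - q.[y]) * (x - y) by ring.
apply: le_trans (cabsD _ _) _; rewrite !cabsM [leRHS]mulrDl lerD //.
  rewrite -mulrA [`|B| * _]mulrC mulrA; apply: ler_pM; rewrite ?cabs_ge0 ?hK //.
  by rewrite (le_trans hy) // ler_norm.
by rewrite expr2 mulrA ler_wpM2r ?cabs_ge0 ?hL.
Qed.

End PolyBounds.

Section Germs.
Variables (R : realType) (T : Type) (U : set_system T).
Context {UU : UltraFilter U}.
Local Notation C := R[i].
Implicit Types (x y z v : T -> C).

Definition tendsto x (l : C) : Prop :=
  forall e : R, 0 < e -> U (fun t => cabs (x t - l) < e).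

Lemma tendsto_ext x y l : U (fun t => x t = y t) -> tendsto x l -> tendsto y l.
Proof.
by move=> hxy hx e e0; apply: filterS2 hxy (hx e e0) => t ->.
Qed.

Lemma tendsto_cst c : tendsto (fun=> c) c.
Proof. by move=> e e0; apply: filterS filterT => t _; rewrite subrr cabs0. Qed.

Lemma tendsto_unique x l m : tendsto x l -> tendsto x m -> l = m.
Proof.
move=> hl hm; apply/eqP; rewrite -subr_eq0 -cabs_eq0; apply/negP => /negP h.
have e0 : 0 < cabs (l - m) / 2 by rewrite divr_gt0 // lt_neqAle eq_sym h cabs_ge0.
have : U set0.
  apply: filterS2 (hl _ e0) (hm _ e0) => t h1 h2.
  have := cabs_tri (x t) l m; rewrite (cabsB l (x t)) => h3; lra.
exact: filter_not_empty.
Qed.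

Lemma tendsto_add x y l m : tendsto x l -> tendsto y m ->
  tendsto (fun t => x t + y t) (l + m).
Proof.
move=> hx hy e e0; have e2 : 0 < e / 2 by lra.
apply: filterS2 (hx _ e2) (hy _ e2) => t h1 h2.
rewrite (_ : _ - _ = (x t - l) + (y t - m)); last by ring.
by apply: le_lt_trans (cabsD _ _) _; lra.
Qed.

Lemma tendsto_bounded x l : tendsto x l -> U (fun t => cabs (x t) <= cabs l + 1).
Proof.
move=> hx; apply: filterS (hx 1 ltr01) => t h.
by have := cabs_dist (x t) l; lra.
Qed.

Lemma tendsto_mul x y l m : tendsto x l -> tendsto y m ->
  tendsto (fun t => x t * y t) (l * m).
Proof.
move=> hx hy e e0; pose B := cabs l + cabs m + 2.
have B0 : 0 < B by have := cabs_ge0 l; have := cabs_ge0 m; rewrite /B; lra.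
have e2 : 0 < e / (2 * B) by rewrite divr_gt0 // mulr_gt0.
apply: filterS3 (hx _ e2) (hy _ e2) (tendsto_bounded hx) => t h1 h2 h3.
rewrite (_ : _ - _ = x t * (y t - m) + m * (x t - l)); last by ring.
apply: le_lt_trans (cabsD _ _) _; rewrite !cabsM.
have -> : e = B * (e / (2 * B)) + B * (e / (2 * B)).
  by field; rewrite gt_eqF.
have hb1 : cabs (x t) <= B by have := cabs_ge0 m; rewrite /B; lra.
have hb2 : cabs m <= B by have := cabs_ge0 l; rewrite /B; lra.
apply: ltr_leD; last by apply: ler_pM; rewrite ?cabs_ge0 // ltW.
apply: le_lt_trans (ler_wpM2r (cabs_ge0 _) hb1) _.
by rewrite ltr_pM2l.
Qed.

Lemma tendsto_horner x l (q : {poly C}) : tendsto x l -> tendsto (fun t => q.[x t]) q.[l].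
Proof.
move=> hx; elim/poly_ind: q => [|q c IH].
  rewrite (_ : (fun t => _) = fun=> 0); last by apply: funext => t; rewrite horner0.
  by rewrite horner0; apply: tendsto_cst.
rewrite (_ : (fun t => _) = fun t => q.[x t] * x t + c); last first.
  by apply: funext => t; rewrite !(hornerD, hornerM, hornerX, hornerC).
by rewrite !(hornerD, hornerM, hornerX, hornerC); apply: tendsto_add (tendsto_mul IH hx) (tendsto_cst c).
Qed.

(** The ultrafilter chooses the branch: if [x] stayed away from each root of [q - m], the
    factorization would keep [q.[x t]] away from [m]. Whole paths thus have limits without passing
    to subsequences. *)
Lemma tendsto_root x z m (q : {poly C}) : (1 < size q)%N ->
  U (fun t => q.[x t] = z t) -> tendsto z m ->
  exists2 rho, q.[rho] = m & tendsto x rho.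
Proof.
move=> sq hq hz; apply: contrapT => nh.
have sqm : size (q - m%:P) = size q.
  by rewrite size_polyDl // size_polyN; apply: leq_ltn_trans sq; apply: size_polyC_leq1.
have qm0 : q - m%:P != 0 by rewrite -size_poly_gt0 sqm (ltn_trans _ sq).
have [r hr] := closed_field_poly_normal (q - m%:P).
pose a := lead_coef (q - m%:P).
have a0 : a != 0 by rewrite lead_coef_eq0.
have far s : s \in r -> exists2 e : R, 0 < e & U (fun t => e <= cabs (x t - s)).
  move=> sr; have : ~ tendsto x s.
    move=> hs; apply: nh; exists s => //; apply/eqP; rewrite -subr_eq0.
    rewrite -[m](hornerC m s) -hornerN -hornerD -/(root _ _) hr rootZ //.
    by rewrite root_prod_XsubC.
  move/existsNP => [e /not_implyP[e0 he]]; exists e => //.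
  have [//|] := in_ultra_setVsetC (fun t => cabs (x t - s) < e) UU.
  by apply: filterS => t /= /negP; rewrite -leNgt.
have [e e0 he] : exists2 e : R, 0 < e & U (fun t => e <= cabs (\prod_(s <- r) (x t - s))).
  elim: (r) far => [|s r' IH] far.
    by exists 1 => //; apply: filterS filterT => t _; rewrite big_nil cabs1.
  have [e1 e10 h1] := IH (fun s' hs' => far s' (mem_behead (s := s :: r') hs')).
  have [e2 e20 h2] := far s (mem_head _ _).
  exists (e2 * e1); first exact: mulr_gt0.
  apply: filterS2 h1 h2 => t h1 h2; rewrite big_cons cabsM.
  by apply: ler_pM => //; apply: ltW.
have e2 : 0 < cabs a * e by rewrite mulr_gt0 // cabs_gt0.
have : U set0.
  apply: filterS3 (hz _ e2) he hq => t h1 h2 h3.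
  move: h1; rewrite -h3 -[m](hornerC m (x t)) -hornerN -hornerD hr hornerZ horner_prod.
  rewrite (eq_bigr (fun s => x t - s)) => [|s _]; last by rewrite hornerXsubC.
  by rewrite cabsM ltr_pM2l ?cabs_gt0 // ltNge h2.
exact: filter_not_empty.
Qed.

Variable w : T -> C.
Hypothesis w0 : tendsto w 0.

(** A Taylor polynomial of order [r] in the parameter [w]. Functions that have one to every order
    replace convergent power series, as only finitely many coefficients are ever used. *)
Definition germ_upto (r : nat) x : Prop :=
  exists p : {poly C}, exists2 K : R, 0 <= K &
    U (fun t => cabs (x t - p.[w t]) <= K * cabs (w t) ^+ r).

Definition germ x : Prop := forall r, germ_upto r x.

Let w1 : U (fun t => cabs (w t) <= 1).
Proof. by apply: filterS (w0 ltr01) => t; rewrite subr0 => /ltW. Qed.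

Lemma germ_ext x y : U (fun t => x t = y t) -> germ x -> germ y.
Proof.
move=> hxy hx r; have [p [K K0 h]] := hx r; exists p, K => //.
by apply: filterS2 hxy h => t ->.
Qed.

Lemma germ_cst c : germ (fun=> c).
Proof.
move=> r; exists c%:P, 0 => //; apply: filterS filterT => t _.
by rewrite hornerC subrr cabs0 mul0r.
Qed.

Lemma germ_w : germ w.
Proof.
move=> r; exists 'X, 0 => //; apply: filterS filterT => t _.
by rewrite hornerX subrr cabs0 mul0r.
Qed.

Lemma germ_upto_add r x y : germ_upto r x -> germ_upto r y ->
  germ_upto r (fun t => x t + y t).
Proof.
move=> [p [K K0 hp]] [q [L L0 hq]]; exists (p + q), (K + L); first exact: addr_ge0.
apply: filterS2 hp hq => t h1 h2; rewrite hornerD.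
rewrite (_ : _ - _ = (x t - p.[w t]) + (y t - q.[w t])); last by ring.
by apply: le_trans (cabsD _ _) _; rewrite [leRHS]mulrDl lerD.
Qed.

Lemma germ_upto_mul r x y : germ_upto r x -> germ_upto r y ->
  germ_upto r (fun t => x t * y t).
Proof.
move=> [p [K K0 hp]] [q [L L0 hq]].
have [P P0 hP] := horner_bound p 1; have [Q Q0 hQ] := horner_bound q 1.
exists (p * q), (P * L + (Q + L) * K); first by rewrite !(addr_ge0, mulr_ge0).
apply: filterS3 hp hq w1 => t h1 h2 h3; rewrite hornerM.
rewrite (_ : _ - _ = p.[w t] * (y t - q.[w t]) +
  (q.[w t] + (y t - q.[w t])) * (x t - p.[w t])); last by ring.
apply: le_trans (cabsD _ _) _; rewrite !cabsM mulrDl -!mulrA.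
apply: lerD; first by apply: ler_pM; rewrite ?cabs_ge0 // hP.
apply: ler_pM; rewrite ?cabs_ge0 //; apply: le_trans (cabsD _ _) _.
apply: lerD; first exact: hQ.
by apply: le_trans h2 _; rewrite ler_piMr // exprn_ile1 ?cabs_ge0.
Qed.

Lemma germ_add x y : germ x -> germ y -> germ (fun t => x t + y t).
Proof. by move=> hx hy r; apply: germ_upto_add. Qed.

Lemma germ_mul x y : germ x -> germ y -> germ (fun t => x t * y t).
Proof. by move=> hx hy r; apply: germ_upto_mul. Qed.

Lemma germ_horner x (q : {poly C}) : germ x -> germ (fun t => q.[x t]).
Proof.
move=> hx; elim/poly_ind: q => [|q c IH].
  rewrite (_ : (fun t => _) = fun=> 0); last by apply: funext => t; rewrite horner0.
  exact: germ_cst.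
rewrite (_ : (fun t => _) = fun t => q.[x t] * x t + c); last first.
  by apply: funext => t; rewrite !(hornerD, hornerM, hornerX, hornerC).
by apply: germ_add (germ_mul IH hx) (germ_cst c).
Qed.

Lemma germ_lipschitz z m : germ z -> tendsto z m ->
  exists2 K : R, 0 <= K & U (fun t => cabs (z t - m) <= K * cabs (w t)).
Proof.
move=> hz zm; have [p [K K0 h]] := hz 1%N.
have [L L0 hL] := horner_lipschitz p 1.
have wh : tendsto (fun t => p.[w t] + (z t - p.[w t])) (p.[0] + 0).
  apply: tendsto_add; first exact: tendsto_horner.
  move=> e e0; have e1 : 0 < e / (K + 1) by rewrite divr_gt0 // ltr_wpDl.
  apply: filterS2 h (w0 e1) => t h1; rewrite !subr0 expr1 in h1 * => h2.
  apply: le_lt_trans h1 _; apply: (@le_lt_trans _ _ ((K + 1) * cabs (w t))).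
    by rewrite ler_wpM2r ?cabs_ge0 // lerDl.
  by rewrite mulrC -ltr_pdivlMr // ltr_wpDl.
have pm : p.[0] = m.
  rewrite -[p.[0]]addr0; apply: tendsto_unique wh _; apply: tendsto_ext zm.
  by apply: filterS filterT => t _; rewrite addrC subrK.
exists (K + L); first exact: addr_ge0.
apply: filterS2 h w1 => t h1 h2; rewrite expr1 in h1.
apply: le_trans (cabs_tri p.[w t] _ _) _; rewrite [leRHS]mulrDl lerD // -pm.
by have := hL (w t) 0 h2; rewrite cabs0 subr0 ler01; apply.
Qed.

(** Implicit function theorem by Newton iteration with the derivative frozen at [rho]. The linear
    rate [x - rho = O(w)] starts it, and each correction by $a^{-1}(Z-q(X))$ improves the order of
    the approximation by one. *)
Lemma germ_root x z rho (q : {poly C}) :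
  germ z -> U (fun t => q.[x t] = z t) -> tendsto x rho -> q^`().[rho] != 0 ->
  germ x.
Proof.
move=> hz hq hx q'0.
have zq : tendsto z q.[rho] by apply: tendsto_ext hq _; apply: tendsto_horner.
pose B := cabs rho + 1.
have xB : U (fun t => cabs (x t) <= B) by apply: tendsto_bounded.
have rB : cabs rho <= B by rewrite /B lerDl.
pose a := q^`().[rho].
have a0 : 0 < cabs a by rewrite cabs_gt0.
have [L L0 hL] : exists2 L : R, 0 <= L & U (fun t => cabs (x t - rho) <= L * cabs (w t)).
  have [M M0 hM] := germ_lipschitz hz zq.
  have [K K0 hK] := horner_taylor2 q B.
  exists (2 * M / cabs a); first by rewrite divr_ge0 ?cabs_ge0 // mulr_ge0.
  have e0 : 0 < cabs a / (2 * (K + 1)) by rewrite divr_gt0 // mulr_gt0 // ltr_wpDl.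
  apply: filterS3 (filterI hq xB) hM (hx _ e0) => t [h1 h2] h3 h4.
  have h5 := hK _ _ h2 rB.
  have h6 : cabs a * cabs (x t - rho) <= cabs (z t - q.[rho]) + K * cabs (x t - rho) ^+ 2.
    rewrite -cabsM -h1; apply: le_trans (_ : _ <= cabs (q.[x t] - q.[rho] -
       (q.[x t] - q.[rho] - a * (x t - rho)))) _; first by rewrite subKr.
    by apply: le_trans (cabsD _ _) _; rewrite cabsN lerD2l.
  have h7 : K * cabs (x t - rho) ^+ 2 <= cabs a / 2 * cabs (x t - rho).
    rewrite expr2 mulrA ler_wpM2r ?cabs_ge0 //.
    apply: (@le_trans _ _ ((K + 1) * (cabs a / (2 * (K + 1))))).
      by apply: ler_pM; rewrite ?cabs_ge0 ?lerDl // ltW.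
    by rewrite le_eqVlt; apply/orP; left; apply/eqP; field; rewrite gt_eqF // ltr_wpDl.
  have : cabs a * cabs (x t - rho) <= 2 * M * cabs (w t) by lra.
  by rewrite mulrC -ler_pdivlMr // => h; apply: le_trans h _; rewrite mulrAC.
elim=> [|r IH].
  exists rho%:P, 1 => //; apply: filterS (hx 1 ltr01) => t h.
  by rewrite hornerC expr0 mulr1 ltW.
case: r IH => [_|r [X [K K0 hK]]].
  by exists rho%:P, L => //; apply: filterS hL => t; rewrite hornerC expr1.
have [Z [M M0 hM]] := hz r.+2.
have [Q Q0 hQ] := horner_bound X 1.
pose B2 := B + Q.
have [N N0 hN] := horner_taylor2 q B2; have [N' N'0 hN'] := horner_lipschitz q^`() B2.
exists (X + a^-1 *: (Z - (q \Po X))), ((cabs a)^-1 * (M + N * K ^+ 2 + N' * L * K)).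
  by rewrite mulr_ge0 ?invr_ge0 ?cabs_ge0 // !addr_ge0 ?mulr_ge0 ?sqr_ge0.
apply: filterS3 (filterI w1 hL) (filterI hq xB) (filterI hK hM) => t [h1 h2] [h3 h4] [h5 h6].
rewrite hornerD hornerZ hornerD hornerN horner_comp.
set Xt := X.[w t] in h5 *; set Zt := Z.[w t] in h6 *.
have xB2 : cabs (x t) <= B2 by rewrite /B2; lra.
have B1 : 0 <= B by rewrite /B addr_ge0 ?cabs_ge0.
have XB2 : cabs Xt <= B2 by rewrite /Xt (le_trans (hQ _ h1)) // /B2 lerDr.
have rB2 : cabs rho <= B2 by rewrite /B2; lra.
have E : x t - (Xt + a^-1 * (Zt - q.[Xt])) = a^-1 * ((z t - Zt) +
  (q.[Xt] - q.[x t] - q^`().[x t] * (Xt - x t)) - (q^`().[x t] - q^`().[rho]) * (x t - Xt)).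
  rewrite -h3 -/a; field; by rewrite -cabs_eq0 gt_eqF.
rewrite E cabsM cabsV -[leRHS]mulrA ler_wpM2l ?invr_ge0 ?cabs_ge0 //.
have wr (n : nat) : 0 <= cabs (w t) ^+ n by rewrite exprn_ge0 ?cabs_ge0.
apply: le_trans (cabsD _ _) _; rewrite cabsN [leRHS]mulrDl lerD //.
  apply: le_trans (cabsD _ _) _; rewrite [leRHS]mulrDl lerD //.
  apply: le_trans (hN _ _ XB2 xB2) _; rewrite -mulrA ler_wpM2l // cabsB.
  apply: (@le_trans _ _ ((K * cabs (w t) ^+ r.+1) ^+ 2)).
    by rewrite ler_sqr ?nnegrE ?cabs_ge0 ?mulr_ge0.
  rewrite exprMn ler_wpM2l ?sqr_ge0 // -exprM.
  apply: ler_wiXn2l => //; first exact: cabs_ge0.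
  by rewrite muln2 -addnn addSn ltnS leq_addl.
rewrite cabsM.
have -> : N' * L * K * cabs (w t) ^+ r.+2 = (N' * (L * cabs (w t))) * (K * cabs (w t) ^+ r.+1).
  by rewrite exprS; ring.
apply: ler_pM; rewrite ?cabs_ge0 //.
by apply: le_trans (hN' _ _ xB2 rB2) _; rewrite ler_wpM2l.
Qed.

(** The same iteration for the linear equation $yv=z$, with the coefficient frozen at its nonzero
    limit [l]. Boundedness of [v] gives order zero. *)
Lemma germ_div y z v l : germ y -> germ z -> tendsto y l -> l != 0 ->
  U (fun t => y t * v t = z t) -> germ v.
Proof.
move=> hy hz yl l0 hv.
have cl : 0 < cabs l by rewrite cabs_gt0.
have [L L0 hL] := germ_lipschitz hy yl.
elim=> [|r [V [K K0 hK]]].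
  have [p [M M0 hM]] := hz 0%N; have [P P0 hP] := horner_bound p 1.
  exists 0, ((P + M) / (cabs l / 2)); first by rewrite divr_ge0 ?addr_ge0 ?divr_ge0 ?cabs_ge0.
  have e0 : 0 < cabs l / 2 by lra.
  apply: filterS3 (filterI hv w1) hM (yl _ e0) => t [h1 h2] h3 h4.
  move: h3; rewrite expr0 mulr1 => h3; rewrite horner0 subr0 mulr1 ler_pdivlMr //.
  have h5 : cabs l / 2 <= cabs (y t).
    by have := cabs_dist l (y t); rewrite cabsB => h5; lra.
  apply: le_trans (ler_wpM2l (cabs_ge0 _) h5) _; rewrite -cabsM mulrC h1.
  rewrite -(subrK p.[w t] (z t)) addrC; apply: le_trans (cabsD _ _) _.
  by rewrite lerD // hP.
have [p [M M0 hM]] := hz r.+1.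
have [q [N N0 hN]] := hy r.+1.
have [P P0 hP] := horner_bound V 1.
exists (V + l^-1 *: (p - q * V)), ((cabs l)^-1 * (M + N * P + L * K)).
  by rewrite mulr_ge0 ?invr_ge0 ?cabs_ge0 // !addr_ge0 ?mulr_ge0.
apply: filterS3 (filterI hv w1) (filterI hM hN) (filterI hK hL) => t [h1 h2] [h3 h4] [h5 h6].
rewrite hornerD hornerZ hornerD hornerN hornerM.
set Vt := V.[w t] in h5 *; set pt := p.[w t] in h3 *; set qt := q.[w t] in h4 *.
have E : v t - (Vt + l^-1 * (pt - qt * Vt)) =
  l^-1 * ((z t - pt) - (y t - qt) * Vt - (y t - l) * (v t - Vt)).
  by rewrite -h1; field.
rewrite E cabsM cabsV -[leRHS]mulrA ler_wpM2l ?invr_ge0 ?cabs_ge0 //.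
apply: le_trans (cabsD _ _) _; rewrite cabsN [leRHS]mulrDl lerD //.
  apply: le_trans (cabsD _ _) _; rewrite cabsN [leRHS]mulrDl lerD // cabsM.
  by rewrite mulrAC; apply: ler_pM; rewrite ?cabs_ge0 // hP.
rewrite cabsM exprS mulrACA; apply: ler_pM; rewrite ?cabs_ge0 //.
Qed.

End Germs.

(** Brings estimates along the ultrafilter back to algebra: the value at 0 is a limit and vanishes,
    and a factor ['X] can be divided out because [t != 0]. *)
Lemma bigO_dvdXn (R : realType) (U : set_system R[i]) (E : {poly R[i]}) (K : R) r :
  UltraFilter U -> tendsto U id 0 -> U (fun t => t != 0) ->
  U (fun t => cabs E.[t] <= K * cabs t ^+ r) -> 'X^r %| E.
Proof.
move=> UU t0 tn0; elim: r E => [|r IH] E hE; first by rewrite expr0 dvd1p.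
have E0 : E.[0] = 0.
  apply: (tendsto_unique (U := U) (tendsto_horner E t0)) => e e0.
  have e1 : 0 < Num.min 1 (e / (`|K| + 1)).
    by rewrite lt_min ltr01 divr_gt0 // ltr_wpDl.
  apply: filterS2 hE (t0 _ e1) => t h1; rewrite !subr0 lt_min => /andP[h2 h3].
  apply: le_lt_trans h1 _; rewrite exprS mulrA.
  apply: (@le_lt_trans _ _ ((`|K| + 1) * cabs t)).
    have kK : K <= `|K| := ler_norm K.
    have w1 : cabs t ^+ r <= 1 by rewrite exprn_ile1 ?cabs_ge0 // ltW.
    have w2 : 0 <= cabs t ^+ r by rewrite exprn_ge0 ?cabs_ge0.
    have w3 := cabs_ge0 t; have k0 := normr_ge0 K.
    rewrite mulrAC ler_wpM2r //; apply: (@le_trans _ _ (`|K| * cabs t ^+ r)).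
      by rewrite ler_wpM2r.
    by apply: (@le_trans _ _ `|K|); rewrite ?lerDl // ler_piMr.
  by rewrite mulrC -ltr_pdivlMr // ltr_wpDl.
have /factor_theorem[q Eq] : root E 0 by apply/rootP.
move: Eq; rewrite subr0 => Eq.
rewrite Eq exprSr dvdp_mul2r ?polyX_eq0 //; apply: IH.
apply: filterS2 hE tn0 => t; rewrite Eq hornerM hornerX cabsM exprSr mulrA => h tn.
by rewrite -(@ler_pM2r _ (cabs t)) // cabs_gt0.
Qed.

End Germs_of_functions.

(** * Fibres, partial derivatives, and speeds along paths *)

Section Fibers.
Import classical_sets filter.

Section Bivariate.
Variable F : fieldType.
Implicit Types (f g : {poly {poly F}}) (x y b : F).

Definition fiber f b : {poly F} := map_poly (horner_eval b) f.
Definition partx f : {poly {poly F}} := f^`().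
Definition party f : {poly {poly F}} := map_poly deriv f.

Lemma horner_fiber f b x : (fiber f b).[x] = f.[x%:P].[b].
Proof.
elim/poly_ind: f => [|f c IH]; first by rewrite /fiber map_poly0 !horner0.
rewrite /fiber rmorphD rmorphM /= map_polyX map_polyC /= -/(fiber f b).
by rewrite !(hornerD, hornerM, hornerX, hornerC) IH.
Qed.

Lemma fiber_partx f b : fiber (partx f) b = (fiber f b)^`().
Proof. by rewrite /fiber /partx deriv_map. Qed.

Lemma coef_fiber f b i : (fiber f b)`_i = (f`_i).[b].
Proof. by rewrite coef_map. Qed.

Lemma fiberD f g b : fiber (f + g) b = fiber f b + fiber g b.
Proof. exact: rmorphD. Qed.

Lemma fiberN f b : fiber (- f) b = - fiber f b.
Proof. exact: rmorphN. Qed.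

Lemma fiberM f g b : fiber (f * g) b = fiber f b * fiber g b.
Proof. exact: rmorphM. Qed.

Lemma fiberX f n b : fiber (f ^+ n) b = fiber f b ^+ n.
Proof. exact: rmorphXn. Qed.

Lemma fiberC (p : {poly F}) b : fiber p%:P b = (p.[b])%:P.
Proof. by rewrite /fiber map_polyC. Qed.

Lemma fiber_lift (p : {poly F}) b : fiber (map_poly polyC p) b = p.
Proof.
rewrite /fiber -map_poly_comp map_poly_id // => x _ /=.
by rewrite /horner_eval hornerC.
Qed.

Lemma partyD f g : party (f + g) = party f + party g.
Proof. by apply/polyP => i; rewrite coefD !coef_map_id0 ?deriv0 // coefD derivD. Qed.

Lemma partyC (p : {poly F}) : party p%:P = (p^`())%:P.
Proof.
by apply/polyP => i; rewrite coef_map_id0 ?deriv0 // !coefC; case: ifP; rewrite ?deriv0.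
Qed.

Lemma party_mulX f : party (f * 'X) = party f * 'X.
Proof.
apply/polyP => i; rewrite coef_map_id0 ?deriv0 // !coefMX; case: ifP; rewrite ?deriv0 //.
by rewrite coef_map_id0 ?deriv0.
Qed.

Lemma partyZ (p : {poly F}) g : party (p%:P * g) = (p^`())%:P * g + p%:P * party g.
Proof.
apply/polyP => i; rewrite coefD !coefCM !coef_map_id0 ?deriv0 // coefCM derivM.
by [].
Qed.

Lemma partyM f g : party (f * g) = party f * g + f * party g.
Proof.
elim/poly_ind: f => [|f c IH]; first by rewrite /party map_poly0 !mul0r map_poly0 addr0.
have -> : (f * 'X + c%:P) * g = (f * g) * 'X + c%:P * g by ring.
by rewrite !partyD !party_mulX IH partyZ partyC; ring.
Qed.

Lemma party_lift (p : {poly F}) : party (map_poly polyC p) = 0.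
Proof.
by apply/polyP => i; rewrite coef_map_id0 ?deriv0 // coef_map /= derivC coef0.
Qed.

Lemma party_partx f : party (partx f) = partx (party f).
Proof.
apply/polyP => i; rewrite /partx coef_deriv !coef_map_id0 ?deriv0 // coef_deriv.
by rewrite derivMn.
Qed.

(** To [b] belongs the vector field $(f_y/f_x)(\cdot,b)\,\partial_x$. It descends when its image
    under $x\mapsto f(x,c)$ is, to every order at [xi], a function of the value $f(x,c)$ alone; the
    denominator $f_x(\cdot,b)$ is cleared. *)
Definition descends f b c (xi : F) : Prop := forall r : nat, exists A : {poly F},
  ('X - xi%:P) ^+ r %|
    fiber (party f) b * fiber (partx f) c -
    fiber (partx f) b * (A \Po (fiber f c - (f.[xi%:P].[c])%:P)).

(* A path x_0, x_1, ..., x_n with f(x_i, b_i) = f(x_(i+1), c_(i+1)), together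
   with the derivative v of the path when each b_i moves with speed db_i and
   x_0 is fixed. *)
Definition lpath f (b c db : nat -> F) (n : nat) (x v : nat -> F) : Prop :=
  v 0%N = 0 /\ forall i, (i < n)%N ->
  [/\ f.[(x i)%:P].[b i] = f.[(x i.+1)%:P].[c i.+1],
      (partx f).[(x i.+1)%:P].[c i.+1] != 0 &
      (partx f).[(x i.+1)%:P].[c i.+1] * v i.+1 =
      (partx f).[(x i)%:P].[b i] * v i + (party f).[(x i)%:P].[b i] * db i].

(** The speed of the final value $f(x_n,b_n)$. A path on which it vanishes is said to stop. *)
Definition endspeed f (b db : nat -> F) n (x v : nat -> F) : F :=
  (partx f).[(x n)%:P].[b n] * v n + (party f).[(x n)%:P].[b n] * db n.

(* No partial derivative f_x vanishes along a chain ending at level z. *)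
Definition regular_level f (b c : nat -> F) (n : nat) (z : F) : Prop :=
  forall rho : nat -> F,
    f.[(rho n.-1)%:P].[b n.-1] = z ->
    (forall i, (i.+1 < n)%N -> f.[(rho i)%:P].[b i] = f.[(rho i.+1)%:P].[c i.+1]) ->
    forall i, (i < n)%N -> (partx f).[(rho i)%:P].[b i] != 0 /\
      ((0 < i)%N -> (partx f).[(rho i)%:P].[c i] != 0).

End Bivariate.

Section Local.
Variable R : realType.
Local Notation C := R[i].

Definition punctured : set_system C :=
  fun A => exists2 e : R, 0 < e & forall t, t != 0 -> cabs t < e -> A t.

Lemma punctured_proper : ProperFilter punctured.
Proof.
split.
  move=> [e e0 h]; apply: (h (real_complex R (e / 2))).
    by rewrite -cabs_gt0 cabs_real normr_gt0 gt_eqF // divr_gt0.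
  by rewrite cabs_real gtr0_norm ?divr_gt0 // ltr_pdivrMr // mulr_natr mulr2n ltrDl.
split.
- by exists 1.
- move=> A B [e e0 hA] [d d0 hB]; exists (Num.min e d); first by rewrite lt_min e0.
  by move=> t t0; rewrite lt_min => /andP[h1 h2]; split; [apply: hA|apply: hB].
- by move=> A B AB [e e0 hA]; exists e => // t t0 te; apply: AB; apply: hA.
Qed.

Lemma punctured_notin (xi : C) (s : seq C) : punctured (fun t => xi + t \notin s).
Proof.
elim: s => [|a s [e e0 IH]]; first by exists 1.
have [->|axi] := eqVneq a xi.
  exists e => // t t0 te; rewrite inE negb_or IH // andbT.
  by rewrite -subr_eq0 addrAC subrr add0r.
exists (Num.min e (cabs (a - xi))); first by rewrite lt_min e0 cabs_gt0 subr_eq0.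
move=> t t0; rewrite lt_min => /andP[h1 h2]; rewrite inE negb_or IH // andbT.
by apply/eqP => E; move: h2; rewrite -E addrAC subrr add0r ltxx.
Qed.

(** On a regular level the earlier points and speeds are germs in $w=f(x_n,c_n)-f(\xi,c_n)$, and so
    is the speed of the value $f(x_{n-1},b_{n-1})$. If all paths that end near [xi] stop, this speed
    is $-db_n\,(f_y/f_x)(x_n,b_n)\,f_x(x_n,c_n)$, so the field of [b n] descends. *)
Lemma descent (f : {poly {poly C}}) (b c db : nat -> C) (n : nat) (xi : C) (s : seq C) :
  (0 < n)%N -> db n != 0 ->
  (forall i, (i < n)%N -> (1 < size (fiber f (b i)))%N) ->
  regular_level f b c n (f.[xi%:P].[c n]) ->
  (forall x0, x0 \notin s -> exists x v, [/\ x n = x0, lpath f b c db n x v &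
     endspeed f b db n x v = 0]) ->
  descends f (b n) (c n) xi.
Proof.
move=> n0 dbn sz reg hpath r.
have [U [UU PU]] := ultraFilterLemma punctured_proper.
have Unotin : U (fun t => xi + t \notin s) by apply: PU; apply: punctured_notin.
have Uneq : U (fun t => t != 0) by apply: PU; exists 1.
have t0 : tendsto U id 0.
  by move=> e e0; apply: PU; exists e => // t _; rewrite subr0.
have /choice[X hX] : forall t, exists xv : (nat -> C) * (nat -> C), xi + t \notin s ->
    [/\ xv.1 n = xi + t, lpath f b c db n xv.1 xv.2 & endspeed f b db n xv.1 xv.2 = 0].
  move=> t; case: (boolP (xi + t \notin s)) => [/hpath[x [v h]]|_]; first by exists (x, v).
  by exists (fun=> 0, fun=> 0).
pose x i t := (X t).1 i; pose v i t := (X t).2 i.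
have hxn : U (fun t => xi + t = x n t) by apply: filterS Unotin => t /hX[].
have lim_xt : tendsto U (fun t => xi + t) xi.
  by have := tendsto_add (tendsto_cst (U := U) xi) t0; rewrite addr0; apply.
have lim_xn : tendsto U (x n) xi by apply: tendsto_ext hxn lim_xt.
have link i : (i < n)%N -> U (fun t => (fiber f (b i)).[x i t] = (fiber f (c i.+1)).[x i.+1 t]).
  move=> hi; apply: filterS Unotin => t /hX[_ [_ /(_ i hi)[h _ _]] _].
  by rewrite !horner_fiber.
have lim_x : exists rho : nat -> C, rho n = xi /\ forall i, (i <= n)%N -> tendsto U (x i) (rho i).
  suff h i : exists l, ((i <= n)%N -> tendsto U (x i) l) /\ (i = n -> l = xi).
    have [rho hrho] := choice h; exists rho; split; first by have [_ ->] := hrho n.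
    by move=> i; have [] := hrho i.
  case: (EM (i <= n)%N) => le; last by exists xi; split.
  move E : (n - i)%N => m; elim: m i le E => [|m IH] i le hi.
    have ni : i = n by lia.
    by exists xi; split=> // _; rewrite ni.
  have lt : (i < n)%N by rewrite -subn_gt0 hi.
  have [l [hl _]] : exists l, ((i.+1 <= n)%N -> tendsto U (x i.+1) l) /\ (i.+1 = n -> l = xi).
    by apply: IH => //; rewrite subnS hi.
  have [l' _ hl'] := tendsto_root (sz i lt) (link i lt)
    (tendsto_horner (fiber f (c i.+1)) (hl lt)).
  by exists l'; split=> // E; move: lt; rewrite E ltnn.
have [rho [rhon lim]] := lim_x.
have rlink i : (i < n)%N -> f.[(rho i)%:P].[b i] = f.[(rho i.+1)%:P].[c i.+1].
  move=> hi; rewrite -!horner_fiber.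
  apply: (tendsto_unique (U := U) (tendsto_horner (fiber f (b i)) (lim i (ltnW hi)))).
  apply: tendsto_ext (tendsto_horner (fiber f (c i.+1)) (lim i.+1 hi)).
  by apply: filterS (link i hi) => t ->.
have rreg := reg rho _ (fun i hi => rlink i (ltnW hi)).
have {}rreg : forall i, (i < n)%N -> (partx f).[(rho i)%:P].[b i] != 0 /\
      ((0 < i)%N -> (partx f).[(rho i)%:P].[c i] != 0).
  by apply: rreg; rewrite rlink ?prednK // rhon.
pose w t := (fiber f (c n)).[xi + t] - f.[xi%:P].[c n].
have w0 : tendsto U w 0.
  have := tendsto_add (tendsto_horner (fiber f (c n)) lim_xt)
    (tendsto_cst (U := U) (- f.[xi%:P].[c n])).
  by rewrite horner_fiber subrr; apply.
(* Descending induction: on a regular level $f_x(\rho_i,b_i)\neq0$, so [x i] is a germ as soon as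
   its prescribed value is. The end point [x n] is left out: it need not be a germ in [w]. *)
have gx i : (i < n)%N -> germ U w (x i).
  move=> lt; move E : (n - i).-1 => m; elim: m i lt E => [|m IH] i lt hi.
    have Ei : i = n.-1 by lia.
    apply: (germ_root w0 (q := fiber f (b i)) (z := fun t => w t + f.[xi%:P].[c n])) _ (lim i (ltnW lt)) _.
    - by apply: germ_add (germ_w (U := U) w) (germ_cst (U := U) w _).
    - apply: filterS2 (link i lt) hxn => t -> h.
      by rewrite Ei prednK // -h /w subrK.
    - by rewrite -fiber_partx horner_fiber; have [] := rreg i lt.
  have lt1 : (i.+1 < n)%N by lia.
  apply: (germ_root w0 (z := fun t => (fiber f (c i.+1)).[x i.+1 t])) (link i lt) (lim i (ltnW lt)) _.
    by apply: germ_horner w0 _ _ _; apply: IH => //; lia.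
  by rewrite -fiber_partx horner_fiber; have [] := rreg i lt.
pose zd i t := (partx f).[(x i t)%:P].[b i] * v i t + (party f).[(x i t)%:P].[b i] * db i.
have gzd_of i : (i < n)%N -> germ U w (v i) -> germ U w (zd i).
  move=> lt gv.
  have -> : zd i = fun t => (fiber (partx f) (b i)).[x i t] * v i t +
      (fiber (party f) (b i)).[x i t] * db i.
    by apply: funext => t; rewrite !horner_fiber.
  apply: germ_add; apply: (germ_mul w0) => //.
  - exact: (germ_horner w0 _ (gx i lt)).
  - exact: (germ_horner w0 _ (gx i lt)).
  - exact: germ_cst.
have gv i : (i < n)%N -> germ U w (v i).
  elim: i => [|i IH] lt.
    apply: germ_ext (germ_cst (U := U) w 0); apply: filterS Unotin => t /hX[_ [h _] _].
    by rewrite /v h.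
  have lti := ltnW lt.
  apply: (germ_div w0 (y := fun t => (fiber (partx f) (c i.+1)).[x i.+1 t]) (z := zd i)
    (l := (fiber (partx f) (c i.+1)).[rho i.+1])).
  - exact: (germ_horner w0 _ (gx _ lt)).
  - by apply: gzd_of => //; apply: IH.
  - by apply: tendsto_horner; apply: lim; apply: ltnW.
  - by rewrite horner_fiber; have [_ ->] := rreg _ lt.
  - by apply: filterS Unotin => t /hX[_ [_ /(_ i lti)[_ _ h]] _]; rewrite horner_fiber.
have [p [K K0 hp]] : germ_upto U w r (zd n.-1).
  by apply: gzd_of; [|apply: gv]; rewrite prednK.
(* Eliminate $v_n$ from $f_x(x_n,c_n)v_n=p(w)+O(w^r)$ and from the vanishing of the final speed. *)
exists (- (db n)^-1 *: p).
set fc := fiber f (c n) - _.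
pose E0 := db n *: (fiber (party f) (b n) * fiber (partx f) (c n)) +
  fiber (partx f) (b n) * (p \Po fc).
suff : ('X - xi%:P) ^+ r %| E0.
  rewrite -(@dvdpZr _ (db n)^-1) ?invr_eq0 //.
  rewrite /E0 scalerDr scalerA mulVf // scale1r comp_polyZ -scalerAr scaleNr opprK //.
have [L L0 hL] := horner_lipschitz (fiber f (c n)) (cabs xi + 1).
have [M M0 hM] := horner_bound (fiber (partx f) (b n)) (cabs xi + 1).
suff : 'X^r %| E0 \Po ('X + xi%:P).
  move=> /dvdpP[q hq]; apply/dvdpP; exists (q \Po ('X - xi%:P)).
  have : (E0 \Po ('X + xi%:P)) \Po ('X - xi%:P) = (q * 'X^r) \Po ('X - xi%:P) by rewrite hq.
  rewrite -comp_polyA (comp_polyD 'X) comp_polyX comp_polyC subrK comp_polyXr => ->.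
  by rewrite comp_polyM comp_Xn_poly.
apply: (bigO_dvdXn (K := M * (K * L ^+ r)) UU t0 Uneq).
have tle1 : U (fun t => cabs t < 1) by have := t0 1 ltr01; apply: filterS => t; rewrite subr0.
apply: filterS3 (filterI hp hxn) Unotin tle1 => t [h1 h2] /hX[h3 [h4 h5] h6] h7.
rewrite horner_comp (hornerD 'X) hornerX hornerC [t + xi]addrC.
have hB : cabs (xi + t) <= cabs xi + 1 by apply: le_trans (cabsD _ _) _; rewrite lerD2l ltW.
have hB' : cabs xi <= cabs xi + 1 by rewrite lerDl.
have [_ _ h8] := h5 n.-1 (etrans (congr1 (leq^~ n) (prednK n0)) (leqnn n)).
rewrite (prednK n0) -/(zd n.-1 t) in h8.
have wE : fc.[xi + t] = w t by rewrite /fc hornerD hornerN hornerC.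
have E : E0.[xi + t] = - ((fiber (partx f) (b n)).[xi + t] * (zd n.-1 t - p.[w t])).
  rewrite /E0 hornerD hornerZ !hornerM horner_comp wE !horner_fiber.
  move: h6; rewrite /endspeed h3 => h6; rewrite h3 in h8.
  set a1 := (partx f).[_].[b n]; set a2 := (party f).[_].[b n].
  set a3 := (partx f).[_].[c n].
  rewrite -/a1 -/a2 in h6; rewrite -/a3 in h8; rewrite -h8.
  have -> : db n * (a2 * a3) = a3 * (a2 * db n) by ring.
  have -> : a2 * db n = - (a1 * (X t).2 n) by apply/eqP; rewrite -addr_eq0 addrC h6.
  by ring.
rewrite E cabsN cabsM -mulrA; apply: ler_pM; rewrite ?cabs_ge0 ?hM //.
apply: le_trans h1 _; rewrite -mulrA ler_wpM2l // -exprMn.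
apply: lerXn2r; rewrite ?nnegrE ?mulr_ge0 ?cabs_ge0 //.
by have := hL _ _ hB hB'; rewrite [xi + t - xi]addrAC subrr add0r /w -horner_fiber.
Qed.

End Local.

End Fibers.

(** * Transport equations between the partial derivatives *)

Section PolyAux.
Variable F : numClosedFieldType.
Implicit Types (p q r z : {poly F}) (f g : {poly {poly F}}).

Lemma exists_nonroot_notin p (s : seq F) : p != 0 -> exists2 b, b \notin s & p.[b] != 0.
Proof.
move=> p0; have : p * \prod_(a <- s) ('X - a%:P) != 0.
  by rewrite mulf_neq0 // monic_neq0 // monic_prod_XsubC.
move/closed_nonrootP => [b]; rewrite rootM root_prod_XsubC negb_or => /andP[h1 h2].
by exists b.
Qed.

Lemma poly_eq0_cofinite p (s : seq F) : (forall b, b \notin s -> p.[b] = 0) -> p = 0.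
Proof.
move=> h; apply: contrapT => /eqP p0.
by have [b /h ->] := exists_nonroot_notin s p0; rewrite eqxx.
Qed.

Lemma fiber_eq_cofinite f g (s : seq F) :
  (forall b, b \notin s -> fiber f b = fiber g b) -> f = g.
Proof.
move=> h; apply/polyP => i; apply/eqP; rewrite -subr_eq0; apply/eqP.
apply: (poly_eq0_cofinite (s := s)) => b /h/polyP/(_ i).
by rewrite !coef_fiber hornerD hornerN => ->; rewrite subrr.
Qed.

Lemma size_fiber f b : (size (fiber f b) <= size f)%N.
Proof. exact: size_poly. Qed.

(** Division by a monic polynomial is compatible with fibres. The remainder has almost all its
    fibres zero, hence is zero. *)
Lemma dvd_fiber_cofinite p f (s : seq F) : p \is monic ->
  (forall b, b \notin s -> p %| fiber f b) -> exists g, f = p^:P * g.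
Proof.
move=> pm h; have Pm : p^:P \is monic by rewrite map_monic.
have E := Pdiv.RingMonic.rdivp_eq Pm f.
exists (Pdiv.Ring.rdivp f p^:P); rewrite {1}E mulrC.
suff -> : Pdiv.Ring.rmodp f p^:P = 0 by rewrite addr0.
apply: (fiber_eq_cofinite (s := s)) => b /h.
rewrite {1}E fiberD fiberM fiber_lift dvdp_addr ?dvdp_mull //.
move=> hd.
have sz : (size (fiber (Pdiv.Ring.rmodp f p^:P) b) < size p)%N.
  apply: leq_ltn_trans (size_fiber _ _) _.
  by rewrite -(size_map_polyC p) Pdiv.Ring.ltn_rmodpN0 ?monic_neq0.
rewrite /fiber map_poly0; apply/eqP; apply: contraTT sz => n0; rewrite -leqNgt.
exact: dvdp_leq.
Qed.

Lemma deriv_eq0 p : p^`() = 0 -> exists c, p = c%:P.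
Proof.
move=> h; exists p`_0; apply/polyP => -[|i]; rewrite coefC //=.
move/polyP/(_ i): h; rewrite coef_deriv coef0 => /eqP.
by rewrite mulrn_eq0 /= => /eqP.
Qed.

Lemma partx_eq0 f : partx f = 0 -> exists c, f = c%:P.
Proof.
move=> h; exists f`_0; apply/polyP => -[|i]; rewrite coefC //=.
move/polyP/(_ i): h; rewrite coef_deriv coef0 -mulr_natr => /eqP.
rewrite mulf_eq0 => /orP[/eqP //|]; rewrite -polyC_natr polyC_eq0 pnatr_eq0 //.
Qed.

Lemma party_eq0 f : party f = 0 -> exists p, f = p^:P.
Proof.
move=> h; exists (fiber f 0); apply/polyP => i.
rewrite coef_map coef_fiber.
move/polyP/(_ i): h; rewrite coef_map_id0 ?deriv0 // coef0 => /deriv_eq0[c ->].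
by rewrite hornerC.
Qed.

Lemma exists_antideriv f : exists g, partx g = f.
Proof.
exists (\poly_(i < (size f).+1) (((i%:R)^-1)%:P * f`_i.-1)).
apply/polyP => i; rewrite coef_deriv coef_poly /= ltnS.
case: ltnP => [lt|ge]; last by rewrite mul0rn nth_default.
have E (x : {poly F}) n : x *+ n = (n%:R)%:P * x by rewrite polyC_natr mulr_natl.
by rewrite E mulrA -polyCM mulfV ?mul1r // pnatr_eq0.
Qed.

Lemma partx_comp f g : partx (f \Po g) = (partx f \Po g) * partx g.
Proof. exact: deriv_comp. Qed.

Lemma party_comp f g :
  party (f \Po g) = (party f \Po g) + (partx f \Po g) * party g.
Proof.
elim/poly_ind: f => [|f c IH].
  by rewrite /partx /party deriv0 map_poly0 !comp_poly0 map_poly0 mul0r addr0.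
rewrite comp_poly_MXaddC partyD partyM IH partyC partyD party_mulX partyC.
rewrite comp_poly_MXaddC /partx derivD derivM derivX derivC addr0 mulr1.
rewrite comp_polyD comp_polyM comp_polyX; ring.
Qed.

Lemma coefM_top (A : nzRingType) (u v : {poly A}) m n :
  (size u <= m.+1)%N -> (size v <= n.+1)%N -> (u * v)`_(m + n) = u`_m * v`_n.
Proof.
move=> su sv; have lt : (m < (m + n).+1)%N by lia.
rewrite coefM (bigD1 (Ordinal lt)) //= addKn big1 ?addr0 // => i ni.
have [lti|gti|Ei] := ltngtP i m; last by case/eqP: ni; apply: val_inj.
  rewrite [v`__]nth_default ?mulr0 //; apply: leq_trans sv _; lia.
rewrite [u`__]nth_default ?mul0r //; apply: leq_trans su _; lia.
Qed.

Lemma coef_derivM_top (z y : {poly F}) :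
  (1 < size z + size y - 1)%N -> (0 < size z)%N -> (0 < size y)%N ->
  (z^`() * y)`_((size z).-1 + (size y).-1).-1 =
    lead_coef z * lead_coef y *+ (size z).-1.
Proof.
move=> h z0 y0; have [sz|sz] := leqP (size z) 1.
  have -> : z^`() = 0 by rewrite (size1_polyC sz) derivC.
  have -> : (size z).-1 = 0%N by case: (size z) sz => [|[|]].
  by rewrite mul0r coef0 mulr0n.
have -> : ((size z).-1 + (size y).-1).-1 = ((size z).-2 + (size y).-1)%N by lia.
rewrite coefM_top ?leqSpred //; last by apply: leq_trans (size_poly _ _) _; case: (size z) => [|[|]].
rewrite coef_deriv -mulrnAl; congr (_ * _).
by rewrite /lead_coef prednK // -ltnS prednK.
Qed.

(** Leading coefficients show that equal logarithmic derivatives force equal degrees. Subtracting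
    the multiple of [z2] with the same leading coefficient would lower the degree, so the difference
    is zero. *)
Lemma wronskian_eq0 z1 z2 : z2 != 0 -> z1^`() * z2 = z1 * z2^`() ->
  exists c, z1 = c *: z2.
Proof.
move=> z20 h; have s2 : (0 < size z2)%N by rewrite size_poly_gt0.
have sz z : z != 0 -> z^`() * z2 = z * z2^`() -> size z = size z2.
  move=> z0 hz; have s1 : (0 < size z)%N by rewrite size_poly_gt0.
  have lc : lead_coef z * lead_coef z2 != 0 by rewrite mulf_neq0 ?lead_coef_eq0.
  have [|big] := leqP (size z + size z2 - 1) 1; first by lia.
  have := coef_derivM_top big s1 s2; rewrite hz [z * _]mulrC addnC.
  rewrite coef_derivM_top //; last by rewrite addnC.
  rewrite [lead_coef z2 * _]mulrC -[_ *+ _]mulr_natr -[RHS]mulr_natr => /(mulfI lc).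
  by move/eqP; rewrite eqr_nat => /eqP; lia.
have [->|z10] := eqVneq z1 0; first by exists 0; rewrite scale0r.
exists (lead_coef z1 / lead_coef z2); apply/eqP; rewrite -subr_eq0.
apply: contraT => n0; set c := _ / _ in n0 *.
have E : (z1 - c *: z2)^`() * z2 = (z1 - c *: z2) * z2^`().
  by rewrite derivB derivZ !mulrBl h -!scalerAl [z2^`() * _]mulrC.
have := sz _ n0 E; have := sz _ z10 h => s12.
have : (size (z1 - c *: z2)%R < size z2)%N.
  rewrite -[X in (_ < X)%N](prednK s2) ltnS; apply/leq_sizeP => j hj.
  rewrite coefB coefZ; move: hj; rewrite leq_eqVlt => /orP[/eqP <-|hj].
    by rewrite -{1}s12 -!/(lead_coef _) /c divfK ?subrr // lead_coef_eq0.
  have hj' : (size z2 <= j)%N by rewrite -(prednK s2).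
  by rewrite !nth_default ?mulr0 ?subr0 ?s12.
by move=> lt eq; move: lt; rewrite eq ltnn.
Qed.

Lemma dvdp_of_mup p z : p != 0 ->
  (forall x, root p x -> ('X - x%:P) ^+ mup x p %| z) -> p %| z.
Proof.
have [n le] := ubnP (size p); elim: n p le => // n IH p le p0 h.
have [sp|sp] := leqP (size p) 1.
  by rewrite (size1_polyC sp) in p0 *; rewrite -alg_polyC dvdpZl ?dvd1p // -polyC_eq0.
have [x rx] := closed_rootP p (negbT (gtn_eqF sp)).
have [q] : exists q, p = q * ('X - x%:P) ^+ mup x p.
  by apply/dvdpP; rewrite -mup_geq.
have := mup_leq x (mup x p) p0; rewrite leqnn => /esym Nm.
move: (mup x p) (h x rx) Nm => m hm Nm Ep.
have q0 : q != 0 by apply: contra_neq p0 => q0; rewrite Ep q0 mul0r.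
have qx : ~~ root q x.
  by apply: contra Nm => hq; rewrite Ep exprS dvdp_mul // dvdp_XsubCl.
have m0 : (0 < m)%N.
  by case: m hm Nm Ep => // _ _; rewrite expr0 mulr1 => Ep; move: rx; rewrite Ep (negPf qx).
rewrite Ep Gauss_dvdp ?hm ?andbT; last first.
  by apply: coprimep_expr; rewrite coprimep_XsubC.
apply: IH => // [|y ry].
  rewrite -ltnS; apply: leq_trans le; rewrite ltnS Ep.
  rewrite size_Mmonic ?monic_exp ?monicXsubC // size_exp_XsubC addnS /=.
  by rewrite -addn1 leq_add2l.
have xy : y != x by apply: contraTneq ry => ->.
have := h y; rewrite Ep rootM ry => /(_ isT).
rewrite mupMl //; apply: contraNN xy => /rootP /eqP.
by rewrite horner_exp !hornerE expf_eq0 m0 subr_eq0.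
Qed.

End PolyAux.

(** * Transport equations with separated variables *)

Section Special.
Variable F : numClosedFieldType.
Implicit Types (p q r z h k : {poly F}) (f g u w : {poly {poly F}}).

Lemma additive_of_partx0 f : partx f = 0 -> additive_poly f.
Proof.
move=> /partx_eq0[c ->]; exists 'X, 0, c.
by rewrite map_polyX comp_polyX map_poly0 add0r.
Qed.

Lemma additive_of_party0 f : party f = 0 -> additive_poly f.
Proof.
move=> /party_eq0[p ->]; exists 'X, p, 0.
by rewrite map_polyX comp_polyX addr0.
Qed.

Lemma lift_neq0 p : (p^:P == 0) = (p == 0).
Proof. by rewrite map_polyC_eq0. Qed.

Lemma comp_lift_inj h u : (1 < size h)%N -> u \Po h^:P = 0 -> u = 0.
Proof. by move=> sh /eqP; rewrite comp_poly_eq0 ?size_map_polyC // => /eqP. Qed.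

Lemma partx_lift p : partx p^:P = (p^`())^:P.
Proof. by rewrite /partx deriv_map. Qed.

Lemma partx_polyC p : partx p%:P = 0.
Proof. by rewrite /partx derivC. Qed.

Lemma partxD f g : partx (f + g) = partx f + partx g.
Proof. exact: derivD. Qed.

Lemma partxM f g : partx (f * g) = partx f * g + f * partx g.
Proof. exact: derivM. Qed.

(* The substitution t - k(y) for t kills the y-derivative of G. *)
Lemma additive_of_transport (f : {poly {poly F}}) h (G : {poly {poly F}}) (k : {poly F}) :
  f = G \Po h^:P -> party G = (k^`())%:P * partx G -> additive_poly f.
Proof.
move=> fE GE.
have /party_eq0[g gE] : party (G \Po ('X - k%:P)) = 0.
  rewrite party_comp GE comp_polyM comp_polyC.
  have -> : party ('X - k%:P) = - (k^`())%:P.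
    rewrite partyD -['X]mul1r party_mulX -polyC1 partyC derivC mul0r add0r.
    by rewrite -polyCN partyC derivN polyCN.
  by ring.
exists g, h, k; rewrite -gE -comp_polyA comp_polyB comp_polyX comp_polyC addrK.
exact: fE.
Qed.

(** For a class stable under $d/dh$, integration with respect to $h$ and induction on the degree in
    $x$ show that $x$ enters only through $h$. *)
Lemma poly_in_h (E : {poly {poly F}} -> Prop) h :
  (forall u, E u -> exists2 w, partx u = (h^`())^:P * w & E w) ->
  forall u, E u -> exists G, u = G \Po h^:P.
Proof.
move=> hE u; have [n le] := ubnP (size u); elim: n u le => // n IH u le Eu.
have [w uw Ew] := hE u Eu.
have [w0|w0] := eqVneq w 0.
  move: uw; rewrite w0 mulr0 => /partx_eq0[c ->]; exists c%:P.
  by rewrite comp_polyC.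
have [h'0|h'0] := eqVneq h^`() 0.
  move: uw; rewrite h'0 map_poly0 mul0r => /partx_eq0[c ->]; exists c%:P.
  by rewrite comp_polyC.
have lt : (size w < n)%N.
  have u'0 : partx u != 0 by rewrite uw mulf_neq0 // lift_neq0.
  have u0 : u != 0 by apply: contra_neq u'0 => ->; rewrite /partx deriv0.
  apply: leq_trans (_ : size u <= n)%N; last by rewrite -ltnS.
  apply: leq_ltn_trans (lt_size_deriv u0).
  rewrite -/(partx u) uw size_mul ?lift_neq0 // size_map_polyC.
  have : (0 < size h^`())%N by rewrite size_poly_gt0.
  by case: (size _) => // m _; rewrite addSn /= leq_addl.
have [V wV] := IH w lt Ew.
have [W WV] := exists_antideriv V.
have : partx (u - (W \Po h^:P)) = 0.
  rewrite partxD /partx derivN -!/(partx _) partx_comp WV -wV partx_lift uw mulrC.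
  by rewrite subrr.
move=> /partx_eq0[c hc]; exists (W + c%:P).
by rewrite comp_polyD comp_polyC -hc addrC subrK.
Qed.

Section PDE.
Variables (P S l theta : {poly F}).
Hypotheses (Pm : P \is monic) (l0 : l != 0) (th0 : theta != 0) (S0 : S != 0).

(** The field $f_y/f_x$ separates as $(\theta/l)(y)\,(S/P)(x)$. *)
Definition pde u : Prop := l%:P * P^:P * party u = theta%:P * S^:P * partx u.

(** The commuting operators $(S/P)\partial_x$ and $(l/\theta)\partial_y$ agree on solutions, so
    their common value is again a solution. It is a polynomial because [P] divides $S u_x$ on every
    fibre where $\theta\neq0$. *)
Lemma pde_step u : pde u ->
  exists w, [/\ S^:P * partx u = P^:P * w, theta%:P * w = l%:P * party u & pde w].
Proof.
move=> hu.
have [w hw] : exists w, S^:P * partx u = P^:P * w.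
  have [s hs] : exists s : seq F, forall b, b \notin s -> theta.[b] != 0.
    have [s hs] := closed_field_poly_normal theta; exists s => b hb.
    by rewrite hs hornerZ mulf_neq0 ?lead_coef_eq0 // -rootE root_prod_XsubC.
  apply: (dvd_fiber_cofinite (s := s)) => // b /hs thb.
  have := congr1 (fun v => fiber v b) hu; rewrite !fiberM !fiber_lift !fiberC => E.
  rewrite -(dvdpZr _ _ thb) -mul_polyC mulrA -E.
  by rewrite mulrAC dvdp_mull.
have P0 : P^:P != 0 by rewrite lift_neq0 monic_neq0.
have e1 : theta%:P * w = l%:P * party u.
  by apply: (mulfI P0); rewrite mulrCA -hw mulrA -hu; ring.
exists w; split => //; rewrite /pde.
have : partx (theta%:P * w) = partx (l%:P * party u) by rewrite e1.
rewrite !partxM !partx_polyC !mul0r !add0r => e2.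
rewrite mulrAC -mulrA || idtac.
have -> : theta%:P * S^:P * partx w = S^:P * (theta%:P * partx w) by ring.
rewrite e2 -party_partx.
have -> : S^:P * (l%:P * party (partx u)) = l%:P * party (S^:P * partx u).
  by rewrite partyM party_lift mul0r add0r; ring.
by rewrite hw partyM party_lift mul0r add0r; ring.
Qed.

Lemma pdeD u w : pde u -> pde w -> pde (u + w).
Proof. by rewrite /pde partyD partxD !mulrDr => -> ->. Qed.

Lemma pdeZ (c : F) u : pde u -> pde (c%:P%:P * u).
Proof.
rewrite /pde partyM partxM partx_polyC partyC derivC !mul0r !add0r.
by rewrite (mulrCA _ _ (party u)) (mulrCA _ _ (partx u)) => ->.
Qed.

Lemma pdeN u : pde u -> pde (- u).
Proof.
have -> : - u = (-1)%:P%:P * u by rewrite !polyCN !polyC1 mulN1r.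
exact: pdeZ.
Qed.

Lemma pde_additive f : pde f -> (size S <= size P)%N -> additive_poly f.
Proof.
move=> hf sz.
have [fx0|fx0] := eqVneq (partx f) 0; first exact: additive_of_partx0.
have SP0 : S^:P != 0 by rewrite lift_neq0.
(* the operator w = (S/P) u_x lowers the degree, so its last nonconstant iterate is h *)
have [h hP] : exists h, S * h^`() = P.
  have [n le] := ubnP (size f); elim: n f le hf fx0 => // n IH u le hu ux0.
  have [w [w1 w2 w3]] := pde_step hu.
  have [wx0|wx0] := eqVneq (partx w) 0.
    have [c wc] := partx_eq0 wx0.
    have c0 : c != 0.
      apply: contra_neq ux0 => c0; move/eqP: w1; rewrite wc c0 mulr0 mulf_eq0 (negPf SP0).
      by move/eqP.
    have [b _ cb] := exists_nonroot_notin [::] c0.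
    exists (c.[b]^-1 *: fiber u b); rewrite derivZ -fiber_partx -scalerAr.
    have := congr1 (fun v => fiber v b) w1; rewrite !fiberM !fiber_lift wc fiberC => ->.
    by rewrite mulrC mul_polyC scalerA mulVf // scale1r.
  apply: (IH w) => //; rewrite -ltnS; apply: leq_trans le; rewrite ltnS.
  have u0 : u != 0 by apply: contra_neq ux0 => ->; rewrite /partx deriv0.
  have w0 : w != 0 by apply: contra_neq wx0 => ->; rewrite /partx deriv0.
  have := congr1 (fun z : {poly {poly F}} => size z) w1.
  have P0 : P^:P != 0 by rewrite lift_neq0 monic_neq0.
  rewrite /= (size_mul SP0 ux0) (size_mul P0 w0) !size_map_polyC.
  have := lt_size_deriv u0; rewrite -/(partx u).
  have : (0 < size S)%N by rewrite size_poly_gt0.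
  have : (0 < size (partx u))%N by rewrite size_poly_gt0.
  have : (0 < size P)%N by rewrite size_poly_gt0 monic_neq0.
  have : (0 < size w)%N by rewrite size_poly_gt0.
  move: sz; clear.
  move: (size S) (size P) (size w) (size u) (size (partx u)); lia.
have fh : forall u, pde u -> exists2 w, partx u = (h^`())^:P * w & pde w.
  move=> u hu; have [w [w1 w2 w3]] := pde_step hu; exists w => //.
  by apply: (mulfI SP0); rewrite w1 mulrA -rmorphM hP.
have [G fG] := poly_in_h fh hf.
have h'0 : h^`() != 0.
  by apply: contraTneq (monic_neq0 Pm) => h'0; rewrite -hP h'0 mulr0 eqxx.
have sh : (1 < size h)%N.
  rewrite ltnNge; apply: contra h'0 => sh; rewrite (size1_polyC sh) derivC //.
have GE : l%:P * party G = theta%:P * partx G.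
  apply/eqP; rewrite -subr_eq0; apply/eqP; apply: (comp_lift_inj sh).
  have P0 : (P^:P : {poly {poly F}}) != 0 by rewrite lift_neq0 monic_neq0.
  apply: (mulfI P0); rewrite mulr0 comp_polyB !comp_polyM !comp_polyC.
  move: hf; rewrite /pde fG party_comp partx_comp party_lift mulr0 addr0 partx_lift.
  have -> : P^:P = S^:P * (h^`())^:P by rewrite -rmorphM hP.
  move=> e; apply/eqP; rewrite mulrBr subr_eq0; apply/eqP.
  by rewrite mulrCA mulrA e; ring.
have Gx0 : partx G != 0.
  by apply: contra_neq fx0 => Gx0; rewrite fG partx_comp Gx0 comp_poly0 mul0r.
(* The top coefficient of $G(t,y)$ is constant in $y$; the next one, divided by [M] times it, has
   derivative $\theta/l$ and is the $k$ with $G(t,y)=g(t+k(y))$. *)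
pose M := (size G).-1.
have M0 : (0 < M)%N.
  rewrite /M -subn1 subn_gt0 ltnNge; apply: contra Gx0 => sG.
  by rewrite (size1_polyC sG) /partx derivC.
have sG : size G = M.+1 by rewrite /M prednK //; move: M0; rewrite /M; case: (size G).
have coefE i : l * (G`_i)^`() = theta * (G`_i.+1 *+ i.+1).
  move/polyP/(_ i): GE; rewrite !coefCM coef_deriv coef_map_id0 ?deriv0 //.
have [phi phiE] : exists c, G`_M = c%:P.
  apply: deriv_eq0; move/eqP: (coefE M); rewrite [G`_M.+1]nth_default ?sG // mul0rn mulr0.
  by rewrite mulf_eq0 (negPf l0) => /eqP.
have phi0 : phi != 0.
  by rewrite -polyC_eq0 -phiE /M -/(lead_coef G) lead_coef_eq0 -size_poly_gt0 sG.
pose k := (M%:R * phi)^-1 *: G`_M.-1.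
apply: (additive_of_transport (k := k) fG).
have lp0 : l%:P != 0 by rewrite polyC_eq0.
apply: (mulfI lp0); rewrite GE mulrA -polyCM; congr (_%:P * _).
have Mphi0 : M%:R * phi != 0 by rewrite mulf_neq0 // pnatr_eq0 -lt0n.
rewrite /k derivZ -scalerAr coefE prednK // phiE.
rewrite -polyCMn [theta * _]mulrC mul_polyC scalerA -[phi *+ M]mulr_natl mulVf //.
by rewrite scale1r.
Qed.

End PDE.
End Special.

Lemma ex_min_nat (P : nat -> Prop) :
  (exists n, P n) -> exists2 n, P n & forall m, P m -> (n <= m)%N.
Proof.
move=> [n0 hn0]; have ex : exists n, `[< P n >] by exists n0; apply/asboolP.
case: (ex_minnP ex) => n /asboolP hn hmin; exists n => // m hm.
by apply: hmin; apply/asboolP.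
Qed.

Lemma mulrn_polyC (F : nzRingType) (x : {poly F}) n : x *+ n = (n%:R)%:P * x.
Proof. by rewrite polyC_natr mulr_natl. Qed.

Section EigPoly.
Variable F : numClosedFieldType.
Implicit Types (p q r z : {poly F}).
Variables A B : {poly F}.
Hypothesis A0 : A != 0.

(** Prescribed logarithmic derivative $z'/z=cB/A$, which fixes [z] up to a constant factor. *)
Definition eigpoly (c : F) z : Prop := A * z^`() = c *: (B * z).

Lemma eigpoly_pow c z m : eigpoly c z -> eigpoly (m%:R * c) (z ^+ m).
Proof.
rewrite /eigpoly deriv_exp => h; case: m => [|m].
  by rewrite mulr0n mulr0 mul0r scale0r.
by rewrite /= mulrnAr mulrA h -mulr_natl exprS -!mul_polyC polyCM polyC_natr; ring.
Qed.

Lemma eigpoly_prop c z1 z2 : eigpoly c z1 -> eigpoly c z2 -> z2 != 0 ->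
  exists k, z1 = k *: z2.
Proof.
rewrite /eigpoly => h1 h2 z20; apply: wronskian_eq0 => //.
by apply: (mulfI A0); rewrite mulrA h1 mulrCA h2 -!mul_polyC; ring.
Qed.

(** The powers $h^d$ and $p^G$ have the same logarithmic derivative, so they are proportional and
    $h$ divides $p$ as $G\le d$. *)
Lemma eigpoly_div c (d G : nat) p h : c != 0 -> (0 < G <= d)%N -> h != 0 -> p != 0 ->
  eigpoly (c * d%:R) p -> eigpoly (c * G%:R) h ->
  exists2 p1, p = h * p1 & eigpoly (c * (d - G)%:R) p1.
Proof.
move=> c0 /andP[G0 Gd] h0 p0 ep eh.
have [k hk] : exists k, h ^+ d = k *: p ^+ G.
  apply: (@eigpoly_prop (c * d%:R * G%:R)); last by rewrite expf_neq0.
    by have := eigpoly_pow d eh; rewrite mulrCA mulrA mulrAC.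
  by have := eigpoly_pow G ep; rewrite mulrC.
have hdp : h %| p.
  rewrite -(dvdp_pexp2r _ _ G0); apply: dvdp_trans (_ : h ^+ d %| _).
    exact: dvdp_exp2l.
  rewrite hk; have [k0|k0] := eqVneq k 0; last by rewrite dvdpZl.
  by move/eqP: hk; rewrite k0 scale0r expf_eq0 (negPf h0) andbF.
have [p1 pE] := dvdpP _ _ hdp; exists p1; first by rewrite mulrC.
move: ep eh; rewrite /eigpoly pE derivM mulrDr => e1 e2.
apply: (mulIf h0); rewrite natrB // mulrBr scalerBl mulrBl.
have -> : A * p1^`() * h = c * d%:R *: (B * (p1 * h)) - p1 * (A * h^`()).
  by rewrite -e1; ring.
by rewrite e2 -!mul_polyC; ring.
Qed.

Lemma eigpoly0_const z : eigpoly 0 z -> exists k, z = k%:P.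
Proof.
by rewrite /eigpoly scale0r => /eqP; rewrite mulf_eq0 (negPf A0) => /eqP/deriv_eq0.
Qed.

End EigPoly.

(** * Separated equations of top degree: eigenvectors and the multiplicative form *)

Section Mult.
Variable F : numClosedFieldType.
Implicit Types (p q r z h k : {poly F}) (f g u w e : {poly {poly F}}).
Variables (P S l theta : {poly F}).
Hypotheses (Pm : P \is monic) (l0 : l != 0) (th0 : theta != 0) (S0 : S != 0).
Hypothesis szS : size S = (size P).+1.

Local Notation pde := (pde P S l theta).
Let a := lead_coef S.
Let a0 : a != 0. Proof. by rewrite lead_coef_eq0. Qed.
Let P0 : P^:P != 0. Proof. by rewrite lift_neq0 monic_neq0. Qed.
Let SP0 : S^:P != 0. Proof. by rewrite lift_neq0. Qed.
Let sP : (0 < size P)%N. Proof. by rewrite size_poly_gt0 monic_neq0. Qed.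

(** For $\deg S=\deg P+1$ the operator $(S/P)\partial_x$ does not raise the degree in $x$ and
    multiplies the coefficient of $x^d$ by $ad$ in degree at most $d$: it is triangular with
    distinct eigenvalues. *)
Lemma step_top u w d : S^:P * partx u = P^:P * w -> (size u <= d.+1)%N ->
  (size w <= d.+1)%N /\ w`_d = (a * d%:R)%:P * u`_d.
Proof.
move=> E su.
have sux : (size (partx u) <= d)%N.
  apply: leq_trans (size_poly _ _) _; by case: (size u) su.
have sw : (size w <= d.+1)%N.
  have [->|w0] := eqVneq w 0; first by rewrite size_poly0.
  have [ux0|ux0] := eqVneq (partx u) 0.
    by move/eqP: E; rewrite ux0 mulr0 eq_sym mulf_eq0 (negPf P0) (negPf w0).
  have := congr1 (fun z : {poly {poly F}} => size z) E.
  rewrite /= (size_mul SP0 ux0) (size_mul P0 w0) !size_map_polyC szS.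
  move: sux sP; clear; move: (size P) (size w) (size (partx u)); lia.
split=> //; case: d su sux sw => [|d] su sux sw.
  have ux0 : partx u = 0 by apply/eqP; rewrite -size_poly_leq0.
  move/eqP: E; rewrite ux0 mulr0 eq_sym mulf_eq0 (negPf P0) => /eqP ->.
  by rewrite coef0 mulr0 mul0r.
have := congr1 (fun z : {poly {poly F}} => z`_((size P).-1 + d.+1)) E.
rewrite /= [RHS]coefM_top ?size_map_polyC ?leqSpred // addnS -addSn prednK //.
rewrite coefM_top ?size_map_polyC ?szS // !coef_map /= -/(lead_coef P) (monicP Pm).
rewrite mul1r => <-; have -> : S`_(size P) = a by rewrite /a /lead_coef szS.
by rewrite coef_deriv mulrn_polyC polyCM; ring.
Qed.

Definition eigen d e : Prop :=
  pde e /\ S^:P * partx e = P^:P * ((a * d%:R)%:P%:P * e).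

Lemma top_eigen u d : pde u -> (size u <= d.+1)%N ->
  exists e, [/\ eigen d e, (size e <= d.+1)%N & e`_d = u`_d].
Proof.
move=> hu su.
suff h m : (m <= d)%N -> exists e (r : {poly {poly F}}), [/\ pde e, pde r, (size e <= d.+1)%N, e`_d = u`_d &
    (size r <= d - m)%N /\ S^:P * partx e = P^:P * ((a * d%:R)%:P%:P * e + r)].
  have [e [r [h1 h2 h3 h4]]] := h d (leqnn d).
  rewrite subnn size_poly_leq0 => -[/eqP r0]; rewrite r0 addr0 => h5.
  by exists e.
elim: m => [_|m IH md].
  have [w [w1 w2 w3]] := pde_step Pm th0 hu.
  have [sw wd] := step_top w1 su.
  exists u, (w - (a * d%:R)%:P%:P * u); split=> //.
    by apply: pdeD => //; apply: pdeN; apply: pdeZ.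
  split; last by rewrite addrC subrK.
  rewrite subn0; apply/leq_sizeP => j; rewrite leq_eqVlt => /orP[/eqP <-|dj].
    by rewrite coefB coefCM wd subrr.
  by rewrite coefB coefCM !nth_default ?mulr0 ?subr0 // ?(leq_trans su) ?(leq_trans sw).
have [e [r [pe pr se ed [sr E]]]] := IH (ltnW md).
pose j := (d - m).-1; have dj : (j < d)%N by rewrite /j; lia.
have {}sr : (size r <= j.+1)%N by rewrite /j prednK // subn_gt0.
have [w [w1 w2 w3]] := pde_step Pm th0 pr.
have [sw wj] := step_top w1 sr.
(* In the top degree [j] of the error [r] the operator has eigenvalue $aj$, so adding [c] times [r]
   to [e] cancels the coefficient of degree [j] in the error. *)
pose c := (a * (d - j)%:R)^-1.
have c0 : a * (d - j)%:R != 0 by rewrite mulf_neq0 // pnatr_eq0 subn_eq0 -ltnNge.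
exists (e + c%:P%:P * r), (r + c%:P%:P * (w - (a * d%:R)%:P%:P * r)); split.
- by apply: pdeD => //; apply: pdeZ.
- apply: pdeD => //; apply: pdeZ; apply: pdeD => //.
  by apply: pdeN; apply: pdeZ.
- apply/leq_sizeP => i di; rewrite coefD coefCM !nth_default ?mulr0 ?addr0 //.
    by apply: leq_trans sr _; lia.
  exact: leq_trans se _.
- rewrite coefD coefCM [r`_d]nth_default ?mulr0 ?addr0 //.
  exact: leq_trans sr _.
split; last first.
  rewrite partxD partxM partx_polyC mul0r add0r mulrDr E mulrCA w1; ring.
have -> : (d - m.+1)%N = j by rewrite /j; lia.
apply/leq_sizeP => i; rewrite leq_eqVlt => /orP[/eqP <-|ji]; last first.
  by rewrite coefD coefCM coefB coefCM !nth_default ?mulr0 ?subr0 ?mulr0 ?addr0 // (leq_trans _ ji).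
rewrite coefD coefCM coefB coefCM wj -mulrBl -polyCB mulrA -polyCM.
have -> : c * (a * j%:R - a * d%:R) = -1.
  have -> : a * j%:R - a * d%:R = - (a * (d - j)%:R) by rewrite natrB 1?ltnW //; ring.
  by rewrite mulrN /c mulVf.
by rewrite polyCN mulN1r subrr.
Qed.

Lemma eigen_sum u n : pde u -> (size u <= n)%N ->
  exists e : nat -> {poly {poly F}}, (forall d, eigen d (e d)) /\ u = \sum_(d < n) e d.
Proof.
elim: n u => [|n IH] u hu su.
  exists (fun=> 0); split.
    by move=> d; split; rewrite /pde /partx /party ?deriv0 ?map_poly0 ?mulr0.
  by rewrite big_ord0; apply/eqP; rewrite -size_poly_leq0.
have [e [he se en]] := top_eigen hu su.
have [||e' [he' E]] := IH (u - e).
- by apply: pdeD => //; apply: pdeN; case: he.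
- apply/leq_sizeP => j; rewrite leq_eqVlt => /orP[/eqP <-|nj].
    by rewrite coefB en subrr.
  by rewrite coefB !nth_default ?subrr // (leq_trans _ nj).
exists (fun d => if d == n then e else e' d); split.
  by move=> d; case: eqP => [->|].
rewrite big_ord_recr /= eqxx -[LHS](subrK e) E; congr (_ + _).
by apply: eq_bigr => i _; rewrite (ltn_eqF (ltn_ord i)).
Qed.

(** All fibres of an eigenvector satisfy one first-order equation in $x$. They are therefore
    proportional, which separates the variables. *)
Lemma eigen_split d e : eigen d e -> e != 0 -> exists p q,
  [/\ e = p^:P * q%:P, p != 0, q != 0, eigpoly S P (a * d%:R) p &
      eigpoly l theta (a * d%:R) q].
Proof.
move=> [he E] e0.
have [b0 _ hb0] : exists2 b0, b0 \notin [::] & (lead_coef e).[b0] != 0.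
  by apply: exists_nonroot_notin; rewrite lead_coef_eq0.
have hz b : eigpoly S P (a * d%:R) (fiber e b).
  have := congr1 (fun v => fiber v b) E.
  rewrite !fiberM !fiber_lift fiber_partx !fiberC hornerC mul_polyC /eigpoly => ->.
  by rewrite -scalerAr.
pose p := fiber e b0.
have p0 : p != 0.
  apply: contra_neq hb0 => p0; rewrite /lead_coef -coef_fiber -/p p0 coef0 //.
have lp0 : lead_coef p != 0 by rewrite lead_coef_eq0.
pose q := (lead_coef p)^-1 *: e`_(size p).-1.
have eE : e = p^:P * q%:P.
  apply: (fiber_eq_cofinite (s := [::])) => b _.
  have [k hk] := eigpoly_prop S0 (hz b) (hz b0) p0.
  rewrite fiberM fiber_lift fiberC /q hornerZ -coef_fiber hk coefZ -/p -/(lead_coef p).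
  by rewrite mulrCA mulVf // mulr1 mulrC mul_polyC.
have q0 : q != 0 by apply: contra_neq e0 => q0; rewrite eE q0 polyC0 mulr0.
exists p, q; split=> //; first exact: hz.
rewrite /eigpoly.
have pP0 : p^:P != 0 by rewrite lift_neq0.
apply: polyC_inj; apply: (mulfI pP0); apply: (mulfI P0).
have e1 : party e = p^:P * (q^`())%:P by rewrite eE partyM party_lift mul0r add0r partyC.
have h : l%:P * P^:P * (p^:P * (q^`())%:P) =
    theta%:P * (P^:P * ((a * d%:R)%:P%:P * e)).
  by rewrite -E -e1 mulrA.
rewrite -mul_polyC !polyCM; transitivity (l%:P * P^:P * (p^:P * (q^`())%:P)).
  by ring.
by rewrite h eE !polyCM; ring.
Qed.

(** Take the least [G > 0] for which [a * G] occurs as an eigenvalue, with pair $h,k$. By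
    [eigpoly_div] a factor $h(x)k(y)$ splits off while the index is positive; index 0 leaves a
    constant. *)
Lemma eigen_powers : exists h k, forall d p q, p != 0 -> q != 0 ->
  eigpoly S P (a * d%:R) p -> eigpoly l theta (a * d%:R) q ->
  exists c m, p^:P * q%:P = c%:P%:P * (h^:P * k%:P) ^+ m.
Proof.
pose good d := [/\ (0 < d)%N & exists p q, [/\ p != 0, q != 0,
  eigpoly S P (a * d%:R) p & eigpoly l theta (a * d%:R) q]].
have const p q : eigpoly S P (a * 0%:R) p -> eigpoly l theta (a * 0%:R) q ->
    exists c, p^:P * q%:P = c%:P%:P.
  rewrite mulr0 => /(eigpoly0_const S0)[k1 ->] /(eigpoly0_const l0)[k2 ->].
  by exists (k1 * k2); rewrite map_polyC /= !polyCM.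
have [[d0 gd0]|ng] := EM (exists d, good d); last first.
  exists 1, 1 => d p q p0 q0 ep eq.
  have [dE|d0] := posnP d; last by case: ng; exists d; split=> //; exists p, q.
  rewrite dE in ep eq; have [c hc] := const _ _ ep eq; exists c, 0%N.
  by rewrite expr0 mulr1.
have [G [G0 [h [k [h0 k0 eh ek]]]] Gmin] := ex_min_nat (ex_intro _ d0 gd0).
exists h, k => d p q; have [n le] := ubnP d; elim: n d le p q => // n IH d le p q p0 q0 ep eq.
have [dE|d1] := posnP d.
  rewrite dE in ep eq; have [c hc] := const _ _ ep eq; exists c, 0%N.
  by rewrite expr0 mulr1.
have Gd : (0 < G <= d)%N by rewrite G0; apply: Gmin; split=> //; exists p, q.
have [p1 pE ep1] := eigpoly_div S0 a0 Gd h0 p0 ep eh.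
have [q1 qE eq1] := eigpoly_div l0 a0 Gd k0 q0 eq ek.
have p10 : p1 != 0 by apply: contra_neq p0 => p10; rewrite pE p10 mulr0.
have q10 : q1 != 0 by apply: contra_neq q0 => q10; rewrite qE q10 mulr0.
have lt : (d - G < n)%N by move: le d1 G0; clear; lia.
have [c [m E]] := IH (d - G)%N lt p1 q1 p10 q10 ep1 eq1.
exists c, m.+1; rewrite pE qE rmorphM /= polyCM mulrACA E exprS.
by rewrite mulrCA.
Qed.

Lemma pde_multiplicative f : pde f -> multiplicative_poly f.
Proof.
move=> hf; have [e [he fE]] := eigen_sum hf (leqnn _).
have [h [k hk]] := eigen_powers.
have /choice[cm hcm] : forall d, exists cm : F * nat,
    e d = (cm.1)%:P%:P * (h^:P * k%:P) ^+ cm.2.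
  move=> d; have [->|e0] := eqVneq (e d) 0; first by exists (0, 0%N); rewrite !polyC0 mul0r.
  have [p [q [-> p0 q0 ep eq]]] := eigen_split (he d) e0.
  by have [c [m ->]] := hk d p q p0 q0 ep eq; exists (c, m).
exists (\sum_(d < size f) (cm d).1 *: 'X^((cm d).2)), h, k.
rewrite {1}fE rmorph_sum /=.
rewrite (big_morph (fun g => g \Po (h^:P * k%:P)) (fun x y => comp_polyD x y _) (comp_poly0 _)).
apply: eq_bigr => d _; rewrite hcm map_polyZ /= map_polyXn comp_polyZ comp_Xn_poly.
by rewrite mul_polyC.
Qed.

End Mult.

(** In the coordinate $t=h(x)$ the fields are $((\gamma t+\delta)/l)\,\partial_t$, and by
    independence they span the Lie algebra of the affine group as $y$ varies. Dependent
    $\gamma,\delta$ would give a separated equation. *)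
Definition affine_type (F : fieldType) (f : {poly {poly F}}) : Prop :=
  exists (h : {poly F}) (G : {poly {poly F}}) (l gam del : {poly F}),
  [/\ (1 < size h)%N, f = G \Po h^:P, l != 0,
      l%:P * party G = (gam%:P * 'X + del%:P) * partx G &
      forall u v : F, u *: gam + v *: del = 0 -> u = 0 /\ v = 0].

(** * Fixed critical points and the Lie algebra of descending fields *)

Section Fixed.
Variable F : numClosedFieldType.
Implicit Types (p q z h R S T : {poly F}).

Lemma dvd_deriv_XsubC (x : F) r z :
  ('X - x%:P) ^+ r.+1 %| z -> ('X - x%:P) ^+ r %| z^`().
Proof.
move=> /dvdpP[q ->]; rewrite derivM deriv_exp derivXsubC mul1r /=.
by rewrite dvdp_add ?dvdp_mull ?dvdp_exp2l // -mulr_natl dvdp_mull.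
Qed.

Lemma XsubC_dvd_mulr (x : F) r p z : p.[x] != 0 ->
  ('X - x%:P) ^+ r %| p * z -> ('X - x%:P) ^+ r %| z.
Proof.
move=> px; rewrite Gauss_dvdpr // coprimep_expl // coprimep_sym coprimep_XsubC.
by rewrite rootE.
Qed.

Variables (f g Q : {poly {poly F}}) (P l : {poly F}) (c : F) (s0 : seq F).
Hypotheses (Pm : P \is monic) (l0 : l != 0) (szQ : (size Q <= (size P).+1)%N).
Hypothesis fxE : partx f = P^:P * g.
Hypothesis fyE : l%:P * party f = Q * g.
Hypothesis fyP : forall x, root P x -> (party f).[x%:P] != 0.
Hypothesis gc : forall x, root P x -> (fiber g c).[x] != 0.

Local Notation phi x := (fiber f c - (f.[x%:P].[c])%:P).

(** The field $(S/P)\partial_x$ descends along $f(\cdot,c)$ at every root of [P]. Its image is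
    $S\,g(\cdot,c)$, since $f_x(\cdot,c)=P\,g(\cdot,c)$. *)
Definition pushes S : Prop := forall x, root P x -> forall r, exists A : {poly F},
  ('X - x%:P) ^+ r %| S * fiber g c - (A \Po phi x).

Hypothesis desc : forall b, b \notin s0 -> pushes (fiber Q b).

Let P0 : P != 0. Proof. exact: monic_neq0. Qed.
Let PP0 : P^:P != 0. Proof. by rewrite lift_neq0. Qed.
Let sP : (0 < size P)%N. Proof. by rewrite size_poly_gt0. Qed.

Lemma main_pde : l%:P * P^:P * party f = Q * partx f.
Proof. by rewrite fxE mulrAC fyE; ring. Qed.

Definition liealg S : Prop := (size S <= (size P).+1)%N /\ pushes S.

Lemma liealg_fiber b : b \notin s0 -> liealg (fiber Q b).
Proof.
by move=> hb; split; [apply: leq_trans (size_fiber _ _) szQ|apply: desc].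
Qed.

Lemma liealg_lin R S k : liealg R -> liealg S -> liealg (R - k *: S).
Proof.
move=> [sR hR] [sS hS]; split.
  apply: leq_trans (size_polyD _ _) _; rewrite size_polyN geq_max sR.
  exact: leq_trans (size_scale_leq _ _) sS.
move=> x rx r; have [A hA] := hR x rx r; have [B hB] := hS x rx r.
exists (A - k *: B); rewrite comp_polyB comp_polyZ mulrBl -scalerAl.
set u := R * _ in hA *; set v := S * _ in hB *; set U := A \Po _ in hA *.
set V := B \Po _ in hB *.
have -> : u - k *: v - (U - k *: V) = (u - U) - k *: (v - V).
  by rewrite scalerBr; ring.
by rewrite dvdp_sub // -mul_polyC dvdp_mull.
Qed.

(** Descending fields are closed under the bracket, and
    $[(R/P)\partial_x,(S/P)\partial_x]=(T/P)\partial_x$ with $PT=RS'-R'S$, the derivative of [P]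
    cancelling. That [P] divides the right side follows from the descent, checked at each root to
    the order of that root; division by [P] then restores the bound on the degree. *)
Lemma liealg_bracket R S : liealg R -> liealg S ->
  exists2 T, R * S^`() - R^`() * S = P * T & liealg T.
Proof.
move=> [sR hR] [sS hS]; set N := R * _ - _; pose G := fiber g c.
have phi' x : (phi x)^`() = P * G.
  by rewrite derivB derivC subr0 -fiber_partx fxE fiberM fiber_lift.
have key x (rx : root P x) r : exists A : {poly F},
    ('X - x%:P) ^+ r %| N * G ^+ 2 - P * G * (A \Po phi x).
  have [A hA] := hR x rx r.+1; have [B hB] := hS x rx r.+1.
  exists (A * B^`() - A^`() * B).
  have := dvd_deriv_XsubC hA; have := dvd_deriv_XsubC hB.
  rewrite !derivB !deriv_comp !phi' -/G.
  have {}hA := dvdp_trans (dvdp_exp2l _ (leqnSn r)) hA.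
  have {}hB := dvdp_trans (dvdp_exp2l _ (leqnSn r)) hB.
  move: hA hB; rewrite -/G comp_polyB !comp_polyM.
  set a := A \Po _; set b := B \Po _; set a' := A^`() \Po _; set b' := B^`() \Po _.
  move=> hA hB hB' hA'.
  have -> : N * G ^+ 2 - P * G * (a * b' - a' * b) =
      a * ((S * G)^`() - b' * (P * G)) + (R * G - a) * (S * G)^`() -
      ((R * G)^`() - a' * (P * G)) * (S * G) - a' * (P * G) * (S * G - b).
    by rewrite /N !derivM; ring.
  apply: dvdp_sub; last exact: dvdp_mull.
  apply: dvdp_sub; last exact: dvdp_mulr.
  by apply: dvdp_add; [apply: dvdp_mull|apply: dvdp_mulr].
have PN : P %| N.
  apply: dvdp_of_mup => // x rx; have [A hA] := key x rx (mup x P).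
  have : ('X - x%:P) ^+ mup x P %| N * G ^+ 2.
    rewrite -(subrK (P * G * (A \Po phi x)) (N * G ^+ 2)) dvdp_add // -mulrA dvdp_mulr //.
    by rewrite -mup_geq.
  by rewrite mulrC => /XsubC_dvd_mulr; apply; rewrite horner_exp expf_neq0 // gc.
have /dvdpP[T TE] := PN; exists T; first by rewrite mulrC.
split.
  have [T0|T0] := eqVneq T 0; first by rewrite T0 size_poly0.
  have L (x y m : nat) : (x <= m.+1 -> y <= m -> (x + y).-1 <= m.*2)%N by lia.
  have : (size N <= (size P).*2)%N.
    apply: leq_trans (size_polyD _ _) _; rewrite size_polyN geq_max.
    have d (U : {poly F}) : (size U <= (size P).+1)%N -> (size U^`() <= size P)%N.
      by move=> h; apply: leq_trans (size_poly _ _) _; case: (size U) h.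
    apply/andP; split; apply: leq_trans (size_polyMleq _ _) _.
      exact: L sR (d _ sS).
    by rewrite addnC; exact: L sS (d _ sR).
  have L2 (x y : nat) : (0 < y -> (x + y).-1 <= y.*2 -> x <= y.+1)%N by lia.
  by rewrite TE size_mul //; apply: L2 sP.
move=> x rx r; have [A hA] := key x rx (r + mup x P)%N; exists A.
have [P1 P1E] : exists P1, P = P1 * ('X - x%:P) ^+ mup x P.
  by apply/dvdpP; rewrite -mup_geq.
have P1x : P1.[x] != 0.
  rewrite -rootE; apply/negP => r1.
  have := mup_leq x (mup x P) P0; rewrite leqnn => /esym/negP; apply.
  by rewrite {2}P1E exprS dvdp_mul // dvdp_XsubCl.
apply: (@XsubC_dvd_mulr x r (P1 * G)).
  by rewrite hornerM mulf_neq0 // gc.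
rewrite -(@dvdp_mul2r _ (('X - x%:P) ^+ mup x P)) ?expf_neq0 ?polyXsubC_eq0 //.
rewrite -exprD; move: hA; rewrite TE => hA.
have -> // : P1 * G * (T * fiber g c - (A \Po phi x)) * ('X - x%:P) ^+ mup x P =
   T * P * G ^+ 2 - P * G * (A \Po phi x).
by rewrite -/G [in RHS]P1E; ring.
Qed.

Lemma size_bracket R S : R != 0 -> S != 0 -> size R != size S ->
  size (R * S^`() - R^`() * S) = (size R + size S - 2)%N.
Proof.
move=> R0 S0 ne.
have r0 : (0 < size R)%N by rewrite size_poly_gt0.
have t0 : (0 < size S)%N by rewrite size_poly_gt0.
have big : (1 < size R + size S - 1)%N by move: ne r0 t0; clear; lia.
have L (x y z : nat) : (0 < x -> z.+1 <= y -> (x + z).-1 <= x + y - 2)%N by lia.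
apply/eqP; rewrite eqn_leq; apply/andP; split.
  apply: leq_trans (size_polyD _ _) _; rewrite size_polyN geq_max.
  have d (U : {poly F}) : (0 < size U)%N -> ((size U^`()).+1 <= size U)%N.
    by move=> h; apply: lt_size_deriv; rewrite -size_poly_gt0.
  apply/andP; split; apply: leq_trans (size_polyMleq _ _) _.
    exact: L r0 (d _ t0).
  by rewrite addnC [(size R + _)%N]addnC; exact: L t0 (d _ r0).
have : (R * S^`() - R^`() * S)`_((size R).-1 + (size S).-1).-1 != 0.
  rewrite coefB mulrC {1}addnC coef_derivM_top //; last by rewrite addnC.
  rewrite coef_derivM_top // mulrC -(mulr_natr _ (size S).-1) -(mulr_natr _ (size R).-1).
  rewrite -mulrBr mulf_neq0 ?mulf_neq0 ?lead_coef_eq0 // subr_eq0 eqr_nat.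
  by move: ne r0 t0; clear; lia.
apply: contraNT; rewrite -ltnNge => lt; apply/eqP; apply: nth_default.
have L3 (x y z : nat) : (z < x + y - 2 -> 0 < x -> 0 < y -> z <= (x.-1 + y.-1).-1)%N by lia.
exact: L3 lt r0 t0.
Qed.

Lemma scale_of_size R S : S != 0 -> size R = size S ->
  exists k : F, (size (R - k *: S)%R < size S)%N.
Proof.
move=> S0 e; exists (lead_coef R / lead_coef S); set k := _ / _.
have t0 : (0 < size S)%N by rewrite size_poly_gt0.
rewrite -[X in (_ < X)%N](prednK t0) ltnS; apply/leq_sizeP => j.
rewrite leq_eqVlt => /orP[/eqP <-|hj]; rewrite coefB coefZ.
  by rewrite -{1}e -!/(lead_coef _) /k divfK ?subrr // lead_coef_eq0.
have hj' : (size S <= j)%N by rewrite -(prednK t0).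
by rewrite !nth_default ?mulr0 ?subr0 ?e.
Qed.

Lemma special_of_product theta S : (size S <= (size P).+1)%N ->
  Q = theta%:P * S^:P -> additive_poly f \/ multiplicative_poly f.
Proof.
move=> sS QE; have h : pde P S l theta f by rewrite /pde main_pde QE.
have fy0 : theta%:P * S^:P = 0 -> additive_poly f.
  move=> e; apply: additive_of_party0; apply/eqP; have := main_pde; rewrite QE e mul0r => /eqP.
  by rewrite mulf_eq0 mulf_eq0 polyC_eq0 (negPf l0) (negPf PP0).
have [t0|t0] := eqVneq theta 0; first by left; apply: fy0; rewrite t0 polyC0 mul0r.
have [S0|S0] := eqVneq S 0; first by left; apply: fy0; rewrite S0 map_poly0 mulr0.
have [sS'|sS'] := leqP (size S) (size P); first by left; apply: pde_additive h _.
by right; apply: pde_multiplicative h => //; apply/eqP; rewrite eqn_leq sS.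
Qed.


Lemma affine_of_linear h kap gam del : kap != 0 -> h^`() = kap *: P -> (1 < size h)%N ->
  Q = gam%:P * h^:P + del%:P ->
  (forall u v : F, u *: gam + v *: del = 0 -> u = 0 /\ v = 0) -> affine_type f.
Proof.
move=> k0 hP sh QE indep.
have hPl : (h^`())^:P = kap%:P%:P * P^:P.
  by rewrite hP -mul_polyC rmorphM /= map_polyC.
have kP0 : (h^`())^:P != 0 by rewrite lift_neq0 hP scaler_eq0 negb_or k0.
pose D := gam%:P * h^:P + del%:P.
(* Independence of [gam] and [del] makes $\gamma h(x)+\delta$ a nonzero polynomial in $y$, so for
   almost all $b$ it can be cancelled at the roots of [P]. *)
have D0 x : h.[x] *: gam + del != 0.
  apply/eqP => e; have [_ /eqP] := indep h.[x] 1 (etrans (congr1 _ (scale1r _)) e).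
  by rewrite oner_eq0.
have [r rE] := closed_field_poly_normal P.
have [s1 hs1] : exists s1 : seq F, forall b, b \notin s1 -> forall x, root P x ->
    (fiber D b).[x] != 0.
  pose Pi := \prod_(x <- r) (h.[x] *: gam + del).
  have Pi0 : Pi != 0.
    by rewrite prodf_seq_neq0; apply/allP => x _; apply: D0.
  have [s1 s1E] := closed_field_poly_normal Pi; exists s1 => b hb x.
  rewrite rE rootZ ?lead_coef_eq0 // root_prod_XsubC => xr.
  have : Pi.[b] != 0.
    by rewrite s1E hornerZ mulf_neq0 ?lead_coef_eq0 // -rootE root_prod_XsubC.
  rewrite horner_prod prodf_seq_neq0 => /allP/(_ x xr) /=.
  rewrite fiberD fiberM !fiberC fiber_lift !hornerD !hornerM !hornerC hornerZ.
  by rewrite mulrC.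
(* The class for [poly_in_h]. Differentiating the equation with respect to $h$ also differentiates
   the coefficient $\gamma h+\delta$ and adds a multiple of $\gamma u$, which the constant [k]
   records. *)
pose E (u : {poly {poly F}}) := exists (k : F) (w : {poly {poly F}}),
  partx u = P^:P * w /\ l%:P * party u = k%:P%:P * gam%:P * u + D * w.
have Ef : E f by exists 0, g; split=> //; rewrite !polyC0 !mul0r add0r fyE QE.
have Dx : partx D = gam%:P * (kap%:P%:P * P^:P).
  by rewrite /D partxD partxM !partx_polyC mul0r add0r addr0 partx_lift hPl.
have Estep u : E u -> exists2 w, partx u = (h^`())^:P * w & E w.
  move=> [k [w [e1 e2]]].
  have e3 : D * partx w = P^:P * (l%:P * party w - (k + kap)%:P%:P * gam%:P * w).
    have : partx (l%:P * party u) = partx (k%:P%:P * gam%:P * u + D * w) by rewrite e2.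
    rewrite partxM partx_polyC mul0r add0r -party_partx e1 partyM party_lift mul0r add0r.
    rewrite partxD !partxM !partx_polyC !mul0r !mulr0 !add0r Dx e1 => e4.
    apply/eqP; rewrite -subr_eq0; apply/eqP; rewrite mulrBr.
    have -> : P^:P * (l%:P * party w) = l%:P * (P^:P * party w) by ring.
    by rewrite e4 !polyCD; ring.
  have [w1 w1E] : exists w1, partx w = P^:P * w1.
    apply: (dvd_fiber_cofinite (s := s1)) => // b hb; apply: dvdp_of_mup => // x rx.
    apply: (XsubC_dvd_mulr (hs1 b hb x rx)).
    rewrite -fiberM e3 fiberM fiber_lift dvdp_mulr //.
    by rewrite -mup_geq.
  have e5 : D * w1 = l%:P * party w - (k + kap)%:P%:P * gam%:P * w.
    by apply: (mulfI PP0); rewrite -e3 w1E mulrCA.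
  exists ((kap^-1)%:P%:P * w).
    rewrite hPl e1.
    have -> : kap%:P%:P * P^:P * ((kap^-1)%:P%:P * w) = (kap * kap^-1)%:P%:P * (P^:P * w).
      by rewrite !polyCM mulrACA mulrA -!mulrA.
    by rewrite mulfV // !polyC1 mul1r.
  exists (k + kap), ((kap^-1)%:P%:P * w1); split.
    by rewrite partxM partx_polyC mul0r add0r w1E mulrCA.
  rewrite partyM partyC derivC polyC0 mul0r add0r.
  by rewrite [D * _]mulrCA e5; ring.
have [G fG] := poly_in_h Estep Ef.
exists h, G, l, (kap *: gam), (kap *: del); split=> // [|u v].
  apply/eqP; rewrite -subr_eq0; apply/eqP; apply: (comp_lift_inj sh).
  rewrite comp_polyB !comp_polyM comp_polyD comp_polyM !comp_polyC comp_polyX.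
  have gE : g = kap%:P%:P * (partx G \Po h^:P).
    by apply: (mulfI PP0); rewrite -fxE fG partx_comp partx_lift hPl; ring.
  have fyG : party f = party G \Po h^:P.
    by rewrite fG party_comp party_lift mulr0 addr0.
  rewrite -fyG fyE QE gE -!mul_polyC !polyCM; ring.
rewrite !scalerA ![_ * kap]mulrC -!scalerA -scalerDr => /eqP.
by rewrite scaler_eq0 (negPf k0) => /eqP/indep.
Qed.

Lemma horner_lift p (x : F) : (p^:P).[x%:P] = (p.[x])%:P.
Proof. by rewrite horner_map. Qed.

Lemma party_horner (v : {poly {poly F}}) (x : F) : (party v).[x%:P] = (v.[x%:P])^`().
Proof.
elim/poly_ind: v => [|v k IH]; first by rewrite /party map_poly0 !horner0 deriv0.
rewrite partyD party_mulX partyC !(hornerD, hornerM, hornerX, hornerC) IH derivD derivM.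
by rewrite derivC mulr0 addr0.
Qed.

(** The equation says that $u^iv^j$ has derivative zero; a polynomial occurring with positive
    exponent then has degree zero. *)
Lemma log_deriv_const (u v : {poly F}) (i j : nat) : u != 0 -> v != 0 ->
  (0 < i)%N -> (0 < j)%N -> i%:R *: (u^`() * v) + j%:R *: (u * v^`()) = 0 -> v^`() = 0.
Proof.
move=> u0 v0 i0 j0 e.
have su : (0 < size u)%N by rewrite size_poly_gt0.
have sv : (0 < size v)%N by rewrite size_poly_gt0.
have [sv1|sv1] := leqP (size v) 1; first by rewrite (size1_polyC sv1) derivC.
have L (x y : nat) : (0 < x -> 1 < y -> 1 < x + y - 1)%N by lia.
have big := L _ _ su sv1.
have := congr1 (fun z : {poly F} => z`_((size u).-1 + (size v).-1).-1) e.
rewrite coefD !coefZ coef_derivM_top // [u * _]mulrC addnC coef_derivM_top //; last first.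
  by rewrite addnC.
rewrite coef0 -(mulr_natr _ (size u).-1) -(mulr_natr _ (size v).-1) => h.
have {h} : lead_coef u * lead_coef v * (i * (size u).-1 + j * (size v).-1)%:R = 0.
  by rewrite -h natrD !natrM; ring.
move/eqP; rewrite !mulf_eq0 !lead_coef_eq0 (negPf u0) (negPf v0) /= pnatr_eq0.
rewrite addn_eq0 !muln_eq0 => /andP[_ /orP[]]; first by rewrite eqn0Ngt j0.
by case: (size v) sv1 => [|[]].
Qed.

(** Compare $f$ near a root [rho] of [S] with $f$ near $x=\infty$. Both fields vanish at [rho], so
    $f$ is constant on $x=\rho$, [P] does not vanish there, and [S] has a multiple root. The leading
    coefficients of $f-f(\rho,\cdot)$ along $x=\rho$ and of $f$ at infinity have logarithmic
    derivatives proportional to $\gamma/l$, with factors of negative rational ratio. For polynomials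
    this forces both to be constant, so $\gamma=0$. *)
Lemma two_case S : partx f != 0 -> S != 0 -> (1 < size S <= size P)%N ->
  forall R1 kap gam del, size R1 = (size P).+1 ->
  S * R1^`() - S^`() * R1 = kap *: (P * S) -> Q = gam%:P * R1^:P + del%:P * S^:P ->
  gam = 0.
Proof.
move=> fx0 S0 /andP[sS1 sS] R1 kap gam del sR1 E QE.
have R10 : R1 != 0 by rewrite -size_poly_gt0 sR1.
pose t := (size P - (size S).-1)%N.
have L1 (x y : nat) : (x <= y -> 1 < x -> x + y.+1 - 2 = y + x.-1)%N by lia.
have kapE : kap = lead_coef R1 * t%:R.
  have big : (1 < size S + size R1 - 1)%N.
    by rewrite sR1; move: sS1; clear; move: (size S) (size P); lia.
  have s1 : (0 < size S)%N := ltnW sS1.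
  have s2 : (0 < size R1)%N by rewrite sR1.
  have := congr1 (fun z : {poly F} => z`_((size S).-1 + (size R1).-1).-1) E.
  rewrite coefB coef_derivM_top // [S * _]mulrC addnC coef_derivM_top //; last by rewrite addnC.
  have -> : ((size R1).-1 + (size S).-1).-1 = ((size P).-1 + (size S).-1)%N.
    by rewrite sR1; move: sP s1; clear; move: (size S) (size P); lia.
  rewrite coefZ coefM_top ?leqSpred // -!/(lead_coef _) (monicP Pm) mul1r => h.
  have lS : lead_coef S != 0 by rewrite lead_coef_eq0.
  apply: (mulIf lS); rewrite -h sR1 /= -(mulr_natr _ (size P)) -(mulr_natr _ (size S).-1).
  rewrite /t natrB; first by ring.
  by move: sS; clear; move: (size S) (size P); lia.
have t0 : (0 < t)%N by rewrite /t; move: sS sS1; clear; move: (size S) (size P); lia.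
have kap0 : kap != 0 by rewrite kapE mulf_neq0 ?lead_coef_eq0 // pnatr_eq0 -lt0n.
have [rho rr] := closed_rootP S (negbT (gtn_eqF sS1)).
pose X := 'X - rho%:P.
have X0 : X != 0 by rewrite polyXsubC_eq0.
have Xr : X.[rho] = 0 by rewrite hornerXsubC subrr.
have [m [sig sig0 SE]] := multiplicity_XsubC S rho.
rewrite S0 /= rootE in sig0.
case: m SE => [|m] SE; first by move: rr; rewrite SE expr0 mulr1 rootE (negPf sig0).
have E1 : sig * X * R1^`() - (sig^`() * X + m.+1%:R *: sig) * R1 = kap *: (P * sig * X).
  apply: (mulIf (_ : X ^+ m != 0)); first by rewrite expf_neq0.
  have e1 : S = sig * X * X ^+ m by rewrite SE exprS mulrA.
  have e2 : S^`() = (sig^`() * X + m.+1%:R *: sig) * X ^+ m.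
    rewrite SE derivM deriv_exp derivXsubC mul1r /= -/X exprS -mulr_natl -!mul_polyC.
    by rewrite polyC_natr; ring.
  transitivity (S * R1^`() - S^`() * R1); first by rewrite e2 e1; ring.
  by rewrite E e1 -!mul_polyC; ring.
have R1r : root R1 rho.
  have := congr1 (fun z : {poly F} => z.[rho]) E1.
  rewrite /= !(Xr, hornerD, hornerN, hornerM, hornerZ) !(mulr0, mul0r, add0r) => /eqP.
  by rewrite oppr_eq0 !mulf_eq0 pnatr_eq0 (negPf sig0).
have [R2 R2E] := factor_theorem _ _ R1r; rewrite -/X in R2E.
have E2 : sig * (R2^`() * X + R2) - (sig^`() * X + m.+1%:R *: sig) * R2 = kap *: (P * sig).
  apply: (mulIf X0).
  have e1 : R1^`() = R2^`() * X + R2 by rewrite R2E derivM derivXsubC mulr1.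
  transitivity (sig * X * R1^`() - (sig^`() * X + m.+1%:R *: sig) * R1).
    by rewrite e1 R2E; ring.
  by rewrite E1 -!mul_polyC; ring.
have E3 : (1 - m.+1%:R) * R2.[rho] = kap * P.[rho].
  have := congr1 (fun z : {poly F} => z.[rho]) E2.
  rewrite /= !(Xr, hornerD, hornerN, hornerM, hornerZ) !(mulr0, mul0r, add0r) => e.
  apply: (mulIf sig0); transitivity (kap * (P.[rho] * sig.[rho])); last by ring.
  by rewrite -e; ring.
have Qr : Q.[rho%:P] = 0.
  rewrite QE hornerD !hornerM !hornerC !horner_lift (rootP rr) (rootP R1r).
  by rewrite !mulr0 addr0.
have fyr : (party f).[rho%:P] = 0.
  have := congr1 (fun z : {poly {poly F}} => z.[rho%:P]) fyE.
  rewrite /= !hornerM hornerC Qr mul0r => /eqP; rewrite mulf_eq0 (negPf l0).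
  by move/eqP.
have Pr : P.[rho] != 0.
  by apply/negP => h; have := fyP h; rewrite fyr eqxx.
case: m SE E1 E2 E3 => [|m] SE _ _ E3.
  by move/eqP: E3; rewrite subrr mul0r eq_sym mulf_eq0 (negPf kap0) (negPf Pr).
have [c0 c0E] : exists c0, f.[rho%:P] = c0%:P by apply: deriv_eq0; rewrite -party_horner.
pose f1 := f - c0%:P%:P.
have fE : f = f1 + c0%:P%:P by rewrite /f1 subrK.
have f10 : f1 != 0.
  by apply: contra_neq fx0 => f10; rewrite fE f10 add0r partx_polyC.
have [s [u u0 f1E]] := multiplicity_XsubC f1 rho%:P.
rewrite f10 /= rootE in u0.
case: s f1E => [|s] f1E.
  case/eqP: u0; have -> : u = f1 by rewrite f1E expr0 mulr1.
  by rewrite /f1 hornerD hornerN hornerC c0E subrr.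
have XE : 'X - rho%:P%:P = X^:P by rewrite rmorphB /= map_polyX map_polyC.
rewrite XE in f1E.
have fyE2 : party f = party u * X^:P ^+ s.+1.
  by rewrite fE partyD !partyC derivC polyC0 addr0 f1E partyM -rmorphXn party_lift mulr0 addr0.
have fxE2 : partx f = (partx u * X^:P + s.+1%:R%:P%:P * u) * X^:P ^+ s.
  rewrite fE partxD partx_polyC addr0 f1E partxM /partx deriv_exp -/(partx _) -/(partx _).
  rewrite partx_lift derivXsubC map_polyC /= mul1r exprS -mulr_natl !polyC_natr.
  by ring.
have Xl0 : X^:P != 0 by rewrite lift_neq0.
have E4 : l%:P * P^:P * party u =
    (gam%:P * R2^:P + del%:P * sig^:P * X^:P ^+ m.+1) * (partx u * X^:P + s.+1%:R%:P%:P * u).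
  apply: (mulIf (_ : X^:P ^+ s.+1 != 0)); first by rewrite expf_neq0.
  transitivity (l%:P * P^:P * party f); first by rewrite fyE2; ring.
  have e1 : S^:P = sig^:P * X^:P ^+ m.+2 by rewrite SE rmorphM /= -rmorphXn.
  have e2 : R1^:P = R2^:P * X^:P by rewrite R2E rmorphM.
  by rewrite main_pde QE fxE2 e1 e2 !exprS; ring.
pose v := u.[rho%:P].
have Xlr : (X^:P).[rho%:P] = 0 by rewrite horner_lift Xr.
have E5 : l * P.[rho]%:P * v^`() = gam * R2.[rho]%:P * (s.+1%:R%:P * v).
  have := congr1 (fun z : {poly {poly F}} => z.[rho%:P]) E4.
  rewrite /= !(Xlr, hornerD, hornerM, horner_exp, hornerC, horner_lift, party_horner).
  by rewrite exprS !(mulr0, mul0r, add0r, addr0).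
pose aN := lead_coef f; pose n := (size f).-1.
have sf : (1 < size f)%N.
  by rewrite ltnNge; apply: contra fx0 => sf; rewrite (size1_polyC sf) partx_polyC.
have n0 : (0 < n)%N by rewrite /n; move: sf; clear; move: (size f); lia.
have E6 : l * aN^`() = gam * (lead_coef R1 * n%:R)%:P * aN.
  have := congr1 (fun z : {poly {poly F}} => z`_((size P).-1 + n)) main_pde.
  rewrite /= mulrAC -mulrA mulrC -mulrA [l%:P * _]mulrC || idtac.
  have -> : l%:P * P^:P * party f = P^:P * (l%:P * party f) by ring.
  rewrite coefM_top ?size_map_polyC ?leqSpred //; last first.
    rewrite mul_polyC; apply: leq_trans (size_scale_leq _ _) _.
    by apply: leq_trans (size_poly _ _) _; rewrite /n leqSpred.
  rewrite coefCM coef_map /= -/(lead_coef P) (monicP Pm) mul1r coef_map_id0 ?deriv0 //.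
  rewrite -/(lead_coef f) -/aN => ->.
  have -> : ((size P).-1 + n)%N = (size P + n.-1)%N.
    by move: sP n0; clear; move: (size P); lia.
  rewrite coefM_top //; last first.
    by apply: leq_trans (size_poly _ _) _; rewrite -/n prednK.
  rewrite coef_deriv prednK // mulrn_polyC -/(lead_coef f) -/aN QE coefD !coefCM !coef_map /=.
  have -> : S`_(size P) = 0 by rewrite nth_default.
  have -> : R1`_(size P) = lead_coef R1 by rewrite /lead_coef sR1.
  by rewrite mulr0 addr0 polyCM polyC_natr; ring.
have aN0 : aN != 0 by rewrite lead_coef_eq0 -size_poly_gt0 ltnW.
have lR1 : lead_coef R1 != 0 by rewrite lead_coef_eq0.
have aN' : aN^`() = 0.
  apply: (log_deriv_const (u := v) (i := n * m.+1) (j := s.+1 * t)) => //.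
  - by rewrite muln_gt0 n0.
  - by rewrite muln_gt0 t0.
  apply: (mulfI l0); rewrite mulr0; apply: (mulIf (_ : P.[rho]%:P != 0)).
    by rewrite polyC_eq0.
  rewrite mul0r mulrDr -!mul_polyC.
  have -> : l * ((n * m.+1)%:R%:P * (v^`() * aN)) + l * ((s.+1 * t)%:R%:P * (v * aN^`())) =
    (n * m.+1)%:R%:P * aN * (l * v^`()) + (s.+1 * t)%:R%:P * v * (l * aN^`()) by ring.
  transitivity ((n * m.+1)%:R%:P * aN * (l * P.[rho]%:P * v^`()) +
    (s.+1 * t)%:R%:P * v * P.[rho]%:P * (l * aN^`())); first by ring.
  rewrite E5 E6.
  have E3' : (m.+1%:R)%:P * R2.[rho]%:P = - (lead_coef R1 * t%:R)%:P * P.[rho]%:P.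
    rewrite -polyCM -polyCN -polyCM; congr (_%:P); rewrite mulNr -kapE -E3.
    by rewrite -[m.+2]addn1 natrD; ring.
  transitivity (n%:R%:P * aN * gam * s.+1%:R%:P * v *
    (m.+1%:R%:P * R2.[rho]%:P + (lead_coef R1 * t%:R)%:P * P.[rho]%:P)).
    by rewrite !natrM !polyCM; ring.
  by rewrite E3' mulNr addNr mulr0.
move/eqP: E6; rewrite aN' mulr0 eq_sym !mulf_eq0 (negPf aN0) polyC_eq0 mulf_eq0 (negPf lR1).
by rewrite pnatr_eq0 eqn0Ngt n0 !orbF => /eqP.
Qed.

(** Let [S] have minimal degree in the algebra. An element of another degree that is not the maximal
    one would bracket with [S] to something of degree below the minimum, so all fibres of [Q] lie in
    the span of [S] and one [R1] of top degree. If [R1] is present, [two_case] excludes a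
    nonconstant [S], and a constant one makes [R1] a primitive of a multiple of [P], the coordinate
    $h$. *)
Lemma fixed_classification : partx f != 0 ->
  [\/ additive_poly f, multiplicative_poly f | affine_type f].
Proof.
move=> fx0.
have spec theta S : (size S <= (size P).+1)%N -> Q = theta%:P * S^:P ->
    [\/ additive_poly f, multiplicative_poly f | affine_type f].
  by move=> sS /(special_of_product sS)[h|h]; [apply: Or31|apply: Or32].
have [Q0|Q0] := eqVneq Q 0.
  by apply: (spec 0 0); rewrite ?size_poly0 // Q0 polyC0 mul0r.
have [b1 hb1 Qb1] : exists2 b, b \notin s0 & fiber Q b != 0.
  apply: contrapT => h; move/eqP: Q0; apply; apply: (fiber_eq_cofinite (s := s0)) => b hb.
  rewrite /fiber map_poly0 -/(fiber Q b); apply: contrapT => /eqP hQ; apply: h.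
  by exists b.
have [n [S [LS S0 szSn]] nmin] := ex_min_nat (ex_intro (fun n => exists S,
  [/\ liealg S, S != 0 & size S = n]) _ (ex_intro _ _
  (And3 (liealg_fiber hb1) Qb1 (erefl _)))).
have smin R : liealg R -> R != 0 -> (size S <= size R)%N.
  by move=> LR R0; rewrite szSn; apply: nmin; exists R.
have mult R : liealg R -> size R = size S -> exists k, R = k *: S.
  move=> LR e; have [k hk] := scale_of_size S0 e; exists k; apply/eqP.
  rewrite -subr_eq0; apply: contraTT hk => n0; rewrite -leqNgt.
  by apply: smin => //; apply: liealg_lin.
have top R : liealg R -> R != 0 -> size R != size S -> size R = (size P).+1.
  move=> LR R0 ne; apply/eqP; rewrite eqn_leq; case: (LR) => -> _ /=.
  rewrite ltnNge; apply/negP => sR.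
  have [T TE LT] := liealg_bracket LR LS.
  have sT := size_bracket R0 S0 ne.
  have s1 : (0 < size S)%N by rewrite size_poly_gt0.
  have lt : (size S < size R)%N by rewrite ltn_neqAle eq_sym ne smin.
  have T0 : T != 0.
    apply/eqP => T0; move: sT; rewrite TE T0 mulr0 size_poly0.
    by move: s1 lt; clear; move: (size S) (size R); lia.
  have := smin T LT T0; move: sT; rewrite TE size_mul //.
  have sT0 : (0 < size T)%N by rewrite size_poly_gt0.
  by move: s1 lt sR sP sT0; clear; move: (size S) (size R) (size T) (size P); lia.
have split_S R : liealg R -> (size R <= size P)%N -> exists k, R = k *: S.
  move=> LR sR; have [->|R0] := eqVneq R 0; first by exists 0; rewrite scale0r.
  have [/mult h|ne] := eqVneq (size R) (size S); first exact: h.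
  by have := top R LR R0 ne; move: sR; clear; move: (size R) (size P); lia.
case: (EM (forall b, b \notin s0 -> exists k, fiber Q b = k *: S)) => [allS|].
  apply: (spec ((lead_coef S)^-1 *: Q`_(size S).-1) S); first by case: LS.
  apply: (fiber_eq_cofinite (s := s0)) => b hb; have [k hk] := allS b hb.
  rewrite fiberM fiberC fiber_lift hornerZ -coef_fiber hk coefZ -/(lead_coef S).
  by rewrite mulrCA mulVf ?lead_coef_eq0 // mulr1 mul_polyC.
move=> /existsNP[b0 /not_implyP[hb0 nmul]].
pose R1 := fiber Q b0.
have LR1 : liealg R1 by apply: liealg_fiber.
have R10 : R1 != 0 by apply/eqP => e; apply: nmul; exists 0; rewrite -/R1 e scale0r.
have ne : size R1 != size S by apply/eqP => e; apply: nmul; apply: mult.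
have sR1 := top R1 LR1 R10 ne.
have sS : (size S <= size P)%N.
  case: LS => sS _; have := ne; rewrite sR1 => ne1.
  by rewrite -ltnS ltn_neqAle eq_sym ne1.
have lS : lead_coef S != 0 by rewrite lead_coef_eq0.
have lR : lead_coef R1 != 0 by rewrite lead_coef_eq0.
pose gam := (lead_coef R1)^-1 *: Q`_(size P).
pose del := (lead_coef S)^-1 *: (Q - gam%:P * R1^:P)`_(size S).-1.
have QE : Q = gam%:P * R1^:P + del%:P * S^:P.
  apply: (fiber_eq_cofinite (s := s0)) => b hb.
  have L1 : liealg (fiber Q b - gam.[b] *: R1) by apply: liealg_lin => //; apply: liealg_fiber.
  have [|k hk] := split_S _ L1.
    apply/leq_sizeP => j; rewrite leq_eqVlt => /orP[/eqP <-|hj].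
      rewrite coefB coefZ hornerZ -coef_fiber.
      have -> : R1`_(size P) = lead_coef R1 by rewrite /lead_coef sR1.
      by rewrite mulrAC mulVf // mul1r subrr.
    rewrite coefB coefZ !nth_default ?mulr0 ?subr0 ?sR1 //.
    by apply: leq_trans (size_fiber _ _) (leq_trans szQ hj).
  have dk : del.[b] = k.
    rewrite /del hornerZ -coef_fiber fiberD fiberN fiberM fiberC fiber_lift mul_polyC hk.
    by rewrite coefZ mulrCA mulVf // mulr1.
  by rewrite fiberD !fiberM !fiberC !fiber_lift dk !mul_polyC -hk addrC subrK.
clearbody gam del.
have [T TE LT] := liealg_bracket LS LR1.
have [kap kapE] : exists k, T = k *: S.
  have s1 : (0 < size S)%N by rewrite size_poly_gt0.
  have := size_bracket S0 R10; rewrite eq_sym => /(_ ne); rewrite TE sR1.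
  have [->|T0] := eqVneq T 0; first by exists 0; rewrite scale0r.
  rewrite size_mul // => sT; apply: mult => //.
  have sT0 : (0 < size T)%N by rewrite size_poly_gt0.
  by move: sT sT0 sP s1; clear; move: (size S) (size T) (size P); lia.
have E : S * R1^`() - S^`() * R1 = kap *: (P * S) by rewrite TE kapE -scalerAr.
have [S1|S1] := leqP (size S) 1; last first.
  have g0 : gam = 0 by apply: (two_case fx0 S0 _ sR1 E QE); rewrite S1.
  by case: nmul; exists del.[b0]; rewrite QE g0 fiberD !fiberM !fiberC !fiber_lift
    horner0 polyC0 mul0r add0r mul_polyC.
pose k0 := S`_0; have SE : S = k0%:P by apply: size1_polyC.
clearbody k0.
have k00 : k0 != 0 by rewrite -polyC_eq0 -SE.
have R1' : R1^`() = kap *: P.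
  have kC : k0%:P != 0 by rewrite polyC_eq0.
  apply: (mulfI kC); move: E; rewrite SE derivC mul0r subr0 => ->.
  by rewrite -!mul_polyC; ring.
have sR11 : (1 < size R1)%N by rewrite sR1.
have kap0 : kap != 0.
  apply/eqP => e; move: R1'; rewrite e scale0r => /deriv_eq0[k hk].
  by move: sR11; rewrite hk size_polyC; case: (k != 0).
have QE' : Q = gam%:P * R1^:P + (k0 *: del)%:P.
  by rewrite [LHS]QE SE map_polyC /= -polyCM; congr (_ + _%:P); rewrite mulrC mul_polyC.
case: (EM (forall u v : F, u *: gam + v *: (k0 *: del) = 0 -> u = 0 /\ v = 0)) => [indep|].
  by apply: Or33; apply: (affine_of_linear kap0 R1' sR11 QE' indep).
move=> /existsNP[u /existsNP[v /not_implyP[uv nuv]]].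
have [v0|v0] := eqVneq v 0.
  have g0 : gam = 0.
    move/eqP: uv; rewrite v0 scale0r addr0 scaler_eq0 => /orP[/eqP u0|/eqP //].
    by case: nuv.
  by apply: (spec (k0 *: del) 1); rewrite ?size_poly1 // QE' g0 polyC0 mul0r add0r rmorph1 mulr1.
apply: (spec gam (R1 - (u / v)%:P)).
  apply: leq_trans (size_polyD _ _) _; rewrite size_polyN geq_max sR1 leqnn /=.
  exact: leq_trans (size_polyC_leq1 _) _.
have -> : (R1 - (u / v)%:P)^:P = R1^:P - (u / v)%:P%:P by rewrite rmorphB /= map_polyC.
rewrite mulrBr QE' -polyCM; congr (_ + _); rewrite -polyCN; congr (_%:P).
apply/eqP; rewrite -subr_eq0 opprK [gam * _]mulrC mul_polyC.
have : v^-1 *: (u *: gam + v *: (k0 *: del)) = 0 by rewrite uv scaler0.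
rewrite scalerDr !scalerA mulVf // mul1r addrC mulrC => h.
by apply/eqP.
Qed.

End Fixed.

(** * Moving critical points and isolated solutions *)

Section Orders.
Variable F : numClosedFieldType.
Implicit Types (p q z : {poly F}) (f g : {poly {poly F}}).

Lemma XsubC_exp_dvd_deriv (x : F) k p :
  ('X - x%:P) ^+ k.+1 %| p <-> p.[x] = 0 /\ ('X - x%:P) ^+ k %| p^`().
Proof.
split=> [h|[px h]].
  split; last exact: dvd_deriv_XsubC.
  by apply/rootP; rewrite -dvdp_XsubCl; apply: dvdp_trans h; rewrite exprS dvdp_mulr.
have [->|p0] := eqVneq p 0; first exact: dvdp0.
have [m [q q0 pE]] := multiplicity_XsubC p x; rewrite p0 /= rootE in q0.
case: m pE => [|m] pE.
  by case/eqP: q0; rewrite -px pE expr0 mulr1.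
have [le|lt] := leqP k m; first by rewrite pE dvdp_mull // dvdp_exp2l.
have : ('X - x%:P) ^+ m.+1 %| p^`() by apply: dvdp_trans h; apply: dvdp_exp2l.
have -> : p^`() = (q^`() * ('X - x%:P) + m.+1%:R%:P * q) * ('X - x%:P) ^+ m.
  by rewrite pE derivM deriv_exp derivXsubC mul1r /= exprS polyC_natr -mulr_natl; ring.
rewrite exprS dvdp_mul2r ?expf_neq0 ?polyXsubC_eq0 // dvdp_XsubCl.
rewrite rootE !(hornerD, hornerM, hornerC, hornerX) hornerN hornerC subrr mulr0 add0r.
by rewrite mulf_eq0 pnatr_eq0 (negPf q0).
Qed.

Lemma XsubC_exp_dvdE (x : F) k p :
  ('X - x%:P) ^+ k %| p <-> forall j, (j < k)%N -> (p^`(j)).[x] = 0.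
Proof.
elim: k p => [|k IH] p; first by split=> // _; rewrite expr0 dvd1p.
rewrite XsubC_exp_dvd_deriv IH; split=> [[h1 h2] [|j] hj|h].
- by rewrite derivn0.
- by rewrite derivSn; apply: h2.
split; first by have := h 0%N isT; rewrite derivn0.
by move=> j hj; have := h j.+1 hj; rewrite derivSn.
Qed.

(* Compare orders at x: if f_x^c vanishes there to order m > 0 then f^c - f^c(x) vanishes to
   order m + 1, so no polynomial in it has order m. *)
Lemma not_descends_moving f b c (x : F) :
  (partx f).[x%:P].[b] != 0 -> (party f).[x%:P].[b] != 0 ->
  (partx f).[x%:P].[c] = 0 -> fiber (partx f) c != 0 -> ~ descends f b c x.
Proof.
rewrite -!horner_fiber => fxb fyb fxc fxc0 /(_ (mup x (fiber (partx f) c)).+1)[A].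
set m := mup _ _; pose phi := fiber f c - (f.[x%:P].[c])%:P.
have dm : ('X - x%:P) ^+ m %| fiber (partx f) c by rewrite -mup_geq.
have dphi : ('X - x%:P) ^+ m.+1 %| phi.
  apply/XsubC_exp_dvd_deriv; split; first by rewrite hornerD hornerN hornerC horner_fiber subrr.
  by rewrite /phi derivB derivC subr0 -fiber_partx.
have [A1 AE] : exists A1, A = A1 * 'X + (A.[0])%:P.
  have /factor_theorem[A1 h] : root (A - (A.[0])%:P) 0.
    by rewrite rootE hornerD hornerN hornerC subrr.
  by exists A1; rewrite -['X]subr0 -h subrK.
have -> : A \Po (fiber f c - (f.[x%:P].[c])%:P) = (A1 \Po phi) * phi + (A.[0])%:P.
  by rewrite {1}AE comp_poly_MXaddC.
rewrite mulrDr opprD addrA => h.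
have {}h : ('X - x%:P) ^+ m.+1 %| fiber (party f) b * fiber (partx f) c
     - fiber (partx f) b * (A.[0])%:P.
  have -> : fiber (party f) b * fiber (partx f) c - fiber (partx f) b * (A.[0])%:P =
    (fiber (party f) b * fiber (partx f) c - fiber (partx f) b * ((A1 \Po phi) * phi) -
      fiber (partx f) b * (A.[0])%:P) + fiber (partx f) b * (A1 \Po phi) * phi by ring.
  by rewrite dvdp_add // dvdp_mull.
have A0 : A.[0] = 0.
  have : root (fiber (party f) b * fiber (partx f) c - fiber (partx f) b * (A.[0])%:P) x.
    by rewrite -dvdp_XsubCl; apply: dvdp_trans h; rewrite exprS dvdp_mulr.
  rewrite rootE hornerD hornerN !hornerM hornerC fxc mulr0 sub0r oppr_eq0 mulf_eq0.
  by rewrite (negPf fxb) => /eqP.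
move: h; rewrite A0 polyC0 mulr0 subr0 => /(XsubC_dvd_mulr fyb).
by rewrite -mup_geq // ltnn.
Qed.

Lemma factor_roots f (s : seq F) : f != 0 ->
  exists P g, [/\ P \is monic, f = P^:P * g, (forall x, root P x -> x \in s) &
    forall x, x \in s -> g.[x%:P] != 0].
Proof.
elim: s f => [|a s IH] f f0.
  exists 1, f; split=> //; [exact: monic1|by rewrite rmorph1 mul1r|].
  by move=> x; rewrite (negPf (root1 x)).
have [P [g [Pm fE hP hg]]] := IH f f0.
have g0 : g != 0 by apply: contra_neq f0 => g0; rewrite fE g0 mulr0.
have [m [u u0 gE]] := multiplicity_XsubC g a%:P; rewrite g0 /= rootE in u0.
exists (P * ('X - a%:P) ^+ m), u; split.
- by rewrite monicMr ?monic_exp ?monicXsubC.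
- rewrite rmorphM rmorphXn rmorphB /= map_polyX map_polyC /= fE {1}gE; ring.
- move=> x; rewrite rootM => /orP[/hP h|]; rewrite inE ?h ?orbT //.
  case: m {gE} => [|m]; first by rewrite expr0 (negPf (root1 x)).
  by rewrite root_exp_XsubC => ->.
move=> x; rewrite inE => /orP[/eqP -> //|/hg]; apply: contra_neq => ux.
by rewrite gE hornerM ux mul0r.
Qed.

(** Pseudo-division in $x$ over the polynomials in $y$: the remainder has smaller degree than $g$
    and vanishes on almost all fibres. *)
Lemma bivariate_dvd f g (s : seq F) : g != 0 ->
  (forall b, b \notin s -> fiber g b %| fiber f b) ->
  exists l Q, l != 0 /\ l%:P * f = Q * g.
Proof.
move=> g0 h.
pose lc := lead_coef g; have lc0 : lc != 0 by rewrite lead_coef_eq0.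
have := Pdiv.ComRing.rdivp_eq g f; set k := Pdiv.Ring.rscalp f g.
set Q := Pdiv.Ring.rdivp f g; set r := Pdiv.Ring.rmodp f g => E.
exists (lc ^+ k), Q; split; first by rewrite expf_neq0.
rewrite mul_polyC E; suff -> : r = 0 by rewrite addr0.
have [s1 s1E] := closed_field_poly_normal lc.
apply: (fiber_eq_cofinite (s := s ++ s1)) => b; rewrite mem_cat negb_or => /andP[hb hb1].
have lb : lc.[b] != 0.
  by rewrite s1E hornerZ mulf_neq0 ?lead_coef_eq0 // -rootE root_prod_XsubC.
have gr : fiber g b %| fiber r b.
  have := congr1 (fun v => fiber v b) E; rewrite -mul_polyC fiberD !fiberM !fiberC => e.
  by rewrite -(@dvdp_addr _ (fiber Q b * fiber g b)) ?dvdp_mull // -e dvdp_mull // h.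
have sg : size (fiber g b) = size g.
  apply/eqP; rewrite eqn_leq size_fiber /= leqNgt; apply/negP => lt.
  case/eqP: lb; rewrite /lc /lead_coef -coef_fiber nth_default // -ltnS prednK //.
  by rewrite size_poly_gt0.
have sr : (size (fiber r b) < size (fiber g b))%N.
  by rewrite sg (leq_ltn_trans (size_fiber _ _)) // Pdiv.Ring.ltn_rmodpN0.
rewrite [RHS]map_poly0; apply/eqP; apply: contraTT sr => n0; rewrite -leqNgt.
exact: dvdp_leq.
Qed.

(** Lagrange interpolation in $b$: every fibre is a combination of the fibres at [d] distinct
    points. *)
Lemma lagrange_fiber (V : {poly F} -> Prop) f (d : nat) (s : seq F) :
  V 0 -> (forall k p q, V p -> V q -> V (p + k *: q)) ->
  (forall i, (size (f`_i)%R <= d)%N) -> uniq s -> size s = d ->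
  (forall b, b \in s -> V (fiber f b)) -> forall b, V (fiber f b).
Proof.
move=> V0 Vlin fd us ss Vs b.
pose L (a : F) : {poly F} := \prod_(a' <- rem a s) ((a - a')^-1 *: ('X - a'%:P)).
have Laa a : a \in s -> (L a).[a] = 1.
  move=> ha; rewrite horner_prod big1_seq // => a' /andP[_ ha'].
  rewrite hornerZ hornerXsubC mulVf // subr_eq0; apply: contraTneq ha' => <-.
  by rewrite mem_rem_uniq // inE eqxx.
have Lab a a' : a \in s -> a' \in s -> a != a' -> (L a).[a'] = 0.
  move=> ha ha' ne; apply/eqP; rewrite horner_prod prodf_seq_eq0.
  apply/hasP; exists a'; first by rewrite mem_rem_uniq // inE eq_sym ne.
  by rewrite /= hornerZ hornerXsubC subrr mulr0.
have sL a : a \in s -> (size (L a) <= d)%N.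
  move=> ha; rewrite /L scaler_prod; apply: leq_trans (size_scale_leq _ _) _.
  rewrite size_prod_XsubC size_rem // ss prednK // -ss.
  by case: (s) ha.
have interp p : (size p <= d)%N -> p.[b] = \sum_(a <- s) (L a).[b] * p.[a].
  move=> sp; pose D := p - \sum_(a <- s) p.[a] *: L a.
  have D0 : D = 0.
    apply: contraTeq (leqnn d) => D0; rewrite -ltnNge -{1}ss.
    apply: leq_trans (max_poly_roots D0 _ us) _.
      apply/allP => a ha; rewrite /root /D hornerD hornerN horner_sum (bigD1_seq a) //=.
      rewrite hornerZ Laa // mulr1 big_seq_cond big1 ?addr0 ?subrr // => a' /andP[ha' ne].
      by rewrite hornerZ Lab ?mulr0.
    apply: leq_trans (size_polyD _ _) _; rewrite size_polyN geq_max sp /=.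
    rewrite big_seq; elim/big_ind: _ => [|u v hu hv|a ha].
    - by rewrite size_poly0.
    - by apply: leq_trans (size_polyD _ _) _; rewrite geq_max hu.
    - exact: leq_trans (size_scale_leq _ _) (sL a ha).
  have := congr1 (fun z : {poly F} => z.[b]) D0.
  rewrite /= hornerD hornerN horner_sum horner0 => /eqP; rewrite subr_eq0 => /eqP ->.
  by apply: eq_bigr => a _; rewrite hornerZ mulrC.
have -> : fiber f b = \sum_(a <- s) (L a).[b] *: fiber f a.
  apply/polyP => i; rewrite coef_fiber (interp _ (fd i)) coef_sum.
  by apply: eq_bigr => a _; rewrite coefZ coef_fiber.
elim: (s) Vs => [|a s' IH] Vs; first by rewrite big_nil.
rewrite big_cons addrC; apply: Vlin; last by apply: Vs; rewrite mem_head.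
by apply: IH => a' ha'; apply: Vs; rewrite inE ha' orbT.
Qed.

End Orders.

Lemma bounded_seq (X : eqType) (S : X -> Prop) (N : nat) :
  (forall s, uniq s -> (forall x, x \in s -> S x) -> (size s <= N)%N) ->
  exists s, (size s <= N)%N /\ forall x, S x -> x \in s.
Proof.
move=> h; apply: contrapT => nh.
suff H n : exists s, [/\ uniq s, (forall x, x \in s -> S x) & size s = n].
  by have [s [us Ss sn]] := H N.+1; have := h s us Ss; rewrite sn ltnn.
elim: n => [|n [s [us Ss sn]]]; first by exists [::].
have [x [Sx xs]] : exists x, S x /\ x \notin s.
  apply: contrapT => nx; apply: nh; exists s; split; first exact: h.
  by move=> x Sx; apply: contrapT => /negP xs; apply: nx; exists x.
exists (x :: s); split=> /=; [by rewrite xs|move=> y|by rewrite sn].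
by rewrite inE => /orP[/eqP ->|/Ss].
Qed.

Section Isolated.
Variable R : realType.
Local Notation C := R[i].
Implicit Types f : {poly {poly C}}.

Definition pairf (x y : C) (j : bool) : C := if j then x else y.

Lemma isolated_pairs (I : finType) (P : (I + bool -> C) -> Prop) :
  definable P -> exists N, forall v,
    (forall w, P (scons v w) -> isolated P v w) ->
    exists s : seq (C * C), (size s <= N)%N /\
      forall x y, P (scons v (pairf x y)) -> (x, y) \in s.
Proof.
move=> /isolated_bounded[N hN]; exists N => v /hN hv.
have [|s [ss hs]] := @bounded_seq _ (fun z : C * C => P (scons v (pairf z.1 z.2))) N.
  move=> s us Ss.
  have := hv _ (fun t : 'I_(size s) => pairf (nth (0, 0) s t).1 (nth (0, 0) s t).2).
  rewrite card_ord; apply; last by move=> t; apply: Ss; apply: mem_nth.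
  move=> t1 t2 e; have e1 := congr1 (fun z => z true) e; have e2 := congr1 (fun z => z false) e.
  apply: val_inj; apply/eqP; rewrite -(nth_uniq (0, 0) (ltn_ord t1) (ltn_ord t2) us).
  apply/eqP; move: e1 e2; rewrite /pairf /=.
  by case: (nth _ _ t1) => a1 a2; case: (nth _ _ t2) => b1 b2 /= -> ->.
by exists s; split=> // x y; apply: (hs (x, y)).
Qed.

(** Sort the critical points by the order [a] of $f_x$. The equations $f=w$ and $\partial_x^af=0$
    then have a triangular Jacobian with entries $f_y$ and $\partial_x^{a+1}f$, both nonzero, so the
    solutions are isolated and bounded in number uniformly in [w]. *)
Lemma crit_level_bounded f : exists N, forall w, exists s : seq C, (size s <= N)%N /\
  forall c x, f.[x%:P].[c] = w -> (partx f).[x%:P].[c] = 0 ->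
    (party f).[x%:P].[c] != 0 -> fiber (partx f) c != 0 -> c \in s.
Proof.
pose P a (v : unit + bool -> C) := let x := v (inr true) in let c := v (inr false) in
  f.[x%:P].[c] = v (inl tt) /\ ((partx f).[x%:P].[c] = 0 /\ (f^`(a)).[x%:P].[c] = 0) /\
  ~ ((party f).[x%:P].[c] = 0) /\ ~ ((f^`(a.+1)).[x%:P].[c] = 0).
have pf (g : {poly {poly C}}) :
    polyfun (fun v : unit + bool -> C => g.[(v (inr true))%:P].[v (inr false)]).
  by apply: polyfun_horner2; apply: PFvar.
have dP a : definable (P a).
  apply: DFand; first by apply: definable_eq => //; apply: PFvar.
  apply: DFand; first by apply: DFand; apply: DFeq0.
  by apply: DFand; apply: DFnot; apply: DFeq0.
have /choice[N hN] := fun a => isolated_pairs (dP a).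
have iso a v w : P a (scons v w) -> isolated (P a) v w.
  move=> [e1 [[e2 e3] [n1 n2]]].
  pose E (j : bool) (u : bool -> C) : C := if j then f.[(u true)%:P].[u false] + - v tt
    else (f^`(a)).[(u true)%:P].[u false].
  have d (g : {poly {poly C}}) := diffat_horner2 g (diffat_var true w) (diffat_var false w).
  pose l (j : bool) (i : bool) : C :=
     if j then (partx f).[(w true)%:P].[w false] * (i == true)%:R +
       (party f).[(w true)%:P].[w false] * (i == false)%:R + 0
     else (partx (f^`(a))).[(w true)%:P].[w false] * (i == true)%:R +
       (party (f^`(a))).[(w true)%:P].[w false] * (i == false)%:R.
  apply: (diffat_isolated (E := E) (l := l)).
  - by move=> w' [h1 [[_ h2] _]] [] /=; [rewrite h1 subrr|].
  - by case=> /=; [rewrite e1 subrr|].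
  - by case; [apply: diffat_add (d f) (diffat_const _ _)|apply: d].
  - move=> u hu; have := hu true; have := hu false.
    rewrite !big_bool /= e2 !(mulr0, mul0r, mulr1, addr0, add0r) => h1 h2.
    have u0 : u false = 0.
      by move/eqP: h2; rewrite mulf_eq0 => /orP[/eqP|/eqP].
    move: h1; rewrite u0 mulr0 addr0 => /eqP; rewrite mulf_eq0 => /orP[/eqP h|/eqP h].
      by case: n2; rewrite derivnS.
    by case.
exists (\sum_(a < size f) N a)%N => w.
have /choice[S hS] := fun a => hN a (fun=> w) (iso a (fun=> w)).
exists (flatten [seq [seq z.2 | z <- S a] | a <- iota 0 (size f)]); split.
  rewrite size_flatten /shape -map_comp sumnE big_map -{1}(subn0 (size f)) big_mkord.
  by apply: leq_sum => a _ /=; rewrite size_map; have [] := hS a.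
move=> c x e1 e2 e3 e4.
have rt : root (fiber (partx f) c) x by rewrite rootE horner_fiber e2.
pose m := mup x (fiber (partx f) c).
have der j : (fiber f c)^`(j.+1).[x] = (f^`(j.+1)).[x%:P].[c].
  by rewrite -horner_fiber /fiber derivn_map.
have derx j : (fiber (partx f) c)^`(j) = (fiber f c)^`(j.+1).
  by rewrite fiber_partx derivSn.
have ha : exists2 a, (a < size f)%N & P a (scons (fun=> w) (pairf x c)).
  have h1 : ('X - x%:P) ^+ m %| fiber (partx f) c by rewrite -mup_geq.
  have h2 : ~ ('X - x%:P) ^+ m.+1 %| fiber (partx f) c by rewrite -mup_geq // ltnn.
  have m0 : (0 < m)%N by rewrite -XsubC_dvd // dvdp_XsubCl.
  move: h1 => /XsubC_exp_dvdE h1.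
  have {}h2 : (fiber (partx f) c)^`(m).[x] != 0.
    apply/eqP => h; apply: h2; apply/XsubC_exp_dvdE => j.
    by rewrite ltnS leq_eqVlt => /orP[/eqP -> //|/h1].
  exists m; last first.
    split=> //=; split; first split=> //.
      have := h1 m.-1; rewrite prednK // => /(_ (leqnn _)).
      by rewrite derx der prednK.
    split; first exact/eqP.
    by apply/eqP; rewrite -der -derx.
  rewrite ltnNge; apply/negP => le; case/eqP: h2; rewrite derx der.
  have -> : f^`(m.+1) = 0.
    apply/polyP => i; rewrite coef0 coef_derivn nth_default ?mul0rn //.
    by rewrite (leq_trans le) // leqW // leq_addr.
  by rewrite !horner0.
case: ha => a la /(fun h => (hS a).2 _ _ h) /= xc.
apply/flattenP; exists [seq z.2 | z <- S a].
  by apply/mapP; exists a; rewrite ?mem_iota.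
by apply/mapP; exists (x, c).
Qed.

(** At an exception stop one step before $f_y$ becomes nonzero: there
    $\partial_x^af_y=\partial_x^{a+1}f=0$, and since $\partial_x^{a+2}f=0$ the Jacobian is
    triangular with both diagonal entries $\partial_x^{a+1}f_y\neq0$. Exceptions are thus isolated
    and finite in number. *)
Lemma order_regular f : exists s : seq C, forall b, b \notin s -> forall x,
  fiber (partx f) b != 0 -> (partx f).[x%:P].[b] = 0 -> (party f).[x%:P].[b] = 0 ->
  ('X - x%:P) ^+ mup x (fiber (partx f) b) %| fiber (party f) b.
Proof.
pose P a (v : unit + bool -> C) := let x := v (inr true) in let c := v (inr false) in
  (((party f)^`(a)).[x%:P].[c] = 0 /\ (f^`(a.+1)).[x%:P].[c] = 0) /\
  (~ (((party f)^`(a.+1)).[x%:P].[c] = 0) /\ (f^`(a.+2)).[x%:P].[c] = 0).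
have pf (g : {poly {poly C}}) :
    polyfun (fun v : unit + bool -> C => g.[(v (inr true))%:P].[v (inr false)]).
  by apply: polyfun_horner2; apply: PFvar.
have dP a : definable (P a).
  by apply: DFand; apply: DFand; rewrite /=; [| |apply: DFnot|]; apply: DFeq0.
have /choice[N hN] := fun a => isolated_pairs (dP a).
have iso a v w : P a (scons v w) -> isolated (P a) v w.
  move=> [[e1 e2] [n1 e3]].
  pose E (j : bool) (u : bool -> C) : C :=
    if j then ((party f)^`(a)).[(u true)%:P].[u false]
    else (f^`(a.+1)).[(u true)%:P].[u false].
  have d (g : {poly {poly C}}) := diffat_horner2 g (diffat_var true w) (diffat_var false w).
  pose l (j : bool) (i : bool) : C :=
     if j then (partx ((party f)^`(a))).[(w true)%:P].[w false] * (i == true)%:R +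
       (party ((party f)^`(a))).[(w true)%:P].[w false] * (i == false)%:R
     else (partx (f^`(a.+1))).[(w true)%:P].[w false] * (i == true)%:R +
       (party (f^`(a.+1))).[(w true)%:P].[w false] * (i == false)%:R.
  apply: (diffat_isolated (E := E) (l := l)).
  - by move=> w' [[h1 h2] _] [].
  - by case.
  - by case; apply: d.
  - move=> u hu; have := hu true; have := hu false.
    have pd j (g : {poly {poly C}}) : party (g^`(j)) = (party g)^`(j).
      elim: j g => [|j IH] g; first by rewrite !derivn0.
      by rewrite !derivSn IH -/(partx g) party_partx.
    rewrite !big_bool /= !pd /partx -!derivnS e3 !(mulr0, mul0r, mulr1, addr0, add0r) => h1 h2.
    have u0 : u false = 0.
      by move/eqP: h1; rewrite mulf_eq0 => /orP[/eqP h|/eqP //]; case: n1; rewrite -pd.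
    move: h2; rewrite u0 mulr0 addr0 => /eqP; rewrite mulf_eq0 => /orP[/eqP h|/eqP h] //.
    by case.
have /choice[S hS] := fun a => hN a (fun=> 0) (iso a (fun=> 0)).
exists (flatten [seq [seq z.2 | z <- S a] | a <- iota 0 (size f)]) => b hb x fb0 fx fy.
apply: contrapT => nd; case/negP: hb.
have der j (g : {poly {poly C}}) : ((fiber g b)^`(j)).[x] = (g^`(j)).[x%:P].[b].
  by rewrite -horner_fiber /fiber derivn_map.
pose a := mup x (fiber (partx f) b).
have : exists j, (j < a)%N && (((fiber (party f) b)^`(j)).[x] != 0).
  apply: contrapT => nj; apply: nd; apply/XsubC_exp_dvdE => j ja.
  by apply: contrapT => /eqP h; apply: nj; exists j; rewrite ja.
move=> ex; case: (ex_minnP ex) => j /andP[ja jn] jmin {ex}.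
case: j ja jn jmin => [|j] ja jn jmin.
  by case/eqP: jn; rewrite derivn0 horner_fiber.
have /XsubC_exp_dvdE hx : ('X - x%:P) ^+ a %| fiber (partx f) b by rewrite -mup_geq.
have fxd i : (i < a)%N -> (f^`(i.+1)).[x%:P].[b] = 0.
  by move=> /hx; rewrite der /partx derivSn.
have Pj : P j (scons (fun=> 0) (pairf x b)).
  rewrite /P /=; split; split.
  - apply/eqP; rewrite -der; apply: contraTT (ltnSn j) => h; rewrite -leqNgt.
    by apply: jmin; rewrite h (ltn_trans _ ja).
  - by apply: fxd; apply: ltn_trans ja.
  - by apply/eqP; rewrite -derivnS -der.
  - by rewrite -!derivnS; apply: fxd.
have jf : (j < size f)%N.
  rewrite ltnNge; apply/negP => le; case/eqP: jn; rewrite der.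
  have -> : (party f)^`(j.+1) = 0.
    apply/polyP => i; rewrite coef0 coef_derivn nth_default ?mul0rn //.
    apply: leq_trans (size_poly _ _) _.
    by rewrite (leq_trans le) // leqW // leq_addr.
  by rewrite !horner0.
apply/flattenP; exists [seq z.2 | z <- S j].
  by apply/mapP; exists j; rewrite ?mem_iota.
by apply/mapP; exists (x, b) => //; apply: (hS j).2.
Qed.

End Isolated.

Section Generic.
Variable F : numClosedFieldType.
Implicit Types (p : {poly F}) (f g : {poly {poly F}}).

Lemma nonroot_seq p : p != 0 ->
  exists s : seq F, (size s < size p)%N /\ forall b, b \notin s -> p.[b] != 0.
Proof.
move=> p0; have [r rE] := closed_field_poly_normal p; exists r; split.
  suff -> : size p = (size r).+1 by [].
  by rewrite rE size_scale ?lead_coef_eq0 // size_prod_XsubC.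
by move=> b hb; rewrite rE hornerZ mulf_neq0 ?lead_coef_eq0 // -rootE root_prod_XsubC.
Qed.

Definition ydeg f : nat := \max_(i < size f) size (f`_i)%R.

Lemma size_coef_ydeg f i : (size (f`_i)%R <= ydeg f)%N.
Proof.
have [le|lt] := leqP (size f) i; first by rewrite nth_default ?size_poly0.
exact: (leq_bigmax (Ordinal lt)).
Qed.

Lemma size_horner_ydeg f (x : F) : (size (f.[x%:P])%R <= ydeg f)%N.
Proof.
rewrite horner_coef; elim/big_ind: _ => [|u v hu hv|i _].
- by rewrite size_poly0.
- by apply: leq_trans (size_polyD _ _) _; rewrite geq_max hu.
rewrite -rmorphXn /= mulrC mul_polyC.
exact: leq_trans (size_scale_leq _ _) (size_coef_ydeg f i).
Qed.

Lemma fiber_neq0_seq g : g != 0 ->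
  exists s : seq F, forall b, b \notin s -> fiber g b != 0.
Proof.
move=> g0; have lc0 : lead_coef g != 0 by rewrite lead_coef_eq0.
have [s [_ hs]] := nonroot_seq lc0; exists s => b /hs.
by apply: contra_neq => h; rewrite /lead_coef -coef_fiber h coef0.
Qed.

End Generic.

(** * Critical points at which the fields do not descend *)

Section Witness.
Variable R : realType.
Local Notation C := R[i].
Implicit Types f : {poly {poly C}}.

(* Either some critical points of the fibres move with c, and those are good;
   or all of them are fixed, and then the classification of the fixed case says
   that a non-descending one exists. *)
Theorem witness_exists f : partx f != 0 -> party f != 0 ->
  ~ additive_poly f -> ~ multiplicative_poly f -> ~ affine_type f ->
  exists (W : C -> C -> Prop) (sc : seq C) (N : nat),
  [/\ forall c, c \notin sc -> exists x, W c x,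
      forall c x, W c x -> [/\ (partx f).[x%:P].[c] = 0, (party f).[x%:P].[c] != 0 &
         fiber (partx f) c != 0] &
      forall c x, W c x -> exists s : seq C, (size s <= N)%N /\
         forall b, b \notin s -> ~ descends f b c x].
Proof.
move=> fx0 fy0 nadd nmul naff.
have [sx hsx] := fiber_neq0_seq fx0.
pose moving c x := [/\ (partx f).[x%:P].[c] = 0, (party f).[x%:P].[c] != 0 &
  (partx f).[x%:P] != 0].
(* The existence of a moving critical point is a definable condition on [c], so it holds for almost
   all [c] or for almost none. *)
have [Nm hm] : exists N, fincofin N (fun c : C => exists x, moving c x).
  pose P (v : option unit -> C) := exists x, ((partx f).[x%:P].[v None] = 0 /\
    ~ (party f).[x%:P].[v None] = 0) /\ exists b, ~ (partx f).[x%:P].[b] = 0.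
  have dP : definable P.
    have pf I (g : {poly {poly C}}) (i j : I) :
        polyfun (fun v : I -> C => g.[(v i)%:P].[v j]).
      by apply: polyfun_horner2; apply: PFvar.
    have d1 : definable (fun v : option (option unit) -> C =>
        (partx f).[(v None)%:P].[v (Some None)] = 0 /\
        ~ (party f).[(v None)%:P].[v (Some None)] = 0).
      by apply: DFand; [|apply: DFnot]; apply: DFeq0.
    have d2 : definable (fun v : option (option unit) -> C =>
        exists b, ~ (partx f).[(v None)%:P].[b] = 0).
      apply: (definable_ext (DFex (DFnot (DFeq0 (pf _ (partx f) (Some None) None))))) => v.
      by split.
    by apply: definable_ext (DFex (DFand d1 d2)) _ => v; split.
  have [N hN] := definable_fincofin dP; exists N.
  apply: fincofin_ext (hN (fun=> 0)) _ => c; split.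
    move=> [x [[h1 h2] [b h3]]]; exists x; split=> //; first exact/eqP.
    by apply/eqP => h; apply: h3; rewrite h horner0.
  move=> [x [h1 h2 h3]]; exists x; split; first by split=> //; apply/eqP.
  by have [b _ hb] := exists_nonroot_notin [::] h3; exists b; apply/eqP.
have [s1 [_ [hfin|hcof]]] := hm; last first.
  exists (fun c x => moving c x /\ c \notin sx), (s1 ++ sx), (ydeg (partx f) + ydeg (party f))%N.
  split.
  - move=> c; rewrite mem_cat negb_or => /andP[h1 h2].
    have : ~ ~ exists x, moving c x by move=> /hcof; apply/negP.
    by move/contrapT => [x hx]; exists x.
  - by move=> c x [[h1 h2 h3] /hsx h4].
  move=> c x [[h1 h2 h3] hc].
  have h2' : (party f).[x%:P] != 0 by apply: contra_neq h2 => ->; rewrite horner0.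
  have [t1 [st1 ht1]] := nonroot_seq h3; have [t2 [st2 ht2]] := nonroot_seq h2'.
  exists (t1 ++ t2); split.
    rewrite size_cat leq_add //.
      exact: leq_trans (ltnW st1) (size_horner_ydeg _ _).
    exact: leq_trans (ltnW st2) (size_horner_ydeg _ _).
  move=> b; rewrite mem_cat negb_or => /andP[/ht1 hb1 /ht2 hb2].
  exact: not_descends_moving hb1 hb2 h1 (hsx _ hc).
have fixedc c x : c \notin s1 -> (partx f).[x%:P].[c] = 0 -> (party f).[x%:P].[c] != 0 ->
    (partx f).[x%:P] = 0.
  move=> hc h1 h2; apply: contrapT => /eqP h3; move/negP: hc; apply; apply: hfin.
  by exists x.
have [Z hZ] : exists Z : seq C, forall x, (partx f).[x%:P] = 0 -> x \in Z.
  have [b hb] : exists b, fiber (partx f) b != 0.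
    have lc0 : lead_coef (partx f) != 0 by rewrite lead_coef_eq0.
    have [b _ hb] := exists_nonroot_notin sx lc0; exists b.
    by apply: contra_neq hb => h; rewrite /lead_coef -coef_fiber h coef0.
  have [Z [_ hZ]] := nonroot_seq hb; exists Z => x hx.
  by apply: contrapT => /negP/hZ; rewrite horner_fiber hx horner0 eqxx.
pose Z1 := [seq x <- Z | (party f).[x%:P] != 0].
pose Z2 := [seq x <- Z | (party f).[x%:P] == 0].
(* [P] collects, with multiplicity, the fixed critical points where $f_y$ is not identically zero;
   the fixed points in [Z2] stay in [g]. *)
have [P [g [Pm fxE hP hg]]] := factor_roots Z1 fx0.
have P0 : P != 0 := monic_neq0 Pm.
have g0 : g != 0 by apply: contra_neq fx0 => g0; rewrite fxE g0 mulr0.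
have [sg hsg] := fiber_neq0_seq g0.
have [so hso] := order_regular f.
have [sZ1 hsZ1] : exists s : seq C, forall b, b \notin s -> forall x, x \in Z1 -> g.[x%:P].[b] != 0.
  elim: (Z1) hg => [|a Z' IH] hg; first by exists [::].
  have [|s hs] := IH; first by move=> x hx; apply: hg; rewrite inE hx orbT.
  have [s' [_ hs']] := nonroot_seq (hg a (mem_head _ _)).
  exists (s ++ s') => b; rewrite mem_cat negb_or => /andP[h1 h2] x.
  by rewrite inE => /orP[/eqP ->|]; [apply: hs'|apply: hs].
(* fixed points where f_y also vanishes identically contribute more to f_y than to f_x *)
have [sZ2 hsZ2] : exists s : seq C, forall b, b \notin s -> forall x, x \in Z2 ->
    fiber (partx f) b != 0 ->
    ('X - x%:P) ^+ mup x (fiber (partx f) b) %| fiber (party f) b.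
  have : forall x, x \in Z2 -> (party f).[x%:P] = 0 by move=> x; rewrite mem_filter => /andP[/eqP].
  elim: (Z2) => [|a Z' IH] hZ'; first by exists [::].
  have [|s hs] := IH; first by move=> x hx; apply: hZ'; rewrite inE hx orbT.
  have [c0 c0E] : exists c0, f.[a%:P] = c0%:P.
    by apply: deriv_eq0; rewrite -party_horner hZ' // mem_head.
  pose f1 := f - c0%:P%:P.
  have fE : f = f1 + c0%:P%:P by rewrite /f1 subrK.
  have f10 : f1 != 0 by apply: contra_neq fx0 => f10; rewrite fE f10 add0r partx_polyC.
  have [k [u u0 f1E]] := multiplicity_XsubC f1 a%:P.
  rewrite f10 /= rootE in u0.
  have [s' [_ hs']] := nonroot_seq u0.
  exists (s ++ s') => b; rewrite mem_cat negb_or => /andP[h1 h2] x.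
  rewrite inE => /orP[/eqP ->|]; last exact: hs.
  move=> fb0.
  have XE : 'X - a%:P%:P = ('X - a%:P)^:P :> {poly {poly C}}.
    by rewrite rmorphB /= map_polyX map_polyC.
  have fyb : fiber (party f) b = fiber (party u) b * ('X - a%:P) ^+ k.
    rewrite fE partyD !partyC derivC polyC0 addr0 f1E XE partyM -rmorphXn party_lift mulr0 addr0.
    by rewrite fiberM fiber_lift.
  have fb : fiber f b = fiber u b * ('X - a%:P) ^+ k + (c0)%:P.
    by rewrite {1}fE f1E XE fiberD fiberM fiberX fiber_lift !fiberC hornerC.
  move: f1E; case: k fyb fb => [|k] fyb fb f1E0.
    case/eqP: u0; have -> : u = f1 by rewrite f1E0 expr0 mulr1.
    by rewrite /f1 hornerD hornerN hornerC c0E subrr.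
  rewrite fyb dvdp_mull // dvdp_exp2l // leqW //.
  rewrite mup_leq // fiber_partx fb derivD derivC addr0 derivM deriv_exp derivXsubC mul1r /=.
  have -> : (fiber u b)^`() * ('X - a%:P) ^+ k.+1 + fiber u b * (('X - a%:P) ^+ k *+ k.+1) =
     ((fiber u b)^`() * ('X - a%:P) + k.+1%:R%:P * fiber u b) * ('X - a%:P) ^+ k.
    by rewrite exprS polyC_natr -mulr_natl; ring.
  rewrite exprS dvdp_mul2r ?expf_neq0 ?polyXsubC_eq0 // dvdp_XsubCl.
  rewrite rootE !(hornerD, hornerM, hornerC, hornerX) hornerN hornerC subrr mulr0 add0r.
  by rewrite mulf_eq0 pnatr_eq0 /= horner_fiber hs'.
(* Consequently $f_y/f_x$ has poles only at the roots of [P] and has the form $Q/(lP)$ that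
   [fixed_classification] requires. *)
have key b : b \notin s1 ++ sx ++ so ++ sZ1 ++ sZ2 -> fiber g b %| fiber (party f) b.
  rewrite !mem_cat !negb_or => /and5P[hb1 hbx hbo hbZ1 hbZ2].
  have fb0 := hsx b hbx.
  have fbE : fiber (partx f) b = P * fiber g b by rewrite fxE fiberM fiber_lift.
  have gb0 : fiber g b != 0 by apply: contra_neq fb0 => h; rewrite fbE h mulr0.
  apply: dvdp_of_mup => // x rx.
  apply: dvdp_trans (_ : ('X - x%:P) ^+ mup x (fiber (partx f) b) %| _).
    by apply: dvdp_exp2l; rewrite fbE mupM // leq_addl.
  have fxb : (partx f).[x%:P].[b] = 0 by rewrite -horner_fiber fbE hornerM (rootP rx) mulr0.
  case: (eqVneq ((party f).[x%:P].[b]) 0) => [fyb|fyb]; first exact: hso.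
  have xZ : x \in Z by apply: hZ; apply: fixedc hb1 fxb fyb.
  apply: (hsZ2 b hbZ2) => //; rewrite mem_filter xZ andbT.
  apply: contraTT rx => fyx; rewrite rootE horner_fiber; apply: hsZ1 => //.
  by rewrite mem_filter fyx.
have [l [Q [l0 fyE]]] := bivariate_dvd g0 key.
(* The behaviour at $x=\infty$: $\deg_xf_y\le\deg_xf=\deg_xf_x+1$. *)
have szQ : (size Q <= (size P).+1)%N.
  have [->|Q0] := eqVneq Q 0; first by rewrite size_poly0.
  have e1 : (size (partx f)).+1 = size f.
    have sf : (1 < size f)%N.
      by rewrite ltnNge; apply: contra fx0 => sf; rewrite (size1_polyC sf) partx_polyC.
    apply/eqP; rewrite eqn_leq; apply/andP; split.
      by apply: lt_size_deriv; rewrite -size_poly_gt0 ltnW.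
    have h : (partx f)`_(size f).-2 != 0.
      rewrite coef_deriv; have -> : (size f).-2.+1 = (size f).-1 by case: (size f) sf => [|[]].
      rewrite mulrn_polyC mulf_neq0 ?lead_coef_eq0 -?size_poly_gt0 ?(ltnW sf) //.
      by rewrite polyC_natr polyC_eq0 || rewrite size_poly_gt0 polyC_natr -polyC_natr polyC_eq0 pnatr_eq0 -lt0n; case: (size f) sf => [|[]].
    have : ((size f).-2 < size (partx f))%N.
      by rewrite ltnNge; apply: contra h => le; rewrite nth_default.
    by case: (size f) sf => [|[|n]].
  have e2 : size (partx f) = (size P + size g).-1.
    by rewrite fxE size_mul ?lift_neq0 // size_map_polyC.
  have e3 : (size Q + size g).-1 = size (party f).
    by rewrite -size_mul // -fyE mul_polyC size_scale.
  have e4 : (size (party f) <= size f)%N := size_poly _ _.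
  have g1 : (0 < size g)%N by rewrite size_poly_gt0.
  have P1 : (0 < size P)%N by rewrite size_poly_gt0.
  have L (f' fx q p g' fy : nat) : (fx.+1 = f' -> fx = (p + g').-1 -> (q + g').-1 = fy ->
    fy <= f' -> 0 < g' -> 0 < p -> q <= p.+1)%N by lia.
  exact: L e1 e2 e3 e4 g1 P1.
have fyP x : root P x -> (party f).[x%:P] != 0.
  by move=> /hP; rewrite mem_filter => /andP[].
have [sf hsf] : exists s : seq C, forall b, b \notin s -> forall x, x \in Z1 ->
    (party f).[x%:P].[b] != 0.
  have : forall x, x \in Z1 -> (party f).[x%:P] != 0 by move=> x; rewrite mem_filter => /andP[].
  elim: (Z1) => [|a Z' IH] h; first by exists [::].
  have [|s hs] := IH; first by move=> x hx; apply: h; rewrite inE hx orbT.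
  have [s' [_ hs']] := nonroot_seq (h a (mem_head _ _)).
  exists (s ++ s') => b; rewrite mem_cat negb_or => /andP[h1 h2] x.
  by rewrite inE => /orP[/eqP ->|]; [apply: hs'|apply: hs].
pose phi c x := fiber f c - (f.[x%:P].[c])%:P.
pose inD c x r S := exists A : {poly C}, ('X - x%:P) ^+ r %| S * fiber g c - (A \Po phi c x).
(* A witness is a root of [P] where some fibre of [Q] fails to descend to some order [r]; without
   one the classification would apply. For fixed [r] the descending polynomials form a linear space,
   so by interpolation at most [ydeg Q] fibres belong to it. *)
exists (fun c x => [/\ root P x, c \notin sx ++ sf & exists r b, ~ inD c x r (fiber Q b)]),
  (sx ++ sf ++ sZ1), (ydeg Q + size sg)%N; split.
- move=> c; rewrite !mem_cat !negb_or => /and3P[h1 h2 h3].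
  apply: contrapT => nx.
  have gc x : root P x -> (fiber g c).[x] != 0.
    by move=> /hP xZ; rewrite horner_fiber hsZ1.
  have desc b : b \notin [::] -> pushes f g P c (fiber Q b).
    move=> _ x rx r; apply: contrapT => nA; apply: nx; exists x.
    by split; [exact: rx|rewrite h1 h2|exists r, b].
  by case: (fixed_classification Pm l0 szQ fxE fyE fyP gc desc fx0).
- move=> c x [rx]; rewrite mem_cat negb_or => /andP[/hsx h1 h2] _; split=> //.
    by rewrite -horner_fiber fxE fiberM fiber_lift hornerM (rootP rx) mul0r.
  by apply: hsf => //; apply: hP.
move=> c x [rx _ [r [b1 hb1]]].
have [|s [ss hs]] := @bounded_seq _ (fun b => inD c x r (fiber Q b)) (ydeg Q).
  move=> s us Ss; rewrite leqNgt; apply/negP => lt; apply: hb1.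
  apply: (@lagrange_fiber _ (inD c x r) Q (size s) s) => //.
  - by exists 0; rewrite mul0r comp_poly0 subr0 dvdp0.
  - move=> k p q [A hA] [B hB]; exists (A + k *: B).
    rewrite comp_polyD comp_polyZ mulrDl -scalerAl.
    set a1 := p * _ in hA *; set a2 := q * _ in hB *.
    have -> : a1 + k *: a2 - ((A \Po phi c x) + k *: (B \Po phi c x)) =
        (a1 - (A \Po phi c x)) + k *: (a2 - (B \Po phi c x)) by rewrite scalerBr; ring.
    by rewrite dvdp_add // -mul_polyC dvdp_mull.
  - by move=> i; apply: leq_trans (size_coef_ydeg Q i) (ltnW lt).
exists (s ++ sg); split; first by rewrite size_cat leq_add2r.
move=> b; rewrite mem_cat negb_or => /andP[hb /hsg gb0] hdesc.
move/negP: hb; apply; apply: hs.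
pose M := P * fiber g b; have M0 : M != 0 by rewrite mulf_neq0.
have [A hA] := hdesc (r + mup x M)%N; exists (l.[b] *: A).
have [M1 M1E] : exists M1, M = M1 * ('X - x%:P) ^+ mup x M by apply/dvdpP; rewrite -mup_geq.
have M1x : M1.[x] != 0.
  rewrite -rootE; apply/negP => r1.
  have := mup_leq x (mup x M) M0; rewrite leqnn => /esym/negP; apply.
  by rewrite {2}M1E exprS dvdp_mul // dvdp_XsubCl.
apply: (XsubC_dvd_mulr M1x).
rewrite -(@dvdp_mul2r _ (('X - x%:P) ^+ mup x M)) ?expf_neq0 ?polyXsubC_eq0 // -exprD.
have {hA} : ('X - x%:P) ^+ (r + mup x M) %| l.[b]%:P * (fiber (party f) b * fiber (partx f) c -
    fiber (partx f) b * (A \Po phi c x)) by rewrite dvdp_mull.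
have e1 : l.[b]%:P * fiber (party f) b = fiber Q b * fiber g b.
  by rewrite -fiberC -!fiberM fyE.
have -> : l.[b]%:P * (fiber (party f) b * fiber (partx f) c -
    fiber (partx f) b * (A \Po phi c x)) =
    M * (fiber Q b * fiber g c - (l.[b] *: A \Po phi c x)).
  rewrite mulrBr mulrA e1 fxE !fiberM !fiber_lift comp_polyZ -mul_polyC /M; ring.
have -> // : M * (fiber Q b * fiber g c - (l.[b] *: A \Po phi c x)) =
  M1 * (fiber Q b * fiber g c - (l.[b] *: A \Po phi c x)) * ('X - x%:P) ^+ mup x M.
by rewrite {1}M1E mulrAC.
Qed.

End Witness.

(** * Chains in the fibres *)

Section Chains.
Variable F : numClosedFieldType.
Variable f : {poly {poly F}}.
Implicit Types (b c : nat -> F).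

Definition chain b c n (x : nat -> F) : Prop :=
  forall i, (i < n)%N -> f.[(x i)%:P].[b i] = f.[(x i.+1)%:P].[c i.+1].

Lemma size_fiber_gt1 a : fiber (partx f) a != 0 -> (1 < size (fiber f a))%N.
Proof.
rewrite fiber_partx => h; rewrite ltnNge; apply: contra h => sf.
by rewrite (size1_polyC sf) derivC.
Qed.

Lemma level_seq a z : fiber (partx f) a != 0 ->
  exists s : seq F, (size s <= size f)%N /\ forall x, f.[x%:P].[a] = z -> x \in s.
Proof.
move=> /size_fiber_gt1 sf.
have szz : size (fiber f a - z%:P) = size (fiber f a).
  by rewrite size_polyDl // size_polyN; apply: leq_ltn_trans sf; apply: size_polyC_leq1.
have nz : fiber f a - z%:P != 0 by rewrite -size_poly_gt0 szz (ltn_trans _ sf).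
have [s [ss hs]] := nonroot_seq nz; exists s; split.
  by apply: leq_trans (ltnW ss) _; rewrite szz size_fiber.
move=> x hx; apply: contrapT => /negP/hs.
by rewrite hornerD hornerN hornerC horner_fiber hx subrr eqxx.
Qed.

Lemma chain_starts b c n y : (forall i, (i < n)%N -> fiber (partx f) (b i) != 0) ->
  exists s : seq F, (size s <= size f ^ n)%N /\
    forall x, chain b c n x -> x n = y -> x 0%N \in s.
Proof.
elim: n y => [|n IH] y hb.
  by exists [:: y]; split=> // x _ ->; rewrite inE.
have [s [ss hs]] := level_seq (f.[y%:P].[c n.+1]) (hb n (ltnSn n)).
have /choice[t ht] : forall y', exists t : seq F, (size t <= size f ^ n)%N /\
    forall x, chain b c n x -> x n = y' -> x 0%N \in t.
  by move=> y'; apply: IH => i hi; apply: hb; apply: ltnW.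
exists (flatten [seq t y' | y' <- s]); split.
  rewrite size_flatten /shape -map_comp sumnE big_map expnS.
  apply: leq_trans (_ : \sum_(y' <- s) size f ^ n <= _)%N.
    by apply: leq_sum => y' _; have [] := ht y'.
  by rewrite big_const_seq count_predT iter_addn_0 mulnC leq_mul2r ss orbT.
move=> x hx xn; have h := hx n (ltnSn n); rewrite xn in h.
apply/flattenP; exists (t (x n)).
  by apply/mapP; exists (x n) => //; apply: hs.
by have [_] := ht (x n); apply => // i hi; apply: hx; apply: ltnW.
Qed.

Lemma chain_seq b c n y : (forall i, (0 < i <= n)%N -> fiber (partx f) (c i) != 0) ->
  exists s : seq (seq F), (size s <= size f ^ n)%N /\
    forall x, chain b c n x -> x 0%N = y -> mkseq x n.+1 \in s.
Proof.
elim: n => [|n IH] hc.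
  by exists [:: [:: y]]; split=> // x _ <-; rewrite inE.
have [s [ss hs]] := IH (fun i h => hc i (introT andP (conj (proj1 (andP h))
  (leqW (proj2 (andP h)))))).
have /choice[t ht] : forall y', exists t : seq F, (size t <= size f)%N /\
    forall x, f.[x%:P].[c n.+1] = f.[y'%:P].[b n] -> x \in t.
  by move=> y'; apply: level_seq; apply: hc; rewrite leqnn.
exists (flatten [seq [seq rcons l x | x <- t (nth 0 l n)] | l <- s]); split.
  rewrite size_flatten /shape -map_comp sumnE big_map expnSr.
  apply: leq_trans (_ : \sum_(l <- s) size f <= _)%N.
    by apply: leq_sum => l _ /=; rewrite size_map; have [] := ht (nth 0 l n).
  by rewrite big_const_seq count_predT iter_addn_0 mulnC leq_mul2r ss orbT.
move=> x hx x0; have h1 : mkseq x n.+1 \in s.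
  by apply: hs => // i hi; apply: hx; apply: ltnW.
apply/flattenP; exists [seq rcons (mkseq x n.+1) x0 | x0 <- t (nth 0 (mkseq x n.+1) n)].
  by apply/mapP; exists (mkseq x n.+1).
rewrite mkseqS; apply: map_f; have [_] := ht (nth 0 (mkseq x n.+1) n); apply.
by rewrite nth_mkseq // hx.
Qed.

(** Fix the position at which $f_x$ vanishes. Boundedly many points are possible there, and each is
    followed forward to the end of the chain in boundedly many ways. *)
Lemma bad_levels b c n : (forall i, (i < n)%N -> fiber (partx f) (b i) != 0) ->
  (forall i, (0 < i < n)%N -> fiber (partx f) (c i) != 0) ->
  exists s : seq F, (size s <= n * (2 * size f) * size f ^ n)%N /\
    forall z, ~ regular_level f b c n z -> z \in s.
Proof.
move=> hb hc.
(* [fwd i m x]: ends of chains that start at x in position i and make m steps *)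
have fwd i m x : (i + m < n)%N -> exists s : seq F, (size s <= size f ^ m)%N /\
    forall rho, (forall j, (j.+1 < n)%N -> f.[(rho j)%:P].[b j] = f.[(rho j.+1)%:P].[c j.+1]) ->
      rho i = x -> rho (i + m)%N \in s.
  elim: m => [|m IH] lt.
    by exists [:: x]; split=> // rho _ <-; rewrite addn0 inE.
  have [|s [ss hs]] := IH; first by apply: leq_trans lt; rewrite addnS.
  have /choice[t ht] : forall y', exists t : seq F, (size t <= size f)%N /\
      forall x, f.[x%:P].[c (i + m).+1] = f.[y'%:P].[b (i + m)%N] -> x \in t.
    by move=> y'; apply: level_seq; apply: hc; rewrite ltn0Sn -addnS.
  exists (flatten [seq t y | y <- s]); split.
    rewrite size_flatten /shape -map_comp sumnE big_map expnSr.
    apply: leq_trans (_ : \sum_(l <- s) size f <= _)%N.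
      by apply: leq_sum => l _ /=; have [] := ht l.
    by rewrite big_const_seq count_predT iter_addn_0 mulnC leq_mul2r ss orbT.
  move=> rho hrho ri; apply/flattenP; exists (t (rho (i + m)%N)).
    by apply: map_f; apply: hs.
  by have [_] := ht (rho (i + m)%N); apply; rewrite addnS hrho // -addnS.
have per i : exists s : seq F, (size s <= (2 * size f) * size f ^ n)%N /\
  ((i < n)%N -> forall rho,
     (forall j, (j.+1 < n)%N -> f.[(rho j)%:P].[b j] = f.[(rho j.+1)%:P].[c j.+1]) ->
     ((partx f).[(rho i)%:P].[b i] = 0 \/ (0 < i)%N /\ (partx f).[(rho i)%:P].[c i] = 0) ->
     f.[(rho n.-1)%:P].[b n.-1] \in s).
  have [lt|ge] := ltnP i n; last by exists [::].
  have sp (p : {poly F}) : p = 0 \/ exists s : seq F, (size s < size p)%N /\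
      forall x, p.[x] = 0 -> x \in s.
    have [->|p0] := eqVneq p 0; [by left|right].
    have [s [ss hs]] := nonroot_seq p0; exists s; split=> // x hx.
    by apply: contrapT => /negP/hs; rewrite hx eqxx.
  have sfx a : (size (fiber (partx f) a) <= size f)%N.
    by apply: leq_trans (size_fiber _ _) (leq_trans (size_poly _ _) (leq_pred _)).
  have [r1 [sr1 hr1]] : exists s : seq F, (size s <= size f)%N /\
      forall x, (partx f).[x%:P].[b i] = 0 -> x \in s.
    have [h|[s [ss hs]]] := sp (fiber (partx f) (b i)); first by have := hb i lt; rewrite h eqxx.
    exists s; split; first exact: leq_trans (ltnW ss) (sfx _).
    by move=> x hx; apply: hs; rewrite horner_fiber.
  have [r2 [sr2 hr2]] : exists s : seq F, (size s <= size f)%N /\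
      forall x, (0 < i)%N -> (partx f).[x%:P].[c i] = 0 -> x \in s.
    have [i0|i0] := posnP i; first by exists [::]; split=> // x; rewrite i0.
    have ci : fiber (partx f) (c i) != 0 by apply: hc; rewrite i0.
    have [h|[s [ss hs]]] := sp (fiber (partx f) (c i)); first by rewrite h eqxx in ci.
    exists s; split; first exact: leq_trans (ltnW ss) (sfx _).
    by move=> x _ hx; apply: hs; rewrite horner_fiber.
  have im : (i + (n.-1 - i) < n)%N by lia.
  have /choice[t ht] := fun x => fwd i (n.-1 - i)%N x im.
  exists [seq f.[y%:P].[b n.-1] | y <- flatten [seq t x | x <- r1 ++ r2]]; split.
    rewrite size_map size_flatten /shape -map_comp sumnE big_map.
    apply: leq_trans (_ : \sum_(x <- r1 ++ r2) size f ^ n <= _)%N.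
      apply: leq_sum => x _ /=; have [h _] := ht x; apply: leq_trans h _.
      have [f0|f0] := posnP (size f); last by rewrite leq_pexp2l //; lia.
      have := hb i lt; rewrite (_ : partx f = 0); last first.
        by move/eqP: f0; rewrite size_poly_eq0 => /eqP ->; rewrite /partx deriv0.
      by rewrite /fiber map_poly0 eqxx.
    rewrite big_const_seq count_predT iter_addn_0 mulnC leq_mul2r size_cat mul2n -addnn.
    by rewrite leq_add ?orbT.
  move=> _ rho hrho hz; have En : n.-1 = (i + (n.-1 - i))%N by lia.
  apply/mapP; exists (rho n.-1) => //; rewrite En.
  apply/flattenP; exists (t (rho i)).
    apply: map_f; rewrite mem_cat; case: hz => [h|[h1 h2]].
      by rewrite hr1.
    by rewrite hr2 ?orbT.
  by have [_] := ht (rho i); apply.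
have /choice[S hS] := per.
exists (flatten [seq S i | i <- iota 0 n]); split.
  rewrite size_flatten /shape -map_comp sumnE big_map -mulnA.
  apply: leq_trans (_ : \sum_(i <- iota 0 n) (2 * size f) * size f ^ n <= _)%N.
    by apply: leq_sum => i _ /=; have [] := hS i.
  by rewrite big_const_seq count_predT iter_addn_0 size_iota mulnC.
move=> z /existsNP[rho /not_implyP[<-]] /not_implyP[hrho] /existsNP[i /not_implyP[lt nh]].
apply/flattenP; exists (S i); first by apply: map_f; rewrite mem_iota.
have [_] := hS i; apply => //.
case: (eqVneq (partx f).[(rho i)%:P].[b i] 0) => [h|h]; [by left|right].
have [i0|i0] := posnP i; first by case: nh; split=> //; rewrite i0.
by split=> //; apply: contrapT => /eqP h2; apply: nh; split.
Qed.

End Chains.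

Definition upd (T : Type) (b : nat -> T) n y i := if i == n then y else b i.

Lemma lpath_ext (F : fieldType) (f : {poly {poly F}}) b c db b' c' db' n x v x' v' :
  (forall i, (i <= n)%N -> [/\ b i = b' i, (0 < i)%N -> c i = c' i, db i = db' i,
     x i = x' i & v i = v' i]) ->
  lpath f b c db n x v -> lpath f b' c' db' n x' v'.
Proof.
move=> e [v0 h]; split; first by have [_ _ _ _ <-] := e 0%N isT.
move=> i hi; have [h1 h2 h3] := h i hi.
have [<- _ <- <- <-] := e i (ltnW hi); have [_ /(_ isT) <- _ <- <-] := e i.+1 hi.
by split.
Qed.

Lemma endspeed_ext (F : fieldType) (f : {poly {poly F}}) b db b' db' n x v x' v' :
  [/\ b n = b' n, db n = db' n, x n = x' n & v n = v' n] ->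
  endspeed f b db n x v = endspeed f b' db' n x' v'.
Proof. by rewrite /endspeed => -[-> -> -> ->]. Qed.

Lemma lpath_chain (F : numClosedFieldType) (f : {poly {poly F}}) b c db n x v :
  lpath f b c db n x v -> chain f b c n x.
Proof. by move=> [_ h] i /h[]. Qed.

(** * Good words and stopping paths *)

Section Words.
Variable R : realType.
Local Notation C := R[i].
Variable f : {poly {poly C}}.

Lemma stop_definable n : definable (fun u : option ('I_3 * 'I_n.+1) -> C =>
  exists x v, [/\ lpath f (fun i => u (Some (inord 0, inord i)))
      (fun i => u (Some (inord 1, inord i))) (fun i => u (Some (inord 2, inord i))) n x v,
    endspeed f (fun i => u (Some (inord 0, inord i)))
      (fun i => u (Some (inord 2, inord i))) n x v = 0 & x n = u None]).
Proof.
pose I := option ('I_3 * 'I_n.+1); pose J : finType := ('I_n.+1 * bool)%type.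
pose b (u : I + J -> C) i := u (inl (Some (inord 0, inord i))).
pose c (u : I + J -> C) i := u (inl (Some (inord 1, inord i))).
pose db (u : I + J -> C) i := u (inl (Some (inord 2, inord i))).
pose x (u : I + J -> C) i := u (inr (inord i, false)).
pose v (u : I + J -> C) i := u (inr (inord i, true)).
have pf (g : {poly {poly C}}) (i j : I + J) : polyfun (fun u : I + J -> C => g.[(u i)%:P].[u j]).
  by apply: polyfun_horner2; apply: PFvar.
have d : definable (fun u : I + J -> C =>
  ((v u 0%N = 0 /\ forall i : 'I_n,
     (f.[(x u i)%:P].[b u i] = f.[(x u i.+1)%:P].[c u i.+1] /\
      ~ ((partx f).[(x u i.+1)%:P].[c u i.+1] = 0)) /\
      (partx f).[(x u i.+1)%:P].[c u i.+1] * v u i.+1 =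
      (partx f).[(x u i)%:P].[b u i] * v u i + (party f).[(x u i)%:P].[b u i] * db u i) /\
   endspeed f (b u) (db u) n (x u) (v u) = 0) /\ x u n = u (inl None)).
  apply: DFand; last by apply: definable_eq; apply: PFvar.
  apply: DFand; last first.
    by apply: DFeq0; apply: PFadd; apply: PFmul; rewrite /x /b; try exact: pf; apply: PFvar.
  apply: DFand; first by apply: DFeq0; apply: PFvar.
  apply: definable_alln => i; apply: DFand.
    by apply: DFand; [apply: definable_eq; apply: pf|apply: DFnot; apply: DFeq0; apply: pf].
  apply: definable_eq; first by apply: PFmul; [apply: pf|apply: PFvar].
  by apply: PFadd; apply: PFmul; rewrite /x /b; try exact: pf; apply: PFvar.
apply: definable_ext (definable_exs d) _ => u.
split=> [[w [[[h1 h2] h3] h4]]|[X [V [[h1 h2] h3 h4]]]].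
  exists (fun i => w (inord i, false)), (fun i => w (inord i, true)); split=> //.
  split=> // i hi; have [[e1 e2] e3] := h2 (Ordinal hi); split=> //.
  exact/eqP.
exists (fun j : ('I_n.+1 * bool)%type => if j.2 then V j.1 else X j.1); rewrite /x /v /b /c /db /=.
split; last by rewrite inordK.
split; last by rewrite /endspeed /= inordK.
split; first by rewrite inordK.
move=> i; have [e1 e2 e3] := h2 i (ltn_ord i).
rewrite !inordK ?ltnS ?(ltnW (ltn_ord i)) //; split=> //; split=> //.
exact/eqP.
Qed.

Variables (W : C -> C -> Prop) (N Nc : nat).
Hypothesis W2 : forall c x, W c x -> [/\ (partx f).[x%:P].[c] = 0,
  (party f).[x%:P].[c] != 0 & fiber (partx f) c != 0].
Hypothesis W3 : forall c x, W c x -> exists s : seq C, (size s <= N)%N /\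
  forall b, b \notin s -> ~ descends f b c x.
Hypothesis W4 : forall w, exists s : seq C, (size s <= Nc)%N /\
  forall c x, f.[x%:P].[c] = w -> (partx f).[x%:P].[c] = 0 ->
    (party f).[x%:P].[c] != 0 -> fiber (partx f) c != 0 -> c \in s.

Definition okl a := [/\ fiber (partx f) a != 0, fiber (party f) a != 0 & exists x, W a x].

(** Goodness of position [n] is secured one letter at a time: [pre_good] is a condition on [c n]
    once the earlier letters are given, and [good_at] then restricts [b n]. *)
Definition pre_good b c n := exists x, W (c n) x /\ regular_level f b c n (f.[x%:P].[c n]).

Definition good_at b c n := exists x, [/\ W (c n) x, regular_level f b c n (f.[x%:P].[c n])
  & ~ descends f (b n) (c n) x].

Lemma regular_level_ext b c b' c' n z : (forall i, (i < n)%N -> b i = b' i) ->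
  (forall i, (i < n)%N -> c i = c' i) -> regular_level f b c n z -> regular_level f b' c' n z.
Proof.
move=> eb ec h rho h1 h2 i hi; rewrite -eb // -ec //.
apply: h => //; first by rewrite eb //; lia.
by move=> j hj; rewrite eb ?(ltnW hj) // ec // h2.
Qed.

(** By [bad_levels] only boundedly many levels are not regular, and by [W4] each of them is a
    critical value for boundedly many letters. *)
Lemma pre_good_bad n : exists K, forall b c,
  (forall i, (i < n)%N -> fiber (partx f) (b i) != 0) ->
  (forall i, (0 < i < n)%N -> fiber (partx f) (c i) != 0) ->
  exists s : seq C, (size s <= K)%N /\
    forall y, okl y -> ~ pre_good b (upd c n y) n -> y \in s.
Proof.
exists (n * (2 * size f) * size f ^ n * Nc)%N => b c hb hc.
have [s [ss hs]] := bad_levels hb hc.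
have /choice[t ht] := W4.
exists (flatten [seq t z | z <- s]); split.
  rewrite size_flatten /shape -map_comp sumnE big_map.
  apply: leq_trans (_ : \sum_(z <- s) Nc <= _)%N.
    by apply: leq_sum => l _ /=; have [] := ht l.
  by rewrite big_const_seq count_predT iter_addn_0 mulnC leq_mul2r ss orbT.
move=> y [_ _ [x Wx]] np; have [w1 w2 w3] := W2 Wx.
have [_ hx] := ht (f.[x%:P].[y]).
apply/flattenP; exists (t (f.[x%:P].[y])); last exact: (hx y x).
apply: map_f; apply: hs => reg; apply: np; exists x; rewrite /upd eqxx; split=> //.
apply: regular_level_ext reg => // i hi; by rewrite (ltn_eqF hi).
Qed.

Lemma good_bad n b c : pre_good b c n -> exists s : seq C, (size s <= N)%N /\
  forall y, ~ good_at (upd b n y) c n -> y \in s.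
Proof.
move=> [x [Wx reg]]; have [s [ss hs]] := W3 Wx; exists s; split=> // y ng.
apply: contrapT => /negP ys; apply: ng; exists x; split=> //.
  by apply: regular_level_ext reg => // i hi; rewrite /upd (ltn_eqF hi).
by rewrite /upd eqxx; apply: hs.
Qed.

(** The end points of stopping paths form a finite or cofinite set with a uniform bound, and in the
    cofinite case [descent] would make the field of [b n] descend at the witness. For [n = 0]
    stopping means $f_y(x_0,b_0)=0$. *)
Lemma stop_bounded n : exists K, forall b c db,
  (forall i, (i <= n)%N -> fiber (partx f) (b i) != 0) ->
  fiber (party f) (b 0%N) != 0 -> ((0 < n)%N -> good_at b c n) -> db n != 0 ->
  exists s : seq C, (size s <= K)%N /\
    forall x v, lpath f b c db n x v -> endspeed f b db n x v = 0 -> x 0%N \in s.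
Proof.
have [M hM] := definable_fincofin (stop_definable n).
exists ((M + size f) * size f ^ n)%N => b c db hb hfy hg dbn.
have [s [ss hs]] : exists s : seq C, (size s <= M + size f)%N /\
    forall x v, lpath f b c db n x v -> endspeed f b db n x v = 0 -> x n \in s.
  have [n0|n0] := posnP n.
    have [s [ss hs]] := nonroot_seq hfy; exists s; split.
      apply: leq_trans (ltnW ss) (leq_trans (size_fiber _ _) (leq_trans (size_poly _ _) _)).
      exact: leq_addl.
    move=> x v [v0 _]; move: dbn; rewrite n0 /endspeed => dbn; rewrite v0 mulr0 add0r => /eqP.
    rewrite mulf_eq0 (negPf dbn) orbF -horner_fiber => /eqP h.
    by apply: contrapT => /negP/hs; rewrite h eqxx.
  pose u (j : 'I_3 * 'I_n.+1) : C := match val j.1 with 0%N => b j.2 | 1%N => c j.2 | _ => db j.2 end.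
  have eq3 (m : nat) (lt : (m < 3)%N) i : (i <= n)%N ->
    u (inord m, inord i) = match m with 0%N => b i | 1%N => c i | _ => db i end.
    by move=> hi; rewrite /u /= !inordK.
  have ext x v : lpath f b c db n x v <-> lpath f (fun i => u (inord 0, inord i))
      (fun i => u (inord 1, inord i)) (fun i => u (inord 2, inord i)) n x v.
    by split; apply: lpath_ext => i hi; rewrite !eq3.
  have exte x v : endspeed f b db n x v = endspeed f (fun i => u (inord 0, inord i))
      (fun i => u (inord 2, inord i)) n x v.
    by apply: endspeed_ext; rewrite !eq3.
  have [s [ss [h|h]]] := hM u.
    exists s; split; first exact: leq_trans ss (leq_addr _ _).
    move=> x v h1 h2; apply: h; exists x, v; split=> //=; first exact/ext.
    by rewrite -exte.
  exfalso; have [xi [Wxi reg nd]] := hg n0; apply: nd.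
  apply: (descent n0 dbn _ reg (s := s)) => [i hi|x0 hx0].
    by apply: size_fiber_gt1; apply: hb; apply: ltnW.
  have : ~ ~ exists x v, [/\ lpath f (fun i => u (inord 0, inord i))
      (fun i => u (inord 1, inord i)) (fun i => u (inord 2, inord i)) n x v,
      endspeed f (fun i => u (inord 0, inord i)) (fun i => u (inord 2, inord i)) n x v = 0
      & x n = x0].
    by move=> /h; apply/negP.
  move=> /contrapT[x [v [h1 h2 h3]]]; exists x, v; split=> //; first exact/ext.
  by rewrite exte.
have /choice[t ht] : forall y, exists t : seq C, (size t <= size f ^ n)%N /\
    forall x, chain f b c n x -> x n = y -> x 0%N \in t.
  by move=> y; apply: chain_starts => i hi; apply: hb; apply: ltnW.
exists (flatten [seq t y | y <- s]); split.
  rewrite size_flatten /shape -map_comp sumnE big_map.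
  apply: leq_trans (_ : \sum_(z <- s) size f ^ n <= _)%N.
    by apply: leq_sum => l _ /=; have [] := ht l.
  by rewrite big_const_seq count_predT iter_addn_0 mulnC leq_mul2r ss orbT.
move=> x v h1 h2; apply/flattenP; exists (t (x n)); first by apply: map_f; apply: hs h1 h2.
by have [_] := ht (x n); apply => //; apply: lpath_chain h1.
Qed.

End Words.

Lemma exists_orthogonal (F : fieldType) (l k : nat) (lam : 'I_l -> 'I_k -> F) : (l < k)%N ->
  exists2 d : 'I_k -> F, exists i, d i != 0 & forall j, \sum_i lam j i * d i = 0.
Proof.
move=> lk; pose M : 'M[F]_(k, l) := \matrix_(i, j) lam j i.
have : kermx M != 0.
  rewrite kermx_eq0 /row_free; apply: contraL lk => /eqP <-.
  by rewrite -leqNgt rank_leq_col.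
move=> /rowV0Pn[v /sub_kermxP vM v0].
exists (fun i => v 0 i).
  apply: contrapT => nv; case/eqP: v0; apply/rowP => i; rewrite mxE.
  by apply: contrapT => /eqP h; apply: nv; exists i.
move=> j; move/matrixP/(_ 0 j): vM; rewrite !mxE => h; rewrite -[RHS]h.
by apply: eq_bigr => i _; rewrite !mxE mulrC.
Qed.

Lemma triangular_kernel (F : fieldType) (k : nat) (lam d : 'I_k -> 'I_k -> F) :
  (forall l l' : 'I_k, (l < l')%N -> \sum_i lam l i * d l' i = 0) ->
  (forall l, \sum_i lam l i * d l i != 0) ->
  forall u : 'I_k -> F, (forall l, \sum_i lam l i * u i = 0) -> forall i, u i = 0.
Proof.
move=> h1 h2 u hu i.
pose M : 'M[F]_k := \matrix_(l, i) lam l i; pose D : 'M[F]_k := \matrix_(i, l) d l i.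
have MD l l' : (M *m D) l l' = \sum_i lam l i * d l' i.
  by rewrite mxE; apply: eq_bigr => j _; rewrite !mxE.
have : \det (M *m D) != 0.
  rewrite det_trig; last by apply/is_trig_mxP => l l' ll'; rewrite MD h1.
  by rewrite prodf_seq_neq0; apply/allP => l _; rewrite /= MD h2.
rewrite det_mulmx mulf_eq0 negb_or => /andP[detM _].
have uM : M \in unitmx by rewrite unitmxE unitfE.
pose U : 'cV[F]_k := \col_i u i.
have : M *m U = 0.
  apply/matrixP => l j; rewrite !mxE -[RHS](hu l).
  by apply: eq_bigr => i' _; rewrite !mxE.
move/(congr1 (mulmx (invmx M))); rewrite mulKmx // mulmx0 => /matrixP/(_ i 0).
by rewrite !mxE.
Qed.

Section Speed.
Variable F : numClosedFieldType.
Variable f : {poly {poly F}}.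

Fixpoint speed (b c db x : nat -> F) (i : nat) : F :=
  if i is j.+1 then ((partx f).[(x j)%:P].[b j] * speed b c db x j +
    (party f).[(x j)%:P].[b j] * db j) / (partx f).[(x j.+1)%:P].[c j.+1] else 0.

(** The speed of the final value as a linear form in the speeds [db] of the letters. *)
Definition lam b c n x db : F := endspeed f b db n x (speed b c db x).

Lemma lam_linear b c n x : exists a : 'I_n.+1 -> F,
  forall db, lam b c n x db = \sum_(i < n.+1) a i * db i.
Proof.
have [cf hcf] : exists cf : nat -> nat -> F,
    forall m db, speed b c db x m = \sum_(i < m) cf m i * db i.
  suff /choice[cf hcf] : forall m, exists cf : nat -> F,
      forall db, speed b c db x m = \sum_(i < m) cf i * db i by exists cf.
  elim=> [|m [cf hcf]]; first by exists (fun=> 0) => db; rewrite big_ord0.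
  pose w := (partx f).[(x m.+1)%:P].[c m.+1].
  exists (fun i => (if (i < m)%N then (partx f).[(x m)%:P].[b m] * cf i
    else (party f).[(x m)%:P].[b m]) / w) => db.
  rewrite /= hcf big_ord_recr /= ltnn mulrDl mulr_sumr mulr_suml -/w; congr (_ + _).
    by apply: eq_bigr => i _; rewrite ltn_ord; ring.
  by ring.
exists (fun i => if (i < n)%N then (partx f).[(x n)%:P].[b n] * cf n i
    else (party f).[(x n)%:P].[b n]) => db.
rewrite /lam /endspeed hcf big_ord_recr /= ltnn mulr_sumr; congr (_ + _).
by apply: eq_bigr => i _; rewrite ltn_ord mulrA.
Qed.

Definition rpath b c n (x : nat -> F) : Prop :=
  [/\ chain f b c n x, forall i, (i <= n)%N -> (partx f).[(x i)%:P].[b i] != 0 &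
      forall i, (0 < i <= n)%N -> (partx f).[(x i)%:P].[c i] != 0].

Lemma rpath_lpath b c n x db m : (m <= n)%N -> rpath b c n x ->
  lpath f b c db m x (speed b c db x).
Proof.
move=> mn [h1 h2 h3]; split=> // i im; have lt := leq_trans im mn.
have h4 : (partx f).[(x i.+1)%:P].[c i.+1] != 0 by apply: h3.
by split=> //; [apply: h1|rewrite /= mulrCA mulfV // mulr1].
Qed.

(** When no letter after [m] moves, the final speed is the one at [m] multiplied by nonzero
    quotients of values of $f_x$. *)
Lemma lam_stop b c n x db m : (m <= n)%N -> rpath b c n x ->
  (forall i, (m < i <= n)%N -> db i = 0) -> lam b c n x db = 0 ->
  endspeed f b db m x (speed b c db x) = 0.
Proof.
move=> mn [h1 h2 h3] hdb hn.
move: (leqnn n); rewrite -{1}(subnK mn) addnC => _.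
have H j : (j <= n - m)%N -> endspeed f b db (n - j)%N x (speed b c db x) = 0.
  elim: j => [|j IH] hj; first by rewrite subn0.
  have := IH (ltnW hj).
  have E : (n - j)%N = (n - j.+1).+1 by lia.
  have hi : (0 < n - j <= n)%N by lia.
  have hb := h2 (n - j)%N; have hc := h3 _ hi.
  rewrite {1}/endspeed hdb ?mulr0 ?addr0; last by lia.
  move/eqP; rewrite mulf_eq0 (negPf (hb _)) ?leq_subr //= E /=.
  by rewrite mulf_eq0 invr_eq0 -E (negPf hc) orbF => /eqP.
by have := H (n - m)%N (leqnn _); rewrite subKn.
Qed.

Lemma speed_ext b c db x x' i : (forall j, (j <= i)%N -> x j = x' j) ->
  speed b c db x i = speed b c db x' i.
Proof.
elim: i => [//|i IH] h /=; rewrite IH => [|j ji]; last by apply: h; apply: leqW.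
by rewrite !h.
Qed.

Lemma lam_ext b c n x x' db : (forall j, (j <= n)%N -> x j = x' j) ->
  lam b c n x db = lam b c n x' db.
Proof. by move=> h; apply: endspeed_ext; split=> //; [apply: h|apply: speed_ext]. Qed.

Lemma singular_starts b c n : (forall i, (i <= n)%N -> fiber (partx f) (b i) != 0) ->
  (forall i, (0 < i <= n)%N -> fiber (partx f) (c i) != 0) ->
  exists s : seq F, (size s <= n.+1 * (2 * size f) * size f ^ n)%N /\
    forall x, chain f b c n x -> ~ rpath b c n x -> x 0%N \in s.
Proof.
move=> hb hc.
have sfx a : (size (fiber (partx f) a) <= size f)%N.
  by apply: leq_trans (size_fiber _ _) (leq_trans (size_poly _ _) (leq_pred _)).
have rs a : fiber (partx f) a != 0 -> exists s : seq F, (size s <= size f)%N /\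
    forall x, (partx f).[x%:P].[a] = 0 -> x \in s.
  move=> /nonroot_seq[s [ss hs]]; exists s; split; first exact: leq_trans (ltnW ss) (sfx _).
  by move=> x hx; apply: contrapT => /negP/hs; rewrite horner_fiber hx eqxx.
have per i : exists s : seq F, (size s <= (2 * size f) * size f ^ n)%N /\
    ((i <= n)%N -> forall x, chain f b c n x ->
      (partx f).[(x i)%:P].[b i] = 0 \/ (0 < i)%N /\ (partx f).[(x i)%:P].[c i] = 0 ->
      x 0%N \in s).
  have [le|gt] := leqP i n; last by exists [::]; split.
  have [r1 [sr1 hr1]] := rs _ (hb i le).
  have [r2 [sr2 hr2]] : exists s : seq F, (size s <= size f)%N /\
      forall x, (0 < i)%N -> (partx f).[x%:P].[c i] = 0 -> x \in s.
    have [i0|i0] := posnP i; first by exists [::]; split=> // x; rewrite i0.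
    have [|s [ss hs]] := rs (c i); first by apply: hc; rewrite i0.
    by exists s; split=> // x _; apply: hs.
  have /choice[t ht] : forall y, exists t : seq F, (size t <= size f ^ i)%N /\
      forall x, chain f b c i x -> x i = y -> x 0%N \in t.
    by move=> y; apply: chain_starts => j ji; apply: hb; rewrite (leq_trans (ltnW ji)).
  have f0 : (0 < size f)%N.
    rewrite lt0n size_poly_eq0; apply: contraTneq (hb i le) => ->.
    by rewrite /partx deriv0 /fiber map_poly0 eqxx.
  exists (flatten [seq t y | y <- r1 ++ r2]); split.
    rewrite size_flatten /shape -map_comp sumnE big_map.
    apply: leq_trans (_ : \sum_(z <- r1 ++ r2) size f ^ n <= _)%N.
      apply: leq_sum => l _ /=; have [h _] := ht l; apply: leq_trans h _.
      by rewrite leq_pexp2l.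
    rewrite big_const_seq count_predT iter_addn_0 mulnC leq_mul2r size_cat mul2n -addnn.
    by rewrite leq_add ?orbT.
  move=> _ x hx hz; apply/flattenP; exists (t (x i)).
    apply: map_f; rewrite mem_cat; case: hz => [h|[h1 h2]].
      by rewrite hr1.
    by rewrite hr2 ?orbT.
  have [_] := ht (x i); apply => // j ji; apply: hx; exact: leq_trans ji le.
have /choice[S hS] := per.
exists (flatten [seq S i | i <- iota 0 n.+1]); split.
  rewrite size_flatten /shape -map_comp sumnE big_map -mulnA.
  apply: leq_trans (_ : \sum_(i <- iota 0 n.+1) (2 * size f) * size f ^ n <= _)%N.
    by apply: leq_sum => i _ /=; have [] := hS i.
  by rewrite big_const_seq count_predT iter_addn_0 size_iota mulnC.
move=> x hx nr; apply: contrapT => /negP ns; apply: nr.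
have key i : (i <= n)%N -> ~ ((partx f).[(x i)%:P].[b i] = 0 \/
    (0 < i)%N /\ (partx f).[(x i)%:P].[c i] = 0).
  move=> le h; case/negP: ns; apply/flattenP; exists (S i).
    by apply: map_f; rewrite mem_iota.
  by have [_ hSi] := hS i; apply: (hSi le x hx h).
split=> // i; first by move=> le; apply/eqP => h; apply: (key i le); left.
by move=> /andP[i0 le]; apply/eqP => h; apply: (key i le); right.
Qed.

End Speed.

Section ND.
Variable R : realType.
Local Notation C := R[i].
Variables (f : {poly {poly C}}) (W : C -> C -> Prop).

Definition good_word b c n : Prop :=
  [/\ forall i, (i <= n)%N -> okl f W (b i), forall i, (0 < i <= n)%N -> okl f W (c i) &
      forall i, (0 < i <= n)%N -> good_at f W b c i].

Definition nondegenerate b c n (X : nat -> nat -> C) : Prop :=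
  forall db, (forall l, (l <= n)%N -> lam f b c n (X l) db = 0) ->
    forall i, (i <= n)%N -> db i = 0.

(** The rows of the linear system are secured one path at a time. Some direction [db] is killed by
    the first [l <= n] paths, and by [stop_bounded] a further path gives it zero final speed for
    boundedly many starting points only. The matrix of the forms against these directions is
    triangular with nonzero diagonal. *)
Lemma nd_start n : exists K, forall b c, good_word b c n ->
  exists S : (nat -> C) -> nat -> seq C,
  [/\ forall p l, (l <= n)%N -> (size (S p l) <= K)%N,
      forall p p' l, (forall i, (i < l)%N -> p i = p' i) -> S p l = S p' l &
      forall p, (forall l, (l <= n)%N -> p l \notin S p l) ->
      forall X, (forall l, (l <= n)%N -> chain f b c n (X l) /\ X l 0%N = p l) ->
        (forall l, (l <= n)%N -> rpath f b c n (X l)) /\ nondegenerate b c n X].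
Proof.
have /choice[K0 hK0] := stop_bounded f W.
pose K1 := \max_(m < n.+1) K0 m.
exists ((n.+1 * (2 * size f) * size f ^ n) + (size f ^ n) ^ n * K1)%N => b c [okb okc good].
have hb i : (i <= n)%N -> fiber (partx f) (b i) != 0 by move=> /okb[].
have hc i : (0 < i <= n)%N -> fiber (partx f) (c i) != 0 by move=> /okc[].
have f0 : (0 < size f)%N.
  rewrite lt0n size_poly_eq0; apply: contraTneq (hb 0%N isT) => ->.
  by rewrite /partx deriv0 /fiber map_poly0 eqxx.
have [s0 [ss0 hs0]] := singular_starts hb hc.
have /choice[paths hpaths] : forall y, exists s : seq (seq C), (size s <= size f ^ n)%N /\
    forall x, chain f b c n x -> x 0%N = y -> mkseq x n.+1 \in s.
  by move=> y; apply: chain_seq.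
(* every direction orthogonal to few paths is detected by almost every further path *)
have /choice[dsel hdsel] : forall lt : nat * seq (seq C), exists ds : (nat -> C) * seq C,
    (lt.1 <= n)%N -> [/\ (size ds.2 <= K1)%N,
    forall i, (i < lt.1)%N -> lam f b c n (nth 0 (nth [::] lt.2 i)) ds.1 = 0 &
    forall x, rpath f b c n x -> x 0%N \notin ds.2 -> lam f b c n x ds.1 != 0].
  move=> [l t] /=; have [le|gt] := leqP l n; last by exists (fun=> 0, [::]).
  have /choice[a ha] : forall x, exists a : 'I_n.+1 -> C,
      forall db, lam f b c n x db = \sum_(i < n.+1) a i * db i by move=> x; apply: lam_linear.
  have [d [i0 di0] hd] := exists_orthogonal (fun i : 'I_l => a (nth 0 (nth [::] t i))) le.
  pose db i := if insub i is Some j then d j else 0 : C.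
  have dbE (i : 'I_n.+1) : db i = d i by rewrite /db valK.
  have db0 i : (n < i)%N -> db i = 0 by move=> h; rewrite /db insubF // ltnNge h.
  have ex : exists m, (m <= n)%N && (db m != 0).
    by exists i0; rewrite -ltnS ltn_ord dbE.
  have ub m : (m <= n)%N && (db m != 0) -> (m <= n)%N by case/andP.
  (* The path is cut at the last letter that moves: [stop_bounded] asks for [db m != 0], and
     [lam_stop] carries a zero final speed back to [m]. *)
  case: (ex_maxnP ex ub) => m /andP[mn dm] mmax.
  have [|||s [ss hs]] := hK0 m b c db _ _ _ dm.
  - by move=> i im; apply: hb; apply: leq_trans mn.
  - by have [] := okb 0%N isT.
  - by move=> m0; apply: good; rewrite m0.
  exists (db, s) => _; split=> /=.
  - exact: leq_trans ss (leq_bigmax (Ordinal (mn : (m < n.+1)%N))).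
  - move=> i il; rewrite ha -[RHS](hd (Ordinal il)); apply: eq_bigr => j _.
    by rewrite dbE.
  - move=> x rx xs; apply: contra xs => /eqP h; apply: (hs x (speed f b c db x)).
      exact: rpath_lpath mn rx.
    apply: (lam_stop mn rx _ h) => i /andP[mi ni]; apply/eqP; apply: contraTT mi => di.
    by rewrite -leqNgt; apply: mmax; rewrite ni.
(* All tuples of paths with the given starting points. The exceptional sets may depend on the
   starting points alone, so every path from them has to be taken into account. *)
pose ext (q : nat -> C) := fix T l : seq (seq (seq C)) :=
  if l is l'.+1 then [seq rcons t y | t <- T l', y <- paths (q l')] else [:: [::]].
have ext_size q l : (size (ext q l) <= (size f ^ n) ^ l)%N.
  elim: l => [//|l IH] /=; rewrite size_allpairs expnSr leq_mul //.
  by have [] := hpaths (q l).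
have ext_mem q l X : (forall i, (i < l)%N -> chain f b c n (X i) /\ X i 0%N = q i) ->
    mkseq (fun i => mkseq (X i) n.+1) l \in ext q l.
  elim: l => [|l IH] h; first by rewrite inE.
  rewrite mkseqS /=; apply/allpairsP.
  exists (mkseq (fun i => mkseq (X i) n.+1) l, mkseq (X l) n.+1); split=> //=.
    by apply: IH => i il; apply: h; apply: ltnW.
  by have [h1 h2] := h l (ltnSn l); have [_] := hpaths (q l); apply.
have ext_ext q q' l : (forall i, (i < l)%N -> q i = q' i) -> ext q l = ext q' l.
  elim: l => [//|l IH] h /=; rewrite h // IH // => i il; apply: h; exact: ltnW.
exists (fun p l => s0 ++ flatten [seq (dsel (l, t)).2 | t <- ext p l]); split.
- move=> p l le; rewrite size_cat leq_add // size_flatten /shape -map_comp sumnE big_map.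
  apply: leq_trans (_ : \sum_(t <- ext p l) K1 <= _)%N.
    by apply: leq_sum => t _ /=; have [] := hdsel (l, t) le.
  rewrite big_const_seq count_predT iter_addn_0 mulnC leq_mul2r; apply/orP; right.
  by apply: leq_trans (ext_size p l) _; rewrite leq_pexp2l // expn_gt0 f0.
- by move=> p p' l h; rewrite (ext_ext p p').
move=> p hp X hX.
have rX l : (l <= n)%N -> rpath f b c n (X l).
  move=> le; have [h1 h2] := hX l le; apply: contrapT => nr.
  by have := hp l le; rewrite -h2 mem_cat (hs0 _ h1 nr).
split=> // db hdb.
pose t l := mkseq (fun i => mkseq (X i) n.+1) l.
have tX l i j : (i < l)%N -> (j <= n)%N -> nth 0 (nth [::] (t l) i) j = X i j.
  by move=> il jn; rewrite /t nth_mkseq // nth_mkseq.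
have /choice[a ha] : forall x, exists a : 'I_n.+1 -> C,
    forall db, lam f b c n x db = \sum_(i < n.+1) a i * db i by move=> x; apply: lam_linear.
have tri := @triangular_kernel _ n.+1 (fun l => a (X l)) (fun l i => (dsel (nat_of_ord l, t l)).1 i).
move=> i hi; apply: (tri _ _ (fun j => db j) _ (Ordinal (hi : (i < n.+1)%N))).
- move=> l l' ll'; rewrite -ha.
  have [_ h _] := hdsel (nat_of_ord l', t l') (ltn_ord l').
  rewrite -(h l ll'); apply: lam_ext => j jn; by rewrite tX.
- move=> l; rewrite -ha; have [_ _ h] := hdsel (nat_of_ord l, t l) (ltn_ord l).
  apply: h; first exact: rX (ltn_ord l).
  have [_ e] := hX l (ltn_ord l); rewrite e; have := hp l (ltn_ord l).
  rewrite mem_cat negb_or => /andP[_]; apply: contra => h.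
  apply/flattenP; exists (dsel (nat_of_ord l, t l)).2 => //.
  apply: (map_f (fun t => (dsel (nat_of_ord l, t)).2)); apply: ext_mem => i0 i0l.
  by apply: hX; apply: leq_trans (ltnW i0l) (ltn_ord l).
- by move=> l; rewrite -ha; apply: hdb (ltn_ord l).
Qed.

End ND.

(** * Bounded number of nondegenerate systems of paths with given ends *)

Section Count.
Variable R : realType.
Local Notation C := R[i].
Variables (f : {poly {poly C}}) (n : nat).

Local Notation J := ('I_n.+1 + 'I_n.+1 * 'I_n.+1)%type.
Local Notation I := ('I_3 * 'I_n.+1)%type.

Definition wletter (u : J -> C) i : C := u (inl (inord i)).
Definition wpath (u : J -> C) l i : C := u (inr (inord l, inord i)).
Definition wparam (v : I -> C) (m : 'I_3) i : C := v (m, inord i).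

(** Linearization of the path equations at [u]. The letters $c_i$, the starting points and the final
    levels are parameters; the unknowns are the letters $b_i$ and all points of the paths. *)
Definition linear_kernel (c : nat -> C) (u w : J -> C) : Prop := forall l : 'I_n.+1,
  [/\ wpath w l 0%N = 0,
      forall i : 'I_n,
        (partx f).[(wpath u l i)%:P].[wletter u i] * wpath w l i +
        (party f).[(wpath u l i)%:P].[wletter u i] * wletter w i =
        (partx f).[(wpath u l i.+1)%:P].[c i.+1] * wpath w l i.+1 &
      (partx f).[(wpath u l n)%:P].[wletter u n] * wpath w l n +
      (party f).[(wpath u l n)%:P].[wletter u n] * wletter w n = 0].

Definition word_solution (v : I -> C) (u : J -> C) : Prop :=
  let c := wparam v (inord 0) in
  (forall l : 'I_n.+1,
    [/\ wpath u l 0%N = wparam v (inord 1) l,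
      forall i : 'I_n, f.[(wpath u l i)%:P].[wletter u i] =
        f.[(wpath u l i.+1)%:P].[c i.+1] &
      f.[(wpath u l n)%:P].[wletter u n] = wparam v (inord 2) l]) /\
  (forall w, linear_kernel c u w -> forall j, w j = 0).

Lemma word_solution_definable :
  definable (fun z : I + J -> C => word_solution (z \o inl) (z \o inr)).
Proof.
have pfz K (g : {poly {poly C}}) (p q : (K -> C) -> C) (hp : polyfun p) (hq : polyfun q) :=
  polyfun_horner2 g hp hq.
have xz (l i : nat) : polyfun (fun z : I + J -> C => wpath (z \o inr) l i).
  by exact: (PFvar C (inr (inr (inord l, inord i)))).
have bz (i : nat) : polyfun (fun z : I + J -> C => wletter (z \o inr) i).
  by exact: (PFvar C (inr (inl (inord i)))).
have vz m (i : nat) : polyfun (fun z : I + J -> C => wparam (z \o inl) m i).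
  by exact: (PFvar C (inl (m, inord i))).
pose y1 (y : (I + J) + J -> C) : J -> C := y \o inl \o inr.
have xy (l i : nat) : polyfun (fun y => wpath (y1 y) l i).
  by exact: (PFvar C (inl (inr (inr (inord l, inord i))))).
have by_ (i : nat) : polyfun (fun y => wletter (y1 y) i).
  by exact: (PFvar C (inl (inr (inl (inord i))))).
have wy (l i : nat) : polyfun (fun y : (I + J) + J -> C => wpath (y \o inr) l i).
  by exact: (PFvar C (inr (inr (inord l, inord i)))).
have dy (i : nat) : polyfun (fun y : (I + J) + J -> C => wletter (y \o inr) i).
  by exact: (PFvar C (inr (inl (inord i)))).
have vy m (i : nat) : polyfun (fun y : (I + J) + J -> C => wparam (y \o inl \o inl) m i).
  by exact: (PFvar C (inl (inl (m, inord i)))).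
have and3 K (P Q S : (K -> C) -> Prop) : definable P -> definable Q -> definable S ->
    definable (fun v => [/\ P v, Q v & S v]).
  move=> hP hQ hS; apply: definable_ext (DFand hP (DFand hQ hS)) _ => v.
  by split=> [[? [? ?]]|[? ? ?]].
apply: DFand.
  apply: definable_alln => l.
  apply: (and3 _ (fun z : I + J -> C => wpath (z \o inr) l 0%N = wparam (z \o inl) (inord 1) l)
    (fun z => forall i : 'I_n, f.[(wpath (z \o inr) l i)%:P].[wletter (z \o inr) i] =
      f.[(wpath (z \o inr) l i.+1)%:P].[wparam (z \o inl) (inord 0) i.+1])
    (fun z => f.[(wpath (z \o inr) l n)%:P].[wletter (z \o inr) n] =
      wparam (z \o inl) (inord 2) l)).
  - exact: (definable_eq (xz l 0%N) (vz _ l)).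
  - by apply: definable_alln => i; exact: (definable_eq (pfz _ f _ _ (xz l i) (bz i)) (pfz _ f _ _ (xz l i.+1) (vz _ i.+1))).
  - exact: (definable_eq (pfz _ f _ _ (xz l n) (bz n)) (vz _ l)).
apply: (definable_ext (P := fun z : I + J -> C => forall w : J -> C,
    (fun y : (I + J) + J -> C => linear_kernel (wparam (y \o inl \o inl) (inord 0))
       (y \o inl \o inr) (y \o inr) -> forall j, y (inr j) = 0) (scons z w))) => [|z].
  apply: (definable_alls (P := fun y : (I + J) + J -> C =>
     linear_kernel (wparam (y \o inl \o inl) (inord 0)) (y \o inl \o inr) (y \o inr) ->
     forall j, y (inr j) = 0)).
  apply: definable_imp.
    apply: definable_alln => l.
    apply: (and3 _ (fun y : (I + J) + J -> C => wpath (y \o inr) l 0%N = 0)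
      (fun y => forall i : 'I_n,
        (partx f).[(wpath (y \o inl \o inr) l i)%:P].[wletter (y \o inl \o inr) i] *
          wpath (y \o inr) l i +
        (party f).[(wpath (y \o inl \o inr) l i)%:P].[wletter (y \o inl \o inr) i] *
          wletter (y \o inr) i =
        (partx f).[(wpath (y \o inl \o inr) l i.+1)%:P].[wparam (y \o inl \o inl) (inord 0) i.+1] *
          wpath (y \o inr) l i.+1)
      (fun y => (partx f).[(wpath (y \o inl \o inr) l n)%:P].[wletter (y \o inl \o inr) n] *
          wpath (y \o inr) l n +
        (party f).[(wpath (y \o inl \o inr) l n)%:P].[wletter (y \o inl \o inr) n] *
          wletter (y \o inr) n = 0)).
    - exact: (DFeq0 (wy l 0%N)).
    - apply: definable_alln => i.
      exact: (definable_eq (PFadd (PFmul (pfz _ (partx f) _ _ (xy l i) (by_ i)) (wy l i))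
         (PFmul (pfz _ (party f) _ _ (xy l i) (by_ i)) (dy i)))
         (PFmul (pfz _ (partx f) _ _ (xy l i.+1) (vy _ i.+1)) (wy l i.+1))).
    - exact: (DFeq0 (PFadd (PFmul (pfz _ (partx f) _ _ (xy l n) (by_ n)) (wy l n))
         (PFmul (pfz _ (party f) _ _ (xy l n) (by_ n)) (dy n)))).
  by apply: definable_alln => j; exact: (DFeq0 (PFvar C (inr j))).
by [].
Qed.

Lemma sum_delta (K : finType) (i : K) (a : C) (u : K -> C) :
  \sum_j a * (j == i)%:R * u j = a * u i.
Proof.
rewrite (bigD1 i) //= eqxx mulr1 big1 ?addr0 // => j /negPf ->.
by rewrite mulr0 mul0r.
Qed.

(** Triviality of the linear kernel is part of [word_solution], so all its solutions are isolated
    and [isolated_bounded] applies uniformly in the parameters. *)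
Lemma nd_count : exists K, forall v : I -> C,
  forall (T : finType) (g : T -> J -> C), injective g ->
    (forall t, word_solution v (g t)) -> (#|T| <= K)%N.
Proof.
have [K hK] := isolated_bounded word_solution_definable.
exists K => v T g ginj hg.
apply: (hK v _ T g ginj) => [u [sol ker]|t]; last exact: hg.
set P := fun z : I + J -> C => word_solution (z \o inl) (z \o inr).
pose c := wparam v (inord 0).
pose xi (l i : nat) : J := inr (inord l, inord i).
pose bi (i : nat) : J := inl (inord i).
pose E (e : 'I_n.+1 * ('I_n + bool)) (u : J -> C) : C :=
  match e.2 with
  | inl i => f.[(u (xi e.1 i))%:P].[u (bi i)] + (-1) * f.[(u (xi e.1 i.+1))%:P].[c i.+1]
  | inr true => u (xi e.1 0%N) + - wparam v (inord 1) e.1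
  | inr false => f.[(u (xi e.1 n))%:P].[u (bi n)] + - wparam v (inord 2) e.1
  end.
pose L (e : 'I_n.+1 * ('I_n + bool)) (j : J) : C :=
  match e.2 with
  | inl i => ((partx f).[(u (xi e.1 i))%:P].[u (bi i)] * (j == xi e.1 i)%:R +
              (party f).[(u (xi e.1 i))%:P].[u (bi i)] * (j == bi i)%:R) +
             (0 * f.[(u (xi e.1 i.+1))%:P].[c i.+1] + (-1) *
              ((partx f).[(u (xi e.1 i.+1))%:P].[c i.+1] * (j == xi e.1 i.+1)%:R +
               (party f).[(u (xi e.1 i.+1))%:P].[c i.+1] * 0))
  | inr true => (j == xi e.1 0%N)%:R + 0
  | inr false => ((partx f).[(u (xi e.1 n))%:P].[u (bi n)] * (j == xi e.1 n)%:R +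
              (party f).[(u (xi e.1 n))%:P].[u (bi n)] * (j == bi n)%:R) + 0
  end.
have Ez w : (forall l : 'I_n.+1,
    [/\ wpath w l 0%N = wparam v (inord 1) l,
      forall i : 'I_n, f.[(wpath w l i)%:P].[wletter w i] =
        f.[(wpath w l i.+1)%:P].[c i.+1] &
      f.[(wpath w l n)%:P].[wletter w n] = wparam v (inord 2) l]) -> forall e, E e w = 0.
  move=> h [l [i|[]]]; have [h1 h2 h3] := h l; rewrite /E /=.
  - by have := h2 i; rewrite /wpath /wletter => ->; rewrite mulN1r subrr.
  - by rewrite -h1 subrr.
  - by rewrite -h3 subrr.
apply: (diffat_isolated (E := E) (l := L)).
- by move=> w' [h _]; apply: Ez.
- exact: Ez.
- move=> [l [i|[]]]; rewrite /E /L /=.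
  + apply: diffat_add; first by apply: diffat_horner2; apply: diffat_var.
    apply: diffat_mul; first exact: diffat_const.
    by apply: diffat_horner2; [apply: diffat_var|apply: diffat_const].
  + by apply: diffat_add; [apply: diffat_var|apply: diffat_const].
  + apply: diffat_add; last exact: diffat_const.
    by apply: diffat_horner2; apply: diffat_var.
move=> w hw; apply: ker => l; split.
- have := hw (l, inr true); rewrite /L /=.
  under eq_bigr do rewrite addr0 -[(_ == _)%:R]mul1r.
  by rewrite sum_delta mul1r.
- move=> i; have := hw (l, inl i); rewrite /L /=.
  under eq_bigr do rewrite mul0r mulr0 add0r addr0 !mulrDl -mulrA -mulrA.
  rewrite !big_split /= => h; apply/eqP; rewrite -subr_eq0 -mulN1r; apply/eqP.
  rewrite -[RHS]h; congr (_ + _ + _).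
  + by under [RHS]eq_bigr do rewrite mulrA; rewrite sum_delta.
  + by under [RHS]eq_bigr do rewrite mulrA; rewrite sum_delta.
  + by under [RHS]eq_bigr do rewrite mulrA; rewrite sum_delta mulrA.
- have := hw (l, inr false); rewrite /L /=.
  under eq_bigr do rewrite addr0 !mulrDl.
  by rewrite big_split /= !sum_delta.
Qed.

Definition encode (b : nat -> C) (X : nat -> nat -> C) (j : J) : C :=
  match j with inl i => b i | inr (l, i) => X l i end.

Lemma encode_solution (b c : nat -> C) (X : nat -> nat -> C) (p z : nat -> C) :
  (forall l, (l <= n)%N -> [/\ rpath f b c n (X l), X l 0%N = p l &
     f.[(X l n)%:P].[b n] = z l]) ->
  nondegenerate f b c n X ->
  word_solution (fun mi : I => match val mi.1 with 0%N => c mi.2 | 1%N => p mi.2 | _ => z mi.2 end)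
    (encode b X).
Proof.
move=> hX nd; have le1 (i : 'I_n) : (i <= n)%N := ltnW (ltn_ord i).
have lel (l : 'I_n.+1) : (l <= n)%N := ltn_ord l.
have eb i : (i <= n)%N -> wletter (encode b X) i = b i by move=> h; rewrite /wletter /= inordK.
have ex l i : (l <= n)%N -> (i <= n)%N -> wpath (encode b X) l i = X l i.
  by move=> h1 h2; rewrite /wpath /= !inordK.
split=> [l|w hw].
  have [[h1 h2 h3] h4 h5] := hX l (lel l); split.
  - by rewrite ex // h4 /wparam /= !inordK.
  - by move=> i; rewrite !ex ?eb // h1 // /wparam /= !inordK // ltnS.
  - by rewrite ex // eb // h5 /wparam /= !inordK.
have ec i : (i <= n)%N -> wparam (fun mi : I => match val mi.1 with 0%N => c mi.2
    | 1%N => p mi.2 | _ => z mi.2 end) (inord 0) i = c i.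
  by move=> h; rewrite /wparam /= !inordK.
pose db i := wletter w i.
have sp l i : (l <= n)%N -> (i <= n)%N -> wpath w l i = speed f b c db (X l) i.
  move=> le; have [[h1 h2 h3] h4 h5] := hX l le.
  have [w1 w2 _] := hw (Ordinal (le : (l < n.+1)%N)).
  elim: i => [_|i IH hi]; first exact: w1.
  have hc : (partx f).[(X l i.+1)%:P].[c i.+1] != 0 by apply: h3.
  have /= := w2 (Ordinal hi); rewrite !ex ?(ltnW hi) // !eb ?(ltnW hi) // ec // => e.
  by apply: (mulfI hc); rewrite -e IH ?(ltnW hi) // mulrCA mulfV // mulr1.
have db0 : forall i, (i <= n)%N -> db i = 0.
  apply: nd => l le; have [_ _ w3] := hw (Ordinal (le : (l < n.+1)%N)).
  by rewrite /lam /endspeed -(sp l n le (leqnn n)) -w3 /= ex // eb.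
have spz l i : (i <= n)%N -> speed f b c db (X l) i = 0.
  elim: i => [//|i IH] hi /=; rewrite IH ?(ltnW hi) // db0 ?(ltnW hi) //.
  by rewrite !mulr0 addr0 mul0r.
case=> [i|[l i]].
  by have := db0 i (lel i); rewrite /db /wletter inord_val.
have := sp l i (lel l) (lel i); rewrite spz ?lel // /wpath !inord_val; exact.
Qed.

End Count.

(** * Walks *)

Section Counting.
Local Open Scope nat_scope.

Lemma leq_card_fibers (S T : finType) (A : {set S}) (h : S -> T) k :
  (forall y, #|[set x in A | h x == y]| <= k) -> #|A| <= #|T| * k.
Proof.
move=> hk; rewrite -sum1_card (partition_big h xpredT) //=.
rewrite -sum_nat_const; apply: leq_sum => y _; apply: leq_trans (hk y).
by rewrite -sum1_card; apply/eq_leq/eq_bigl => x; rewrite inE.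
Qed.

Definition fupd (J T : finType) (w : {ffun J -> T}) j t : {ffun J -> T} :=
  [ffun i => if i == j then t else w i].

(** Pair a word violated at [j] with a spare letter. Exchanging the spare letter with the one at [j]
    is an involution, and turns the count into a choice of the letter at [j] for a given rest. *)
Lemma card_bad_words (J T : finType) (P : J -> pred {ffun J -> T}) k :
  (forall j w, #|[set t | P j (fupd w j t)]| <= k) ->
  #|[set w | [exists j, P j w]]| * #|T| <= #|J| * k * #|T| ^ #|J|.
Proof.
move=> hk.
have hj j : #|[set w | P j w]| * #|T| <= k * #|T| ^ #|J|.
  pose Q := [set p : {ffun J -> T} * T | P j (fupd p.1 j p.2)].
  have -> : #|[set w | P j w]| * #|T| = #|Q|.
    rewrite -cardsT -cardsX.
    pose g (p : {ffun J -> T} * T) := (fupd p.1 j p.2, p.1 j).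
    have gK : involutive g.
      move=> [w t]; rewrite /g /= ffunE eqxx; congr (_, _).
      by apply/ffunP => i; rewrite !ffunE; case: eqP => [->|].
    rewrite -(card_imset _ (inv_inj gK)); apply: eq_card => p.
    apply/imsetP/idP => [[q hq ->]|hp].
      have /(congr1 fst) /= e := gK q.
      by rewrite inE e; move: hq; rewrite !inE andbT.
    by exists (g p); rewrite ?gK // !inE andbT; move: hp; rewrite inE.
  apply: (@leq_trans (#|{ffun J -> T}| * k)); last by rewrite card_ffun mulnC.
  apply: (leq_card_fibers (h := fst)) => w; apply: leq_trans (hk j w).
  have wi : injective (pair w : T -> {ffun J -> T} * T) by move=> ? ? [].
  rewrite -(card_imset _ wi).
  apply: subset_leq_card; apply/subsetP => -[w' t]; rewrite !inE /= => /andP[h /eqP e].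
  by apply/imsetP; exists t; rewrite ?inE // -?e.
apply: (@leq_trans (\sum_j #|[set w | P j w]| * #|T|)); last first.
  apply: (@leq_trans (\sum_(j : J) k * #|T| ^ #|J|)); first exact: leq_sum.
  by rewrite sum_nat_const mulnA.
rewrite -big_distrl leq_mul2r; apply/orP; right.
have -> : [set w | [exists j, P j w]] = \bigcup_j [set w | P j w].
  apply/setP => w; rewrite inE; apply/existsP/bigcupP => [[j h]|[j _]].
    by exists j; rewrite ?inE.
  by rewrite inE => h; exists j.
elim/big_ind2: _ => [|m A m' B h h'|j _]; rewrite ?cards0 //.
by apply: leq_trans (leq_card_setU _ _) (leq_add h h').
Qed.

Lemma card_path_ge (T : finType) (S : {set T}) (r : rel T) d n :
  (forall x, x \in S -> d <= #|[set y in S | r x y]|) ->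
  forall x, x \in S -> d ^ n <= #|[set t : n.-tuple T | path r x t]|.
Proof.
move=> hd; elim: n => [|n IH] x xS.
  by rewrite expn0; apply/card_gt0P; exists [tuple]; rewrite inE.
pose g (p : T * n.-tuple T) : n.+1.-tuple T := [tuple of p.1 :: p.2].
have gi : injective g.
  move=> [a s] [b s'] /(congr1 val) /= [-> e]; congr (_, _); exact: val_inj.
apply: (@leq_trans #|[set p : T * n.-tuple T | [&& p.1 \in S, r x p.1 & path r p.1 p.2]]|);
  last first.
  rewrite -(card_imset _ gi); apply: subset_leq_card; apply/subsetP => _ /imsetP[p hp ->].
  by move: hp; rewrite !inE /= => /andP[_].
rewrite -sum1_card (eq_bigl (fun p : T * n.-tuple T => (p.1 \in [set y in S | r x y]) &&
  (p.2 \in [set t : n.-tuple T | path r p.1 t]))); last first.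
  by move=> p; rewrite !inE andbA.
rewrite -(pair_big_dep (fun y => y \in [set y in S | r x y])
   (fun y t => t \in [set t : n.-tuple T | path r y t]) (fun _ _ => 1)) /=.
apply: (@leq_trans (\sum_(y in [set y in S | r x y]) d ^ n)).
  by rewrite sum_nat_const expnS leq_mul2r hd ?orbT.
apply: leq_sum => y; rewrite inE => /andP[yS _]; rewrite sum1_card; exact: IH.
Qed.

(* The pruned pair of vertex sets maximises edges minus weighted vertices. *)
Lemma prune_graph (E D ZT : finType) (Z : {set ZT}) (src : ZT -> E) (dst : ZT -> D) beta L :
  0 < L -> #|D| <= L * #|E| -> (forall e, #|[set z in Z | src z == e]| <= beta) ->
  #|E| * beta <= 2 * #|Z| ->
  exists (E' : {set E}) (D' : {set D}),
  let Z' := [set z in Z | (src z \in E') && (dst z \in D')] in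
  [/\ forall e, e \in E' -> beta <= 8 * #|[set z in Z' | src z == e]|,
      forall d, d \in D' -> beta <= 8 * L * #|[set z in Z' | dst z == d]| &
      #|E| * beta <= 4 * #|E'| * beta].
Proof.
move=> L0 hD hdeg hZ.
pose ZZ (p : {set E} * {set D}) := [set z in Z | (src z \in p.1) && (dst z \in p.2)].
pose Phi p : int := ((8 * L * #|ZZ p|)%:Z - (L * beta * #|p.1| + beta * #|p.2|)%:Z)%R.
case: (@Order.TotalTheory.arg_maxP _ _ _ ([set: E], [set: D]) xpredT Phi isT) => -[E' D'] _ hmax.
exists E', D' => Z'.
have leZ (p q : {set E} * {set D}) : (Phi q <= Phi p)%R ->
  8 * L * #|ZZ q| + (L * beta * #|p.1| + beta * #|p.2|) <=
  8 * L * #|ZZ p| + (L * beta * #|q.1| + beta * #|q.2|).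
  by rewrite /Phi; lia.
split.
- move=> e eE; have := leZ _ _ (hmax (E' :\ e, D') isT); rewrite /= (cardsD1 e E') eE.
  have -> : #|ZZ (E', D')| = #|ZZ (E' :\ e, D')| + #|[set z in Z' | src z == e]|.
    rewrite -(cardsID [set z | src z == e] (ZZ (E', D'))) addnC; congr (_ + _).
      by apply: eq_card => z; rewrite !inE /=;
        case: (z \in Z); case: (src z \in E'); case: (dst z \in D'); case: (src z == e).
    by apply: eq_card => z; rewrite !inE /=;
      case: (z \in Z); case: (src z \in E'); case: (dst z \in D'); case: (src z == e).
  move: #|ZZ _| #|E' :\ e| #|D'| #|[set z in Z' | src z == e]| => u v x y h.
  have {h} : L * beta <= L * (8 * y) by nia.
  by rewrite leq_pmul2l.
- move=> d dD; have := leZ _ _ (hmax (E', D' :\ d) isT); rewrite /= (cardsD1 d D') dD.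
  have -> : #|ZZ (E', D')| = #|ZZ (E', D' :\ d)| + #|[set z in Z' | dst z == d]|.
    rewrite -(cardsID [set z | dst z == d] (ZZ (E', D'))) addnC; congr (_ + _).
      by apply: eq_card => z; rewrite !inE /=;
      case: (z \in Z); case: (src z \in E'); case: (dst z \in D'); case: (dst z == d).
    by apply: eq_card => z; rewrite !inE /=;
      case: (z \in Z); case: (src z \in E'); case: (dst z \in D'); case: (dst z == d).
  by move: #|ZZ _| #|D' :\ d| #|E'| #|[set z in Z' | dst z == d]| => u v x y h; nia.
have h1 : #|Z'| <= #|E'| * beta.
  rewrite -sum1_card (partition_big src (mem E')) /=; last by move=> z; rewrite inE => /and3P[].
  rewrite -sum_nat_const; apply: leq_sum => e _; apply: leq_trans (hdeg e).
  rewrite -sum1_card [X in _ <= X](bigID (fun z => z \in Z')) /=.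
  apply: leq_trans (leq_addr _ _); apply/eq_leq/eq_bigl => z; rewrite !inE.
  by case: (z \in Z); case: (src z \in E'); case: (dst z \in D'); case: (src z == e).
have := leZ _ _ (hmax ([set: E], [set: D]) isT); rewrite /= !cardsT.
have -> : #|ZZ ([set: E], [set: D])| = #|Z|.
  by apply: eq_card => z; rewrite !inE !andbT.
change (ZZ (E', D')) with Z'.
move: #|Z'| #|E'| #|D'| #|E| #|D| #|Z| h1 hD hZ => z e d E0 D0 Z0 h1 hD hZ h.
have h2 : beta * D0 <= L * (E0 * beta) by nia.
have h3 : L * (E0 * beta) <= L * (2 * Z0) by rewrite leq_mul2l hZ orbT.
have h4 : L * z <= L * (e * beta) by rewrite leq_mul2l h1 orbT.
have : L * (E0 * beta) <= L * (4 * e * beta) by nia.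
by rewrite leq_pmul2l.
Qed.

Section Walks.
Variables (E T D : finType) (F : E -> T -> D) (Z : {set E * T}).

(* A step [(e, c, b)] of a walk enters its point [e] by [c] and leaves it by [b]. *)
Definition wstep (y y' : E * T * T) := [&& (y'.1.1, y'.2) \in Z, (y'.1.1, y'.1.2) \in Z &
  F y.1.1 y.2 == F y'.1.1 y'.1.2].

Definition walks n := [set p : (E * T * T) * n.-tuple (E * T * T) |
  ((p.1.1.1, p.1.2) \in Z) && path wstep p.1 p.2].

(** After pruning each remaining vertex keeps a definite share of its degree, so every step of a
    walk has at least $|T|^2/(64L)$ continuations and these numbers multiply. *)
Lemma walks_ge L n : 0 < L -> #|D| <= L * #|E| -> #|E| * #|T| <= 2 * #|Z| ->
  #|E| * #|T| ^ (n.+1).*2 <= 32 * (64 * L) ^ n * #|walks n|.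
Proof.
move=> L0 hD hZ.
have hdeg e : #|[set z in Z | z.1 == e]| <= #|T|.
  have -> : #|T| = #|setX [set e] [set: T]| by rewrite cardsX cards1 cardsT mul1n.
  apply: subset_leq_card.
  by apply/subsetP => -[a b]; rewrite !inE /= andbT => /andP[].
have [E' [D' /= [hE' hD' hEE]]] := prune_graph (fun z : E * T => F z.1 z.2) L0 hD hdeg hZ.
set Z' := [set z in Z | _] in hE' hD'.
pose S := [set y : E * T * T | (y.1.1, y.2) \in Z'].
have hsucc x : x \in S -> #|T| ^ 2 <= 64 * L * #|[set y in S | wstep x y]|.
  case: x => [[e c] b]; rewrite !inE /= => /and3P[_ _ dD].
  set s := #|[set y in S | _]|.
  suff: #|[set z in Z' | F z.1 z.2 == F e b]| * #|T| <= 8 * s.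
    have /= := hD' _ dD; rewrite -mulnn.
    move: #|[set z in Z' | _]| #|T| (s) L0 => u v w _ h1 h2.
    have : 8 * L * (u * v) <= 8 * L * (8 * w) by rewrite leq_mul2l h2 orbT.
    have : v * v <= 8 * L * u * v by rewrite leq_mul2r h1 orbT.
    rewrite -mulnA; lia.
  have -> : s = \sum_(z in [set z in Z' | F z.1 z.2 == F e b]) #|[set z' in Z' | z'.1 == z.1]|.
    rewrite /s -sum1_card (partition_big (fun y => (y.1.1, y.1.2))
      (mem [set z in Z' | F z.1 z.2 == F e b])) /=; last first.
      move=> [[e' c'] b']; rewrite !inE /= => /andP[/and3P[_ h1 _] /and3P[/= _ -> /eqP <-]].
      by rewrite eqxx andbT h1 dD.
    apply: eq_bigr => -[e' c'] /=; rewrite !inE /= => /andP[/and3P[h1 h2 h3] /eqP h4].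
    rewrite -sum1_card (reindex_onto (fun z : E * T => (z.1, c', z.2))
       (fun y => (y.1.1, y.2))) /=; last first.
      by move=> [[u v] w] /andP[_ /eqP /= [-> ->]].
    apply: eq_bigl => -[u v]; rewrite !inE /= /wstep /= xpair_eqE !eqxx andbT.
    case: (u =P e') => [->|]; rewrite ?andbF // h1 h4 eqxx !andbT /=.
    by case: ((e', v) \in Z); rewrite ?andbF ?andbT.
  rewrite big_distrr /= -sum_nat_const; apply: leq_sum => z.
  by rewrite !inE => /andP[/and3P[_ h _] _]; apply: hE'.
have [s0|Spos] := set_0Vmem S.
  have e0 e : e \in E' -> #|T| = 0.
    move=> /hE' h; have h0 : #|[set z in Z' | z.1 == e]| = 0.
      apply: eq_card0 => -[u v]; apply/negP; rewrite inE => /andP[h1 _].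
      have : (u, v, v) \in S by rewrite /S in_set.
      by rewrite s0 in_set0.
    by apply/eqP; move: h; rewrite h0 muln0 leqn0.
  have [e1|[e /e0 ->]] := set_0Vmem E'; last by rewrite exp0n ?muln0.
  by move: hEE; rewrite e1 cards0 muln0 mul0n leqn0 muln_eq0 => /orP[] /eqP ->;
    rewrite ?mul0n // exp0n ?muln0.
have hex : exists d, #|T| ^ 2 <= 64 * L * d.
  by case: Spos => x xS; pose v := #|[set y in S | wstep x y]|; exists v; apply: hsucc.
have [d d1 dmin] := ex_minnP hex.
have hpath := card_path_ge n (fun x xS => dmin _ (hsucc x xS)).
have hS : #|E| * #|T| ^ 2 <= 32 * #|S|.
  have -> : #|S| = #|T| * #|Z'|.
    rewrite -cardsT -cardsX.
    pose g (z : T * (E * T)) := (z.2.1, z.1, z.2.2).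
    have gi : injective g by move=> [? [? ?]] [? [? ?]] [-> -> ->].
    rewrite -(card_imset _ gi); apply: eq_card => -[[e c] b].
    apply/idP/imsetP => [|[[u [v w]]]].
      by rewrite inE /= => h; exists (c, (e, b)); rewrite // in_setX inE.
    by rewrite in_setX inE /g => /= h [-> -> ->]; rewrite inE.
  have : #|E'| * #|T| <= 8 * #|Z'|.
    rewrite -[in X in _ <= X]sum1_card (partition_big fst (mem E')) /=; last first.
      by move=> z; rewrite inE => /and3P[].
    rewrite big_distrr /= -sum_nat_const; apply: leq_sum => e /hE' h.
    apply: leq_trans h _; rewrite leq_mul2l /= -sum1_card.
    by apply/eq_leq/eq_bigl => z; rewrite in_set.
  move: hEE; move: #|E| #|T| #|Z'| #|E'|; clear => e t z e'.
  rewrite -mulnn => h1 h2.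
  have : e * t * t <= 4 * e' * t * t by rewrite leq_mul2r h1 orbT.
  have : t * (e' * t) <= t * (8 * z) by rewrite leq_mul2l h2 orbT.
  nia.
have hw : #|S| * d ^ n <= #|walks n|.
  rewrite -[in X in _ <= X]sum1_card.
  apply: (@leq_trans (\sum_(x in S) \sum_(t | t \in [set t : n.-tuple _ | path wstep x t]) 1)).
    rewrite -sum_nat_const; apply: leq_sum => x xS; rewrite sum1_card; exact: hpath.
  rewrite pair_big_dep /= [X in _ <= X](bigID (fun p : _ * n.-tuple _ => p.1 \in S)) /=.
  apply: leq_trans (leq_addr _ _); apply/eq_leq/eq_bigl => -[x t]; rewrite !inE /=.
  by case: (_ \in Z) => //=; rewrite andbC.
rewrite -mul2n expnM expnS mulnA.
apply: (@leq_trans (32 * #|S| * (64 * L * d) ^ n)).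
  apply: leq_mul; first exact: hS.
  by elim: (n) => // k IH; rewrite !(expnS _ k); apply: leq_mul.
rewrite expnMn -!mulnA leq_mul2l /= mulnCA leq_mul2l; apply/orP; right.
exact: hw.
Qed.
End Walks.

End Counting.

Lemma card_le_seq (T : finType) (V : eqType) (g : T -> V) (A : {set T}) (s : seq V) :
  injective g -> (forall t, t \in A -> g t \in s) -> (#|A| <= size s)%N.
Proof.
move=> gi h; rewrite cardE -(size_map g); apply: uniq_leq_size.
  by rewrite map_inj_uniq // enum_uniq.
by move=> y /mapP[t]; rewrite mem_enum => tA ->; apply: h.
Qed.

Lemma leq_card_fibers_in (S T : finType) (A : {set S}) (Q : {set T}) (h : S -> T) k :
  (forall x, x \in A -> h x \in Q) ->
  (forall y, (#|[set x in A | h x == y]| <= k)%N) -> (#|A| <= #|Q| * k)%N.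
Proof.
move=> hQ hk; rewrite -sum1_card (partition_big h (mem Q)) //=.
rewrite -sum_nat_const; apply: leq_sum => y _; apply: leq_trans (hk y).
by rewrite -sum1_card; apply/eq_leq/eq_bigl => x; rewrite inE.
Qed.

Lemma mul_bound1 a e b s t k p :
  (a <= e * b * s -> b * t <= k * p -> a * t <= k * s * (e * p))%N.
Proof.
move=> h1 h2; apply: (@leq_trans (e * b * s * t)); first by rewrite leq_mul2r h1 orbT.
have -> : (e * b * s * t = e * s * (b * t))%N by ring.
have -> : (k * s * (e * p) = e * s * (k * p))%N by ring.
by rewrite leq_mul2l h2 orbT.
Qed.

Lemma mul_bound2 a b s m q e p :
  (b * m <= q * e * p -> a <= b * s -> a * m <= q * s * (e * p))%N.
Proof.
move=> h1 h2; apply: (@leq_trans (b * s * m)); first by rewrite leq_mul2r h2 orbT.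
have -> : (b * s * m = s * (b * m))%N by ring.
have -> : (q * s * (e * p) = s * (q * e * p))%N by ring.
by rewrite leq_mul2l h1 orbT.
Qed.

Section WalkBound.
Variable R : realType.
Local Notation C := R[i].
Variable f : {poly {poly C}}.
Variables (W : C -> C -> Prop) (N Nc : nat).
Hypothesis W2 : forall c x, W c x -> [/\ (partx f).[x%:P].[c] = 0,
  (party f).[x%:P].[c] != 0 & fiber (partx f) c != 0].
Hypothesis W3 : forall c x, W c x -> exists s : seq C, (size s <= N)%N /\
  forall b, b \notin s -> ~ descends f b c x.
Hypothesis W4 : forall w, exists s : seq C, (size s <= Nc)%N /\
  forall c x, f.[x%:P].[c] = w -> (partx f).[x%:P].[c] = 0 ->
    (party f).[x%:P].[c] != 0 -> fiber (partx f) c != 0 -> c \in s.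
Variable n : nat.

Section Letters.
Variables (T : finType) (lt : T -> C).
Definition bword (w : {ffun 'I_n.+1 * bool -> T}) i := lt (w (inord i, true)).
Definition cword (w : {ffun 'I_n.+1 * bool -> T}) i := lt (w (inord i, false)).
End Letters.

Lemma pre_good_ext b c b' c' m : (forall i, (i <= m)%N -> b i = b' i) ->
  (forall i, (i <= m)%N -> c i = c' i) -> pre_good f W b c m -> pre_good f W b' c' m.
Proof.
move=> hb hc [x [h1 h2]]; exists x; rewrite -hc //; split=> //.
by apply: regular_level_ext h2 => i im; [apply: hb|apply: hc]; apply: ltnW.
Qed.

Lemma good_at_ext b c b' c' m : (forall i, (i <= m)%N -> b i = b' i) ->
  (forall i, (i <= m)%N -> c i = c' i) -> good_at f W b c m -> good_at f W b' c' m.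
Proof.
move=> hb hc [x [h1 h2 h3]]; exists x; rewrite -hc // -hb //; split=> //.
by apply: regular_level_ext h2 => i im; [apply: hb|apply: hc]; apply: ltnW.
Qed.

Lemma bad_words_bound : exists k, forall (T : finType) (lt : T -> C), injective lt ->
  (forall t, okl f W (lt t)) ->
  (#|[set w | ~~ `[< good_word f W (bword lt w) (cword lt w) n >]]| * #|T| <=
    k * #|T| ^ (n.+1).*2)%N.
Proof.
have [Kp hKp] := choice (fun i => pre_good_bad W2 W4 i).
pose k0 := (N + \max_(i < n.+1) Kp i)%N.
exists (#|{: 'I_n.+1 * bool}| * k0)%N => T lt lti ok.
have ob a : fiber (partx f) (lt a) != 0 by case: (ok a).
pose P (j : 'I_n.+1 * bool) : pred {ffun 'I_n.+1 * bool -> T} := fun w =>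
  (0 < j.1)%N && (if j.2 then `[< pre_good f W (bword lt w) (cword lt w) j.1 >] &&
    ~~ `[< good_at f W (bword lt w) (cword lt w) j.1 >]
  else ~~ `[< pre_good f W (bword lt w) (cword lt w) j.1 >]).
have sub : [set w | ~~ `[< good_word f W (bword lt w) (cword lt w) n >]] \subset
    [set w | [exists j, P j w]].
  apply/subsetP => w; rewrite !inE => /asboolPn h; apply: contrapT => /negP h'.
  apply: h; split=> [i _|i _|i hi]; rewrite ?/bword ?/cword //.
  have hi' : (i < n.+1)%N by rewrite ltnS; case/andP: hi.
  have hP (e : bool) : ~~ P (Ordinal hi', e) w.
    by apply: contra h' => h'; apply/existsP; exists (Ordinal hi', e).
  have := hP true; have := hP false; rewrite /P /=.
  have -> /= : (0 < i)%N by case/andP: hi.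
  by rewrite negbK => /[dup] /asboolP h1 -> /=; rewrite negbK => /asboolP.
have := @card_bad_words _ _ P k0; rewrite card_prod card_ord card_bool muln2 => hh.
apply: leq_trans (hh _); first by rewrite leq_mul2r (subset_leq_card sub) orbT.
move=> [i e] w; rewrite /P /=.
have [i0|i0] := posnP i.
  by rewrite (_ : [set t | _] = set0) ?cards0 //; apply/setP => t; rewrite !inE.
case: e => /=.
  have bE t : forall j, (j <= i)%N -> bword lt (fupd w (i, true) t) j = upd (bword lt w) i (lt t) j.
    move=> j ji; rewrite /bword /fupd ffunE /upd xpair_eqE eqxx andbT -val_eqE /= inordK //.
      by case: eqP.
    exact: leq_ltn_trans ji (ltn_ord i).
  have cE t : cword lt (fupd w (i, true) t) = cword lt w.
    by apply: funext => j; rewrite /cword /fupd ffunE xpair_eqE andbF.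
  have [hp|hp] := EM (pre_good f W (bword lt w) (cword lt w) i); last first.
    rewrite (_ : [set t | _] = set0) ?cards0 //; apply/setP => t; rewrite !inE.
    apply/negP => /andP[/asboolP hp' _]; apply: hp; rewrite cE in hp'.
    case: hp' => x [h1 h2]; exists x; split=> //.
    apply: regular_level_ext h2 => // j ji.
    by rewrite bE ?(ltnW ji) // /upd ltn_eqF.
  have [s [ss hs]] := good_bad W3 hp.
  apply: (@leq_trans (size s)); last by apply: leq_trans ss _; rewrite leq_addr.
  apply: (card_le_seq lti) => t; rewrite inE => /andP[_ /asboolPn h]; apply: hs => h'.
  apply: h; rewrite cE; apply: good_at_ext h' => // j ji; by rewrite bE.
have bE t : bword lt (fupd w (i, false) t) = bword lt w.
  by apply: funext => j; rewrite /bword /fupd ffunE xpair_eqE andbF.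
have cE t : forall j, (j <= i)%N -> cword lt (fupd w (i, false) t) j = upd (cword lt w) i (lt t) j.
  move=> j ji; rewrite /cword /fupd ffunE /upd xpair_eqE eqxx andbT -val_eqE /= inordK //.
    by case: eqP.
  exact: leq_ltn_trans ji (ltn_ord i).
have [s [ss hs]] := hKp i (bword lt w) (cword lt w) (fun _ _ => ob _) (fun _ _ => ob _).
apply: (@leq_trans (size s)); last first.
  apply: leq_trans ss _; apply: leq_trans (leq_addl _ _).
  exact: (leq_bigmax_cond (F := fun i : 'I_n.+1 => Kp i)).
apply: (card_le_seq lti) => t; rewrite inE => /asboolPn h; apply: hs => // h'.
by apply: h; rewrite bE; apply: pre_good_ext h' => // j ji; rewrite cE.
Qed.

Section Walks.
Variables (E T D : finType) (pt : E -> nat -> C) (lt : T -> C) (zv : D -> nat -> C).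
Variables (F : E -> T -> D) (Z : {set E * T}).
Hypothesis lt_inj : injective lt.
Hypothesis lt_ok : forall t, okl f W (lt t).
Hypothesis pt_inj : forall e e', (forall l, (l <= n)%N -> pt e l = pt e' l) -> e = e'.
Hypothesis hF : forall e b, (e, b) \in Z -> forall l, (l <= n)%N ->
  f.[(pt e l)%:P].[lt b] = zv (F e b) l.

Notation walk := ((E * T * T) * n.-tuple (E * T * T))%type.
Definition wnth (p : walk) i := nth p.1 (p.1 :: p.2) i.
Definition wpt (p : walk) l i := pt (wnth p i).1.1 l.
Definition wword (p : walk) : {ffun 'I_n.+1 * bool -> T} :=
  [ffun q : 'I_n.+1 * bool => if q.2 then (wnth p q.1).2 else (wnth p q.1).1.2].

Lemma bword_walk p i : (i <= n)%N -> bword lt (wword p) i = lt (wnth p i).2.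
Proof. by move=> h; rewrite /bword ffunE /= inordK. Qed.

Lemma cword_walk p i : (i <= n)%N -> cword lt (wword p) i = lt (wnth p i).1.2.
Proof. by move=> h; rewrite /cword ffunE /= inordK. Qed.

Lemma walk_step p i : p \in walks F Z n -> (i < n)%N -> wstep F Z (wnth p i) (wnth p i.+1).
Proof.
rewrite inE => /andP[_ /(pathP p.1) h] hi; apply: h.
by rewrite size_tuple.
Qed.

Lemma walk_mem p i : p \in walks F Z n -> (i <= n)%N -> ((wnth p i).1.1, (wnth p i).2) \in Z.
Proof.
move=> hp; case: i => [|i] hi; first by move: hp; rewrite inE => /andP[].
by have /and3P[] := walk_step hp hi.
Qed.

Lemma walk_chain p l : p \in walks F Z n -> (l <= n)%N ->
  chain f (bword lt (wword p)) (cword lt (wword p)) n (wpt p l).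
Proof.
move=> hp hl i hi; rewrite bword_walk ?cword_walk ?(ltnW hi) // /wpt.
have /and3P[_ h1 /eqP h2] := walk_step hp hi.
by rewrite (hF (walk_mem hp (ltnW hi))) // (hF h1) // h2.
Qed.

Lemma walk_eq p q : wword p = wword q ->
  (forall l i, (l <= n)%N -> (i <= n)%N -> wpt p l i = wpt q l i) -> p = q.
Proof.
move=> hw hX.
have e i : (i <= n)%N -> wnth p i = wnth q i.
  move=> hi; have h1 := congr1 (fun w : {ffun _ -> T} => w (inord i, true)) hw.
  have h2 := congr1 (fun w : {ffun _ -> T} => w (inord i, false)) hw.
  move: h1 h2; rewrite !ffunE /= !inordK // => h1 h2.
  have h3 : (wnth p i).1.1 = (wnth q i).1.1 by apply: pt_inj => l hl; apply: hX.
  move: h1 h2 h3; case: (wnth p i) => [[? ?] ?]; case: (wnth q i) => [[? ?] ?] /=.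
  by move=> -> -> ->.
have e1 : p.1 :: p.2 = q.1 :: q.2.
  apply: (@eq_from_nth _ p.1) => [|i]; rewrite /= !size_tuple // ltnS => hi.
  rewrite -/(wnth p i) e // /wnth; apply: set_nth_default.
  by rewrite /= size_tuple ltnS.
case: p q e1 {hw hX e} => [p1 p2] [q1 q2] /= [-> e2]; congr (_, _); exact: val_inj.
Qed.

(** A value has boundedly many preimages under $f(\cdot,c_i)$, so a start and a word leave at most
    [size f ^ n] possibilities for each of the [n.+1] coordinate paths. *)
Lemma walks_of_word (Q : pred (E * {ffun 'I_n.+1 * bool -> T})) :
  (#|[set p in walks F Z n | Q ((wnth p 0).1.1, wword p)]| <=
   #|[set q | Q q]| * (size f ^ n).+1 ^ n.+1)%N.
Proof.
apply: (leq_card_fibers_in (h := fun p => ((wnth p 0).1.1, wword p))) => [p|[e w]].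
  by rewrite !inE => /andP[].
have okc i : fiber (partx f) (cword lt w i) != 0 by case: (lt_ok (w (inord i, false))).
have [S hS] := choice (fun l => @chain_seq _ f (bword lt w) (cword lt w) n (pt e l) (fun i _ => okc i)).
set A := [set p in _ | _].
pose g (p : walk) : {ffun 'I_n.+1 -> 'I_(size f ^ n).+1} :=
  [ffun l : 'I_n.+1 => inord (index (mkseq (wpt p l) n.+1) (S l))].
have hA p : p \in A -> [/\ p \in walks F Z n, (wnth p 0).1.1 = e & wword p = w].
  by rewrite /A in_set [p \in [set _ in _ | _]]in_set => /andP[/andP[h1 _] /eqP[-> ->]].
have hin p l : p \in A -> (l <= n)%N -> mkseq (wpt p l) n.+1 \in S l.
  move=> /hA[h1 h2 h3] hl; apply: (hS l).2; last by rewrite /wpt h2.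
  by have := walk_chain h1 hl; rewrite h3.
have gi : {in A &, injective g}.
  move=> p q pA qA /ffunP gpq; have [_ _ hp] := hA p pA; have [_ _ hq] := hA q qA.
  apply: walk_eq; first by rewrite hp hq.
  move=> l i hl hi; have := gpq (Ordinal (hl : (l < n.+1)%N)); rewrite !ffunE /=.
  move=> /(congr1 (@nat_of_ord _)); rewrite !inordK ?ltnS; last 2 first.
  - by apply: leq_trans (hS l).1; rewrite ltnW // index_mem hin.
  - by apply: leq_trans (hS l).1; rewrite ltnW // index_mem hin.
  move=> /(congr1 (nth [::] (S l))); rewrite !nth_index ?hin //.
  by move=> /(congr1 (fun s => nth 0 s i)); rewrite !nth_mkseq.
rewrite -(card_in_imset gi); apply: leq_trans (max_card _) _.
by rewrite card_ffun !card_ord.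
Qed.

(** A nondegenerate walk is determined, up to [K] choices, by its start, its final value and the
    letters $c_i$, because the letters $b_i$ are recovered from the path equations. The $|T|^{n+1}$
    choices of the $b_i$ are thus traded for the $|D|$ final values. *)
Lemma good_walks_bound K (A : {set walk}) :
  (forall v (U : finType) (g : U -> 'I_n.+1 + 'I_n.+1 * 'I_n.+1 -> C), injective g ->
    (forall t, word_solution f v (g t)) -> (#|U| <= K)%N) ->
  (forall p, p \in A -> p \in walks F Z n /\
     (forall l, (l <= n)%N -> rpath f (bword lt (wword p)) (cword lt (wword p)) n (wpt p l)) /\
     nondegenerate f (bword lt (wword p)) (cword lt (wword p)) n (wpt p)) ->
  (#|A| <= #|E| * #|D| * #|T| ^ n.+1 * K)%N.
Proof.
move=> hK hA.
pose h (p : walk) := ((wnth p 0).1.1, F (wnth p n).1.1 (wnth p n).2,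
  [ffun i : 'I_n.+1 => (wnth p i).1.2]).
have := @leq_card_fibers _ _ A h K; rewrite !card_prod card_ffun card_ord => hh; apply: hh.
move=> [[e d] cf]; set B := [set p in A | _].
have hB p : p \in B -> [/\ p \in A, (wnth p 0).1.1 = e, F (wnth p n).1.1 (wnth p n).2 = d &
    cword lt (wword p) = fun i => lt (cf (inord i))].
  rewrite in_set => /andP[pA /eqP[h1 h2 h3]]; split=> //.
  by apply: funext => i; rewrite /cword -h3 !ffunE.
rewrite -[#|B|]card_sig.
pose v (mi : 'I_3 * 'I_n.+1) : C := match val mi.1 with
  0%N => lt (cf (inord mi.2)) | 1%N => pt e mi.2 | _ => zv d mi.2 end.
apply: (hK v _ (fun p : {p | p \in B} => encode (bword lt (wword (val p))) (wpt (val p)))).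
  move=> [p hp] [q hq] /= hpq; apply: val_inj => /=.
  have [pA p1 p2 p3] := hB p hp; have [qA q1 q2 q3] := hB q hq.
  apply: walk_eq; last first.
    move=> l i hl hi; have := congr1 (fun u => u (inr (inord l, inord i))) hpq.
    by rewrite /= !inordK.
  apply/ffunP => -[i []].
    have := congr1 (fun u => u (inl i)) hpq; rewrite /= /bword inord_val.
    exact: lt_inj.
  have : cword lt (wword p) i = cword lt (wword q) i by rewrite p3 q3.
  by rewrite /cword inord_val; apply: lt_inj.
move=> [p hp] /=; have [pA p1 p2 p3] := hB p hp; have [pw [h1 h2]] := hA p pA.
have := @encode_solution _ f n (bword lt (wword p)) (cword lt (wword p)) (wpt p) (pt e) (zv d).
rewrite p3 => hs; apply: hs; last by rewrite -p3.
move=> l hl; split; first by rewrite -p3; apply: h1.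
  by rewrite /wpt p1.
by rewrite bword_walk // /wpt (hF (walk_mem pw (leqnn n))) // p2.
Qed.

End Walks.

(** Walks with a bad word and walks from a bad start each amount to at most a third of the number
    guaranteed by [walks_ge]. For the others the lower bound of order $|E|\,|T|^{2n+2}/L^n$ meets
    the upper bound $K\,|E|\,|D|\,|T|^{n+1}$. *)
Lemma walk_bound : exists C1 : nat,
  forall (E T D : finType) (pt : E -> nat -> C) (lt : T -> C) (zv : D -> nat -> C)
    (F : E -> T -> D) (Z : {set E * T}) (L m : nat),
  injective lt -> (forall t, okl f W (lt t)) ->
  (forall e e', (forall l, (l <= n)%N -> pt e l = pt e' l) -> e = e') ->
  (forall e b, (e, b) \in Z -> forall l, (l <= n)%N ->
    f.[(pt e l)%:P].[lt b] = zv (F e b) l) ->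
  (0 < L)%N -> (0 < #|E|)%N -> (#|D| <= L * #|E|)%N -> (#|E| * #|T| <= 2 * #|Z|)%N ->
  (forall (S : (nat -> C) -> nat -> seq C) K,
    (forall p l, (l <= n)%N -> (size (S p l) <= K)%N) ->
    (forall p p' l, (forall i, (i < l)%N -> p i = p' i) -> S p l = S p' l) ->
    (#|[set e | `[< exists l, (l <= n)%N /\ pt e l \in S (pt e) l >]]| * m <=
      n.+1 * K * #|E|)%N) ->
  (C1 * L ^ n <= #|T|)%N -> (C1 * L ^ n <= m)%N ->
  (#|T| ^ n.+1 <= C1 * L ^ n * #|D|)%N.
Proof.
have [k hk] := bad_words_bound.
have [K1 hK1] := nd_start f W n.
have [K2 hK2] := nd_count f n.
pose s' := ((size f ^ n).+1 ^ n.+1)%N.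
exists (96 * 64 ^ n * (k * s' + n.+1 * K1 * s' + K2)).+1%N.
move=> E T D pt lt zv F Z L m lti ltok pti hF L0 E0 hD hZ hst hT hm.
have hwalks := walks_ge F n L0 hD hZ.
have hkT := hk T lt lti ltok.
pose G (w : {ffun 'I_n.+1 * bool -> T}) := good_word f W (bword lt w) (cword lt w) n.
have hex w : exists S : (nat -> C) -> nat -> seq C,
  [/\ forall p l, (l <= n)%N -> (size (S p l) <= K1)%N,
      forall p p' l, (forall i, (i < l)%N -> p i = p' i) -> S p l = S p' l &
      G w -> forall p, (forall l, (l <= n)%N -> p l \notin S p l) ->
      forall X, (forall l, (l <= n)%N -> chain f (bword lt w) (cword lt w) n (X l) /\ X l 0%N = p l) ->
        (forall l, (l <= n)%N -> rpath f (bword lt w) (cword lt w) n (X l)) /\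
        nondegenerate f (bword lt w) (cword lt w) n X].
  have [gw|gw] := EM (G w); last by exists (fun _ _ => [::]).
  by have [S [h1 h2 h3]] := hK1 _ _ gw; exists S; split.
have [S hS] := choice hex.
pose badE w := [set e | `[< exists l, (l <= n)%N /\ pt e l \in S w (pt e) l >]].
pose Wk := walks F Z n.
pose A1 := [set p in Wk | ~~ `[< G (wword p) >]].
pose A2 := [set p in Wk | `[< G (wword p) >] && ((wnth p 0).1.1 \in badE (wword p))].
pose A3 := [set p in Wk | `[< G (wword p) >] && ((wnth p 0).1.1 \notin badE (wword p))].
have hA : (#|Wk| <= #|A1| + #|A2| + #|A3|)%N.
  rewrite -(cardsID A1 Wk) -addnA; apply: leq_add.
    by apply: subset_leq_card; apply: subsetIr.
  rewrite -(cardsID A2 (Wk :\: A1)); apply: leq_add; apply: subset_leq_card.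
    exact: subsetIr.
  apply/subsetP => p; rewrite !in_set => /andP[h1 /andP[h2 h3]]; rewrite h3 /=.
  by move: h1 h2; rewrite h3 /= negbK => h1 h2; rewrite h2 /= in h1 *.
have h1 : (#|A1| * #|T| <= k * s' * (#|E| * #|T| ^ (n.+1).*2))%N.
  have := walks_of_word ltok pti hF (fun q => ~~ `[< G q.2 >]).
  rewrite (_ : [set q | _] = setX [set: E] [set w | ~~ `[< G w >]]); last first.
    by apply/setP => q; rewrite !inE.
  by rewrite cardsX cardsT -/s' -/A1 => h; apply: mul_bound1 h hkT.
have h2 : (#|A2| * m <= n.+1 * K1 * s' * (#|E| * #|T| ^ (n.+1).*2))%N.
  have := walks_of_word ltok pti hF (fun q => `[< G q.2 >] && (q.1 \in badE q.2)).
  have : (#|[set q : E * {ffun 'I_n.+1 * bool -> T} | `[< G q.2 >] && (q.1 \in badE q.2)]| * m <=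
    n.+1 * K1 * #|E| * #|T| ^ (n.+1).*2)%N.
    have -> : (#|T| ^ (n.+1).*2 = #|{ffun 'I_n.+1 * bool -> T}|)%N.
      by rewrite card_ffun card_prod card_ord card_bool muln2.
    rewrite -sum1_card (partition_big snd xpredT) //= big_distrl /=.
    rewrite [leqRHS]mulnC -sum_nat_const; apply: leq_sum => w _.
    have [q1 q2 _] := hS w; apply: leq_trans (hst _ _ q1 q2); rewrite leq_mul2r; apply/orP; right.
    rewrite -/(badE w) -[leqRHS]sum1_card (reindex_onto (fun e => (e, w)) fst) /=; last first.
      by move=> [e w'] /andP[_ /eqP /= ->].
    rewrite [leqRHS](bigID (fun e => `[< G w >])) /=; apply: leq_trans (leq_addr _ _).
    by apply/eq_leq/eq_bigl => e; rewrite in_set !eqxx /= !andbT andbC.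
  by rewrite -/s' -/A2; apply: mul_bound2.
have h3 : (#|A3| <= #|E| * #|D| * #|T| ^ n.+1 * K2)%N.
  apply: (good_walks_bound lti pti hF hK2) => p; rewrite in_set => /and3P[pW /asboolP pG pS].
  split=> //; have [_ _ q3] := hS (wword p).
  apply: (q3 pG (pt (wnth p 0).1.1)) => l hl; last first.
    by split; [apply: (walk_chain hF pW hl)|].
  apply/negP => hin; move: pS; rewrite in_set => /negP; apply; apply/asboolP.
  by exists l.
move: hwalks hA h1 h2 h3 hT hm; rewrite -/Wk -addnn expnD expnMn.
have Ln : (0 < L ^ n)%N by rewrite expn_gt0 L0.
have n64 : (0 < 64 ^ n)%N by rewrite expn_gt0.
move: #|Wk| #|A1| #|A2| #|A3| (#|T| ^ n.+1)%N (L ^ n)%N (64 ^ n)%N Ln n64 => w a1 a2 a3 tn ln e64 Ln n64.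
have : (#|T| = 0 -> False)%N -> True by [].
move: #|T| #|E| E0 #|D| s' (n.+1)%N => t e E0 d s n1 _ hw hA h1 h2 h3 hT hm.
have t0 : (0 < t)%N by apply: leq_trans hT; rewrite muln_gt0 Ln.
have m0 : (0 < m)%N by apply: leq_trans hm; rewrite muln_gt0 Ln.
set P := (e * (tn * tn))%N in hw h1 h2.
set Lam := (32 * (e64 * ln))%N in hw.
have g1 : (3 * Lam * a1 <= P)%N.
  rewrite -(leq_pmul2r t0); apply: (@leq_trans (3 * Lam * (k * s * P))%N).
    by rewrite -mulnA leq_mul2l h1 orbT.
  rewrite mulnA [leqRHS]mulnC leq_mul2r; apply/orP; right; apply: leq_trans hT.
  rewrite /Lam; clear; nia.
have g2 : (3 * Lam * a2 <= P)%N.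
  rewrite -(leq_pmul2r m0); apply: (@leq_trans (3 * Lam * (n1 * K1 * s * P))%N).
    by rewrite -mulnA leq_mul2l h2 orbT.
  rewrite mulnA [leqRHS]mulnC leq_mul2r; apply/orP; right; apply: leq_trans hm.
  rewrite /Lam; clear; nia.
have g3 : (P <= 3 * Lam * a3)%N.
  have : (P <= Lam * (a1 + a2 + a3))%N by apply: leq_trans hw _; rewrite leq_mul2l hA orbT.
  by move: g1 g2; clear; rewrite !mulnDr -!mulnA; lia.
have [->|tn0] := posnP tn; first by rewrite leq0n.
have g4 : (P <= 3 * Lam * (e * d * tn * K2))%N by apply: leq_trans g3 _; rewrite leq_mul2l h3 orbT.
have et : (0 < e * tn)%N by rewrite muln_gt0 E0.
rewrite -(leq_pmul2l et); have -> : (e * tn * tn = P)%N by rewrite /P mulnA.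
apply: leq_trans g4 _; rewrite /Lam.
have -> : (3 * (32 * (e64 * ln)) * (e * d * tn * K2) = e * tn * ((96 * e64 * K2) * ln * d))%N.
  by clear; nia.
by rewrite leq_mul2l leq_mul2r leq_mul2r; apply/orP; right; apply/orP; right; apply/orP; right; clear; nia.
Qed.

End WalkBound.

(** * Tuples of neighbouring starting points *)

Section Starts.
Variable C : eqType.
Variables (TA : finType) (h n : nat) (pa : TA -> C) (sg : TA -> 'I_h -> C).
Local Notation E := (TA * {ffun 'I_n.+1 -> 'I_h})%type.

(** One point [pa a] and [n.+1] points among its [h] neighbours. The neighbours are chosen
    independently, as the successive exclusions of [nd_start] require. *)
Definition start_pt (e : E) l := if l is l'.+1 then sg e.1 (e.2 (inord l')) else pa e.1.

Lemma bad_starts (S : (nat -> C) -> nat -> seq C) K m :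
  injective pa -> (forall a, injective (sg a)) -> (m <= #|TA|)%N -> (m <= h)%N ->
  (forall p l, (l <= n.+1)%N -> (size (S p l) <= K)%N) ->
  (forall p p' l, (forall i, (i < l)%N -> p i = p' i) -> S p l = S p' l) ->
  (#|[set e | `[< exists l, (l <= n.+1)%N /\ start_pt e l \in S (start_pt e) l >]]| * m <=
    n.+2 * K * #|{: E}|)%N.
Proof.
move=> pai sgi mA mh hS hloc.
pose P a (j : 'I_n.+1) : pred {ffun 'I_n.+1 -> 'I_h} :=
  fun w => start_pt (a, w) j.+1 \in S (start_pt (a, w)) j.+1.
pose B0 := [set e : E | start_pt e 0 \in S (start_pt e) 0].
pose B1 := [set e : E | [exists j, P e.1 j e.2]].
have sub : [set e | `[< exists l, (l <= n.+1)%N /\ start_pt e l \in S (start_pt e) l >]] \subset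
    B0 :|: B1.
  apply/subsetP => -[a w]; rewrite !inE => /asboolP[[|l] [hl hin]]; first by rewrite hin.
  by apply/orP; right; apply/existsP; exists (Ordinal (hl : (l < n.+1)%N)).
have h0 : (#|B0| * m <= K * #|{: E}|)%N.
  have [e0|e0] := posnP #|{: E}|.
    by rewrite (_ : #|B0| = 0%N) //; apply/eqP; rewrite -leqn0 -e0 max_card.
  have /card_gt0P [[a0 w0] _] := e0.
  have le : (#|B0| <= K * #|{ffun 'I_n.+1 -> 'I_h}|)%N.
    apply: (@leq_trans #|setX [set a | pa a \in S (start_pt (a0, w0)) 0%N] [set: {ffun 'I_n.+1 -> 'I_h}]|).
      apply: subset_leq_card; apply/subsetP => -[a w]; rewrite !inE andbT /=.
      by rewrite (hloc (start_pt (a, w)) (start_pt (a0, w0)) 0%N).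
    rewrite cardsX cardsT leq_mul2r; apply/orP; right.
    apply: leq_trans (hS (start_pt (a0, w0)) 0%N isT).
    by apply: (card_le_seq pai) => t; rewrite inE.
  rewrite card_prod; apply: (@leq_trans (#|B0| * #|TA|)); first by rewrite leq_mul2l mA orbT.
  by rewrite mulnCA mulnC leq_mul2l le orbT.
have h1 : (#|B1| * m <= n.+1 * K * #|{: E}|)%N.
  apply: (@leq_trans (#|B1| * h)); first by rewrite leq_mul2l mh orbT.
  rewrite -[#|B1|]sum1_card (partition_big fst xpredT) //= big_distrl /=.
  rewrite card_prod [leqRHS]mulnCA -[leqRHS]sum_nat_const; apply: leq_sum => a _.
  have := @card_bad_words _ _ (P a) K; rewrite card_ffun !card_ord => hb.
  apply: leq_trans (hb _).
    rewrite leq_mul2r; apply/orP; right; rewrite -[leqRHS]sum1_card.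
    rewrite (reindex_onto (fun w => (a, w)) snd) /=; last by move=> [u w] /andP[_ /eqP /= ->].
    by apply/eq_leq/eq_bigl => w; rewrite !inE !eqxx !andbT.
  move=> j w; have hj : (j.+1 <= n.+1)%N := ltn_ord j.
  apply: leq_trans (hS (start_pt (a, w)) j.+1 hj).
  apply: (card_le_seq (sgi a)) => t; rewrite inE /P /start_pt /= ffunE inord_val eqxx.
  congr (_ \in _); apply: hloc => -[//|i] ij /=; rewrite ffunE.
  have hi : (i < n.+1)%N by apply: ltn_trans (ltn_ord j).
  by rewrite -val_eqE /= inordK // ltn_eqF.
have h2 := leq_trans (subset_leq_card sub) (leq_card_setU B0 B1).
apply: (@leq_trans ((#|B0| + #|B1|) * m)); first by rewrite leq_mul2r h2 orbT.
rewrite mulnDl; apply: leq_trans (leq_add h0 h1) _.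
by rewrite -mulnDl -mulSn.
Qed.
End Starts.

(** * Growth from a family of cells *)

Section Main.
Variable R : realType.
Local Notation C := R[i].

(** Walks run through tuples of neighbouring points, with tuples of close values as targets.
    Closeness bounds the number of targets by $|TD|K_1^{n+1}$ rather than $|TD|^{n+2}$, while [n.+2]
    letters are still recovered: $|TB|^{n+2}$ stands against one factor $|TD|$. *)
Theorem nonaffine_growth (f : {poly {poly C}}) : partx f != 0 -> party f != 0 ->
  ~ additive_poly f -> ~ multiplicative_poly f -> ~ affine_type f ->
  exists sb : seq C, forall n, exists C1 : nat,
  forall (TA TB TD : finType) (pa : TA -> C) (lt : TB -> C) (zd : TD -> C) (h : nat)
    (sg : TA -> 'I_h -> C) (cl : rel TD) (K1 L : nat) (Zg : {set TA * TB}),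
  injective pa -> injective lt -> (forall a, injective (sg a)) -> (forall b, lt b \notin sb) ->
  (forall z, (#|[set z' | cl z z']| <= K1)%N) ->
  (forall a b, (a, b) \in Zg -> exists z, f.[(pa a)%:P].[lt b] = zd z /\
    forall j, exists z', f.[(sg a j)%:P].[lt b] = zd z' /\ cl z z') ->
  (#|TA| * #|TB| <= 2 * #|Zg|)%N -> (0 < L)%N ->
  (#|TD| * K1 ^ n.+1 <= L * (#|TA| * h ^ n.+1))%N ->
  (C1 * L ^ n.+1 <= #|TB|)%N -> (C1 * L ^ n.+1 <= #|TA|)%N -> (C1 * L ^ n.+1 <= h)%N ->
  (#|TB| ^ n.+2 <= C1 * L ^ n.+1 * (#|TD| * K1 ^ n.+1))%N.
Proof.
move=> fx fy na nm naf.
have [W [sc [N [w1 w2 w3]]]] := witness_exists fx fy na nm naf.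
have [Nc w4] := crit_level_bounded f.
have [sx hsx] := fiber_neq0_seq fx; have [sy hsy] := fiber_neq0_seq fy.
exists (sc ++ sx ++ sy) => n.
have [C1 hC1] := walk_bound w2 w3 w4 n.+1.
exists C1.+1 => TA TB TD pa lt zd h sg cl K1 L Zg pai lti sgi hsb hK1 hZ hcard L0 hD hB hA hh.
have pos x : (C1.+1 * L ^ n.+1 <= x)%N -> (0 < x)%N.
  by apply: leq_trans; rewrite muln_gt0 expn_gt0 L0.
have A0 := pos _ hA; have B0 := pos _ hB; have h0 := pos _ hh.
have le1 x : (C1.+1 * L ^ n.+1 <= x)%N -> (C1 * L ^ n.+1 <= x)%N.
  by apply: leq_trans; rewrite leq_mul2r leqnSn orbT.
pose EDp (p : TD * {ffun 'I_n.+1 -> TD}) := [forall l, cl p.1 (p.2 l)].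
pose ED := {p | EDp p}.
have cED : (#|{: ED}| <= #|TD| * K1 ^ n.+1)%N.
  rewrite card_sig -[leqLHS]cardsE; apply: (leq_card_fibers (h := fst)) => z.
  pose g (w : {ffun 'I_n.+1 -> TD}) := (z, w).
  have gi : injective g by move=> ? ? [].
  apply: (@leq_trans #|g @: [set w | w \in ffun_on (mem [set z' | cl z z'])]|).
    apply: subset_leq_card; apply/subsetP => -[z' w]; rewrite !inE /= => /andP[/forallP /= hw /eqP e].
    rewrite e in hw *; apply/imsetP; exists w => //; rewrite inE; apply/ffun_onP => l.
    by rewrite inE.
  rewrite card_imset // cardsE card_ffun_on card_ord.
  set c := #|_|; have hc : (c <= K1)%N by apply: leq_trans (hK1 z); apply/eq_leq/eq_card => y.
  by elim: (n.+1) => // k IH; rewrite !(expnS _ k); apply: leq_mul.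
pose E := (TA * {ffun 'I_n.+1 -> 'I_h})%type.
have key (e : E) b : exists d : ED, (e.1, b) \in Zg -> forall l, (l <= n.+1)%N ->
    f.[(start_pt pa sg e l)%:P].[lt b] =
    (if l is l'.+1 then zd ((val d).2 (inord l')) else zd (val d).1).
  have gen a b' : (a, b') \in Zg -> forall w : {ffun 'I_n.+1 -> 'I_h}, exists d : ED,
    forall l, (l <= n.+1)%N -> f.[(start_pt pa sg (a, w) l)%:P].[lt b'] =
    (if l is l'.+1 then zd ((val d).2 (inord l')) else zd (val d).1).
    move=> /hZ[z [hz hj]] w; have [z' hz'] := choice hj.
    have hd : EDp (z, [ffun l => z' (w l)]).
      by apply/forallP => l /=; rewrite ffunE; case: (hz' (w l)).
    exists (exist _ (z, [ffun l => z' (w l)]) hd) => -[|l] _ //=.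
    by rewrite ffunE; case: (hz' (w (inord l))).
  have [hin|hin] := boolP ((e.1, b) \in Zg).
    by have [d hd] := gen _ _ hin e.2; exists d => _; rewrite -surjective_pairing in hd.
  have /card_gt0P [[a0 b0] h00] : (0 < #|Zg|)%N.
    by have := leq_trans (_ : 0 < #|TA| * #|TB|)%N hcard; rewrite muln_gt0 A0 B0 muln_gt0; apply.
  by have [d _] := gen _ _ h00 e.2; exists d.
have [F hF] := choice (fun eb : E * TB => key eb.1 eb.2).
apply: leq_trans (_ : C1 * L ^ n.+1 * #|{: ED}| <= _)%N; last by apply: leq_mul => //; rewrite leq_mul2r leqnSn orbT.
pose zv (d : ED) l := if l is l'.+1 then zd ((val d).2 (inord l')) else zd (val d).1.
apply: (hC1 {: E}%type TB {: ED}%type (start_pt pa sg) lt zv (fun e b => F (e, b))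
   [set q : E * TB | (q.1.1, q.2) \in Zg] L (minn #|TA| h)) => //.
- move=> b; have := hsb b; rewrite !mem_cat !negb_or => /and3P[h1 h2 h3]; split.
  + exact: hsx.
  + exact: hsy.
  + exact: (w1 _ h1).
- move=> [a w] [a' w'] hl; have e0 := pai _ _ (hl 0%N isT); rewrite /= in e0.
  rewrite -e0 in hl *; congr (_, _); apply/ffunP => i; apply: (sgi a).
  by have := hl i.+1 (ltn_ord i); rewrite /start_pt /= inord_val.
- by move=> e b; rewrite inE => hin l hl; apply: (hF (e, b)).
- by rewrite card_prod card_ffun !card_ord muln_gt0 A0 expn_gt0 h0.
- by apply: leq_trans cED _; rewrite card_prod card_ffun !card_ord.
- have -> : #|[set q : E * TB | (q.1.1, q.2) \in Zg]| = (#|{ffun 'I_n.+1 -> 'I_h}| * #|Zg|)%N.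
    rewrite -cardsT -cardsX; pose g (p : {ffun 'I_n.+1 -> 'I_h} * (TA * TB)) : E * TB :=
      ((p.2.1, p.1), p.2.2).
    have gi : injective g by move=> [? [? ?]] [? [? ?]] [-> -> ->].
    rewrite -(card_imset _ gi); apply: eq_card => -[[a w] b].
    apply/idP/imsetP => [|[[u [v x]]]].
      by rewrite inE /= => hin; exists (w, (a, b)); rewrite // in_setX inE.
    by rewrite in_setX => /andP[_ hin] e; case: e hin => -> _ -> /= hin; rewrite inE.
  rewrite card_prod mulnAC mulnCA mulnC leq_mul2l; apply/orP; right; exact: hcard.
- move=> S K hS hloc; apply: bad_starts => //; [exact: geq_minl|exact: geq_minr].
- exact: le1.
- by rewrite leq_min !le1.
Qed.
End Main.

(** * Annuli and crowded cells *)

Section Annuli.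
Variable R : realType.
Local Notation C := R[i].
Implicit Types (g h : {poly C}) (r t : R) (p a : C).

Definition ann (T : finType) (v : T -> C) (p : C) (s r : R) : {set T} :=
  [set z | s <= cabs (v z - p) <= r].

(** Both points lie well inside an annulus with few of the given points: a notion of nearness
    without a fixed scale, suited to images under polynomials. The factor 8 leaves room for the
    triangle inequalities in [close_card]. *)
Definition close (T : finType) (v : T -> C) (K : nat) (y y' : C) : Prop :=
  exists p s r, [/\ 0 <= s, 8 * s <= cabs (y - p) /\ 8 * s <= cabs (y' - p),
    8 * cabs (y - p) <= r /\ 8 * cabs (y' - p) <= r & (#|ann v p s r| <= K)%N].

Lemma exists_max (T : finType) (S : {set T}) (w : T -> R) x0 : x0 \in S ->
  exists2 x, x \in S & forall y, y \in S -> w y <= w x.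
Proof.
move=> x0S; case: (arg_maxP w x0S) => x xS hx; exists x => // y yS; exact: hx.
Qed.

Lemma exists_min (T : finType) (S : {set T}) (w : T -> R) x0 : x0 \in S ->
  exists2 x, x \in S & forall y, y \in S -> w x <= w y.
Proof.
move=> x0S; case: (arg_minP w x0S) => x xS hx; exists x => // y yS; exact: hx.
Qed.

(* The annulus with the largest outer radius, then the one with the smallest hole among
   those meeting the first hole, and any one meeting both holes cover everything. *)
Lemma close_card (T : finType) (v : T -> C) K y :
  (#|[set x | `[< close v K y (v x) >]]| <= 3 * K)%N.
Proof.
set S := [set x | _].
have [w hw] : exists w : T -> C * R * R, forall x, x \in S ->
  [/\ 0 <= (w x).1.2, 8 * (w x).1.2 <= cabs (y - (w x).1.1) /\ 8 * (w x).1.2 <= cabs (v x - (w x).1.1),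
    8 * cabs (y - (w x).1.1) <= (w x).2 /\ 8 * cabs (v x - (w x).1.1) <= (w x).2 &
    (#|ann v (w x).1.1 (w x).1.2 (w x).2| <= K)%N].
  have h x : exists w : C * R * R, x \in S ->
     [/\ 0 <= w.1.2, 8 * w.1.2 <= cabs (y - w.1.1) /\ 8 * w.1.2 <= cabs (v x - w.1.1),
    8 * cabs (y - w.1.1) <= w.2 /\ 8 * cabs (v x - w.1.1) <= w.2 &
    (#|ann v w.1.1 w.1.2 w.2| <= K)%N].
    have [|xS] := boolP (x \in S); last by exists (0, 0, 0).
    by rewrite inE => /asboolP[p [s [r h]]]; exists (p, s, r).
  by have [w hw] := choice h; exists w.
have [->|[x0 x0S]] := set_0Vmem S; first by rewrite cards0.
have tri (a b c : C) := cabs_tri b a c.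
have sym (a b : C) : cabs (a - b) = cabs (b - a) by rewrite -cabsN opprB.
have [x1 x1S hx1] := exists_max (fun x => (w x).2) x0S.
have [s1 [a1 b1] [c1 d1] k1] := hw _ x1S.
pose An x := ann v (w x).1.1 (w x).1.2 (w x).2.
pose H1 := [set x in S | cabs (v x - (w x1).1.1) < (w x1).1.2].
have sub1 : S \subset An x1 :|: H1.
  apply/subsetP => x xS; rewrite !inE; have := xS; rewrite inE => ->; rewrite /=.
  have [h|h] := ltP (cabs (v x - (w x1).1.1)) (w x1).1.2; first by rewrite orbT.
  rewrite orbF /=; have [s2 [a2 b2] [c2 d2] _] := hw _ xS; have := hx1 _ xS.
  have := tri (v x) (w x).1.1 (w x1).1.1; have := tri (w x).1.1 y (w x1).1.1.
  rewrite (sym (w x).1.1 y); lra.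
have [e1|[x2' x2'H]] := set_0Vmem H1.
  rewrite e1 setU0 in sub1; apply: leq_trans (subset_leq_card sub1) _.
  by apply: leq_trans k1 _; rewrite leq_pmull.
have [x2 x2H hx2] := exists_min (fun x => (w x).1.2) x2'H.
have hH1 x : x \in H1 -> x \in S /\ cabs (v x - (w x1).1.1) < (w x1).1.2.
  by rewrite in_set => /andP[].
have inner x x' : x \in H1 -> x' \in H1 -> cabs (v x' - (w x).1.1) <= (w x).2.
  move=> /hH1[xS h] /hH1[_ h']; have [s2 [a2 b2] [c2 d2] _] := hw _ xS.
  have t1 := tri (v x') (v x) (w x).1.1; have t2 := tri (v x') (w x1).1.1 (v x).
  have t3 := tri y (v x) (w x1).1.1; have t4 := tri y (w x).1.1 (v x).
  rewrite (sym (w x1).1.1 (v x)) in t2; rewrite (sym (w x).1.1 (v x)) in t4; lra.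
have [x2S h2] := hH1 _ x2H; have [s2 [a2 b2] [c2 d2] k2] := hw _ x2S.
pose H2 := [set x in H1 | cabs (v x - (w x2).1.1) < (w x2).1.2].
have sub2 : H1 \subset An x2 :|: H2.
  apply/subsetP => x xH; rewrite in_setU [x \in H2]in_set xH /= [x \in An x2]in_set.
  by rewrite (inner x2 x) // andbT; case: leP.
have [e2|[x3 x3H]] := set_0Vmem H2.
  rewrite e2 setU0 in sub2; have sub : S \subset An x1 :|: An x2.
    by apply: subset_trans sub1 _; apply: setUS.
  apply: leq_trans (subset_leq_card sub) _; apply: leq_trans (leq_card_setU _ _) _.
  by apply: leq_trans (leq_add k1 k2) _; rewrite addnn -mul2n leq_mul2r orbT.
have hH2 x : x \in H2 -> x \in H1 /\ cabs (v x - (w x2).1.1) < (w x2).1.2.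
  by rewrite in_set => /andP[].
have [x3H1 h3] := hH2 _ x3H; have [x3S _] := hH1 _ x3H1.
have [s3 [a3 b3] [c3 d3] k3] := hw _ x3S; have s23 := hx2 _ x3H1.
have sub3 : H2 \subset An x3.
  apply/subsetP => x xH; have [xH1 h] := hH2 _ xH; rewrite in_set (inner x3 x) // andbT.
  have t1 := tri (v x3) (v x) (w x3).1.1; have t2 := tri (v x3) (w x2).1.1 (v x).
  rewrite (sym (w x2).1.1 (v x)) in t2; lra.
have sub : S \subset An x1 :|: (An x2 :|: An x3).
  apply: subset_trans sub1 _; apply: setUS; apply: subset_trans sub2 _; exact: setUS.
apply: leq_trans (subset_leq_card sub) _; apply: leq_trans (leq_card_setU _ _) _.
rewrite mulSn mul2n -addnn; apply: leq_add => //.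
by apply: leq_trans (leq_card_setU _ _) _; apply: leq_add.
Qed.

Definition pnorm (r : R) (h : {poly C}) : R := \sum_(i < size h) cabs h`_i * r ^+ i.

Lemma pnorm_widen r h n : (size h <= n)%N -> pnorm r h = \sum_(i < n) cabs h`_i * r ^+ i.
Proof.
move=> hn; rewrite /pnorm -!(big_mkord xpredT (fun i => cabs h`_i * r ^+ i)).
rewrite (big_cat_nat _ hn) //= [X in _ = _ + X](_ : _ = 0) ?addr0 //.
by rewrite big_nat_cond big1 // => i /andP[/andP[h1 _] _]; rewrite nth_default // cabs0 mul0r.
Qed.

Lemma pnorm_ge0 r h : 0 <= r -> 0 <= pnorm r h.
Proof. by move=> r0; apply: sumr_ge0 => i _; rewrite mulr_ge0 ?cabs_ge0 ?exprn_ge0. Qed.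

Lemma pnorm_le r g h : 0 <= r -> (forall i, cabs g`_i <= cabs h`_i) -> pnorm r g <= pnorm r h.
Proof.
move=> r0 hgh; rewrite (pnorm_widen r (leq_maxl (size g) (size h))).
rewrite (pnorm_widen r (leq_maxr (size g) (size h))).
by apply: ler_sum => i _; rewrite ler_wpM2r ?exprn_ge0.
Qed.

Lemma pnormC r c : pnorm r c%:P = cabs c.
Proof.
rewrite (pnorm_widen r (n := 1)) ?size_polyC ?leq_b1 //.
by rewrite big_ord1 coefC mulr1.
Qed.

Lemma pnormD r g h : 0 <= r -> pnorm r (g + h) <= pnorm r g + pnorm r h.
Proof.
move=> r0; pose n := maxn (size (g + h)) (maxn (size g) (size h)).
rewrite (pnorm_widen r (n := n)) ?leq_maxl // (pnorm_widen (h := g) r (n := n)); last first.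
  by rewrite /n !leq_max leqnn orbT.
rewrite (pnorm_widen (h := h) r (n := n)); last by rewrite /n !leq_max leqnn !orbT.
rewrite -big_split /=; apply: ler_sum => i _.
by rewrite -mulrDl coefD ler_wpM2r ?exprn_ge0 ?cabsD.
Qed.

Lemma pnormMXaddC r h c : pnorm r (h * 'X + c%:P) = pnorm r h * r + cabs c.
Proof.
rewrite (pnorm_widen r (n := (size h).+1)); last first.
  by rewrite size_MXaddC; case: ifP => // /andP[/eqP -> _]; rewrite size_poly0.
rewrite big_ord_recl /= coefD coefMX coefC /= add0r mulr1 addrC; congr (_ + _).
rewrite /pnorm mulr_suml; apply: eq_bigr => i _.
by rewrite coefD coefMX coefC /= addr0 -mulrA exprSr.
Qed.

Lemma pnormZ r c h : pnorm r (c *: h) = cabs c * pnorm r h.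
Proof.
rewrite (pnorm_widen r (n := size h)) ?size_scale_leq // mulr_sumr.
by apply: eq_bigr => i _; rewrite coefZ cabsM mulrA.
Qed.

Lemma pnormMXaddC_le r h c : 0 <= r -> pnorm r (h * ('X + c%:P)) <= pnorm r h * (r + cabs c).
Proof.
move=> r0; rewrite mulrDr mulrDr; apply: le_trans (pnormD _ _ r0) _; apply: lerD.
  by have := pnormMXaddC r h 0; rewrite addr0 cabs0 addr0 => ->.
by rewrite mulrC mul_polyC pnormZ mulrC.
Qed.

Lemma pnorm_shift r h u : 0 <= r -> pnorm r (h \Po ('X + u%:P)) <= pnorm (r + cabs u) h.
Proof.
move=> r0; elim/poly_ind: h => [|h c IH].
  by rewrite comp_poly0 -polyC0 !pnormC.
rewrite comp_polyD comp_polyM comp_polyX comp_polyC pnormMXaddC.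
apply: le_trans (pnormD _ _ r0) _; rewrite pnormC lerD2r.
apply: le_trans (pnormMXaddC_le _ _ r0) _; apply: ler_wpM2r => //.
by rewrite addr_ge0 ?cabs_ge0.
Qed.

Lemma cabs_horner_le h x : cabs h.[x] <= pnorm (cabs x) h.
Proof.
rewrite horner_coef /pnorm; elim/big_ind2: _ => [|a b a' b' h1 h2|i _].
- by rewrite cabs0.
- by apply: le_trans (cabsD _ _) _; apply: lerD.
- by rewrite cabsM cabsX.
Qed.

(** Factor [h] linearly. A root $x$ with $|x|\ge r$ contributes at most $r+|x|\le2|x|$ to the norm
    and $|x|$ to the constant term. *)
Lemma pnorm_roots r h : 0 <= r -> (forall x, root h x -> r <= cabs x) ->
  pnorm r h <= 2 ^+ (size h).-1 * cabs h`_0.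
Proof.
move=> r0; have [->|h0] := eqVneq h 0.
  by move=> _; rewrite -polyC0 pnormC cabs0 mulr_ge0 ?exprn_ge0 ?cabs_ge0.
have [s hs] := closed_field_poly_normal h; have lc0 : lead_coef h != 0 by rewrite lead_coef_eq0.
have sz : size h = (size s).+1 by rewrite hs size_scale // size_prod_XsubC.
move=> hr; have {}hr x : x \in s -> r <= cabs x.
  by move=> xs; apply: hr; rewrite hs rootZ // root_prod_XsubC.
rewrite sz hs pnormZ /= coefZ cabsM mulrCA ler_wpM2l ?cabs_ge0 //.
elim: s hr {hs sz} => [|x s IH] hr; first by rewrite big_nil -polyC1 pnormC coefC mul1r.
rewrite big_cons mulrC -polyCN; apply: le_trans (pnormMXaddC_le _ _ r0) _.
have hx := hr x (mem_head _ _).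
have {}IH := IH (fun y ys => hr y (mem_behead (s := x :: s) ys)).
rewrite coefM big_ord1 /= coefD coefX coefC /= add0r cabsM cabsN exprS.
apply: le_trans (ler_wpM2r _ IH) _; first by rewrite addr_ge0 ?cabs_ge0.
have : 0 <= 2 ^+ size s * cabs (\prod_(j <- s) ('X - j%:P))`_0 by rewrite mulr_ge0 ?exprn_ge0 ?cabs_ge0.
move: (cabs _`_0) (2 ^+ size s) (cabs x) hx => u v z hx huv; nra.
Qed.

(** A majorant of the variation of [g] on a disc. Unlike the supremum, it obeys explicit bounds
    under changes of the radius and the centre. *)
Definition osc (g : {poly C}) p r := pnorm r (g \Po ('X + p%:P) - g.[p]%:P).

Lemma taylor_coef0 (g : {poly C}) p : (g \Po ('X + p%:P))`_0 = g.[p].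
Proof. by rewrite -horner_coef0 horner_comp !hornerE. Qed.

Lemma osc_ge0 g p r : 0 <= r -> 0 <= osc g p r. Proof. exact: pnorm_ge0. Qed.

Lemma osc_value g p x : cabs (g.[x] - g.[p]) <= osc g p (cabs (x - p)).
Proof.
apply: le_trans (cabs_horner_le _ _).
by rewrite hornerD hornerN hornerC horner_comp !(hornerD, hornerX, hornerC) subrK.
Qed.

Lemma size_taylor (g : {poly C}) p : size (g \Po ('X + p%:P)) = size g.
Proof. by rewrite size_comp_poly2 // size_XaddC. Qed.

Lemma osc_widen g p r n : (size g <= n.+1)%N ->
  osc g p r = \sum_(i < n) cabs (g \Po ('X + p%:P))`_i.+1 * r ^+ i.+1.
Proof.
move=> hg; rewrite /osc (pnorm_widen r (n := n.+1)); last first.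
  rewrite (leq_trans (size_polyD _ _)) // geq_max size_taylor hg size_polyN size_polyC.
  by case: (_ != 0).
rewrite big_ord_recl coefB coefC /= taylor_coef0 subrr cabs0 mul0r add0r.
by apply: eq_bigr => i _; rewrite coefB coefC /= subr0.
Qed.

Lemma osc_shrink g p r t : 0 <= r -> 0 <= t <= 1 -> osc g p (t * r) <= t * osc g p r.
Proof.
move=> r0 /andP[t0 t1]; rewrite !(osc_widen _ _ (n := size g)) // mulr_sumr.
apply: ler_sum => i _; rewrite mulrCA ler_wpM2l ?cabs_ge0 // exprMn ler_wpM2r ?exprn_ge0 //.
by rewrite exprS ler_piMr // exprn_ile1.
Qed.

Lemma osc_mono g p r r' : 0 <= r -> r <= r' -> osc g p r <= osc g p r'.
Proof.
move=> r0 rr; rewrite !(osc_widen _ _ (n := size g)) //.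
by apply: ler_sum => i _; rewrite ler_wpM2l ?cabs_ge0 // lerXn2r ?nnegrE // (le_trans r0).
Qed.

Lemma osc_grow g p r t d : (size g <= d.+1)%N -> 0 <= r -> 1 <= t ->
  osc g p (t * r) <= t ^+ d * osc g p r.
Proof.
move=> hg r0 t1; rewrite !(osc_widen _ _ hg) mulr_sumr.
apply: ler_sum => i _; rewrite mulrCA ler_wpM2l ?cabs_ge0 // exprMn ler_wpM2r ?exprn_ge0 //.
by apply: ler_weXn2l => //; apply: ltn_ord.
Qed.

Lemma osc_shift g p a r : 0 <= r -> osc g p r <= osc g a (r + cabs (p - a)).
Proof.
move=> r0; pose h := g \Po ('X + a%:P) - g.[a]%:P.
apply: le_trans (pnorm_shift h (p - a) r0); apply: pnorm_le => // -[|i].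
  by rewrite coefB coefC /= taylor_coef0 subrr cabs0 cabs_ge0.
rewrite /h comp_polyB comp_polyC -comp_polyA comp_polyD comp_polyX comp_polyC.
by rewrite -addrA -polyCD subrK !coefB !coefC.
Qed.

Lemma osc_gt0 g p r : (1 < size g)%N -> 0 < r -> 0 < osc g p r.
Proof.
move=> hg r0; rewrite (osc_widen _ _ (leqSpred (size g))).
have [m hm] : exists m, (size g).-1 = m.+1 by case: (size g) hg => [|[|m]] // _; exists m.
rewrite hm big_ord_recr /= ltr_wpDl ?sumr_ge0 // => [i _|].
  by rewrite mulr_ge0 ?cabs_ge0 ?exprn_ge0 // ltW.
rewrite mulr_gt0 ?exprn_gt0 // cabs_gt0 -hm -(size_taylor g p) -lead_coefE lead_coef_eq0.
by rewrite -size_poly_gt0 size_taylor (ltn_trans _ hg).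
Qed.

(** If the disc missed the value $w$, [pnorm_roots] for $g-w$ would bound the oscillation by
    $2^d|w-g(p)|$. *)
Lemma osc_cover g p r w d : (size g <= d.+1)%N -> 0 <= r ->
  2 ^+ d * cabs (w - g.[p]) < osc g p r -> exists2 x, cabs (x - p) < r & g.[x] = w.
Proof.
move=> hg r0 hw; pose h := g \Po ('X + p%:P) - w%:P.
have hc : h`_0 = g.[p] - w by rewrite coefB coefC /= taylor_coef0.
have [[x [hx xr]]|no] := EM (exists x, root h x /\ cabs x < r).
  exists (x + p); first by rewrite addrK.
  by move: hx; rewrite rootE hornerD hornerN hornerC horner_comp !(hornerD, hornerX, hornerC) subr_eq0 => /eqP.
have hr x : root h x -> r <= cabs x.
  by move=> hx; rewrite leNgt; apply/negP => xr; apply: no; exists x.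
have := pnorm_roots r0 hr; rewrite hc -cabsN opprB.
have h1 : osc g p r <= pnorm r h.
  apply: pnorm_le => // -[|i]; first by rewrite coefB coefC /= taylor_coef0 subrr cabs0 cabs_ge0.
  by rewrite !coefB !coefC.
have h2 : 2 ^+ (size h).-1 * cabs (w - g.[p]) <= 2 ^+ d * cabs (w - g.[p]).
  rewrite ler_wpM2r ?cabs_ge0 // ler_weXn2l ?ler1n // -ltnS.
  have : (size h <= d.+1)%N.
    rewrite (leq_trans (size_polyD _ _)) // geq_max size_taylor hg size_polyN size_polyC.
    by case: (_ != 0).
  by case: (size h).
by move=> h3; have := lt_le_trans hw (le_trans h1 (le_trans h3 h2)); rewrite ltxx.
Qed.

Definition image_pts (TD : finType) (zd : TD -> C) g p s r : {set TD} :=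
  [set z | `[< exists x, s <= cabs (x - p) <= r /\ g.[x] = zd z >]].

Definition cell (Lam : R) (p : C) (s r : R) (a : C) : Prop :=
  Lam * s <= cabs (a - p) /\ Lam * cabs (a - p) <= r.

Section Image.
Variables (TA TD : finType) (pa : TA -> C) (zd : TD -> C) (g : {poly C}) (d K : nat).
Hypothesis pa_inj : injective pa.
Hypothesis hg : (1 < size g <= d.+1)%N.
Variables (p : C) (s r : R).
Hypotheses (s0 : 0 <= s) (r0 : 0 < r).
(** In $16^d=2^d8^d$ the factor $8^d$ pays for the change of centre and radius, $2^d$ for
    [osc_cover], and 18 exceeds $17=16+1$, the number of oscillations by which a core value may miss
    $g(a)$ in the proof of [cell_lower]. *)
Let Lam : R := 18 * 16 ^+ d.
Hypothesis hK : (#|image_pts zd g p s r| <= K)%N.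
Hypothesis hcore : s = 0 \/ exists2 core : {set TA}, (d * K < #|core|)%N &
  forall x, x \in core -> cabs (pa x - p) <= s /\ exists z, g.[pa x] = zd z.

(** If $g(a)$ were near $g(p)$, the disc of radius $|a-p|/4$ about [a] would cover all values of [g]
    on the core. More than $dK$ core points give more than [K] such values, but the annulus has at
    most [K] image points. *)
Lemma cell_lower a : cell Lam p s r a -> 16 * osc g p s <= cabs (g.[a] - g.[p]).
Proof.
have /andP[hg1 hg2] := hg; move=> [ha1 ha2].
have L18 : 18 <= Lam by rewrite /Lam ler_peMr ?ler0n // exprn_ege1 // ler1n.
have L0 : 0 < Lam by apply: lt_le_trans L18.
have hs0 : s = 0 -> 16 * osc g p s <= cabs (g.[a] - g.[p]).
  move=> sz; have := osc_shrink g p (t := 0) (ltW r0); rewrite lexx ler01 !mul0r => /(_ isT).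
  by have := cabs_ge0 (g.[a] - g.[p]); rewrite sz; lra.
case: hcore => [/hs0 //|[core hc hcore']].
have [//|hlt] := leP; exfalso; move: hc; apply/negP; rewrite -leqNgt.
have [/hs0|spos] := eqVneq s 0; first by move: hlt; lra.
have {}spos : 0 < s by rewrite lt_neqAle eq_sym spos.
have ap : 0 < cabs (a - p) by apply: lt_le_trans ha1; rewrite mulr_gt0.
pose t := cabs (a - p) / 4; have t0 : 0 < t by rewrite divr_gt0.
have o1 : osc g p (cabs (a - p)) <= 8 ^+ d * osc g a t.
  apply: le_trans (osc_shift g p a (cabs_ge0 _)) _; rewrite -[cabs (p - a)]cabsN opprB.
  rewrite (_ : cabs (a - p) + cabs (a - p) = 8 * t); last by rewrite /t; field.
  by apply: osc_grow => //; [apply: ltW|rewrite ler1n].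
have o2 : Lam * osc g p s <= osc g p (cabs (a - p)).
  apply: le_trans (osc_mono g p _ ha1); last by rewrite mulr_ge0 // ltW.
  have := osc_shrink g p (r := Lam * s) (t := Lam^-1); rewrite mulKf ?gt_eqF //.
  rewrite invr_ge0 invf_le1 // (ltW L0) mulr_ge0 ?(ltW L0) // => /(_ isT).
  rewrite (le_trans _ L18) ?ler1n // => /(_ isT) h.
  by rewrite -ler_pdivlMl.
have ot : 0 < osc g a t by apply: osc_gt0.
have key z : cabs (z - g.[p]) <= osc g p s -> exists2 x, cabs (x - a) < t & g.[x] = z.
  move=> hz; apply: (osc_cover hg2 (ltW t0)).
  have hz2 : cabs (z - g.[a]) <= 17 * osc g p s.
    have := cabsD (z - g.[p]) (g.[p] - g.[a]); rewrite addrA subrK -[cabs (g.[p] - _)]cabsN opprB.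
    by move: hlt hz; lra.
  have p2 : 0 < (2 : R) ^+ d by rewrite exprn_gt0.
  have p8 : 0 < (8 : R) ^+ d by rewrite exprn_gt0.
  have e16 : (16 : R) ^+ d = 2 ^+ d * 8 ^+ d by rewrite -exprMn -natrM.
  have os : 0 <= osc g p s by apply: osc_ge0.
  have : 18 * (2 ^+ d * osc g p s) <= osc g a t.
    rewrite -(ler_pM2l p8); apply: le_trans o1; apply: le_trans o2.
    by rewrite /Lam e16 le_eqVlt; apply/orP; left; apply/eqP; ring.
  have : 2 ^+ d * cabs (z - g.[a]) <= 17 * (2 ^+ d * osc g p s).
    by rewrite mulrCA ler_pM2l.
  have := mulr_ge0 (ltW p2) os; move: ot; move: (2 ^+ d * osc g p s) (2 ^+ d * cabs _) => u v; lra.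
pose Z := image_pts zd g p s r.
have hz x : exists z : option TD, x \in core -> exists2 z0, z = Some z0 & g.[pa x] = zd z0.
  have [xc|] := boolP (x \in core); last by exists None.
  by have [_ [z hz]] := hcore' x xc; exists (Some z) => _; exists z.
have [zf hzf] := choice hz.
rewrite mulnC; apply: leq_trans (_ : #|[set Some z | z in Z]| * d <= _)%N; last first.
  by rewrite leq_mul2r card_imset ?hK ?orbT // => u v [].
apply: (leq_card_fibers_in (h := zf)) => [x xc|y].
  have [z0 -> e] := hzf x xc; apply/imsetP; exists z0 => //; rewrite /Z /image_pts in_set; apply/asboolP.
  have [x' hx' e'] : exists2 x', cabs (x' - a) < t & g.[x'] = zd z0.
    apply: key; rewrite -e; apply: le_trans (osc_value _ _ _) _.
    by apply: osc_mono; [apply: cabs_ge0|apply: (hcore' x xc).1].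
  exists x'; split=> //; have := cabs_tri a x' p; have := cabs_tri x' a p.
  rewrite [cabs (a - x')]cabsB; move: hx'; rewrite /t => hx' h1 h2.
  apply/andP; split.
    have : 2 * s <= Lam * s by rewrite ler_pM2r //; apply: le_trans L18; rewrite ler_nat.
    by move: ha1 spos; lra.
  have : 2 * cabs (a - p) <= Lam * cabs (a - p) by rewrite ler_pM2r //; apply: le_trans L18; rewrite ler_nat.
  by move: ha2; lra.
case: y => [z0|]; last first.
  rewrite (_ : [set x in core | _] = set0) ?cards0 //; apply/setP => x; rewrite !in_set.
  by apply/negP => /andP[/hzf[z0 ->]].
set F := [set x in core | _].
have nz : g - (zd z0)%:P != 0.
  by rewrite subr_eq0; apply: contraTneq hg1 => ->; rewrite size_polyC -leqNgt leq_b1.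
rewrite cardE -(size_map pa) -ltnS; apply: leq_trans (max_poly_roots nz _ _) _.
- apply/allP => y /mapP[x]; rewrite mem_enum in_set => /andP[xc /eqP e] ->.
  have [z1 e1 e2] := hzf x xc; rewrite e1 in e; case: e => e.
  by rewrite rootE hornerD hornerN hornerC e2 e subrr.
- by rewrite map_inj_uniq ?enum_uniq.
- rewrite (leq_trans (size_polyD _ _)) // geq_max hg2 size_polyN size_polyC.
  by case: (_ != 0).
Qed.

(** Around $g(p)$ take the annulus from twice the oscillation at radius [s] to a fraction of the one
    at radius [r]. By [osc_cover] a given value in it has a preimage in the large disc, and by its
    distance from $g(p)$ this preimage lies outside radius [s]. *)
Lemma image_close a a' : cell Lam p s r a -> cell Lam p s r a' -> close zd K g.[a] g.[a'].
Proof.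
have /andP[hg1 hg2] := hg.
have L18 : 18 <= Lam by rewrite /Lam ler_peMr ?ler0n // exprn_ege1 // ler1n.
have L0 : 0 < Lam by apply: lt_le_trans L18.
move=> ha ha'; have p2 : 0 < (2 : R) ^+ d by rewrite exprn_gt0.
pose r' := osc g p r / (2 * 2 ^+ d).
have up b : cell Lam p s r b -> 8 * cabs (g.[b] - g.[p]) <= r'.
  move=> [_ hb]; rewrite /r' ler_pdivlMr ?mulr_gt0 //.
  have h1 : cabs (g.[b] - g.[p]) <= Lam^-1 * osc g p r.
    apply: le_trans (osc_value _ _ _) _; apply: le_trans (osc_shrink _ _ (ltW r0) _); last first.
      by rewrite invr_ge0 (ltW L0) invf_le1 // (le_trans _ L18) // ler1n.
    by apply: osc_mono; rewrite ?cabs_ge0 // ler_pdivlMl.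
  have h2 : 16 * 2 ^+ d <= Lam.
    apply: ler_pM; rewrite ?exprn_ge0 ?ler_nat //.
    by apply: lerXn2r; rewrite ?nnegrE ?ler0n ?ler_nat.
  have o := osc_ge0 g p (ltW r0).
  rewrite mulrACA (_ : 8 * 2 = 16); last by rewrite -natrM.
  rewrite mulrCA mulrA; apply: le_trans (_ : Lam * cabs (g.[b] - g.[p]) <= _); last first.
    by rewrite -ler_pdivlMl.
  by rewrite mulrC; apply: le_trans (ler_wpM2r (cabs_ge0 _) h2); rewrite le_eqVlt; apply/orP; left; apply/eqP; ring.
exists g.[p], (2 * osc g p s), r'; split.
- by rewrite mulr_ge0 // osc_ge0.
- by rewrite mulrA -natrM; split; apply: cell_lower.
- by split; apply: up.
apply: leq_trans hK; apply: subset_leq_card; apply/subsetP => z; rewrite /ann /image_pts !in_set => /andP[z1 z2].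
apply/asboolP; have or : 0 < osc g p r by apply: osc_gt0.
have [x hx e] : exists2 x, cabs (x - p) < r & g.[x] = zd z.
  apply: (osc_cover hg2 (ltW r0)); have : cabs (zd z - g.[p]) * (2 * 2 ^+ d) <= osc g p r.
    by rewrite -ler_pdivlMr // mulr_gt0.
  by rewrite mulrA mulrAC [_ * 2 ^+ d]mulrC => h; move: or h; move: (2 ^+ d * _) => u; lra.
exists x; rewrite (ltW hx) andbT; split=> //; rewrite leNgt; apply/negP => xs.
have sp : 0 < s by apply: le_lt_trans xs; apply: cabs_ge0.
have := osc_value g p x; have := osc_mono g p (cabs_ge0 (x - p)) (ltW xs).
by have := osc_gt0 p hg1 sp; move: z1; rewrite e; lra.
Qed.
End Image.
End Annuli.

Lemma double_count (K T : finType) (P : K -> T -> bool) :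
  (\sum_k #|[set z | P k z]| = \sum_z #|[set k | P k z]|)%N.
Proof.
transitivity (\sum_k \sum_z P k z : nat)%N.
  by apply: eq_bigr => k _; rewrite -sum1dep_card big_mkcond; apply: eq_bigr => z _; case: (P k z).
rewrite exchange_big; apply: eq_bigr => z _; rewrite -[RHS]sum1dep_card [RHS]big_mkcond.
by apply: eq_bigr => k _; case: (P k z).
Qed.

Lemma card_close_ords m w (S : {set 'I_m}) :
  (forall k k', k \in S -> k' \in S -> (k' < k + w)%N) -> (#|S| <= w)%N.
Proof.
move=> h; have [->|[k0 k0S]] := set_0Vmem S; first by rewrite cards0.
have [k kS hk] : exists2 k, k \in S & forall k', k' \in S -> (k <= k')%N.
  by case: (arg_minnP (fun k : 'I_m => val k) k0S) => k kS hk; exists k.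
have w0 : (0 < w)%N by have := h k k kS kS; lia.
case: w w0 h => // w _ h.
pose g (k' : 'I_m) : 'I_w.+1 := inord (k' - k).
have gi : {in S &, injective g}.
  move=> a b aS bS /(congr1 val); rewrite /= !inordK; last 2 first.
  - by have := h k b kS bS; have := hk b bS; lia.
  - by have := h k a kS aS; have := hk a aS; lia.
  by move=> e; apply: val_inj => /=; have := hk a aS; have := hk b bS; lia.
by rewrite -(card_in_imset gi) (leq_trans (max_card _)) ?card_ord.
Qed.

(** * Annuli with many points inside and few around *)

Section Cells.
Variable R : realType.
Local Notation C := R[i].
Variables (T : finType) (v : T -> C).
Hypothesis v_inj : injective v.

Definition disc (p : C) (r : R) : {set T} := [set z | cabs (v z - p) <= r].

(** A square grid of mesh [eps / 2]: two points in one square are at distance below [eps]. *)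
Lemma grid_packing (S : {set T}) (x : C) rad eps (G h : nat) : 0 < eps -> 2 * rad <= G%:R * eps ->
  (forall a, a \in S -> cabs (v a - x) <= rad) ->
  (forall a, a \in S -> (#|[set z in S | (cabs (v z - v a) < eps)%R]| <= h)%N) ->
  (#|S| <= (2 * G).+1 ^ 2 * h)%N.
Proof.
move=> e0 hG hrad heps.
pose fl (t : R) : int := Num.floor (t * 2 / eps).
pose ix (t : R) : 'I_(2 * G).+1 := inord (absz (fl t + G%:Z)).
have bnd t : `|t| <= rad -> (- G%:Z <= fl t <= G%:Z)%R.
  move=> ht; have : `|t * 2 / eps| <= G%:R.
    rewrite normrM normfV [`|eps|]gtr0_norm // ler_pdivrMr // normrM normr_nat mulrC.
    by apply: le_trans hG; rewrite ler_pM2l.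
  rewrite ler_norml => /andP[h1 h2]; apply/andP; split.
    by rewrite floor_ge_int mulrNz.
  by rewrite -(ler_int R); apply: le_trans h2; apply: floor_le.
have ixP t t' : `|t| <= rad -> `|t'| <= rad -> ix t = ix t' -> `|t - t'| < eps / 2.
  move=> ht ht' /(congr1 val); have /andP[a1 a2] := bnd _ ht; have /andP[b1 b2] := bnd _ ht'.
  rewrite /= !inordK; [|lia|lia] => e; have {}e : fl t = fl t' by lia.
  have f1 := floor_itv (t * 2 / eps); have f2 := floor_itv (t' * 2 / eps).
  have : `|(t - t') * 2 / eps| < 1.
    have -> : (t - t') * 2 / eps = t * 2 / eps - t' * 2 / eps by ring.
    by move: f1 f2; rewrite -/(fl t) -/(fl t') e intrD => /andP[? ?] /andP[? ?]; rewrite ltr_norml; lra.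
  rewrite !normrM normfV [`|eps|]gtr0_norm // ltr_pdivrMr // normr_nat mul1r => hh.
  by rewrite ltr_pdivlMr.
have ReIm (z : C) : `|complex.Re z| <= cabs z /\ `|complex.Im z| <= cabs z.
  rewrite /cabs normc_def; case: z => a b /=; split.
    by rewrite -sqrtr_sqr ler_wsqrtr // lerDl sqr_ge0.
  by rewrite -sqrtr_sqr ler_wsqrtr // lerDr sqr_ge0.
pose g a := (ix (complex.Re (v a - x)), ix (complex.Im (v a - x))).
have := @leq_card_fibers_in _ _ S setT g h; rewrite cardsT card_prod !card_ord mulnn; apply.
  by move=> y _; rewrite inE.
move=> y; set F := [set _ in S | _].
have [->|[a aF]] := set_0Vmem F; first by rewrite cards0.
have /andP[aS /eqP ga] : (a \in S) && (g a == y) by move: aF; rewrite in_set.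
apply: leq_trans (heps a aS); apply: subset_leq_card; apply/subsetP => b; rewrite !in_set.
move=> /andP[bS /eqP gb]; rewrite bS /=.
have [ra ia] := ReIm (v a - x); have [rb ib] := ReIm (v b - x).
have ha := hrad a aS; have hb := hrad b bS.
move: gb; rewrite -ga => -[g1 g2].
have h1 := ixP _ _ (le_trans rb hb) (le_trans ra ha) g1.
have h2 := ixP _ _ (le_trans ib hb) (le_trans ia ha) g2.
have -> : v b - v a = (v b - x) - (v a - x) by ring.
apply: le_lt_trans (cabs_ReIm _) _.
rewrite !raddfB /=; move: h1 h2; rewrite !raddfB /=; lra.
Qed.

(** The bound [rho] concerns the annulus widened by 8, so that overlaps can be counted with
    [close_card]. The core of more than [Q] points is what [cell_lower] uses to keep images away
    from the centre value. *)
Definition good_cell (Lam : R) (h rho Q : nat) (a : C) : Prop :=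
  exists p s r (S : {set T}), [/\ 0 <= s /\ 0 < r, cell Lam p s r a,
    (h <= #|S|)%N /\ forall x, x \in S -> cell Lam p s r (v x),
    (#|ann v p (s / 8) (8 * r)| <= rho)%N & s = 0 \/ (Q < #|disc p s|)%N].

(** List [S] by distance from [x]. An annulus of ratio $\Lambda^2$ holds at most [W] points of [S],
    so moving [W] places multiplies the distance by more than $\Lambda^2$, and the window about a
    place is a cell with the required margins. A point lies in at most [5 * W] windows, hence few
    windows contain more than [rho] points. *)
Lemma sliding_windows (Lam : R) (h rho Q W M : nat) (S : {set T}) (x : C) :
  18 <= Lam -> (0 < h <= W)%N -> (0 < rho)%N ->
  (forall a, a \in S -> 0 < cabs (v a - x)) ->
  (forall t, 0 < t -> (#|[set a in S | (t <= cabs (v a - x) <= Lam ^+ 2 * t)%R]| <= W)%N) ->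
  (forall a, a \in S -> (#|disc x (cabs (v a - x)%R)| <= M)%N) ->
  (rho * #|S| <= rho * #|[set a in S | `[< good_cell Lam h rho Q (v a) >]]| +
    rho * (Q + 5 * W) + 5 * W * M)%N.
Proof.
move=> L18 /andP[h0 hW] rho0 Spos hscale hM.
have [->|[x0 x0S]] := set_0Vmem S; first by rewrite cards0 muln0.
pose dl a := cabs (v a - x).
pose le_dl : rel T := fun a b => dl a <= dl b.
pose L := sort le_dl (enum S).
have tot : total le_dl by move=> a b; apply: le_total.
have trn : transitive le_dl by move=> b a c; apply: le_trans.
have srt : sorted le_dl L by apply: sort_sorted.
have uL : uniq L by rewrite sort_uniq enum_uniq.
have mL a : (a \in L) = (a \in S) by rewrite mem_sort mem_enum.
set m := #|S|.
have sL : size L = m by rewrite size_sort -cardE.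
pose el k := nth x0 L k.
have elS k : (k < m)%N -> el k \in S by move=> hk; rewrite -mL mem_nth ?sL.
have mono i j : (i <= j < m)%N -> dl (el i) <= dl (el j).
  move=> /andP[ij jm]; apply: (sorted_leq_nth trn _ x0 srt) => //; rewrite ?inE ?sL //.
    by move=> a; apply: lexx.
  exact: leq_ltn_trans ij jm.
have eli i j : (i < m)%N -> (j < m)%N -> el i = el j -> i = j.
  by move=> im jm /eqP; rewrite nth_uniq ?sL // => /eqP.
have jump k : (k + W < m)%N -> Lam ^+ 2 * dl (el k) < dl (el (k + W)%N).
  move=> kW; rewrite ltNge; apply/negP => hle.
  have km : (k < m)%N by lia.
  have := hscale _ (Spos _ (elS k km)); apply/negP; rewrite -ltnNge.
  pose g (i : 'I_W.+1) := el (k + i)%N.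
  have gi : injective g.
    move=> i j /eli e; apply: val_inj => /=; have hi := ltn_ord i; have hj := ltn_ord j.
    by have := e ltac:(clear -hi kW; lia) ltac:(clear -hj kW; lia); clear; lia.
  rewrite -[leqLHS]card_ord -(card_imset _ gi); apply: subset_leq_card.
  apply/subsetP => _ /imsetP[i _ ->]; have hi := ltn_ord i.
  rewrite in_set elS /=; last by clear -hi kW; lia.
  rewrite -!/(dl _) mono /=; last by clear -hi kW; lia.
  by apply: le_trans hle; apply: mono; clear -hi kW; lia.
(* Places with two windows and the core of more than [Q] points on the inside, and three windows on
   the outside. *)
pose mid (k : 'I_m) := (Q + 2 * W <= k)%N && (k + 3 * W < m)%N.
pose P (k : 'I_m) (z : T) := mid k && (dl (el (k - 2 * W)%N) < dl z < dl (el (k + 3 * W)%N)).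
pose gd := [set a in S | `[< good_cell Lam h rho Q (v a) >]].
have L2 : 324 <= Lam ^+ 2 by rewrite expr2; move: L18; nra.
have L0 : 0 < Lam by apply: lt_le_trans L18.
have hgood k : mid k -> (#|[set z | P k z]| <= rho)%N -> el k \in gd.
  move=> hk hc; have /andP[k1 k2] := hk; rewrite in_set elS // /=; apply/asboolP.
  have j1 := jump (k - 2 * W)%N ltac:(clear -k1 k2 h0 hW; lia); have j2 := jump (k - W)%N ltac:(clear -k1 k2 h0 hW; lia).
  have e1 : ((k - 2 * W + W) = k - W)%N by clear -k1; lia.
  have e2 : ((k - W + W) = k)%N by clear -k1; lia.
  rewrite e1 in j1; rewrite e2 in j2.
  have j3 := jump (k + W)%N ltac:(clear -k1 k2 h0 hW; lia); have j4 := jump (k + 2 * W)%N ltac:(clear -k1 k2 h0 hW; lia).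
  have e3 : ((k + W + W) = k + 2 * W)%N by clear; lia.
  have e4 : ((k + 2 * W + W) = k + 3 * W)%N by clear; lia.
  rewrite e3 in j3; rewrite e4 in j4.
  have j5 := jump k ltac:(clear -k1 k2 h0 hW; lia).
  have p1 : 0 < dl (el (k - W)%N) by apply/Spos/elS; clear -k1 k2; lia.
  have p2 : 0 < dl (el (k + 2 * W)%N) by apply/Spos/elS; clear -k1 k2; lia.
  have p3 : 0 < dl (el (k - 2 * W)%N) by apply/Spos/elS; clear -k1 k2; lia.
  have inner i : (k <= i <= k + W)%N -> cell Lam x (dl (el (k - W)%N)) (dl (el (k + 2 * W)%N)) (v (el i)).
    move=> hi; have m1 := mono k i ltac:(clear -hi k2; lia); have m2 := mono i (k + W)%N ltac:(clear -hi k2; lia).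
    split; rewrite -/(dl _).
      have : Lam * dl (el (k - W)%N) <= Lam ^+ 2 * dl (el (k - W)%N).
        by rewrite ler_pM2r // expr2 ler_peMl ?(ltW L0) //; move: L18; lra.
      by move: m1 j2; lra.
    have p4 : 0 <= dl (el i) by apply: cabs_ge0.
    have : Lam * dl (el i) <= Lam ^+ 2 * dl (el (k + W)%N).
      apply: ler_pM => //; first exact: ltW.
      by rewrite expr2 ler_peMl ?(ltW L0) //; move: L18; lra.
    by move: j3; lra.
  exists x, (dl (el (k - W)%N)), (dl (el (k + 2 * W)%N)), [set el (k + nat_of_ord i)%N | i : 'I_W]; split.
  - by split=> //; apply: ltW.
  - by apply: inner; rewrite leqnn leq_addr.
  - split.
      rewrite card_imset ?card_ord // => i j /eli e; apply: val_inj => /=.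
      have hi := ltn_ord i; have hj := ltn_ord j.
      by have := e ltac:(clear -hi k2; lia) ltac:(clear -hj k2; lia); clear; lia.
    by move=> _ /imsetP[i _ ->]; apply: inner; have hi := ltn_ord i; clear -hi; lia.
  - apply: leq_trans hc; apply: subset_leq_card; apply/subsetP => z; rewrite !in_set => /andP[z1 z2].
    rewrite /P hk /= -/(dl z) in z1 z2 *; apply/andP; split.
      have : 324 * dl (el (k - 2 * W)%N) <= Lam ^+ 2 * dl (el (k - 2 * W)%N) by rewrite ler_pM2r.
      by move: z1 j1 p3; lra.
    have : 324 * dl (el (k + 2 * W)%N) <= Lam ^+ 2 * dl (el (k + 2 * W)%N) by rewrite ler_pM2r.
    by move: z2 j4 p2; lra.
  - right; pose g (i : 'I_Q.+1) := el i.
    have gi : injective g.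
      move=> i j /eli e; apply: val_inj => /=; have hi := ltn_ord i; have hj := ltn_ord j.
      by apply: e; clear -hi hj k1 k2; lia.
    rewrite -[leqLHS]card_ord -(card_imset _ gi); apply: subset_leq_card.
    apply/subsetP => _ /imsetP[i _ ->]; rewrite in_set -/(dl _); apply: mono.
    by have hi := ltn_ord i; clear -hi k1 k2; lia.
pose Bd := [set k : 'I_m | mid k && (rho < #|[set z | P k z]|)%N].
have hB : (rho * #|Bd| <= 5 * W * M)%N.
  have m0 : (0 < m)%N by apply/card_gt0P; exists x0.
  apply: (@leq_trans (\sum_k #|[set z | P k z]|)%N).
    rewrite mulnC -sum_nat_const [leqRHS](bigID (mem Bd)) /=.
    apply: leq_trans (leq_addr _ _); apply: leq_sum => k; rewrite in_set => /andP[_ h1].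
    exact: ltnW.
  rewrite double_count (bigID (mem (disc x (dl (el m.-1))))) /= [X in (_ + X)%N]big1 ?addn0; last first.
    move=> z; rewrite in_set -ltNge -/(dl z) => hz; apply/eqP; rewrite cards_eq0 -subset0.
    apply/subsetP => k; rewrite in_set => /andP[/andP[k1 k2] /andP[_ h2]].
    have := mono (k + 3 * W)%N m.-1 ltac:(clear -k2; lia); move: hz h2; clear; lra.
  apply: (@leq_trans (\sum_(z in disc x (dl (el m.-1))) 5 * W)%N).
    apply: leq_sum => z _; apply: card_close_ords => k k'.
    rewrite !in_set => /andP[/andP[k1 k2] /andP[h1 h2]] /andP[/andP[k3 k4] /andP[h3 h4]].
    rewrite ltnNge; apply/negP => hk; have := mono (k + 3 * W)%N (k' - 2 * W)%N ltac:(clear -hk k4; lia).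
    by move: h2 h3; clear; lra.
  by rewrite sum_nat_const mulnC leq_mul2l hM ?orbT //; apply: elS; clear -m0; lia.
have hm : (m <= #|gd| + (Q + 5 * W) + #|Bd|)%N.
  pose F (k : 'I_m) := el k.
  have Fi : injective F by move=> i j /eli e; apply: val_inj; apply: e.
  pose lo := [set k : 'I_m | (k < Q + 2 * W)%N]; pose hi := [set k : 'I_m | (m <= k + 3 * W)%N].
  have c1 : (#|lo| <= Q + 2 * W)%N.
    by apply: card_close_ords => k k'; rewrite !in_set; clear; lia.
  have c2 : (#|hi| <= 3 * W)%N.
    by apply: card_close_ords => k k'; rewrite !in_set; have := ltn_ord k'; clear; lia.
  have c3 : (#|F @^-1: gd| <= #|gd|)%N.
    by rewrite -(card_imset _ Fi); apply: subset_leq_card; apply/subsetP => _ /imsetP[k h1 ->]; move: h1; rewrite inE.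
  have sub : [set: 'I_m] \subset (F @^-1: gd :|: Bd) :|: (lo :|: hi).
    apply/subsetP => k _; rewrite !in_setU; have [mk|mk] := boolP (mid k).
      have [hr|hr] := leqP #|[set z | P k z]| rho.
        have kg : k \in F @^-1: gd by rewrite inE; apply: hgood.
        by rewrite kg.
      have kB : k \in Bd by rewrite in_set mk hr.
      by rewrite kB orbT.
    have : (k \in lo) || (k \in hi).
      by move: mk; rewrite negb_and -leqNgt -ltnNge [k \in lo]in_set [k \in hi]in_set.
    by move=> ->; rewrite orbT.
  have := subset_leq_card sub; rewrite cardsT card_ord => h1.
  apply: leq_trans h1 _; apply: leq_trans (leq_card_setU _ _) _.
  apply: leq_trans (leq_add (leq_card_setU _ _) (leq_card_setU _ _)) _.
  apply: leq_trans (leq_add (leq_add c3 (leqnn _)) (leq_add c1 c2)) _.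
  by move: #|gd| #|Bd|; clear; lia.
have := leq_mul (leqnn rho) hm; rewrite !mulnDr; move: hB; rewrite -/gd -/m; clear; lia.
Qed.

End Cells.

(** * Existence of good cells *)

Section Crowded.
Variable R : realType.
Local Notation C := R[i].
Variables (T : finType) (v : T -> C).
Hypothesis v_inj : injective v.
Variables (Lam : R) (cl K h G F : nat).
Local Notation n := #|T|.
Let w0 := ((2 * G).+1 ^ 2)%N.
Hypotheses (L18 : 18 <= Lam) (h2 : (1 < h)%N) (hn : (h <= n)%N) (ncl : (n < h * K ^ cl)%N).
Hypothesis hG : 2 * Lam ^+ (2 * cl + 2) <= G%:R.
Hypothesis hK : (2 + 16 * cl * (80 * cl * w0 + 5 * w0) <= K)%N.
Hypothesis hF : (F <= K ^ 3)%N.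

Lemma radius a : exists r, [/\ 0 < r, (h <= #|disc v (v a) r|)%N &
  (#|[set z | (cabs (v z - v a) < r)%R]| < h)%N].
Proof.
pose B := [set z | (h <= #|disc v (v a) (cabs (v z - v a)%R)|)%N].
have [z0 _ hz0] := exists_max (fun z => cabs (v z - v a)) (in_setT a).
have z0B : z0 \in B.
  rewrite in_set (_ : disc _ _ _ = setT) ?cardsT //; apply/setP => z.
  by rewrite !in_set hz0 ?in_setT.
have [z1 z1B hz1] := exists_min (fun z => cabs (v z - v a)) z0B.
have h1 : (h <= #|disc v (v a) (cabs (v z1 - v a)%R)|)%N by move: z1B; rewrite in_set.
exists (cabs (v z1 - v a)); split=> //.
  rewrite lt_neqAle cabs_ge0 andbT eq_sym; apply: contraL h1 => /eqP ->; rewrite -ltnNge.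
  apply: leq_ltn_trans h2; rewrite -(cards1 a); apply: subset_leq_card.
  apply/subsetP => z; rewrite in_set in_set1 => hz; apply/eqP; apply: v_inj; apply/eqP; rewrite -subr_eq0 -cabs_eq0.
  by rewrite eq_le hz cabs_ge0.
rewrite ltnNge; apply/negP => hle.
set Y := [set z | _] in hle.
have [e|[y yY]] := set_0Vmem Y; first by rewrite e cards0 in hle; move: h2; clear -hle; lia.
have [y1 y1Y hy1] := exists_max (fun z => cabs (v z - v a)) yY.
have y1B : y1 \in B.
  rewrite in_set; apply: leq_trans hle _; apply: subset_leq_card; apply/subsetP => z zY.
  by rewrite in_set hy1.
by have := hz1 _ y1B; move: y1Y; rewrite in_set => h3; rewrite leNgt h3.
Qed.

(** Enlarge the disc with [h] points about [a] by powers of $\Lambda^2$. Fewer than $hK^{cl}$ points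
    exist, so at some stage [ix a] the next enlargement multiplies their number by less than [K]. If
    the stage is early for half of the points, discs serve as cells. Otherwise a common late stage
    is fixed, and [sliding_windows] about the points [x] around such [a], averaged over [x],
    provides the annuli. *)
Lemma exists_cells : exists rho, (0 < rho <= h * K ^ 6)%N /\ exists Ag : {set T},
  (n <= 8 * cl * K * #|Ag|)%N /\ forall a, a \in Ag -> good_cell v Lam h rho (F * rho) (v a).
Proof.
have K2 : (1 < K)%N by clear -hK; lia.
have h0 : (0 < h)%N by apply: ltnW.
have KX m : (0 < K ^ m)%N by rewrite expn_gt0 (ltnW K2).
have L0 : 0 < Lam by apply: lt_le_trans L18.
have L1 : 1 <= Lam by apply: le_trans L18; rewrite ler1n.
have cl0 : (0 < cl)%N.
  by move: ncl hn; case: (cl) => // ; rewrite expn0 muln1 ltnNge => /negP h1 /h1.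
have [ra hra] := choice radius.
have ra0 a : 0 < ra a by case: (hra a).
have hix a : exists i : 'I_cl, (h * K ^ i <= #|disc v (v a) (Lam ^+ (2 * i) * ra a)%R|)%N /\
    (#|disc v (v a) (Lam ^+ (2 * i + 2) * ra a)%R| < h * K ^ i.+1)%N.
  pose P i := (h * K ^ i <= #|disc v (v a) (Lam ^+ (2 * i) * ra a)%R|)%N.
  have P0 : P 0%N by rewrite /P expn0 muln1 muln0 expr0 mul1r; case: (hra a).
  have Pcl i : P i -> (i < cl)%N.
    move=> Pi; have : (h * K ^ i < h * K ^ cl)%N by apply: leq_ltn_trans ncl; apply: leq_trans Pi (max_card _).
    by rewrite ltn_pmul2l // ltn_exp2l.
  have Pb i : P i -> (i <= cl)%N by move=> /Pcl /ltnW.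
  case: (ex_maxnP (ex_intro P 0%N P0) Pb) => i Pi imax; exists (Ordinal (Pcl i Pi)); split=> //=.
  rewrite ltnNge; apply/negP => hle; have := imax i.+1; rewrite /P mulnS addnC.
  by move=> /(_ hle); rewrite ltnn.
have [ix hixP] := choice hix.
(* From stage 6 on, $\tau=hK^i$ dominates the losses $16\,cl\,(Q+5W)$ of the window argument, in
   which $Q=F\rho$ and $F\le K^3$. *)
pose Ord := [set a | (ix a < 6)%N].
have [big|small] := leqP n (2 * #|Ord|).
  exists (h * K ^ 6)%N; rewrite muln_gt0 h0 KX leqnn; split=> //.
  exists Ord; split.
    apply: leq_trans big _; rewrite leq_mul2r; apply/orP; right.
    by move: cl0 K2; clear; nia.
  move=> a; rewrite in_set => ai; have [i1 i2] := hixP a; set i := ix a in ai i1 i2.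
  exists (v a), 0, (Lam ^+ (2 * i + 1) * ra a), (disc v (v a) (Lam ^+ (2 * i) * ra a)).
  have cellP z : cabs (z - v a) <= Lam ^+ (2 * i) * ra a -> cell Lam (v a) 0 (Lam ^+ (2 * i + 1) * ra a) z.
    move=> hz; split; first by rewrite mulr0 cabs_ge0.
    by rewrite addn1 exprS -mulrA ler_pM2l.
  split.
  - by rewrite lexx mulr_gt0 ?exprn_gt0.
  - by apply: cellP; rewrite subrr cabs0 mulr_ge0 ?exprn_ge0 ?ltW.
  - split; first by apply: leq_trans i1; rewrite leq_pmulr.
    by move=> x; rewrite in_set => /cellP.
  - apply: leq_trans (_ : h * K ^ i.+1 <= _)%N; last by rewrite leq_mul2l leq_exp2l // ai orbT.
    apply: ltnW; apply: leq_ltn_trans i2; apply: subset_leq_card; apply/subsetP => z.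
    rewrite !in_set => /andP[_ hz]; apply: le_trans hz _.
    rewrite addn1 addn2 !exprS !mulrA; do 2! (apply: ler_wpM2r; first by rewrite ?exprn_ge0 ?ltW).
    by move: L18; nra.
  - by left.
have [i [i6 hAi]] : exists i : 'I_cl, (6 <= i)%N /\ (n <= 2 * cl * #|[set a | ix a == i]|)%N.
  apply: contrapT => no.
  have fib : (#|~: Ord| <= cl * (n %/ (2 * cl)))%N.
    rewrite -[X in (X * _)%N]card_ord; apply: (leq_card_fibers (h := ix)) => y.
    rewrite leqNgt; apply/negP => hlt; apply: no; exists y; split.
      have : (0 < #|[set x in ~: Ord | ix x == y]|)%N by apply: leq_ltn_trans hlt.
      by move=> /card_gt0P [a]; rewrite !in_set -leqNgt => /andP[h1 /eqP <-].
    have c2 : (0 < 2 * cl)%N by rewrite muln_gt0.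
    apply: ltnW; apply: leq_trans (ltn_ceil n c2) _; rewrite mulnC leq_mul2l; apply/orP; right.
    apply: leq_trans hlt _; apply: subset_leq_card; apply/subsetP => a; rewrite !in_set.
    by move=> /andP[].
  have := leq_trunc_div n (2 * cl); have := cardsC Ord; move: small fib.
  move: #|Ord| #|~: Ord| (n %/ (2 * cl))%N #|T|; clear => o o' q m; nia.
set Ai := [set a | ix a == i] in hAi.
pose tau := (h * K ^ i)%N; pose W := (w0 * h)%N; pose M := (tau * K)%N.
pose rho := (80 * cl * K * W)%N; pose Q := (F * rho)%N.
have w00 : (0 < w0)%N by rewrite expn_gt0.
have W0 : (0 < W)%N by rewrite muln_gt0 w00.
have rho0 : (0 < rho)%N by rewrite !muln_gt0 cl0 (ltnW K2).
have AiP a : a \in Ai -> (tau <= #|disc v (v a) (Lam ^+ (2 * i) * ra a)%R|)%N /\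
    (#|disc v (v a) (Lam ^+ (2 * i + 2) * ra a)%R| < M)%N.
  rewrite in_set => /eqP e; have := hixP a; rewrite e /tau /M /tau expnSr mulnA; exact.
(* Each [a] of the class belongs to [X x] for at least $\tau-h\ge\tau/2$ points [x], which is what
   the averaging over [x] needs. *)
pose X x := [set a in Ai | ra a <= cabs (v a - v x) <= Lam ^+ (2 * i) * ra a].
have XP x a : a \in X x -> [/\ a \in Ai, ra a <= cabs (v a - v x) &
    cabs (v a - v x) <= Lam ^+ (2 * i) * ra a].
  by rewrite in_set => /andP[? /andP[? ?]].
have Li a : 2 * (Lam ^+ (2 * i) * ra a) <= Lam ^+ (2 * i + 2) * ra a.
  rewrite addn2 !exprS !mulrA ler_pM2r // ler_pM2r ?exprn_gt0 //; move: L18; nra.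
have hwin x : (rho * #|X x| <= rho * #|[set a in X x | `[< good_cell v Lam h rho Q (v a) >]]| +
    rho * (Q + 5 * W) + 5 * W * M)%N.
  apply: (@sliding_windows _ _ v Lam h rho Q W M (X x) (v x)) => //.
  - by rewrite h0 leq_pmull.
  - by move=> a /XP[_ h3 _]; apply: lt_le_trans h3.
  - move=> t t0; set Y := [set a in X x | _].
    have YP a : a \in Y -> a \in X x /\ t <= cabs (v a - v x) <= Lam ^+ 2 * t.
      by rewrite in_set => /andP[].
    apply: (@grid_packing _ _ v Y (v x) (Lam ^+ 2 * t) (t / Lam ^+ (2 * i)) G h).
    + by rewrite divr_gt0 ?exprn_gt0.
    + rewrite (_ : G%:R * (t / Lam ^+ (2 * i)) = (G%:R / Lam ^+ (2 * i)) * t); last by ring.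
      rewrite mulrA ler_pM2r // ler_pdivlMr ?exprn_gt0 // -mulrA -exprD.
      apply: le_trans hG; rewrite ler_pM2l // ler_weXn2l // addnC leq_add2r leq_mul2l.
      by rewrite ltnW.
    + by move=> a /YP[_ /andP[]].
    move=> a /YP[/XP[_ h3 h4] /andP[h5 _]]; have [_ _ h6] := hra a.
    apply: ltnW; apply: leq_ltn_trans h6; apply: subset_leq_card; apply/subsetP => z.
    rewrite !in_set => /andP[_ hz]; apply: lt_le_trans hz _.
    by rewrite ler_pdivrMr ?exprn_gt0 // mulrC (le_trans h5).
  move=> a /XP[aA h3 h4]; have [_ h5] := AiP a aA; apply: ltnW; apply: leq_ltn_trans h5.
  apply: subset_leq_card; apply/subsetP => z; rewrite !in_set => hz.
  apply: le_trans (cabs_tri (v x) _ _) _; rewrite [cabs (v x - _)]cabsB.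
  by apply: le_trans (Li a); move: hz h4; lra.
have sumX : (#|Ai| * tau <= 2 * \sum_x #|X x|)%N.
  have -> : (\sum_x #|X x| = \sum_a #|[set x | a \in X x]|)%N.
    rewrite -(double_count (fun x a => a \in X x)); apply: eq_bigr => x _.
    by apply: eq_card => a; rewrite in_set.
  rewrite big_distrr /= [leqRHS](bigID (mem Ai)) /=; apply: leq_trans (leq_addr _ _).
  rewrite -sum_nat_const; apply: leq_sum => a aA.
  have [h3 _] := AiP a aA; have [_ _ h4] := hra a.
  have : (#|disc v (v a) (Lam ^+ (2 * i) * ra a)%R| <= #|[set x | a \in X x]| +
      #|[set z | (cabs (v z - v a) < ra a)%R]|)%N.
    apply: leq_trans (leq_card_setU _ _); apply: subset_leq_card; apply/subsetP => z.
    rewrite in_setU [z \in disc _ _ _]in_set [z \in [set x | _]]in_set [a \in _]in_set aA /=.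
    by rewrite [z \in _]in_set [cabs (v a - _)]cabsB => ->; rewrite andbT; case: leP.
  have : (2 * h <= tau)%N.
    rewrite /tau mulnC leq_mul2l; apply/orP; right; apply: leq_trans K2 _.
    by case: (nat_of_ord i) i6 => // u _; rewrite expnS leq_pmulr.
  move: h3 h4; move: #|disc _ _ _| #|[set x | a \in _]| #|[set z | _]| (tau); clear; lia.
pose Ag := [set a | `[< good_cell v Lam h rho Q (v a) >]].
have sumG : (\sum_x #|[set a in X x | `[< good_cell v Lam h rho Q (v a) >]]| <= #|Ag| * M)%N.
  rewrite (double_count (fun x a => (a \in X x) && `[< good_cell v Lam h rho Q (v a) >])).
  rewrite (bigID (mem Ag)) /= [X in (_ + X)%N]big1 ?addn0; last first.
    move=> a; rewrite in_set => /negbTE na; apply/eqP; rewrite cards_eq0; apply/eqP/setP => x.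
    by rewrite !in_set na andbF.
  rewrite -sum_nat_const; apply: leq_sum => a _.
  have [aA|aA] := boolP (a \in Ai); last first.
    rewrite (_ : [set x | _] = set0) ?cards0 //; apply/setP => x.
    by rewrite !in_set; move: aA; rewrite in_set => /negbTE ->.
  have [_ h5] := AiP a aA; apply: ltnW; apply: leq_ltn_trans h5.
  apply: subset_leq_card; apply/subsetP => x; rewrite in_set => /andP[/XP[_ _ h4] _].
  rewrite in_set cabsB; apply: le_trans h4 _; apply: le_trans (Li a).
  by rewrite ler_peMl ?ler1n // mulr_ge0 ?exprn_ge0 ?ltW.
exists rho; split.
  rewrite rho0 /= /rho /W; apply: (@leq_trans (h * (K * K))%N).
    rewrite (_ : 80 * cl * K * (w0 * h) = h * (80 * cl * w0 * K))%N; last by clear; ring.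
    rewrite leq_mul2l leq_mul2r; apply/orP; right; apply/orP; right.
    by move: hK cl0; move: (w0) (cl); clear; nia.
  by rewrite mulnn leq_mul2l leq_exp2l // orbT.
exists Ag; split; last by move=> a; rewrite in_set => /asboolP.
have tot : (rho * \sum_x #|X x| <= rho * (#|Ag| * M) + n * (rho * (Q + 5 * W) + 5 * W * M))%N.
  have -> : (n * (rho * (Q + 5 * W) + 5 * W * M) = \sum_(x : T) (rho * (Q + 5 * W) + 5 * W * M))%N.
    by rewrite sum_nat_const.
  apply: leq_trans (leq_add (leq_mul (leqnn rho) sumG) (leqnn _)).
  rewrite !big_distrr /= -big_split /=; apply: leq_sum => x _; rewrite addnA; exact: hwin.
have b1 : (16 * cl * (Q + 5 * W) <= tau)%N.
  apply: (@leq_trans (h * K ^ 6)%N); last by rewrite leq_mul2l leq_exp2l // i6 orbT.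
  apply: (@leq_trans (16 * cl * (K ^ 4 * (80 * cl * w0 * h) + K ^ 4 * (5 * w0 * h)))%N).
    rewrite leq_mul2l; apply/orP; right; apply: leq_add.
      rewrite /Q /rho /W (_ : F * (80 * cl * K * (w0 * h)) = F * K * (80 * cl * w0 * h))%N; last by clear; ring.
      by rewrite leq_mul2r expnSr leq_mul2r hF !orbT.
    by rewrite /W mulnA leq_pmull.
  rewrite (_ : 16 * cl * _ = h * (K ^ 4 * (16 * cl * (80 * cl * w0 + 5 * w0))))%N; last by clear; ring.
  rewrite leq_mul2l (expnD K 4 2) leq_mul2l; apply/orP; right; apply/orP; right.
  apply: (@leq_trans K); first by apply: leq_trans hK; apply: leq_addl.
  by rewrite -mulnn leq_pmull // ltnW.
have b2 : (16 * cl * (5 * W * M) = rho * tau)%N by rewrite /M /rho; clear; ring.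
have tau0 : (0 < tau)%N by rewrite muln_gt0 h0 KX.
have b3 : (8 * cl * (rho * (Q + 5 * W) + 5 * W * M) <= rho * tau)%N.
  have : (16 * cl * (rho * (Q + 5 * W)) <= rho * tau)%N.
    by rewrite mulnCA leq_mul2l b1 orbT.
  by move: b2; clear; rewrite mulnDr -!mulnA; lia.
set q := (rho * (Q + 5 * W) + 5 * W * M)%N in tot b3.
have b4 : (4 * (n * q) <= #|Ai| * (rho * tau))%N.
  have : (n * (8 * cl * q) <= 2 * cl * #|Ai| * (rho * tau))%N by apply: leq_mul.
  rewrite (_ : n * (8 * cl * q) = 2 * cl * (4 * (n * q)))%N; last by clear; ring.
  by rewrite -[X in (_ <= X)%N]mulnA leq_pmul2l // muln_gt0.
have b5 : (rho * (#|Ai| * tau) <= 2 * (rho * (#|Ag| * M) + n * q))%N.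
  apply: (@leq_trans (2 * (rho * \sum_x #|X x|)))%N; last by rewrite leq_mul2l tot orbT.
  by rewrite [leqRHS]mulnCA leq_mul2l sumX orbT.
have b6 : (rho * tau * #|Ai| <= rho * tau * (4 * K * #|Ag|))%N.
  rewrite /M in b5; move: b4 b5; rewrite -[q]/q; move: #|Ai| #|Ag| (q) (n) (rho) (tau) => x1 x2 x3 x4 x5 x6.
  rewrite (_ : x5 * (x1 * x6) = x5 * x6 * x1)%N; last by clear; ring.
  rewrite (_ : x1 * (x5 * x6) = x5 * x6 * x1)%N; last by clear; ring.
  rewrite (_ : x5 * (x2 * (x6 * K)) = x5 * x6 * (K * x2))%N; last by clear; ring.
  rewrite -[(4 * K * x2)%N]mulnA (mulnCA (x5 * x6)%N 4%N).
  by move: (x5 * x6 * x1)%N (x5 * x6 * (K * x2))%N (x4 * x3)%N; clear; lia.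
have rt0 : (0 < rho * tau)%N by rewrite muln_gt0 rho0.
rewrite (leq_pmul2l rt0) in b6.
apply: leq_trans hAi _; apply: (@leq_trans (2 * cl * (4 * K * #|Ag|))%N).
  by rewrite leq_mul2l b6 orbT.
by rewrite leq_eqVlt; apply/orP; left; apply/eqP; clear; ring.
Qed.
End Crowded.

Lemma card_exists_seq (V : Type) (W : eqType) (T : finType) (rs : seq W) (P : W -> pred T) k :
  (forall x, (#|[set a | P x a]| <= k)%N) ->
  (#|[set a | has (fun x => P x a) rs]| <= size rs * k)%N.
Proof.
move=> hk; elim: rs => [|x rs IH]; first by rewrite (_ : [set a | _] = set0) ?cards0 //; apply/setP => a; rewrite !inE.
have -> : [set a | has (fun x => P x a) (x :: rs)] = [set a | P x a] :|: [set a | has (fun x => P x a) rs].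
  by apply/setP => a; rewrite !inE.
by apply: leq_trans (leq_card_setU _ _) _; rewrite mulSn leq_add.
Qed.

(** * The general case *)

Section Nonaffine.
Variable R : realType.
Local Notation C := R[i].

(** A value has at most [d] preimages. A preimage $x$ in the annulus of [a] is close to [pa a],
    thanks to the widened annulus, and by [close_card] this happens for at most [3 * rho] points
    [a]. *)
Lemma overlap_bound (TA TD : finType) (pa : TA -> C) (zd : TD -> C) (Ag : {set TA})
    (g : {poly C}) (d rho : nat) (cp : TA -> C) (cs cr : TA -> R) :
  injective zd -> (1 < size g <= d.+1)%N ->
  (forall a, a \in Ag -> [/\ 0 <= cs a, cs a <= cabs (pa a - cp a), cabs (pa a - cp a) <= cr a &
     (#|ann pa (cp a) (cs a / 8) (8 * cr a)| <= rho)%N]) ->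
  (\sum_(a in Ag) #|image_pts zd g (cp a) (cs a) (cr a)| <= #|TD| * (d * (3 * rho)))%N.
Proof.
move=> zi /andP[hg1 hg2] hA.
have -> : (\sum_(a in Ag) #|image_pts zd g (cp a) (cs a) (cr a)| =
    \sum_z #|[set a | (a \in Ag) && (z \in image_pts zd g (cp a) (cs a) (cr a))]|)%N.
  rewrite -(double_count (fun a z => (a \in Ag) && (z \in image_pts zd g (cp a) (cs a) (cr a)))).
  rewrite big_mkcond; apply: eq_bigr => a _; case: (a \in Ag); last first.
    by apply/esym/eqP; rewrite cards_eq0; apply/eqP/setP => z; rewrite !in_set.
  by apply: eq_card => z; rewrite [RHS]in_set.
rewrite -sum_nat_const; apply: leq_sum => z _.
have nz : g - (zd z)%:P != 0.
  by rewrite subr_eq0; apply: contraTneq hg1 => ->; rewrite size_polyC -leqNgt leq_b1.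
have [rs hrs] := closed_field_poly_normal (g - (zd z)%:P).
have szr : (size rs <= d)%N.
  rewrite -ltnS -(size_prod_XsubC rs id) -(size_scale _ (_ : lead_coef (g - (zd z)%:P) != 0)) ?lead_coef_eq0 //.
  rewrite -hrs (leq_trans (size_polyD _ _)) // geq_max hg2 size_polyN size_polyC.
  by case: (_ != 0).
apply: leq_trans (_ : size rs * (3 * rho) <= _)%N; last by rewrite leq_mul2r szr orbT.
pose P (x : C) (a : TA) := (a \in Ag) && (cs a <= cabs (x - cp a) <= cr a).
apply: leq_trans (_ : #|[set a | has (fun x => P x a) rs]| <= _)%N.
  apply: subset_leq_card; apply/subsetP => a; rewrite [a \in [set _ | _]]in_set => /andP[aA].
  rewrite /image_pts in_set => /asboolP[x [hx gx]]; rewrite in_set; apply/hasP; exists x; last by rewrite /P aA.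
  have : root (g - (zd z)%:P) x by rewrite rootE hornerD hornerN hornerC gx subrr.
  by rewrite hrs rootZ ?lead_coef_eq0 // root_prod_XsubC.
apply: (@card_exists_seq unit) => x; apply: leq_trans (close_card pa rho x).
apply: subset_leq_card; apply/subsetP => a; rewrite in_set => /andP[aA /andP[h1 h2]].
have [s0 s1 s2 s3] := hA a aA; rewrite in_set; apply/asboolP.
exists (cp a), (cs a / 8), (8 * cr a); split=> //; first by rewrite divr_ge0.
  by rewrite mulrC divfK ?pnatr_eq0.
by rewrite !ler_pM2l.
Qed.

(** With $e=(9s+3)s+1$ this is $e(s+1)+10s+21$, chosen so that $e+(9s+3)+Ms+es<(M-1)(s+1)$ holds at
    the end of [nonaffine_bound], where $M$ is this exponent. *)
Definition inf_exponent (s : nat) : nat :=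
  (2 + (9 * s + 3) * s + 9 * s + ((9 * s + 3) * s + 1) * s + s + 20)%N.

Theorem nonaffine_bound (f : {poly {poly C}}) : partx f != 0 -> party f != 0 ->
  ~ additive_poly f -> ~ multiplicative_poly f -> ~ affine_type f ->
  forall s : nat, (0 < s)%N -> exists K0 : nat, forall (TA TB TD : finType)
    (pa : TA -> C) (lt : TB -> C) (zd : TD -> C) (K : nat),
  injective pa -> injective lt -> injective zd ->
  (forall a b, exists z, f.[(pa a)%:P].[lt b] = zd z) ->
  (K0 <= K)%N -> (K ^ inf_exponent s <= #|TB|)%N -> (#|TB| <= #|TA|)%N ->
  (#|TA| <= K ^ (inf_exponent s * s))%N -> (#|TD| <= K * #|TA|)%N -> False.
Proof.
move=> fx fy na nm naf s s0.
have [sb0 hsb0] := nonaffine_growth fx fy na nm naf.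
have [sx hsx] := fiber_neq0_seq fx.
pose sb := sb0 ++ sx.
case: s s0 => // t _; set s := t.+1.
have [C1 hC1] := hsb0 t.
pose M := inf_exponent s; pose cl := (M * s)%N.
pose d := (size f).-1.
pose Lam : R := 18 * 16 ^+ d.
have [G hG] : exists G : nat, 2 * Lam ^+ (2 * cl + 2) <= G%:R.
  by exists (Num.bound (2 * Lam ^+ (2 * cl + 2))); apply/ltW/archi_boundP; rewrite mulr_ge0 ?exprn_ge0 // mulr_ge0 ?exprn_ge0.
pose w0 := ((2 * G).+1 ^ 2)%N.
exists (2 + 16 * cl * (80 * cl * w0 + 5 * w0) + 144 * d.+1 * d.+1 * cl + C1 + size sb)%N.
move=> TA TB TD pa lt zd K pai lti zdi hD hK0 hB hBA hA hDA.
have K2 : (2 <= K)%N by clear -hK0; lia.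
have K1 : (0 < K)%N by apply: leq_trans K2.
have KX m : (0 < K ^ m)%N by rewrite expn_gt0 K1.
have Kle i j : (i <= j)%N -> (K ^ i <= K ^ j)%N by move=> ij; rewrite leq_exp2l.
have M20 : (20 <= M)%N by rewrite /M /inf_exponent; clear; lia.
have cl0 : (0 < cl)%N by rewrite /cl muln_gt0; clear -M20; lia.
(* The bound $\rho\le hK^6$ gives $3K_2'\le hK^9$, and the share of good points costs $K^3$ together
   with $|TD|\le K|TA|$; this explains $L=K^{9s+3}$. The exponent $e$ then yields $C_1L^s\le h$. *)
pose e := ((9 * s + 3) * s + 1)%N; pose L := (K ^ (9 * s + 3))%N; pose h := (K ^ e)%N.
have eM : (e + s + 19 <= M)%N by rewrite /M /inf_exponent /e /s; clear; nia.
have hhA : (h <= #|TA|)%N.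
  by apply: leq_trans hBA; apply: leq_trans hB; apply: Kle; clear -eM; lia.
have h2 : (1 < h)%N by apply: leq_trans K2 _; rewrite -[X in (X <= _)%N]expn1 Kle // /e; clear; lia.
have ncl : (#|TA| < h * K ^ cl)%N.
  by apply: leq_ltn_trans hA _; rewrite ltn_Pmull.
have hKc : (2 + 16 * cl * (80 * cl * w0 + 5 * w0) <= K)%N.
  by apply: leq_trans hK0; rewrite -!addnA leq_add2l leq_addr.
have hKd : (144 * d.+1 * d.+1 * cl <= K)%N.
  apply: leq_trans hK0; move: (16 * cl * _)%N (144 * _ * _ * cl)%N; clear; lia.
have hKC1 : (C1 <= K)%N by apply: leq_trans hK0; move: (16 * cl * _)%N (144 * _ * _ * cl)%N; clear; lia.
have hKsb : (size sb <= K)%N by apply: leq_trans hK0; rewrite leq_addl.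
(* Makes [F * rho] equal to [d * K2'], the size of core that [image_close] demands. *)
pose F := (d * (48 * d * cl * K ^ 2))%N.
have hF : (F <= K ^ 3)%N.
  rewrite /F (_ : d * (48 * d * cl * K ^ 2) = 48 * d * d * cl * K ^ 2)%N; last by clear; ring.
  rewrite expnS leq_mul2r; apply/orP; right; apply: leq_trans hKd.
  by move: (d) (cl); clear; nia.
have L18 : 18 <= Lam by rewrite /Lam ler_peMr ?ler0n // exprn_ege1 // ler1n.
have [rho [/andP[rho0 rhoK] [Ag [cAg hAg]]]] := exists_cells pai L18 h2 hhA ncl hG hKc hF.
(* Twice the average number of image points per pair, by [overlap_bound] and
   $|TD|\le8\,cl\,K^2|Ag|$: $48=2\cdot3\cdot8$. At least half of the pairs stay below it. *)
pose K2' := (48 * d * cl * K ^ 2 * rho)%N.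
have [cell0 hcell] : exists c : TA -> (C * R * R) * {set TA}, forall a, a \in Ag ->
   [/\ 0 <= (c a).1.1.2 /\ 0 < (c a).1.2, cell Lam (c a).1.1.1 (c a).1.1.2 (c a).1.2 (pa a),
    (h <= #|(c a).2|)%N /\ forall x, x \in (c a).2 -> cell Lam (c a).1.1.1 (c a).1.1.2 (c a).1.2 (pa x),
    (#|ann pa (c a).1.1.1 ((c a).1.1.2 / 8) (8 * (c a).1.2)| <= rho)%N &
    (c a).1.1.2 = 0 \/ (F * rho < #|disc pa (c a).1.1.1 (c a).1.1.2|)%N].
  have hc a : exists c : (C * R * R) * {set TA}, a \in Ag ->
   [/\ 0 <= c.1.1.2 /\ 0 < c.1.2, cell Lam c.1.1.1 c.1.1.2 c.1.2 (pa a),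
    (h <= #|c.2|)%N /\ forall x, x \in c.2 -> cell Lam c.1.1.1 c.1.1.2 c.1.2 (pa x),
    (#|ann pa c.1.1.1 (c.1.1.2 / 8) (8 * c.1.2)| <= rho)%N &
    c.1.1.2 = 0 \/ (F * rho < #|disc pa c.1.1.1 c.1.1.2|)%N].
    have [aA|aA] := boolP (a \in Ag); last by exists (0, 0, 0, set0).
    by have [p [u [r [S hS]]]] := hAg a aA; exists (p, u, r, S).
  by have [c hc'] := choice hc; exists c.
pose cp a := (cell0 a).1.1.1; pose cs a := (cell0 a).1.1.2; pose cr a := (cell0 a).1.2.
pose TB' := {b : TB | lt b \notin sb}.
pose TA' := {a : TA | a \in Ag}.
have cTA' : #|{: TA'}| = #|Ag| by rewrite card_sig.
have cTB' : (K ^ (M - 1) <= #|{: TB'}|)%N.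
  have h1 : (#|TB| <= size sb + #|{: TB'}|)%N.
    rewrite card_sig -(cardC [pred b | lt b \notin sb]) addnC leq_add2r -cardsE.
    by apply: (card_le_seq lti) => b; rewrite !inE negbK.
  have h3 : (K + K ^ (M - 1) <= K ^ M)%N.
    have eMM : M = (M - 1).+1 by clear -M20; lia.
    rewrite [X in (_ <= K ^ X)%N]eMM expnS.
    have : (K ^ 1 <= K ^ (M - 1))%N by apply: Kle; clear -M20; lia.
    by rewrite expn1; move: K2; move: (K ^ (M - 1))%N; clear; nia.
  rewrite -(leq_add2l K); apply: leq_trans h3 _; apply: leq_trans hB _.
  by apply: leq_trans h1 _; rewrite leq_add2r.
pose gb b := fiber f (lt b).
have hgb (b : TB') : (1 < size (gb (val b)) <= d.+1)%N.
  have := valP b; rewrite mem_cat negb_or => /andP[_ hb]; apply/andP; split.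
    by apply: size_fiber_gt1; apply: hsx.
  have f0 : (0 < size f)%N by rewrite size_poly_gt0; apply: contraNneq fx => ->; rewrite /partx derivE.
  by rewrite /d prednK // size_fiber.
have d0 : (0 < d)%N.
  have : (0 < #|{: TB'}|)%N by apply: leq_trans cTB'.
  by move=> /card_gt0P [b _]; have := hgb b; case: (d) => // /andP[]; case: (size _) => [|[|]].
pose Zg := [set q : TA' * TB' |
  (#|image_pts zd (gb (val q.2)) (cp (val q.1)) (cs (val q.1)) (cr (val q.1))| <= K2')%N].
have K2'0 : (0 < K2')%N by rewrite /K2' muln_gt0 rho0 muln_gt0 KX muln_gt0 cl0 muln_gt0 d0.
have cZ : (#|{: TA'}| * #|{: TB'}| <= 2 * #|Zg|)%N.
  have bad : (#|~: Zg| * K2' <= #|{: TB'}| * (#|TD| * (d * (3 * rho))))%N.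
    apply: (@leq_trans (\sum_(b : TB') \sum_(a in Ag) #|image_pts zd (gb (val b)) (cp a) (cs a) (cr a)|)%N).
      rewrite exchange_big /= (reindex_omap (val : TA' -> TA) insub) /=; last by move=> a aA; rewrite insubT.
      rewrite (eq_bigl xpredT); last by move=> a; rewrite valK eqxx andbT (valP a).
      rewrite pair_big /= -sum_nat_const [leqRHS](bigID (mem (~: Zg))) /=.
      apply: leq_trans (leq_addr _ _); rewrite big_mkcond [leqRHS]big_mkcond; apply: leq_sum => q _.
      by rewrite !inE -ltnNge; case: ifP => // /ltnW.
    rewrite -sum_nat_const; apply: leq_sum => b _; apply: overlap_bound => // a aA.
    have [[u0 r0] [u1 u2] _ u3 _] := hcell a aA; split=> //.
      by apply: le_trans u1; rewrite ler_peMl // (le_trans _ L18) // ler1n.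
      by apply: le_trans u2; rewrite ler_peMl ?cabs_ge0 // (le_trans _ L18) // ler1n.
    exact: u3.
  have bad2 : (2 * #|~: Zg| <= #|{: TA'}| * #|{: TB'}|)%N.
    rewrite -(leq_pmul2r K2'0) -mulnA; apply: leq_trans (leq_mul (leqnn 2) bad) _.
    have : (#|TD| <= K * (8 * cl * K * #|Ag|))%N by apply: leq_trans hDA _; rewrite leq_mul2l cAg orbT.
    rewrite cTA' /K2'; move: #|TD| #|Ag| #|{: TB'}| => x y z hx.
    apply: (@leq_trans (2 * (z * (K * (8 * cl * K * y) * (d * (3 * rho))))))%N.
      by rewrite leq_mul2l leq_mul2l leq_mul2r hx !orbT.
    by rewrite leq_eqVlt; apply/orP; left; apply/eqP; clear; ring.
  have ez := cardsC Zg; rewrite card_prod in ez; move: bad2; rewrite -ez.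
  by move: #|Zg| #|~: Zg|; clear; lia.
pose sg (a : TA') (j : 'I_h) : C := pa (nth (val a) (enum (cell0 (val a)).2) j).
have hS (a : TA') : (h <= size (enum (cell0 (val a)).2))%N.
  by rewrite -cardE; have [_ _ [h1 _] _ _] := hcell _ (valP a).
have sgi a : injective (sg a).
  move=> i j /pai /eqP; rewrite nth_uniq ?enum_uniq ?(leq_trans (ltn_ord _) (hS a)) //.
  by move=> /eqP /val_inj.
pose clz : rel TD := fun z z' => `[< close zd K2' (zd z) (zd z') >].
have hclz z : (#|[set z' | clz z z']| <= 3 * K2')%N by apply: close_card.
have hZ (a : TA') (b : TB') : (a, b) \in Zg -> exists z, f.[(pa (val a))%:P].[lt (val b)] = zd z /\
    forall j, exists z', f.[(sg a j)%:P].[lt (val b)] = zd z' /\ clz z z'.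
  rewrite in_set /= => hK2; have [z hz] := hD (val a) (val b); exists z; split=> // j.
  have [z' hz'] := hD (nth (val a) (enum (cell0 (val a)).2) j) (val b).
  exists z'; split=> //; apply/asboolP; rewrite -hz -hz' -!horner_fiber.
  have [[u0 r0] u1 [_ u2] u3 u4] := hcell _ (valP a).
  apply: (image_close pai (hgb b) u0 r0 hK2) => //; last first.
    by apply: u2; rewrite -mem_enum mem_nth // (leq_trans (ltn_ord _) (hS a)).
  case: u4 => [u4|u4]; [by left|right]; exists (disc pa (cp (val a)) (cs (val a))).
    by apply: leq_ltn_trans u4; rewrite /F /K2' mulnA.
  move=> x; rewrite in_set => hx; split=> //; have [z1 hz1] := hD x (val b).
  by exists z1; rewrite -hz1 -horner_fiber.
have hLb : (#|TD| * (3 * K2') ^ s <= L * (#|{: TA'}| * h ^ s))%N.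
  have k1 : (3 * K2' <= h * K ^ 9)%N.
    apply: (@leq_trans (K * K ^ 2 * (h * K ^ 6)))%N; last first.
      by rewrite leq_eqVlt; apply/orP; left; apply/eqP; rewrite mulnCA -expnS -expnD.
    rewrite /K2' (_ : 3 * (48 * d * cl * K ^ 2 * rho) = 144 * d * cl * K ^ 2 * rho)%N; last by clear; ring.
    apply: leq_mul => //; rewrite leq_mul2r; apply/orP; right; apply: leq_trans hKd.
    by move: (d) (cl); clear; nia.
  have k2 : ((3 * K2') ^ s <= h ^ s * K ^ (9 * s))%N.
    rewrite [(9 * s)%N]mulnC mulnC -[(s * 9)%N]mulnC expnM -expnMn mulnC; by elim: (s) => // u IH; rewrite !(expnS _ u) leq_mul.
  apply: leq_trans (leq_mul hDA k2) _.
  have k3 : (K * #|TA| <= K ^ 3 * #|Ag|)%N.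
    rewrite expnS -mulnA leq_mul2l; apply/orP; right; apply: leq_trans cAg _.
    rewrite leq_mul2r; apply/orP; right; rewrite -mulnn leq_mul2r; apply/orP; right.
    by apply: leq_trans hKd; move: (d) (cl); clear; nia.
  apply: leq_trans (leq_mul k3 (leqnn _)) _; rewrite cTA' /L expnD.
  by rewrite leq_eqVlt; apply/orP; left; apply/eqP; ring.
have hCL x : (K ^ e <= x)%N -> (C1 * L ^ s <= x)%N.
  by apply: leq_trans; rewrite /e addn1 expnS expnM leq_mul2r hKC1 orbT.
have cAg2 : (K ^ (M - 2) <= #|Ag|)%N.
  have k3 : (#|TA| <= K ^ 2 * #|Ag|)%N.
    apply: leq_trans cAg _; rewrite leq_mul2r; apply/orP; right; rewrite -mulnn leq_mul2r; apply/orP; right.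
    by apply: leq_trans hKd; move: (d) (cl); clear; nia.
  rewrite -(leq_pmul2l (KX 2)) -expnD subnKC ?(leq_trans _ M20) //.
  by apply: leq_trans k3; apply: leq_trans hBA.
have L0 : (0 < L)%N by apply: KX.
have := @hC1 {: TA'}%type {: TB'}%type TD (fun a => pa (val a)) (fun b => lt (val b)) zd h sg clz (3 * K2')%N L Zg.
have pai' : injective (fun a : TA' => pa (val a)) by move=> a a' /pai /val_inj.
have lti' : injective (fun a : TB' => lt (val a)) by move=> a a' /lti /val_inj.
have hsb (b : TB') : lt (val b) \notin sb0 by have := valP b; rewrite mem_cat negb_or => /andP[].
move=> /(_ pai' lti' sgi hsb hclz hZ cZ L0 hLb).
have r1 : (C1 * L ^ s <= #|{: TB'}|)%N.
  by apply: hCL; apply: leq_trans cTB'; apply: Kle; clear -eM; lia.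
have r2 : (C1 * L ^ s <= #|{: TA'}|)%N.
  by apply: hCL; rewrite cTA'; apply: leq_trans cAg2; apply: Kle; clear -eM; lia.
move=> /(_ r1 r2 (hCL _ (leqnn _))); apply/negP; rewrite -ltnNge.
have up : (C1 * L ^ s * (#|TD| * (3 * K2') ^ s) <= K ^ e * (K ^ (9 * s + 3) * (K ^ (M * s) * (K ^ e) ^ s)))%N.
  apply: leq_mul; first exact: hCL.
  apply: leq_trans hLb _; rewrite leq_mul2l; apply/orP; right; rewrite leq_mul2r; apply/orP; right.
  by rewrite cTA'; apply: leq_trans (max_card _) hA.
apply: leq_ltn_trans up _; apply: (@leq_trans ((K ^ (M - 1)) ^ s.+1)%N); last first.
  by elim: (s.+1) => // u IH; rewrite !(expnS _ u) leq_mul.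
rewrite -!expnM -!expnD ltn_exp2l // /M /inf_exponent /e /s; clear.
by move: t.+1 => u; nia.
Qed.
End Nonaffine.

(** * Affine families *)

Section Multisets.
Variables (R : realFieldType) (V : eqType).
Implicit Types (s t : seq V) (F : V -> R).

(* Finitely supported functions are encoded as sequences with repetitions; [ip] is the
   scalar product of the multiplicity functions. *)
Definition ip s t : R := \sum_(x <- s) \sum_(y <- t) (x == y)%:R.

Definition mult s z : R := \sum_(x <- s) (x == z)%:R.

Lemma ip_sym s t : ip s t = ip t s.
Proof. by rewrite /ip exchange_big; apply: eq_bigr => x _; apply: eq_bigr => y _; rewrite eq_sym. Qed.

Lemma ip_ge0 s t : 0 <= ip s t.
Proof. by apply: sumr_ge0 => x _; apply: sumr_ge0 => y _; apply: ler0n. Qed.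

Lemma sum_pick (U : seq V) x F : uniq U -> x \in U ->
  \sum_(z <- U) (if z == x then F z else 0) = F x.
Proof.
move=> uU xU; rewrite (bigD1_seq x) //= eqxx big1 ?addr0 // => z.
by move=> /negPf ->.
Qed.

Lemma sum_mult s (U : seq V) F : uniq U -> {subset s <= U} ->
  \sum_(x <- s) F x = \sum_(z <- U) mult s z * F z.
Proof.
move=> uU sU; under [RHS]eq_bigr do rewrite /mult mulr_suml.
rewrite exchange_big /= !big_seq; apply: eq_bigr => x xs.
rewrite (eq_bigr (fun z => if z == x then F z else 0)); last first.
  by move=> z _; rewrite eq_sym; case: eqP => _; rewrite ?mul1r ?mul0r.
by rewrite sum_pick // sU.
Qed.

Lemma ip_mult s t (U : seq V) : uniq U -> {subset s <= U} ->
  ip s t = \sum_(z <- U) mult s z * mult t z.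
Proof.
move=> uU sU; rewrite /ip (sum_mult (fun x => \sum_(y <- t) (x == y)%:R) uU sU).
by apply: eq_bigr => z _; congr (_ * _); apply: eq_bigr => y _; rewrite eq_sym.
Qed.

Lemma ip_cauchy s t : ip s t ^+ 2 <= ip s s * ip t t.
Proof.
pose U := undup (s ++ t); have uU : uniq U by apply: undup_uniq.
have sU : {subset s <= U} by move=> x xs; rewrite mem_undup mem_cat xs.
have tU : {subset t <= U} by move=> x xs; rewrite mem_undup mem_cat xs orbT.
rewrite (ip_mult t uU sU) (ip_mult s uU sU) (ip_mult t uU tU).
set P := \sum_(z <- U) _; set A := \sum_(z <- U) _; set B := \sum_(z <- U) mult t z * _.
have B0 : 0 <= B by apply: sumr_ge0 => z _; apply: sqr_ge0.
have key : 0 <= B * (B * A - P ^+ 2).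
  have -> : B * (B * A - P ^+ 2) = \sum_(z <- U) (B * mult s z - P * mult t z) ^+ 2.
    transitivity (\sum_(z <- U) B ^+ 2 * (mult s z * mult s z) -
      \sum_(z <- U) (2 * B * P) * (mult s z * mult t z) + \sum_(z <- U) P ^+ 2 * (mult t z * mult t z)).
      by rewrite -!mulr_sumr -/A -/P -/B; ring.
    by rewrite -sumrB -big_split; apply: eq_bigr => z _ /=; ring.
  by apply: sumr_ge0 => z _; apply: sqr_ge0.
have [B00|Bn] := eqVneq B 0; last first.
  have Bp : 0 < B by rewrite lt_neqAle eq_sym Bn.
  by move: key; rewrite pmulr_rge0 // subr_ge0 mulrC.
have z0 z : z \in U -> mult t z = 0.
  move=> zU; have : B = 0 := B00; move/eqP; rewrite /B big_seq psumr_eq0; last by move=> *; apply: sqr_ge0.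
  by move=> /allP /(_ _ zU); rewrite zU /= mulf_eq0 orbb => /eqP.
have -> : P = 0 by rewrite /P big_seq big1 // => z zU; rewrite z0 // mulr0.
by rewrite expr0n B00 mulr0.
Qed.

Lemma ip_amgm s t : 2 * ip s t <= ip s s + ip t t.
Proof.
have h := ip_cauchy s t; have h1 := ip_ge0 s t; have h2 := ip_ge0 s s; have h3 := ip_ge0 t t.
rewrite leNgt; apply/negP => h4; move: h; apply/negP; rewrite -ltNge.
have := sqr_ge0 (ip s s - ip t t); move: (ip s t) (ip s s) (ip t t) h1 h2 h3 h4 => a b c; nra.
Qed.

Lemma ip_flatten (I : Type) (r : seq I) (F : I -> seq V) t :
  ip (flatten [seq F i | i <- r]) t = \sum_(i <- r) ip (F i) t.
Proof. by rewrite /ip big_flatten big_map. Qed.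

Lemma ip_flatten2 (I J : Type) (r : seq I) (F : I -> seq V) (r' : seq J) (G : J -> seq V) :
  ip (flatten [seq F i | i <- r]) (flatten [seq G i | i <- r']) =
  \sum_(i <- r) \sum_(j <- r') ip (F i) (G j).
Proof.
by rewrite ip_flatten; apply: eq_bigr => i _; rewrite ip_sym ip_flatten; apply: eq_bigr => j _; rewrite ip_sym.
Qed.

Lemma ip_convex (I : Type) (r : seq I) (F : I -> seq V) :
  ip (flatten [seq F i | i <- r]) (flatten [seq F i | i <- r]) <=
  (size r)%:R * \sum_(i <- r) ip (F i) (F i).
Proof.
rewrite ip_flatten2.
have h : \sum_(i <- r) \sum_(j <- r) (2 * ip (F i) (F j)) <=
    \sum_(i <- r) \sum_(j <- r) (ip (F i) (F i) + ip (F j) (F j)).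
  by apply: ler_sum => i _; apply: ler_sum => j _; apply: ip_amgm.
move: h; under eq_bigr do rewrite -mulr_sumr.
rewrite -mulr_sumr; under [X in _ <= X]eq_bigr do rewrite big_split /= big_const_seq count_predT iter_addr_0.
rewrite big_split /= big_const_seq count_predT iter_addr_0.
rewrite sumrMnl [(size r)%:R * _]mulr_natl.
by move: (_ *+ size r) (\sum_(i <- r) \sum_(j <- r) _) => u v; lra.
Qed.

Lemma ip_uniq (Q : seq V) : uniq Q -> ip Q Q = (size Q)%:R.
Proof.
move=> uQ; rewrite /ip big_seq (eq_bigr (fun=> 1)); last first.
  move=> x xQ; rewrite (eq_bigr (fun y => if y == x then 1 else 0)); last first.
    by move=> y _; rewrite eq_sym; case: eqP.
  exact: (sum_pick (fun=> 1) uQ).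
by rewrite -big_seq big_const_seq count_predT iter_addr_0.
Qed.

Lemma ip_sub (Q s : seq V) : uniq Q -> {subset s <= Q} -> ip s Q = (size s)%:R.
Proof.
move=> uQ sQ; rewrite /ip big_seq (eq_bigr (fun=> 1)); last first.
  move=> x xs; rewrite (eq_bigr (fun y => if y == x then 1 else 0)); last first.
    by move=> y _; rewrite eq_sym; case: eqP.
  by apply: (sum_pick (fun=> 1) uQ); apply: sQ.
by rewrite -big_seq big_const_seq count_predT iter_addr_0.
Qed.

(* Values above half the mean are taken often, hence take many distinct values. *)
Lemma popular (s : seq V) F c th : 0 <= th -> 0 < c -> (forall z, F z <= c) ->
  2 * th * c * (size s)%:R <= \sum_(z <- s) F z ->
  exists Q : seq V, [/\ uniq Q, forall z, z \in Q -> th * c <= F z &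
    (th * (size s)%:R) ^+ 2 <= (size Q)%:R * ip s s].
Proof.
move=> th0 c0 hF hs; pose p z := th * c <= F z; pose s1 := [seq z <- s | p z].
exists (undup s1); split; first exact: undup_uniq.
  by move=> z; rewrite mem_undup mem_filter => /andP[].
have h1 : th * (size s)%:R <= (size s1)%:R.
  have : \sum_(z <- s) F z <= c * (size s1)%:R + th * c * (size s)%:R.
    rewrite (bigID p) /=; apply: lerD.
      rewrite -big_filter; apply: le_trans (_ : \sum_(z <- s1) c <= _); first by apply: ler_sum.
      by rewrite big_const_seq count_predT iter_addr_0 mulr_natr.
    apply: le_trans (_ : \sum_(z <- s) th * c <= _); last first.
      by rewrite big_const_seq count_predT iter_addr_0 mulr_natr.
    rewrite big_mkcond; apply: ler_sum => z _; rewrite /p -ltNge; case: ifP => [/ltW //|_].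
    by rewrite mulr_ge0 // ltW.
  move=> h; rewrite -(ler_pM2l c0); lra.
have s1U : {subset s1 <= undup s1} by move=> z; rewrite mem_undup.
have h2 := ip_cauchy s1 (undup s1); rewrite (ip_sub (undup_uniq s1) s1U) (ip_uniq (undup_uniq s1)) in h2.
apply: le_trans (_ : (size s1)%:R ^+ 2 <= _).
  by rewrite lerXn2r ?nnegrE ?mulr_ge0 // ler0n.
apply: le_trans h2 _; rewrite mulrC ler_wpM2l ?ler0n //.
rewrite /ip /s1 big_filter big_mkcond; apply: ler_sum => x _.
have hle : \sum_(y <- [seq z <- s | p z]) (x == y)%:R <= \sum_(y <- s) (x == y)%:R :> R.
  by rewrite big_filter big_mkcond; apply: ler_sum => y _; case: ifP.
by case: ifP => // _; apply: sumr_ge0.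
Qed.

End Multisets.

Lemma ip_map (R : realFieldType) (V W : eqType) (g : V -> W) (g' : W -> V) s t :
  cancel g g' -> cancel g' g -> ip R (map g s) t = ip R s (map g' t).
Proof.
move=> gK g'K; rewrite /ip big_map; apply: eq_bigr => x _; rewrite big_map; apply: eq_bigr => y _.
by rewrite (can2_eq gK g'K).
Qed.

(** * An energy bound for scalings of a point set *)

Section Energy.
Variable R : realType.
Local Notation C := R[i].
Local Notation "x %:C" := (real_complex R x) : ring_scope.

(* Seen from w, two points whose mutual distance exceeds both distances to w lie in
   directions at distance at least 1 on the unit circle. *)
Lemma nn_overlap (T : finType) (u : T -> C) (S : {set T}) (dl : T -> R) (w : C) :
  injective u -> (forall y z, y \in S -> z \in S -> z != y -> dl y <= cabs (u z - u y)) ->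
  (#|[set y in S | (cabs (w - u y) <= dl y)%R]| <= 26)%N.
Proof.
move=> ui hS; set Y := [set y in S | _].
pose Y0 := [set y in Y | u y != w].
have c1 : (#|Y :\: Y0| <= 1)%N.
  have [->|[y yY]] := set_0Vmem (Y :\: Y0); first by rewrite cards0.
  have P z : z \in Y :\: Y0 -> u z = w.
    by rewrite in_setD [z \in Y0]in_set => /andP[h h']; move: h; rewrite h' /= negbK => /eqP.
  rewrite -(cards1 y); apply: subset_leq_card; apply/subsetP => z zY.
  by rewrite in_set1; apply/eqP; apply: ui; rewrite !P.
have c2 : (#|Y0| <= 25)%N.
  pose e y := (u y - w) / (cabs (u y - w))%:C.
  have YP y : y \in Y0 -> [/\ y \in S, cabs (u y - w) <= dl y & 0 < cabs (u y - w)].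
    by rewrite !in_set => /andP[/andP[h1 h2] h3]; rewrite cabs_gt0 subr_eq0 cabsB.
  have ce y : y \in Y0 -> cabs (e y) = 1.
    move=> /YP[_ _ h]; rewrite /e cabsM cabsV cabs_real gtr0_norm // divff //.
    by rewrite gt_eqF.
  have sep y z : y \in Y0 -> z \in Y0 -> z != y -> 1 <= cabs (e z - e y).
    wlog le : y z / cabs (u z - w) <= cabs (u y - w).
      move=> h hy hz zy; have [h1|/ltW h1] := leP (cabs (u z - w)) (cabs (u y - w)); first exact: h.
      by rewrite cabsB; apply: h => //; rewrite eq_sym.
    move=> hy hz zy; have [yS y1 y2] := YP y hy; have [zS z1 z2] := YP z hz.
    have h1 := hS _ _ yS zS zy.
    have nz x : 0 < x -> (x%:C : C) != 0.
      by move=> x0; rewrite -cabs_eq0 cabs_real gtr0_norm // gt_eqF.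
    have eu x : 0 < cabs (u x - w) -> u x - w = (cabs (u x - w))%:C * e x.
      by move=> x0; rewrite /e mulrC divfK // nz.
    have dec : u z - u y = (cabs (u z - w))%:C * (e z - e y) + (cabs (u z - w) - cabs (u y - w))%:C * e y.
      rewrite (_ : u z - u y = (u z - w) - (u y - w)); last by ring.
      rewrite {1}(eu z z2) {1}(eu y y2) rmorphB /=; ring.
    have h2 : cabs (u z - u y) <= cabs (u z - w) * cabs (e z - e y) + (cabs (u y - w) - cabs (u z - w)).
      rewrite dec; apply: le_trans (cabsD _ _) _; rewrite [cabs (_ * (e z - e y))]cabsM [cabs (_ * e y)]cabsM !cabs_real ce // mulr1.
      by rewrite (ger0_norm (ltW z2)) distrC ger0_norm ?subr_ge0.
    have h3 : cabs (u z - w) * 1 <= cabs (u z - w) * cabs (e z - e y) by lra.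
    by rewrite ler_pM2l in h3.
  have := @grid_packing _ _ e Y0 0 1 1 2 1; apply.
  - exact: ltr01.
  - by rewrite !mulr1.
  - by move=> y /ce h; rewrite subr0 h.
  move=> y yY; rewrite -(cards1 y); apply: subset_leq_card; apply/subsetP => z.
  rewrite in_set in_set1 => /andP[zY hz]; apply: contraTT hz => zy; rewrite -leNgt.
  exact: sep.
have := cardsID Y0 Y; have : (#|Y :&: Y0| <= #|Y0|)%N by apply/subset_leq_card/subsetIr.
by move: c1 c2; move: #|Y :\: Y0| #|Y0| #|Y :&: Y0| #|Y|; clear; lia.
Qed.

Variables (T TB : finType) (v : T -> C) (a : TB -> C) (C1 nu : nat).
Hypotheses (v_inj : injective v) (a0 : forall b, a b != 0).
Hypothesis hC1 : forall c, (#|[set b | a b == c]| <= C1)%N.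
Local Notation q := #|T|.
Local Notation N := #|TB|.
Hypotheses (nu0 : (0 < nu)%N) (hq : (2 * nu <= q)%N) (hN : (nu ^ 3 <= N)%N).
Local Notation tau := ((TB * TB) * (T * T))%type.

(** The affine map of slope $a_b/a_{b'}$ that sends one chosen point to another. A coincidence of
    quotients $(v_y-v_x)/a_b=(v_{y'}-v_{x'})/a_{b'}$ is a point that such a map returns to the
    set. *)
Definition amap (t : tau) (z : C) : C := a t.1.1 / a t.1.2 * (z - v t.2.2) + v t.2.1.
Definition hits (t : tau) : {set T} := [set z | [exists z', v z' == amap t (v z)]].

Definition near_pts (m : nat) (u : T) : {set T} :=
  [set w | (#|[set w' | (cabs (v w' - v u) <= cabs (v w - v u))%R]| <= m)%N].

Lemma card_near_pts m u : (#|near_pts m u| <= m)%N.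
Proof.
have [->|[w0 w0P]] := set_0Vmem (near_pts m u); first by rewrite cards0.
have [w wP hw] := exists_max (fun w => cabs (v w - v u)) w0P.
move: (wP); rewrite in_set => h; apply: leq_trans h; apply: subset_leq_card.
by apply/subsetP => w' w'P; rewrite in_set hw.
Qed.

(** Half of the hit points of a rich map have their nearest hit point among their $m=104\nu$ nearest
    points, before and after the map, because [nn_overlap] bounds the overlap of nearest-neighbour
    discs by 26; $104=4\cdot26$ allows for the two exclusions. A pair and its image determine the
    slope, so with one letter and the base point fixed at most [C1] maps remain, and there are only
    $qm$ near pairs. *)
Lemma rich_bound : (\sum_(t : tau | q <= nu * #|hits t|) #|hits t| <=
  2 * C1 * N * q * (q * (104 * nu)) * (q * (104 * nu)))%N.
Proof.
pose m := (104 * nu)%N.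
have iv_ex : exists iv : C -> option T, forall c z, v z = c -> iv c = Some z.
  exists (fun c => [pick z | v z == c]) => c z e; case: pickP => [z' /eqP e'|/(_ z)].
    by congr Some; apply: v_inj; rewrite e'.
  by rewrite e eqxx.
have [iv hiv] := iv_ex.
pose im t z := odflt z (iv (amap t (v z))).
have imP t z : z \in hits t -> v (im t z) = amap t (v z).
  by rewrite in_set => /existsP[z' /eqP e]; rewrite /im (hiv _ _ e) /= e.
have sl0 (t : tau) : a t.1.1 / a t.1.2 != 0 by rewrite mulf_neq0 ?invr_neq0 ?a0.
have amapB (t : tau) x y : amap t x - amap t y = a t.1.1 / a t.1.2 * (x - y) by rewrite /amap; ring.
have nb_ex (t : tau) (z : T) : exists z', (q <= nu * #|hits t|)%N -> [/\ z' \in hits t, z' != z &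
    forall y, y \in hits t -> y != z -> cabs (v z' - v z) <= cabs (v y - v z)].
  have [hr|hr] := leqP q (nu * #|hits t|); last by exists z.
  have : (1 < #|hits t|)%N.
    have := leq_trans hq hr; rewrite [(2 * nu)%N]mulnC leq_pmul2l //.
  rewrite (cardsD1 z) => h; have : (0 < #|hits t :\ z|)%N by move: h; case: (z \in hits t); rewrite ?add1n ?add0n //; apply: ltnW.
  move=> /card_gt0P[z0 hz0]; have [z' hz' hmin] := exists_min (fun y => cabs (v y - v z)) hz0.
  exists z' => _; move: hz'; rewrite in_setD1 => /andP[h1 h2]; split=> // y yS yz.
  by apply: hmin; rewrite in_setD1 yz.
have [nb hnb] : exists nb : tau -> T -> T, forall t z, (q <= nu * #|hits t|)%N -> [/\ nb t z \in hits t, nb t z != z &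
    forall y, y \in hits t -> y != z -> cabs (v (nb t z) - v z) <= cabs (v y - v z)].
  have [nb h] := choice (fun p : tau * T => nb_ex p.1 p.2).
  by exists (fun t z => nb (t, z)) => t z; apply: (h (t, z)).
pose good (t : tau) z := (nb t z \in near_pts m z) && (im t (nb t z) \in near_pts m (im t z)).
have half (t : tau) : (q <= nu * #|hits t|)%N -> (#|hits t| <= 2 * #|[set z in hits t | good t z]|)%N.
  move=> hr; set S := hits t in hr *.
  have generic (u : T -> C) (P : T -> T -> R) : injective u ->
     (forall y z, y \in S -> z \in S -> z != y -> P y (nb t y) <= cabs (u z - u y)) ->
     (m * #|[set z in S | (m < #|[set w' | (cabs (v w' - u z) <= P z (nb t z))%R]|)%N]| <= 26 * q)%N.
    move=> ui hu.
    apply: (@leq_trans (\sum_z #|[set w' | (z \in S) && (cabs (v w' - u z) <= P z (nb t z))%R]|)%N).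
      rewrite mulnC -sum_nat_const [leqRHS](bigID (mem [set z in S | (m < #|[set w' | (cabs (v w' - u z) <= P z (nb t z))%R]|)%N])) /=.
      apply: leq_trans (leq_addr _ _); apply: leq_sum => z; rewrite in_set => /andP[zS hz].
      by apply: leq_trans (ltnW hz) _; apply: subset_leq_card; apply/subsetP => w'; rewrite in_set => h; rewrite in_set zS.
    rewrite (double_count (fun z w' => (z \in S) && (cabs (v w' - u z) <= P z (nb t z)))).
    rewrite mulnC -sum_nat_const; apply: leq_sum => w' _.
    exact: (nn_overlap (v w') ui hu).
  have b1 := generic v (fun y y' => cabs (v y' - v y)) v_inj (fun y z yS zS zy => (let: And3 _ _ h := hnb t y hr in h) z zS zy).
  have ui : injective (fun z => amap t (v z)).
    move=> y z /eqP; rewrite -subr_eq0 amapB mulf_eq0 (negbTE (sl0 t)) /= subr_eq0 => /eqP; exact: v_inj.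
  have h2 y z : y \in S -> z \in S -> z != y ->
      cabs (amap t (v (nb t y)) - amap t (v y)) <= cabs (amap t (v z) - amap t (v y)).
    move=> yS zS zy; have [_ _ h] := hnb t y hr; have {}h := h z zS zy.
    rewrite !amapB; move: (a t.1.1 / a t.1.2) => k; by rewrite !cabsM ler_wpM2l ?cabs_ge0.
  have b2 := generic _ (fun y y' => cabs (amap t (v y') - amap t (v y))) ui h2.
  set B1 := [set z in S | _] in b1; set B2 := [set z in S | _] in b2.
  have sub : S \subset [set z in S | good t z] :|: (B1 :|: B2).
    apply/subsetP => z zS; have [n1 n2 _] := hnb t z hr.
    rewrite !in_setU [z \in [set _ in S | good t _]]in_set [z \in B1]in_set [z \in B2]in_set zS /= /good.
    rewrite [nb t z \in _]in_set [im t (nb t z) \in _]in_set !imP //.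
    by case: leqP => //=; case: leqP => //=; rewrite ?orbT.
  have s1 := subset_leq_card sub.
  have s2 := leq_trans s1 (leq_trans (leq_card_setU _ _) (leq_add (leqnn _) (leq_card_setU _ _))).
  have s3 : (104 * nu * (#|B1| + #|B2|) <= 52 * (nu * #|S|))%N.
    by move: b1 b2 hr; rewrite /m; move: #|B1| #|B2| #|T| #|S|; clear; lia.
  have s4 : (2 * (#|B1| + #|B2|) <= #|S|)%N.
    rewrite -(leq_pmul2l (_ : 0 < 52 * nu)%N) ?muln_gt0 ?nu0 //.
    by move: s3; move: #|B1| #|B2| #|S|; clear; lia.
  by move: s2 s4; move: #|[set z in S | good t z]| #|B1| #|B2| #|S|; clear; lia.
pose A := [set p : tau * T | [&& (q <= nu * #|hits p.1|)%N, p.2 \in hits p.1 & good p.1 p.2 && (p.1.2.2 \in hits p.1) && (im p.1 p.1.2.2 == p.1.2.1)]].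
have selfhit (t : tau) : (t.2.2 \in hits t) && (im t t.2.2 == t.2.1).
  have h : t.2.2 \in hits t.
    by rewrite in_set; apply/existsP; exists t.2.1; rewrite /amap subrr mulr0 add0r.
  rewrite h /=; apply/eqP; apply: v_inj; rewrite imP // /amap subrr mulr0 add0r //.
apply: (@leq_trans (2 * #|A|)%N).
  apply: (@leq_trans (\sum_(t : tau | q <= nu * #|hits t|) 2 * #|[set z in hits t | good t z]|)%N).
    by apply: leq_sum => t; apply: half.
  rewrite -big_distrr leq_mul2l /= -[leqRHS]sum1_card (partition_big fst (fun t => (q <= nu * #|hits t|)%N)) /=; last first.
    by move=> p; rewrite in_set => /and3P[].
  apply: leq_sum => t ht; rewrite -sum1_card (reindex_onto (fun z => (t, z)) snd) /=; last first.
    by move=> [u z] /andP[_ /eqP /= ->].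
  apply/eq_leq/eq_bigl => z; rewrite [(t, z) \in A]in_set [z \in [set _ in hits t | _]]in_set /= ht !eqxx !andbT.
  by have /andP[h1 h2] := selfhit t; rewrite h1 h2 !andbT.
rewrite -!mulnA leq_mul2l /=.
pose NP := [set p : T * T | p.2 \in near_pts m p.1].
have cNP : (#|NP| <= q * m)%N.
  apply: (leq_card_fibers (h := fst)) => u.
  pose g (w : T) := (u, w); have gi : injective g by move=> ? ? [].
  apply: leq_trans (card_near_pts m u); rewrite -(card_imset _ gi).
  apply: subset_leq_card; apply/subsetP => -[u' w]; rewrite !in_set /= => /andP[h /eqP e].
  by rewrite e in h *; apply/imsetP; exists w; rewrite // in_set.
pose Phi (p : tau * T) := ((p.1.1.1, p.1.2.2), ((p.2, nb p.1 p.2), (im p.1 p.2, im p.1 (nb p.1 p.2)))).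
have := @leq_card_fibers_in _ _ A (setX [set: TB * T] (setX NP NP)) Phi C1.
rewrite !cardsX cardsT card_prod => hh.
apply: (@leq_trans (N * q * (#|NP| * #|NP|) * C1)%N); last first.
  apply: (@leq_trans (N * q * ((q * m) * (q * m)) * C1)%N).
    by rewrite leq_mul2r leq_mul2l leq_mul ?orbT.
  by rewrite /m; apply/eq_leq; clear; ring.
apply: hh => [[t z]|y].
  rewrite [_ \in A]in_set => /and3P[_ _ /andP[/andP[/andP[h1 h2] _] _]].
  by rewrite !in_setX in_setT /= [_ \in NP]in_set [_ \in NP]in_set /= h1 h2.
set Fb := [set x in A | Phi x == y].
have [->|[[t0 z0] F0]] := set_0Vmem Fb; first by rewrite cards0.
have FP t z : (t, z) \in Fb -> [/\ (q <= nu * #|hits t|)%N, z \in hits t, im t t.2.2 = t.2.1, t.2.2 \in hits t & Phi (t, z) = y].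
  by rewrite in_set => /andP[]; rewrite in_set /= => /and3P[h1 h2 /andP[/andP[_ h3] /eqP h4]] /eqP h5.
have det t z : (t, z) \in Fb -> [/\ z = z0, t.1.1 = t0.1.1, t.2.2 = t0.2.2, a t.1.2 = a t0.1.2 & t.2.1 = t0.2.1].
  move=> h; have [r1 r2 r3 r4 r5] := FP _ _ h; have [p1 p2 p3 p4 p5] := FP _ _ F0.
  have e : Phi (t, z) = Phi (t0, z0) by rewrite r5 p5.
  rewrite /Phi /= in e; case: e => e1 e2 e3 e4 e5 e6.
  have [n1 n2 _] := hnb t z r1; have [n3 n4 _] := hnb t0 z0 p1.
  have d1 : amap t (v (nb t z)) - amap t (v z) = amap t0 (v (nb t0 z0)) - amap t0 (v z0).
    by rewrite -!imP // e5 e6.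
  have nz : v (nb t0 z0) - v z0 != 0 by rewrite subr_eq0 (inj_eq v_inj).
  have sl : a t.1.1 / a t.1.2 = a t0.1.1 / a t0.1.2.
    by move: d1; rewrite !amapB e4 e3 => /(mulIf nz).
  have ab : a t.1.2 = a t0.1.2.
    by move: sl; rewrite e1 => /(mulfI (a0 _)) /invr_inj.
  split=> //; apply: v_inj; rewrite -r3 -p3 !imP //.
  have h1 : amap t (v z0) = amap t0 (v z0) by rewrite -(imP t0 z0 p2) -e5 (imP t z r2) e3.
  have -> : amap t (v t.2.2) = amap t (v z0) + (amap t (v t.2.2) - amap t (v z0)) by ring.
  have -> : amap t0 (v t0.2.2) = amap t0 (v z0) + (amap t0 (v t0.2.2) - amap t0 (v z0)) by ring.
  by congr (_ + _); [exact: h1|rewrite !amapB sl e2].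
apply: leq_trans (hC1 (a t0.1.2)).
pose g (p : tau * T) := p.1.1.2.
have gi : {in Fb &, injective g}.
  move=> [[[b b'] [x w]] z] [[[c c'] [x' w']] z'] h h'; have [/= q1 q2 q3 q4 q5] := det _ _ h.
  have [/= s1 s2 s3 s4 s5] := det _ _ h'; rewrite /g /= => ->.
  by rewrite q1 q2 q3 q5 s1 s2 s3 s5.
rewrite -(card_in_imset gi); apply: subset_leq_card; apply/subsetP => _ /imsetP[[t z] h ->].
by rewrite in_set; have [_ _ _ -> _] := det _ _ h.
Qed.

(** The trivial bound is $N^2q^3$, with $q$ hits for each of $N^2q^2$ maps. Poor maps have fewer
    than $q/\nu$ hits, and the rich ones are covered by [rich_bound] since $\nu^3\le N$. *)
Lemma energy_bound : (nu * \sum_(t : tau) #|hits t| <= (1 + 2 * 104 * 104 * C1) * (N ^ 2 * q ^ 3))%N.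
Proof.
rewrite (bigID (fun t => (q <= nu * #|hits t|)%N)) /= mulnDr mulnDl mul1n addnC; apply: leq_add.
  rewrite big_distrr /=; apply: (@leq_trans (\sum_(t : tau) q)%N); last first.
    rewrite sum_nat_const !card_prod; apply/eq_leq; ring.
  by rewrite big_mkcond; apply: leq_sum => t _; case: ifP => //; rewrite -ltnNge => /ltnW.
apply: leq_trans (leq_mul (leqnn nu) rich_bound) _.
have h : (2 * 104 * 104 * C1 * N * q ^ 3 * nu ^ 3 <= 2 * 104 * 104 * C1 * N * q ^ 3 * N)%N by rewrite leq_mul2l hN orbT.
apply: (@leq_trans (2 * 104 * 104 * C1 * N * q ^ 3 * nu ^ 3)%N); first by apply/eq_leq; clear; ring.
by apply: leq_trans h _; apply/eq_leq; clear; ring.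
Qed.
End Energy.

Lemma size_index_enum (T : finType) : size (index_enum T) = #|T|.
Proof. by rewrite -sum1_size sum1_card. Qed.

Lemma sqr_sum_le (R : realFieldType) (I : finType) (x : I -> R) :
  (\sum_i x i) ^+ 2 <= #|I|%:R * \sum_i x i ^+ 2.
Proof.
set S := \sum_i x i; set n : R := #|I|%:R.
have h : 0 <= \sum_i (n * x i - S) ^+ 2 by apply: sumr_ge0 => i _; apply: sqr_ge0.
have e : \sum_i (n * x i - S) ^+ 2 = n * (n * \sum_i x i ^+ 2 - S ^+ 2).
  transitivity (\sum_i (n ^+ 2 * x i ^+ 2 - (2 * n * S) * x i + S ^+ 2)).
    by apply: eq_bigr => i _; ring.
  have e3 : \sum_(i : I) S ^+ 2 = n * S ^+ 2 by rewrite sumr_const mulr_natl.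
  by rewrite big_split /= sumrB e3 -!mulr_sumr -/S; ring.
have [n0|n0] := posnP #|I|.
  rewrite /S big1 ?expr0n ?mulr_ge0 ?ler0n ?sumr_ge0 // => i; first by rewrite sqr_ge0.
  by have := card0_eq n0 i; rewrite inE.
rewrite e pmulr_rge0 ?ltr0n // subr_ge0 in h; exact: h.
Qed.

(** * Convolution powers of an affine family *)

Section Dynamics.
Variable R : realType.
Local Notation C := R[i].
Variables (TB : finType) (al be : TB -> C) (s0 : seq C).
Hypothesis al0 : forall b, al b != 0.
Local Notation N := (#|TB|%:R : R).
Local Notation ip := (ip R).

Definition op (e : bool) b (x : C) := if e then (x - be b) / al b else al b * x + be b.
Definition sl (e : bool) b : C := if e then (al b)^-1 else al b.

Lemma sl0 e b : sl e b != 0. Proof. by case: e; rewrite /= ?invr_neq0 ?al0. Qed.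

Lemma opK e b : cancel (op e b) (op (~~ e) b).
Proof.
have h := al0 b; case: e => x; rewrite /op /=; last by rewrite addrK mulrC mulKf.
by rewrite mulrC divfK // subrK.
Qed.

Lemma op_add e b x h : op e b (x + h) = op e b x + sl e b * h.
Proof. by case: e; rewrite /op /sl /=; ring. Qed.

Definition Top e (s : seq C) := flatten [seq map (op e b) s | b <- index_enum TB].

Lemma ip_Top e s t : ip (Top e s) t = ip s (Top (~~ e) t).
Proof.
rewrite /Top ip_flatten [RHS]ip_sym ip_flatten; apply: eq_bigr => b _.
rewrite [RHS]ip_sym; apply: (ip_map _ _ _ (opK e b)).
by have := opK (~~ e) b; rewrite negbK.
Qed.

(** The family and its inverse alternate, so that consecutive operators are adjoint to each other
    and [nrm] is log-convex. *)
Fixpoint w i := if i is j.+1 then Top (odd j) (w j) else s0.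
Definition nrm i := ip (w i) (w i).

Lemma nrm_shift i : nrm i.+1 = ip (w i) (w i.+2).
Proof. by rewrite /nrm {1}/w -/w ip_Top. Qed.

Lemma nrm_convex i : nrm i.+1 ^+ 2 <= nrm i * nrm i.+2.
Proof. by rewrite nrm_shift; apply: ip_cauchy. Qed.

Variable K : R.
Hypotheses (K1 : 1 <= K) (N0 : 0 < N) (s00 : 0 < nrm 0) (hK : N ^+ 2 * nrm 0 <= K * nrm 1).

(** By log-convexity the ratio of consecutive norms never decreases, so the first one, at least
    $N^2/K$, controls all the others. *)
Lemma nrm_grow i : 0 < nrm i /\ N ^+ 2 * nrm i <= K * nrm i.+1.
Proof.
have K0 : 0 < K by apply: lt_le_trans K1.
elim: i => [|i [p h]]; first by [].
have p1 : 0 < nrm i.+1.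
  by rewrite -(pmulr_rgt0 _ K0); apply: lt_le_trans h; rewrite mulr_gt0 ?exprn_gt0.
split=> //; have c := nrm_convex i.
rewrite -(ler_pM2l p) -(ler_pM2r p1).
have h1 : N ^+ 2 * nrm i * (nrm i.+1 * nrm i.+1) <= K * nrm i.+1 * (nrm i.+1 * nrm i.+1).
  by rewrite ler_pM2r // mulr_gt0.
have h2 : K * nrm i.+1 * nrm i.+1 ^+ 2 <= K * nrm i.+1 * (nrm i * nrm i.+2).
  by rewrite ler_pM2l // mulr_gt0.
by move: h1 h2; rewrite expr2; move: (nrm i) (nrm i.+1) (nrm i.+2) (N ^+ 2) => x y z m; lra.
Qed.

Definition tr (h : C) (s : seq C) := [seq x + h | x <- s].
(** The translation [h] is an almost-period when this is not much below its maximum [ip s s]. *)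
Definition corr s h := ip s (tr h s).

Lemma ip_tr h k s t : ip (tr h s) (tr k t) = ip s (tr (k - h) t).
Proof.
rewrite /tr (@ip_map R _ _ (fun x => x + h) (fun x => x - h)); last 2 first.
- by move=> x; rewrite addrK.
- by move=> x; rewrite subrK.
by rewrite -map_comp; congr (ip s _); apply: eq_map => x /=; ring.
Qed.

Lemma corr_le s h : corr s h <= ip s s.
Proof.
have := ip_amgm R s (tr h s); rewrite ip_tr subrr -/(corr s h).
have -> : tr 0 s = s by rewrite /tr -[RHS]map_id; apply: eq_map => x; rewrite addr0.
by lra.
Qed.

Lemma corr_sum_le (Q s : seq C) : uniq Q -> \sum_(h <- Q) corr s h <= (size s)%:R ^+ 2.
Proof.
move=> uQ; rewrite /corr /ip exchange_big /=.
have -> : ((size s)%:R : R) ^+ 2 = \sum_(x <- s) \sum_(y <- s) 1.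
  by rewrite !big_const_seq !count_predT !iter_addr_0 expr2 mulr_natr.
apply: ler_sum => x _; rewrite /tr; under eq_bigr do rewrite big_map.
rewrite exchange_big /=; apply: ler_sum => y _.
have [h|h] := boolP (x - y \in Q).
  rewrite (eq_bigr (fun z => if z == x - y then 1 else 0)); last first.
    by move=> z _; rewrite -(subr_eq x) -[X in X == _]/(x - z) eq_sym; case: eqP => e1; case: eqP => e2 //; [case: e2; rewrite e1|case: e1; rewrite e2]; rewrite ?opprB addrC ?subrK.
  by rewrite (sum_pick (fun=> 1) uQ h).
rewrite big_seq big1 // => z zQ; case: eqP => // e; case/negP: h.
by rewrite e [y + z]addrC addrK.
Qed.

Variables (C1 C2 nu : nat).
Hypothesis hC1 : forall c, (#|[set b | al b == c]| <= C1)%N.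
Hypothesis hC2 : forall x y, (#|[set b | (al b * x + be b == y)%R]| <= C2)%N.
Hypotheses (nu0 : (0 < nu)%N) (hN : (nu ^ 3 <= #|TB|)%N).

Lemma slope_fiber e c : (#|[set b | sl e b == c]| <= C1)%N.
Proof.
case: e; rewrite /sl; last exact: hC1.
apply: leq_trans (hC1 c^-1); apply: subset_leq_card; apply/subsetP => b; rewrite !in_set.
by move=> /eqP <-; rewrite invrK.
Qed.

Let C0 := (1 + 2 * 104 * 104 * C1)%N.

(** The sum $U$ of the translates of [w i.+1] by [Q] has large norm. Pulled back through the affine
    maps, translations are divided by the slopes, so [w i] correlates with its translates by
    $(v_y-v_x)/a_b$ on average. The popular ones number, up to losses, at least $(Nq^2)^2$ divided
    by the energy, and the saving in [energy_bound] is the factor [nu]. *)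
Lemma corr_step i (Q : seq C) eta : 0 < eta -> uniq Q -> (2 * nu <= size Q)%N ->
  (forall h, h \in Q -> eta * nrm i.+1 <= corr (w i.+1) h) ->
  exists Q' : seq C, [/\ uniq Q', forall h, h \in Q' -> eta ^+ 2 / (2 * K) * nrm i <= corr (w i) h &
    (eta ^+ 2 / (2 * K)) ^+ 2 * (nu * size Q)%:R <= C0%:R * (size Q')%:R].
Proof.
move=> e0 uQ hq hQ; set q := size Q in hq *.
have K0 : 0 < K by apply: lt_le_trans K1.
have q0 : (0 < q)%N by move: hq nu0; clear; lia.
pose v (x : 'I_q) := Q`_x; pose a := sl (odd i).
have vi : injective v by move=> x y /eqP; rewrite nth_uniq // => /eqP /val_inj.
have [np hg] := nrm_grow i; have [np1 _] := nrm_grow i.+1.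
pose dz (p : TB * ('I_q * 'I_q)) := (v p.2.2 - v p.2.1) / a p.1.
pose P := [seq dz p | p <- index_enum (TB * ('I_q * 'I_q))%type].
have sP : (size P)%:R = N * q%:R ^+ 2 :> R.
  by rewrite size_map size_index_enum !card_prod !card_ord !natrM.
pose U := flatten [seq tr (v x) (w i.+1) | x <- index_enum 'I_q].
have u1 : q%:R * (eta * nrm i.+1) <= ip U (w i.+1).
  rewrite /U ip_flatten mulr_natl -[X in _ *+ X]card_ord -sumr_const; apply: ler_sum => x _.
  by rewrite ip_sym; apply: hQ; apply: mem_nth.
have u2 : (q%:R * eta) ^+ 2 * nrm i.+1 <= ip U U.
  have h := ip_cauchy R U (w i.+1); rewrite -/(nrm i.+1) in h.
  have h2 : (q%:R * (eta * nrm i.+1)) ^+ 2 <= ip U (w i.+1) ^+ 2.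
    by rewrite lerXn2r ?nnegrE ?ip_ge0 // !mulr_ge0 ?ler0n // ltW.
  have := le_trans h2 h; rewrite mulrA exprMn [nrm i.+1 ^+ 2]expr2 mulrA ler_pM2r //.
(* Translating by [v x] after a map amounts to translating by [v x / a b] before it. Convexity of
   the norm then reduces the sum over letters to single letters. *)
have u3 : ip U U <= N * \sum_p corr (w i) (dz p).
  pose Ub b := flatten [seq map (op (odd i) b) (tr (v x / a b) (w i)) | x <- index_enum 'I_q].
  have eU s : ip U s = ip (flatten [seq Ub b | b <- index_enum TB]) s.
    rewrite /U !ip_flatten; under [RHS]eq_bigr do rewrite /Ub ip_flatten.
    rewrite exchange_big /=; apply: eq_bigr => x _.
    rewrite -ip_flatten /tr /= /Top map_flatten -map_comp; congr (ip (flatten _) _).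
    apply: eq_map => b /=; rewrite -!map_comp; apply: eq_map => y /=.
    by rewrite op_add mulrC divfK // sl0.
  rewrite eU ip_sym eU; apply: le_trans (ip_convex R _ _) _; rewrite size_index_enum.
  rewrite ler_pM2l // -(pair_bigA _ (fun b xy => corr (w i) (dz (b, xy)))) /=.
  apply: ler_sum => b _; rewrite /Ub ip_flatten2 pair_bigA /= le_eqVlt; apply/orP; left; apply/eqP.
  apply: eq_bigr => -[x y] _ /=; rewrite (ip_map _ _ _ (opK (odd i) b)); last first.
    by have := opK (~~ odd i) b; rewrite negbK.
  by rewrite mapK ?ip_tr /corr /dz /= ?mulrBl //; apply: opK.
have u4 : 2 * (eta ^+ 2 / (2 * K)) * nrm i * (size P)%:R <= \sum_(z <- P) corr (w i) z.
  rewrite /P big_map sP.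
  have h1 : (q%:R * eta) ^+ 2 * (N ^+ 2 * nrm i) <= K * (N * \sum_p corr (w i) (dz p)).
    apply: le_trans (ler_wpM2l (sqr_ge0 _) hg) _; rewrite mulrCA ler_pM2l //.
    exact: le_trans u2 u3.
  rewrite -(ler_pM2l (_ : 0 < K * N)) ?mulr_gt0 //.
  apply: le_trans (_ : (q%:R * eta) ^+ 2 * (N ^+ 2 * nrm i) <= _); last by rewrite -[X in _ <= X]mulrA.
  rewrite le_eqVlt; apply/orP; left; apply/eqP; field; rewrite gt_eqF //.
have th0 : 0 <= eta ^+ 2 / (2 * K) by rewrite divr_ge0 ?sqr_ge0 // mulr_ge0 // ltW.
have [Q' [uQ' hQ' szQ']] := popular th0 np (fun z => corr_le (w i) z) u4.
exists Q'; split=> //.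
have eP : ip P P <= (\sum_(t : (TB * TB) * ('I_q * 'I_q)) #|hits v a t|)%:R.
  pose X := [set pp : (TB * ('I_q * 'I_q)) * (TB * ('I_q * 'I_q)) | dz pp.1 == dz pp.2].
  have -> : ip P P = #|X|%:R.
    rewrite /ip /P big_map; under eq_bigr do rewrite big_map.
    rewrite pair_bigA /= -sum1_card natr_sum big_mkcond [RHS]big_mkcond; apply: eq_bigr => pp _.
    by rewrite in_set; case: (_ == _).
  rewrite ler_nat.
  pose g (pp : (TB * ('I_q * 'I_q)) * (TB * ('I_q * 'I_q))) :=
    (((pp.1.1, pp.2.1), (pp.1.2.1, pp.2.2.1)), pp.2.2.2).
  have key pp : pp \in X -> v pp.1.2.2 = amap v a (g pp).1 (v pp.2.2.2).
    rewrite in_set /dz /amap /g /= => /eqP e.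
    have n1 := sl0 (odd i) pp.1.1; have n2 := sl0 (odd i) pp.2.1; rewrite -/a in n1 n2.
    have := congr1 (fun z => z * a pp.1.1 + v pp.1.2.1) e; rewrite divfK // subrK => ->.
    by ring.
  have gi : {in X &, injective g}.
    move=> [[b [x x']] [c [y y']]] [[b2 [x2 x2']] [c2 [y2 y2']]] h h2 e.
    have k1 := key _ h; have k2 := key _ h2; rewrite /= in k1 k2.
    move: e k1 k2; rewrite /g /= => -[<- <- <- <- <-] <- /vi <- //.
  rewrite -(card_in_imset gi) -[leqLHS]sum1_card.
  apply: (@leq_trans (\sum_(p | p.2 \in hits v a p.1) 1)%N); last first.
    by rewrite -(pair_big_dep xpredT (fun t z => z \in hits v a t) (fun _ _ => 1%N)) /=; apply: leq_sum => t _; rewrite sum1_card.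
  rewrite big_mkcond [leqRHS]big_mkcond; apply: leq_sum => p _; case: ifP => // /imsetP[pp hpp ->].
  by rewrite (_ : _ \in _) // in_set; apply/existsP; exists pp.1.2.2; rewrite (key pp hpp).
have eB := energy_bound vi (fun b => sl0 (odd i) b) (slope_fiber (odd i)) nu0.
rewrite card_ord in eB; have {}eB := eB hq hN.
have h5 : (nu%:R * ip P P : R) <= (C0 * (#|TB| ^ 2 * q ^ 3))%:R.
  apply: le_trans (_ : (nu * \sum_(t : (TB * TB) * ('I_q * 'I_q)) #|hits v a t|)%:R <= _); last by rewrite ler_nat.
  by rewrite natrM ler_wpM2l ?ler0n.
have nuR : 0 < (nu%:R : R) by rewrite ltr0n.
have h6 := ler_wpM2l (ltW nuR) szQ'; rewrite [X in _ <= X]mulrCA in h6.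
have {h5}h6 := le_trans h6 (ler_wpM2l (ler0n _ (size Q')) h5).
have pos : 0 < N ^+ 2 * (q%:R : R) ^+ 3 by rewrite mulr_gt0 ?exprn_gt0 // ltr0n.
have e5 : (C0 * (#|TB| ^ 2 * q ^ 3))%:R = C0%:R * (N ^+ 2 * q%:R ^+ 3) :> R by rewrite natrM natrM !natrX.
rewrite -(ler_pM2r pos); move: h6; rewrite sP e5 (natrM _ nu q); set th := _ / _.
by move: (size Q')%:R (q%:R : R) (nu%:R : R) N (C0%:R : R) => x y z m c h; lra.
Qed.

(** For fixed $b_1,b_2$ the conjugates $g_bg_{b_1}^{-1}g_{b_2}g_b^{-1}$ share the slope [mu p], so
    any two of them differ by a translation. Two uses of Cauchy's inequality on [nrm J.+2] make
    these translations almost-periods on average; [J] is odd so that the inverse family acts first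
    and the family itself second. *)
Lemma corr_start J : odd J -> exists Q : seq C, [/\ uniq Q,
  forall h, h \in Q -> (2 * K ^+ 4)^-1 * nrm J <= corr (w J) h &
  N <= 4 * K ^+ 8 * (C1 + C2)%:R * (size Q)%:R].
Proof.
move=> oJ; have K0 : 0 < K by apply: lt_le_trans K1.
have [np hg] := nrm_grow J; have [np1 hg1] := nrm_grow J.+1.
pose mu (p : TB * TB) := al p.2 / al p.1.
pose kap (p : TB * TB) b := al b * ((be p.2 - be p.1) / al p.1) + (1 - mu p) * be b.
have mu0 p : mu p != 0 by rewrite mulf_neq0 ?invr_neq0 ?al0.
pose cj p b (x : C) := mu p * x + kap p b.
pose Z p := flatten [seq map (cj p b) (w J) | b <- index_enum TB].
pose hh (x : (TB * TB) * (TB * TB)) := (kap x.1 x.2.2 - kap x.1 x.2.1) / mu x.1.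
have z1 : nrm J.+2 <= N * \sum_p ip (w J) (Z p).
  pose Ub b := Top false (map (op true b) (w J)).
  have eW s : ip (w J.+2) s = ip (flatten [seq Ub b | b <- index_enum TB]) s.
    rewrite [w J.+2]/= oJ /= ip_Top /= /Top ip_flatten [RHS]ip_flatten; apply: eq_bigr => b _.
    by rewrite /Ub ip_Top.
  rewrite /nrm eW ip_sym eW; apply: le_trans (ip_convex R _ _) _; rewrite size_index_enum ler_pM2l //.
  rewrite (eq_bigr (fun b => \sum_p ip (w J) (map (cj p b) (w J)))); last first.
    move=> b _; rewrite /Ub /Top ip_flatten2 pair_bigA; apply: eq_bigr => -[b1 b2] _ /=.
    rewrite (ip_map _ _ _ (opK false b1)); last exact: (opK true b1).
    rewrite (ip_map _ _ _ (opK true b)); last exact: (opK false b).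
    rewrite -!map_comp; congr (ip _ _); apply: eq_map => x; rewrite /= /op /cj /kap /mu /=.
    by field; rewrite !al0.
  rewrite exchange_big /= le_eqVlt; apply/orP; left; apply/eqP; apply: eq_bigr => p _.
  by rewrite [RHS]ip_sym /Z ip_flatten; apply: eq_bigr => b _; rewrite ip_sym.
have z2 : (\sum_p ip (w J) (Z p)) ^+ 2 <= N ^+ 2 * (nrm J * \sum_x corr (w J) (hh x)).
  apply: le_trans (sqr_sum_le _) _; rewrite card_prod natrM -expr2 ler_wpM2l ?sqr_ge0 //.
  rewrite -(pair_bigA _ (fun p q => corr (w J) (hh (p, q)))) /= mulr_sumr; apply: ler_sum => p _.
  apply: le_trans (ip_cauchy _ _ _) _; rewrite ler_pM2l // /Z ip_flatten2 pair_bigA.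
  rewrite le_eqVlt; apply/orP; left; apply/eqP; apply: eq_bigr => -[b b'] _ /=.
  have ck b1 : cancel (cj p b1) (fun y => (y - kap p b1) / mu p).
    by move=> x; rewrite /cj addrK mulrC mulKf.
  have ck' b1 : cancel (fun y => (y - kap p b1) / mu p) (cj p b1).
    by move=> x; rewrite /cj mulrC divfK // subrK.
  rewrite (ip_map _ _ _ (ck b) (ck' b)) /corr /tr -map_comp; congr (ip _ _).
  by apply: eq_map => x; rewrite /cj /hh /=; field.
pose S := [seq hh x | x <- index_enum ((TB * TB) * (TB * TB))%type].
have sS : (size S)%:R = N ^+ 4 :> R.
  by rewrite size_map size_index_enum !card_prod !natrM !exprS expr0; ring.
pose th := (2 * K ^+ 4)^-1.
have K4 : 0 < K ^+ 4 by rewrite exprn_gt0.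
have th0 : 0 < th by rewrite invr_gt0 mulr_gt0.
have z3 : 2 * th * nrm J * (size S)%:R <= \sum_(z <- S) corr (w J) z.
  rewrite sS /S big_map; set X := \sum_x corr (w J) (hh x) in z2 *.
  have g2 : N ^+ 4 * nrm J <= K ^+ 2 * nrm J.+2.
    have h1 : N ^+ 2 * (N ^+ 2 * nrm J) <= N ^+ 2 * (K * nrm J.+1) by rewrite ler_pM2l ?exprn_gt0.
    have h2 : K * (N ^+ 2 * nrm J.+1) <= K * (K * nrm J.+2) by rewrite ler_pM2l.
    rewrite !exprS expr0 !mulr1 in h1 h2 *; move: h1 h2; move: (nrm J) (nrm J.+1) (nrm J.+2) => x y z; lra.
  have g3 : nrm J.+2 ^+ 2 <= N ^+ 4 * (nrm J * X).
    apply: le_trans (_ : (N * \sum_p ip (w J) (Z p)) ^+ 2 <= _).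
      by rewrite lerXn2r ?nnegrE ?(le_trans (ip_ge0 _ _ _) z1) // ip_ge0.
    rewrite exprMn; apply: le_trans (ler_wpM2l (sqr_ge0 _) z2) _.
    by rewrite le_eqVlt; apply/orP; left; apply/eqP; ring.
  have g4 : (N ^+ 4 * nrm J) ^+ 2 <= (K ^+ 2 * nrm J.+2) ^+ 2.
    by rewrite lerXn2r ?nnegrE // mulr_ge0 ?exprn_ge0 ?ip_ge0 ?(ltW N0) ?(ltW K0).
  have g5 : (N ^+ 4 * nrm J) ^+ 2 <= K ^+ 4 * (N ^+ 4 * (nrm J * X)).
    apply: le_trans g4 _; rewrite exprMn -exprM; apply: ler_wpM2l => //.
    by rewrite exprn_ge0 // ltW.
  have N4 : 0 < N ^+ 4 by rewrite exprn_gt0.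
  rewrite (_ : 2 * th * nrm J * N ^+ 4 = (N ^+ 4 * nrm J) / K ^+ 4); last by rewrite /th; field; rewrite gt_eqF.
  rewrite ler_pdivrMr // -(ler_pM2l (_ : 0 < N ^+ 4 * nrm J)) ?mulr_gt0 //.
  by move: g5; rewrite expr2; move: (N ^+ 4) (nrm J) (K ^+ 4) => x y t; lra.
have [Q [uQ hQ szQ]] := popular (ltW th0) np (fun z => corr_le (w J) z) z3.
exists Q; split=> //.
(* Either $b_1$ and $b_2$ have equal slopes, which leaves [C1] choices, or [x] and the other letters
   determine $g_b(t_0)$, where $t_0$ is the fixed point of $g_{b_1}^{-1}g_{b_2}$, which leaves [C2]
   choices of the last letter. *)
have fib x : (#|[set p | hh p == x]| <= (C1 + C2) * #|TB| ^ 3)%N.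
  pose A1 := [set p : (TB * TB) * (TB * TB) | al p.1.2 == al p.1.1].
  have cA1 : (#|A1| <= #|TB| ^ 3 * C1)%N.
    have := @leq_card_fibers _ _ A1 (fun p => (p.1.1, p.2)) C1; rewrite !card_prod.
    rewrite (_ : #|TB| * (#|TB| * #|TB|) = #|TB| ^ 3)%N //.
    apply => -[b1 b34]; apply: leq_trans (hC1 (al b1)).
    have gi : {in [set p in A1 | (p.1.1, p.2) == (b1, b34)] &, injective (fun p : (TB * TB) * (TB * TB) => p.1.2)}.
      by move=> [[u1 u2] u3] [[t1 t2] t3]; rewrite !in_set /= => /andP[_ /eqP[-> ->]] /andP[_ /eqP[-> ->]] ->.
    rewrite -(card_in_imset gi); apply: subset_leq_card; apply/subsetP => _ /imsetP[p hp ->].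
    by move: hp; rewrite !in_set => /andP[/eqP -> /eqP[-> _]].
  pose A2 := [set p | (hh p == x) && (al p.1.2 != al p.1.1)].
  have cA2 : (#|A2| <= #|TB| ^ 3 * C2)%N.
    have := @leq_card_fibers _ _ A2 (fun p => (p.1, p.2.1)) C2; rewrite !card_prod.
    rewrite (_ : #|TB| * #|TB| * #|TB| = #|TB| ^ 3)%N //; last by rewrite !expnS expn0 muln1 mulnA.
    apply => -[b12 b3].
    pose m := mu b12; pose k0 := kap b12 b3 + x * m.
    pose t0 := (be b12.2 - be b12.1) / al b12.1 / (1 - m).
    apply: leq_trans (hC2 t0 (k0 / (1 - m))).
    have gi : {in [set p in A2 | (p.1, p.2.1) == (b12, b3)] &, injective (fun p : (TB * TB) * (TB * TB) => p.2.2)}.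
      by move=> [u1 [u2 u3]] [t1 [t2 t3]]; rewrite !in_set /= => /andP[_ /eqP[-> ->]] /andP[_ /eqP[-> ->]] ->.
    rewrite -(card_in_imset gi); apply: subset_leq_card; apply/subsetP => _ /imsetP[[u1 [u2 u3]] hp ->].
    move: hp; rewrite !in_set /= => /andP[/andP[/eqP hx hne] /eqP[e1 e2]]; rewrite e1 e2 in hx hne.
    have m1 : 1 - m != 0.
      rewrite subr_eq0 eq_sym; apply: contra hne => /eqP e; apply/eqP.
      by rewrite -[LHS](divfK (al0 b12.1)) -/(mu b12) -/m e mul1r.
    have mz := mu0 b12; rewrite -/m in mz.
    have hk : kap b12 u3 = k0 by rewrite /k0 -hx /hh /= -/m divfK // addrC subrK.
    apply/eqP; rewrite -hk /t0 /kap -/m; field.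
    by rewrite m1 al0.
  have sub : [set p | hh p == x] \subset A1 :|: A2.
    by apply/subsetP => p; rewrite !in_set => ->; case: (_ == _).
  apply: leq_trans (subset_leq_card sub) _; apply: leq_trans (leq_card_setU _ _) _.
  by apply: leq_trans (leq_add cA1 cA2) _; rewrite -mulnDr mulnC.
have eS : ip S S <= N ^+ 4 * ((C1 + C2)%:R * N ^+ 3).
  rewrite /ip /S big_map.
  apply: le_trans (_ : \sum_(x : (TB * TB) * (TB * TB)) (C1 + C2)%:R * N ^+ 3 <= _); last first.
    by rewrite sumr_const !card_prod -[X in X <= _]mulr_natl !natrM le_eqVlt; apply/orP; left; apply/eqP; ring.
  apply: ler_sum => p _; rewrite big_map -natrX -natrM.
  apply: le_trans (_ : (#|[set p' | hh p' == hh p]|)%:R <= _); last by rewrite ler_nat.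
  rewrite -sum1_card natr_sum [X in _ <= X]big_mkcond; apply: ler_sum => p' _.
  by rewrite in_set eq_sym; case: (_ == _).
have h := le_trans szQ (ler_wpM2l (ler0n _ _) eS); rewrite sS in h.
have N7 : 0 < N ^+ 7 by rewrite exprn_gt0.
have h2 : th ^+ 2 * N <= (size Q)%:R * (C1 + C2)%:R.
  rewrite -(ler_pM2r N7); apply: le_trans (_ : _ <= (th * N ^+ 4) ^+ 2) _.
    by rewrite le_eqVlt; apply/orP; left; apply/eqP; ring.
  by apply: le_trans h _; rewrite le_eqVlt; apply/orP; left; apply/eqP; ring.
have t2 : 0 < th ^+ 2 by rewrite exprn_gt0.
rewrite -(ler_pM2l t2); apply: le_trans h2 _; rewrite le_eqVlt; apply/orP; left; apply/eqP.
rewrite /th; field; rewrite gt_eqF //.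
Qed.
End Dynamics.

(** Correlations are kept above $K^{-loss}$ times the norm: $2K^4\le K^5$ at the start, and each
    backward step replaces $\eta$ by $\eta^2/(2K)$. *)
Fixpoint loss j : nat := if j is i.+1 then (2 * loss i + 2)%N else 5.

Lemma loss_mono i j : (i <= j)%N -> (loss i <= loss j)%N.
Proof. by move=> /subnKC <-; elim: (j - i)%N => [|k IH]; rewrite ?addn0 // addnS /=; lia. Qed.

(** Odd, for [corr_start], and large enough for the gains of all steps together to exceed
    $K^{6s\,gain}$, the bound on the size of the starting set. *)
Definition steps s : nat := (6 * s + 3)%N.
(** With $g$ this number, a step wins $\nu=K^{2g}$ and loses at most $K^{4loss+3}\le K^g$, a net
    gain of $K^g$. The factor 6 in [aff_exponent] ensures $\nu^3\le|TB|$. *)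
Definition gain s : nat := (4 * loss (steps s) + 10)%N.
Definition aff_exponent s : nat := (6 * gain s)%N.

Section Bound.
Variable R : realType.
Local Notation C := R[i].

Theorem affine_maps_bound (C1 C2 s : nat) : exists K0 : nat, forall (TB : finType) (al be : TB -> C)
    (s0 D : seq C) (K : nat),
  (forall b, al b != 0) -> (forall c, (#|[set b | al b == c]| <= C1)%N) ->
  (forall x y, (#|[set b | (al b * x + be b == y)%R]| <= C2)%N) ->
  uniq s0 -> uniq D -> (forall b x, x \in s0 -> al b * x + be b \in D) ->
  (K0 <= K)%N -> (K ^ aff_exponent s <= #|TB|)%N -> (0 < size s0)%N ->
  (size s0 <= K ^ (aff_exponent s * s))%N -> (size D <= K * size s0)%N -> False.
Proof.
pose C0 := (1 + 2 * 104 * 104 * C1)%N.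
exists (2 + 4 * C0 + 4 * (C1 + C2))%N => TB al be s0 D Kn al0 hC1 hC2 us uD hD hK0 hB n0 hs hDs.
have [Kn2 KnC0 KnC] : [/\ 2 <= Kn, 4 * C0 <= Kn & 4 * (C1 + C2) <= Kn]%N.
  by move: hK0; move: (4 * C0)%N (4 * (C1 + C2))%N; clear; split; lia.
pose K : R := Kn%:R; pose g := gain s; pose J := steps s; pose nu := (Kn ^ (2 * g))%N.
have K2 : 2 <= K by rewrite ler_nat.
have K1 : 1 <= K by apply: le_trans K2; rewrite ler1n.
have K0 : 0 < K by apply: lt_le_trans K1.
have KX m : 0 < K ^+ m by rewrite exprn_gt0.
have Kle i j : (i <= j)%N -> K ^+ i <= K ^+ j by move=> ij; apply: ler_weXn2l.
have nuN : (nu ^ 3 <= #|TB|)%N.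
  apply: leq_trans hB; rewrite /nu -expnM leq_exp2l // /aff_exponent -/g; clear; lia.
have nu0 : (0 < nu)%N by rewrite expn_gt0 (ltnW Kn2).
have N0 : 0 < (#|TB|%:R : R).
  by rewrite ltr0n; apply: leq_trans nuN; rewrite expn_gt0 nu0.
have nrm0 : nrm al be s0 0%N = (size s0)%:R by rewrite /nrm /= (ip_uniq R us).
pose w := w al be s0; pose nrm := nrm al be s0.
have {}nrm0 : nrm 0%N = (size s0)%:R := nrm0.
have s00 : 0 < nrm 0%N by rewrite nrm0 ltr0n.
have hK : (#|TB|%:R : R) ^+ 2 * nrm 0%N <= K * nrm 1%N.
  have szw : size (Top al be false s0) = (#|TB| * size s0)%N.
    rewrite /Top size_flatten /shape -map_comp sumnE big_map.
    rewrite (eq_bigr (fun=> size s0)); last by move=> b _ /=; rewrite size_map.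
    by rewrite sum_nat_const.
  have sub : {subset Top al be false s0 <= D}.
    by move=> y /flatten_mapP[b _ /mapP[x xs ->]]; apply: hD.
  have h := ip_cauchy R (Top al be false s0) D.
  rewrite (ip_sub R uD sub) (ip_uniq R uD) szw natrM in h.
  have h2 : (size D)%:R <= K * (size s0)%:R by rewrite -natrM ler_nat.
  have ss : 0 < ((size s0)%:R : R) by rewrite ltr0n.
  rewrite nrm0 -(ler_pM2r ss); apply: le_trans (_ : _ <= nrm 1%N * (size D)%:R) _.
    by apply: le_trans h; rewrite le_eqVlt; apply/orP; left; apply/eqP; ring.
  apply: le_trans (ler_wpM2l (ip_ge0 R _ _) h2) _.
  by rewrite le_eqVlt; apply/orP; left; apply/eqP; rewrite mulrCA mulrA.
have grow := nrm_grow al0 K1 N0 s00 hK.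
have main j : (j <= J)%N -> exists Q : seq C, [/\ uniq Q,
   forall h, h \in Q -> nrm (J - j)%N <= K ^+ loss j * corr (w (J - j)%N) h &
   K ^+ (2 * g + 1 + j * g) <= (size Q)%:R].
  elim: j => [_|j IH hj].
    rewrite subn0; have oJ : odd J by rewrite /J /steps addnC oddD /= oddM.
    have [Q [uQ hQ szQ]] := corr_start al0 K1 N0 s00 hK hC1 hC2 oJ.
    exists Q; split=> // [h /hQ hh|].
      have : nrm J <= 2 * K ^+ 4 * corr (w J) h by rewrite -ler_pdivrMl // mulr_gt0.
      move/le_trans; apply; rewrite ler_wpM2r ?ip_ge0 // [loss 0%N]/= [K ^+ 5]exprS.
      by apply: ler_wpM2r => //; apply: ltW (KX _).
    have h1 : 4 * K ^+ 8 * (C1 + C2)%:R <= K ^+ 9.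
      rewrite [K ^+ 9]exprS mulrAC ler_wpM2r ?(ltW (KX _)) //.
      by rewrite -natrM ler_nat.
    have h2 : K ^+ aff_exponent s <= #|TB|%:R by rewrite -natrX ler_nat.
    rewrite -(ler_pM2l (KX 9%N)) -exprD; apply: le_trans (_ : K ^+ aff_exponent s <= _).
      apply: Kle; rewrite /aff_exponent -/g /g /gain; clear; lia.
    apply: le_trans h2 (le_trans szQ _).
    by rewrite ler_wpM2r ?ler0n.
  have [Q [uQ hQ szQ]] := IH (ltnW hj); set i := (J - j.+1)%N.
  have ei : (J - j)%N = i.+1 by rewrite /i -subSn // subSS.
  rewrite ei in hQ.
  have e0 : 0 < (K ^+ loss j)^-1 by rewrite invr_gt0.
  have hq : (2 * nu <= size Q)%N.
    rewrite -(ler_nat R) natrM natrX -/K; apply: le_trans szQ.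
    apply: le_trans (_ : K ^+ (2 * g).+1 <= _); last by apply: Kle; rewrite addn1 leq_addr.
    by rewrite exprS; apply: ler_wpM2r => //; apply: ltW (KX _).
  have hQ' h : h \in Q -> (K ^+ loss j)^-1 * nrm i.+1 <= corr (w i.+1) h.
    by move=> /hQ; rewrite ler_pdivrMl.
  have [Q' [uQ2 hQ2 szQ2]] := corr_step al0 K1 N0 s00 hK hC1 nu0 nuN e0 uQ hq hQ'.
  exists Q'; split=> // [h /hQ2 hh|].
    have : nrm i <= (K ^+ loss j) ^+ 2 * (2 * K) * corr (w i) h.
      rewrite -ler_pdivrMl ?mulr_gt0 ?exprn_gt0 //; apply: le_trans hh.
      by rewrite le_eqVlt; apply/orP; left; apply/eqP; congr (_ * _); field; rewrite !gt_eqF.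
    move/le_trans; apply; rewrite ler_wpM2r ?ip_ge0 // [loss j.+1]/= exprD mulnC exprM.
    rewrite ler_wpM2l ?exprn_ge0 ?(ltW (KX _)) // expr2.
    by apply: ler_wpM2r => //; apply: ltW.
  set e := loss j in szQ2 *.
  have el : (e <= loss (steps s))%N by apply: loss_mono; apply: ltnW.
  have h1 : K ^+ (2 * g) * (size Q)%:R <= C0%:R * (2 * K) ^+ 2 * K ^+ (4 * e) * (size Q')%:R.
    have p : 0 < ((K ^+ e)^-1 ^+ 2 / (2 * K)) ^+ 2 by rewrite !(exprn_gt0, divr_gt0, mulr_gt0).
    rewrite -(ler_pM2l p); apply: le_trans (_ : _ <= C0%:R * (size Q')%:R) _.
      by apply: le_trans szQ2; rewrite natrM natrX.
    rewrite le_eqVlt; apply/orP; left; apply/eqP.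
    rewrite (_ : K ^+ (4 * e) = (K ^+ e) ^+ 4); last by rewrite mulnC exprM.
    by field; rewrite !gt_eqF.
  have h2 : C0%:R * (2 * K) ^+ 2 * K ^+ (4 * e) <= K ^+ (4 * e + 3).
    rewrite exprD mulrC ler_wpM2l ?(ltW (KX _)) // (_ : K ^+ 3 = K * K ^+ 2); last by rewrite exprS.
    rewrite exprMn mulrA ler_wpM2r ?(ltW (KX _)) // mulrC -natrX -natrM ler_nat; exact: KnC0.
  have h3 : K ^+ (2 * g) * K ^+ (2 * g + 1 + j * g) <= K ^+ (4 * e + 3) * (size Q')%:R.
    apply: le_trans (ler_wpM2l (ltW (KX _)) szQ) _; apply: le_trans h1 _.
    by rewrite ler_wpM2r ?ler0n.
  rewrite -(ler_pM2l (KX (4 * e + 3)%N)) -exprD; apply: le_trans h3; rewrite -exprD; apply: Kle.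
  have : (4 * e + 3 <= g)%N by rewrite /g /gain; move: el; clear; lia.
  by rewrite mulSn; clear; lia.
(* At time 0 the correlations of all translates sum to at most the square of the size of [s0], so
   the size of [Q] is at most $K^{loss}$ times that of [s0]. *)
have [Q [uQ hQ szQ]] := main J (leqnn J); rewrite subnn in hQ.
have h1 : (size Q)%:R * nrm 0%N <= K ^+ loss J * (size s0)%:R ^+ 2.
  apply: le_trans (ler_wpM2l (ltW (KX _)) (corr_sum_le s0 uQ)).
  rewrite [X in _ <= X]mulr_sumr mulr_natl; apply: le_trans (_ : \sum_(h <- Q) nrm 0%N <= _).
    by rewrite big_const_seq count_predT iter_addr_0.
  by rewrite big_seq [X in _ <= X]big_seq; apply: ler_sum => h /hQ.
have ss : 0 < ((size s0)%:R : R) by rewrite ltr0n.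
rewrite nrm0 expr2 mulrA ler_pM2r // in h1.
have h2 : (size s0)%:R <= K ^+ (aff_exponent s * s) by rewrite -natrX ler_nat.
have h3 := le_trans szQ (le_trans h1 (ler_wpM2l (ltW (KX _)) h2)).
move: h3; rewrite -exprD ler_eXn2l; last by apply: lt_le_trans K2; rewrite ltr1n.
rewrite /aff_exponent -/g /J /steps => h3.
have hl : (loss (6 * s + 3) < g)%N by rewrite /g /gain /steps; clear; lia.
by move: h3 hl; move: (loss _) (g); clear; nia.
Qed.
End Bound.

(** * Normal form of affine type polynomials *)

Lemma deriv_nat (F : fieldType) n : (n%:R : {poly F})^`() = 0.
Proof. by rewrite -polyC_natr derivC. Qed.

Lemma coefX_partx (F : fieldType) (p : {poly {poly F}}) j : ('X * partx p)`_j = p`_j *+ j.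
Proof. by rewrite coefXM /partx; case: j => [|j] /=; rewrite ?mulr0n // coef_deriv. Qed.

Section Normalization.
Variable F : numClosedFieldType.
Variables (G : {poly {poly F}}) (l gam del : {poly F}).
Hypothesis l0 : l != 0.
Hypothesis hG : l%:P * party G = (gam%:P * 'X + del%:P) * partx G.
Hypothesis indep : forall u v : F, u *: gam + v *: del = 0 -> u = 0 /\ v = 0.
Let M := (size G).-1.
Hypothesis M0 : (0 < M)%N.
Let phi := G`_M.
Let sig := G`_M.-1.

Lemma phi0 : phi != 0.
Proof.
rewrite /phi /M -lead_coefE lead_coef_eq0; apply: contraTneq M0 => e.
by rewrite /M e size_poly0.
Qed.

Lemma coef_rel j : l * (G`_j)^`() = gam * G`_j *+ j + del * G`_j.+1 *+ j.+1.
Proof.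
have := congr1 (fun p : {poly {poly F}} => p`_j) hG.
rewrite coefCM coef_map_id0 ?deriv0 // => ->; rewrite mulrDl coefD coefCM -mulrA !coefCM coefXM.
rewrite /partx; case: j => [|j] /=; rewrite !coef_deriv.
  by rewrite mulr0 mulr0n !mulr1n.
by rewrite !mulrnAr.
Qed.

Lemma phi_rel : l * phi^`() = M%:R * gam * phi.
Proof.
rewrite /phi coef_rel [G`_M.+1]nth_default ?mulr0 ?mul0rn ?addr0; last by rewrite /M leqSpred.
by rewrite -mulr_natl mulrA.
Qed.

(** This is $M^M\phi^{M-1}G(t/(M\phi),y)$: monic in $t$, with polynomial coefficients. *)
Definition anorm : {poly {poly F}} := \poly_(j < M.+1)
  (if (j == M)%N then 1 else (M ^ (M - j))%:R * G`_j * phi ^+ (M.-1 - j)).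

Lemma anorm_rel j : (j <= M)%N ->
  l * (anorm`_j)^`() = (M.-1 * (M - j))%:R * gam * anorm`_j + (M * j.+1)%:R * del * phi * anorm`_j.+1.
Proof.
move=> hj; rewrite /anorm !coef_poly ltnS hj; have [e|ne] := eqVneq j M.
  by rewrite e subnn muln0 mulr0n !mul0r add0r ltnn mulr0 derivC mulr0.
have jM : (j < M)%N by rewrite ltn_neqAle ne.
rewrite ltnS jM derivM derivM deriv_nat mul0r add0r.
set k := (M.-1 - j)%N.
have hphi : l * (phi ^+ k)^`() = (k * M)%:R * gam * phi ^+ k.
  rewrite deriv_exp; case: (k) => [|k']; first by rewrite mulr0n mulr0 mul0n !mul0r.
  by rewrite mulrnAr [l * (_ * _)]mulrA phi_rel /= exprS natrM -mulr_natl; ring.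
transitivity ((M ^ (M - j))%:R * (l * (G`_j)^`()) * phi ^+ k + (M ^ (M - j))%:R * G`_j * (l * (phi ^+ k)^`())).
  by ring.
rewrite coef_rel hphi -[gam * G`_j *+ j]mulr_natl -[del * _ *+ j.+1]mulr_natl.
have e1 : (M.-1 * (M - j) = j + k * M)%N.
  by rewrite /k; move: M0 jM; clear; case: (M) => // m _ h; rewrite /=; nia.
have e2 : (M ^ (M - j))%:R * G`_j.+1 * phi ^+ k =
    M%:R * phi * (if (j.+1 == M)%N then 1 else (M ^ (M - j.+1))%:R * G`_j.+1 * phi ^+ (M.-1 - j.+1)).
  have [e|ne2] := eqVneq j.+1 M.
    have -> : k = 0%N by rewrite /k -e subnn.
    by rewrite -[in (M - j)%N]e subSnn expn1 expr0 mulr1 mulr1 -/phi /phi -e.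
  have lt2 : (j.+1 < M)%N by rewrite ltn_neqAle ne2.
  have -> : k = (M.-1 - j.+1).+1 by rewrite /k; move: lt2; clear; lia.
  have -> : (M - j = (M - j.+1).+1)%N by move: lt2; clear; lia.
  by rewrite expnS natrM exprS; ring.
rewrite e1 natrD natrM [(M * j.+1)%:R]natrM.
transitivity ((j%:R + k%:R * M%:R) * gam * ((M ^ (M - j))%:R * G`_j * phi ^+ k) +
  j.+1%:R * del * ((M ^ (M - j))%:R * G`_j.+1 * phi ^+ k)).
  by ring.
by rewrite e2; move: (if _ then _ else _) => X; ring.
Qed.

(** Tschirnhaus shift: the coefficient of degree [M.-1] of [anorm] is [M] times [sig], and the shift
    removes it. *)
Definition hnorm := anorm \Po ('X - sig%:P).

Lemma sig_rel : l * sig^`() = M.-1%:R * gam * sig + M%:R * del * phi.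
Proof.
rewrite /sig coef_rel prednK // -/phi -/sig -[gam * _ *+ _]mulr_natl -[del * _ *+ _]mulr_natl.
by rewrite !mulrA.
Qed.

Lemma anorm_pde : l%:P * party anorm = (M.-1%:R * gam)%:P * ((M%:R)%:P * anorm - 'X * partx anorm) +
  (M%:R * del * phi)%:P * partx anorm.
Proof.
apply/polyP => j; rewrite coefD !coefCM coefB coefCM coefX_partx coef_map_id0 ?deriv0 //.
rewrite /partx coef_deriv.
have [hj|hj] := leqP j M; last first.
  rewrite [anorm`_j]nth_default ?[anorm`_j.+1]nth_default; last 2 first.
  - by rewrite (leq_trans (size_poly _ _)) // leqW.
  - by rewrite (leq_trans (size_poly _ _)).
  by rewrite deriv0 !mul0rn !mulr0 subrr mulr0 addr0.
rewrite anorm_rel // -[anorm`_j *+ j]mulr_natl -[anorm`_j.+1 *+ j.+1]mulr_natl.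
by rewrite natrM natrB // [(M * _)%:R]natrM; ring.
Qed.

(** The shift removes the term in [del], and the transport equation becomes diagonal: each
    coefficient evolves by a multiple of $\gamma/l$, as $\phi$ does. *)
Lemma hnorm_rel i : l * (hnorm`_i)^`() = M.-1%:R * gam * hnorm`_i * (M%:R - i%:R).
Proof.
have pde : l%:P * party hnorm = (M.-1%:R * gam)%:P * ((M%:R)%:P * hnorm - 'X * partx hnorm).
  have dx : partx hnorm = partx anorm \Po ('X - sig%:P).
    by rewrite /hnorm /partx deriv_comp derivB derivX derivC subr0 mulr1.
  have dy : party hnorm = party anorm \Po ('X - sig%:P) - (partx anorm \Po ('X - sig%:P)) * (sig^`())%:P.
    rewrite /hnorm party_comp partyD; congr (_ + _).
    have -> : party ('X : {poly {poly F}}) = 0 by have := party_lift ('X : {poly F}); rewrite map_polyX.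
    have -> : party (- sig%:P) = - (sig^`())%:P by rewrite -polyCN partyC derivN polyCN.
    by rewrite add0r mulrN.
  have := congr1 (fun p => p \Po ('X - sig%:P)) anorm_pde.
  rewrite !(comp_polyB, comp_polyD, comp_polyM, comp_polyC, comp_polyX) -dx.
  have sr := congr1 (@polyC {poly F}) sig_rel; rewrite !(polyCM, polyCD) in sr *.
  move=> h; rewrite dy -dx mulrBr h -/hnorm.
  have -> : l%:P * (partx hnorm * (sig^`())%:P) = partx hnorm * (l%:P * (sig^`())%:P) by ring.
  by rewrite sr; ring.
have := congr1 (fun p : {poly {poly F}} => p`_i) pde.
rewrite coefCM coef_map_id0 ?deriv0 // => ->; rewrite coefCM coefB coefCM coefX_partx.
by rewrite -[hnorm`_i *+ i]mulr_natl; ring.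
Qed.

Lemma size_hnorm : (size hnorm <= M.+1)%N.
Proof.
rewrite /hnorm -polyCN size_comp_poly2 ?size_XaddC //; exact: size_poly.
Qed.

(** Both sides have the same logarithmic derivative by [hnorm_rel] and [phi_rel]. Each coefficient
    is thus a constant times a fractional power of $\phi$, which is why only finitely many normal
    forms occur in [affine_bound]. *)
Lemma hnorm_const i : (i <= M)%N -> exists k, hnorm`_i ^+ M = k *: phi ^+ (M.-1 * (M - i)).
Proof.
move=> hi; apply: wronskian_eq0; first by rewrite expf_neq0 // phi0.
set e := (M.-1 * (M - i))%N; set H := hnorm`_i.
apply: (mulfI l0).
have hX (p c : {poly F}) k : l * p^`() = c * p -> l * (p ^+ k)^`() = k%:R * c * p ^+ k.
  move=> h; rewrite deriv_exp; case: k => [|k]; first by rewrite mulr0n mulr0 !mul0r.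
  by rewrite mulrnAr [l * (_ * _)]mulrA h /= exprS -mulr_natl; ring.
have h1 : l * (H ^+ M)^`() = M%:R * (M.-1%:R * gam * (M%:R - i%:R)) * H ^+ M.
  by apply: hX; rewrite [LHS]hnorm_rel -/H; ring.
have h2 : l * (phi ^+ e)^`() = e%:R * (M%:R * gam) * phi ^+ e by apply: hX; rewrite phi_rel; ring.
by rewrite mulrA h1 [RHS]mulrCA h2 /e natrM natrB //; ring.
Qed.

Lemma fiber_normal b t : phi.[b] != 0 ->
  (fiber hnorm b).[M%:R * phi.[b] * t + sig.[b]] = M%:R ^+ M * phi.[b] ^+ M.-1 * (fiber G b).[t].
Proof.
move=> pb; have -> : fiber hnorm b = fiber anorm b \Po ('X - (sig.[b])%:P).
  rewrite /hnorm /fiber map_comp_poly /= rmorphB /= map_polyX map_polyC //.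
rewrite horner_comp !(hornerD, hornerN, hornerX, hornerC) addrK.
have sa : (size (fiber anorm b) <= M.+1)%N by apply: leq_trans (size_fiber _ _) (size_poly _ _).
have sg : (size (fiber G b) <= M.+1)%N by apply: leq_trans (size_fiber _ _) (leqSpred _).
rewrite (horner_coef_wide _ sa) (horner_coef_wide _ sg) mulr_sumr; apply: eq_bigr => j _.
rewrite !coef_fiber /anorm coef_poly ltn_ord.
have [e|ne] := eqVneq (j : nat) M.
  have ephi : phi.[b] ^+ M = phi.[b] ^+ M.-1 * phi.[b] by rewrite -exprSr prednK.
  by rewrite e hornerC mul1r !exprMn ephi -/phi; ring.
have jM : (j < M)%N by rewrite ltn_neqAle ne -ltnS ltn_ord.
rewrite !hornerM horner_exp -polyC_natr hornerC !exprMn natrX.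
have -> : M%:R ^+ M = M%:R ^+ (M - j) * M%:R ^+ j :> F by rewrite -exprD subnK // ltnW.
have -> : phi.[b] ^+ M.-1 = phi.[b] ^+ (M.-1 - j) * phi.[b] ^+ j.
  by rewrite -exprD subnK // -ltnS prednK.
ring.
Qed.

(** An identity would give $M\phi t+\sigma$ the logarithmic derivative of $\phi^{(M-1)/M}$, or make
    it zero; its own equation then leaves $\gamma t+\delta=0$, against independence. This bounds the
    number of maps of the family that send a given point to a given point. *)
Lemma no_fixed_point t c : (M%:R * phi * t%:P + sig) ^+ M != c *: phi ^+ M.-1.
Proof.
set s := M%:R * phi * t%:P + sig; apply/eqP => e.
have M0F : (M%:R : {poly F}) != 0 by rewrite -polyC_natr polyC_eq0 pnatr_eq0 -lt0n.
have hs : l * s^`() = M.-1%:R * gam * s + M%:R * phi * (gam * t%:P + del).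
  rewrite /s derivD !derivM derivC mulr0 addr0 deriv_nat mul0r add0r mulrDr sig_rel.
  rewrite (_ : l * (M%:R * phi^`() * t%:P) = M%:R * t%:P * (l * phi^`())); last by ring.
  have eM : (M%:R : {poly F}) = 1 + M.-1%:R by rewrite -[in LHS](prednK M0) -natr1 addrC.
  by rewrite phi_rel eM; ring.
have nz : gam * t%:P + del != 0.
  apply/eqP => h; have e1 : t *: gam + 1 *: del = 0 by rewrite scale1r -mul_polyC mulrC.
  by have [_ /eqP] := indep e1; rewrite oner_eq0.
suff : M%:R * phi * (gam * t%:P + del) = 0.
  by move/eqP; rewrite !mulf_eq0 (negbTE M0F) (negbTE phi0) (negbTE nz).
have [s0|s0] := eqVneq s 0; first by move: hs; rewrite s0 deriv0 !mulr0 add0r.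
have hd : l * (s ^+ M)^`() = M.-1%:R * (M%:R * gam) * s ^+ M.
  rewrite e derivZ -[c *: _]mul_polyC mulrCA.
  have -> : l * (phi ^+ M.-1)^`() = M.-1%:R * (M%:R * gam) * phi ^+ M.-1.
    rewrite deriv_exp; case: (M.-1) => [|k]; first by rewrite mulr0n mulr0 !mul0r.
    by rewrite mulrnAr [l * (_ * _)]mulrA phi_rel /= exprS -mulr_natl; ring.
  by rewrite -mul_polyC; ring.
have hd2 : l * (s ^+ M)^`() = M%:R * s ^+ M.-1 * (l * s^`()).
  by rewrite deriv_exp -mulr_natl; ring.
have sM : s ^+ M = s ^+ M.-1 * s by rewrite -exprSr prednK.
have : M%:R * s ^+ M.-1 * (l * s^`() - M.-1%:R * gam * s) = 0.
  by rewrite mulrBr -hd2 hd sM; ring.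
move/eqP; rewrite !mulf_eq0 (negbTE M0F) expf_eq0 (negbTE s0) andbF /= subr_eq0 hs.
by move=> /eqP h; rewrite -[LHS](addKr (M.-1%:R * gam * s)) h addNr.
Qed.

End Normalization.

Lemma root_list (F : closedFieldType) (p : {poly F}) : p != 0 ->
  exists rs : seq F, (size rs <= (size p).-1)%N /\ forall x, p.[x] = 0 -> x \in rs.
Proof.
move=> p0; have [rs hrs] := closed_field_poly_normal p; exists rs; split.
  have := congr1 (fun q : {poly F} => size q) hrs.
  by rewrite size_scale ?lead_coef_eq0 // size_prod_XsubC => ->.
by move=> x /eqP; rewrite -rootE hrs rootZ ?lead_coef_eq0 // root_prod_XsubC.
Qed.

(** [affine_maps_bound] is applied with [K ^ 2] in the role of [K], whence the factor 2; the summand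
    2 pays for the zeros of $\phi$ and the pigeonholing. *)
Definition affine_exponent s : nat := (2 * aff_exponent s.+1 + 2)%N.

Section Affine.
Variable R : realType.
Local Notation C := R[i].

Theorem affine_bound (f : {poly {poly C}}) : partx f != 0 -> affine_type f ->
  forall s : nat, (0 < s)%N -> exists K0 : nat, forall (TA TB TD : finType)
    (pa : TA -> C) (lt : TB -> C) (zd : TD -> C) (K : nat),
  injective pa -> injective lt -> injective zd ->
  (forall a b, exists z, f.[(pa a)%:P].[lt b] = zd z) ->
  (K0 <= K)%N -> (K ^ affine_exponent s <= #|TB|)%N -> (#|TB| <= #|TA|)%N ->
  (#|TA| <= K ^ (affine_exponent s * s))%N -> (#|TD| <= K * #|TA|)%N -> False.
Proof.
move=> fx [h [G [l [gam [del [hh fE l0 hG indep]]]]]] s s0.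
pose M := (size G).-1; pose phi := G`_M; pose sig := G`_M.-1; pose H := hnorm G.
have M0 : (0 < M)%N.
  rewrite lt0n; apply: contraNneq fx => e.
  have sz : (size G <= 1)%N by rewrite -subn_eq0 subn1 -/M e.
  by rewrite fE (size1_polyC sz) comp_polyC /partx derivC.
have ph0 : phi != 0 := phi0 M0.
have MC : (M%:R : C) != 0 by rewrite pnatr_eq0 -lt0n.
have HM : H`_M = 1.
  have sa : size (anorm G) = M.+1.
    by apply: size_poly_eq; rewrite eqxx oner_neq0.
  have la : lead_coef (anorm G) = 1 by rewrite lead_coefE sa /= coef_poly ltnSn eqxx.
  have sh : size H = M.+1 by rewrite /H /hnorm -polyCN size_comp_poly2 ?size_XaddC.
  have -> : H`_M = lead_coef H by rewrite lead_coefE sh.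
  by rewrite /H /hnorm -polyCN lead_coef_comp ?size_XaddC // la lead_coefXaddC expr1n mulr1.
have hk (i : 'I_M.+1) : exists k, H`_i ^+ M = k *: phi ^+ (M.-1 * (M - i)).
  by apply: (hnorm_const l0 hG M0); rewrite -ltnS.
have [kap hkap] := choice hk.
have hrs (i : 'I_M.+1) : exists rs : seq C, (size rs <= M)%N /\ forall x, x ^+ M = kap i -> x \in rs.
  have nz : 'X^M - (kap i)%:P != 0 by rewrite -size_poly_gt0 size_XnsubC.
  have [rs [h1 h2]] := root_list nz; exists rs; rewrite size_XnsubC // in h1; split=> // x hx.
  by apply: h2; rewrite !(hornerE, hornerXn) hx subrr.
have [rs {}hrs] := choice hrs.
pose alp b := M.-root phi.[b].
have alpM b : alp b ^+ M = phi.[b] by rewrite /alp rootCK.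
have alpS b : phi.[b] = alp b ^+ M.-1 * alp b by rewrite -exprSr prednK.
(* By [hnorm_const] its [M]-th power is the constant [kap i], so at most [M] values occur, whatever
   branch of the root [alp] takes. *)
pose ta b (i : nat) := (H`_i).[b] / alp b ^+ (M.-1 * (M - i)).
have ta_rs b (i : 'I_M.+1) : phi.[b] != 0 -> ta b i \in rs i.
  move=> pb; apply: (hrs i).2; rewrite /ta exprMn exprVn -exprM mulnC exprM alpM.
  rewrite -horner_exp hkap hornerZ horner_exp mulfK // expf_neq0 //.
have phi_nc c : phi - c%:P != 0.
  rewrite subr_eq0; apply/eqP => e; have := phi_rel hG; rewrite -/M -/phi e derivC mulr0 => /esym/eqP.
  rewrite -e !mulf_eq0 (negbTE ph0) orbF -polyC_natr polyC_eq0 (negbTE MC) /= => /eqP g0.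
  have e2 : 1 *: gam + 0 *: del = 0 by rewrite g0 scaler0 scale0r addr0.
  by have [/eqP] := indep _ _ e2; rewrite oner_eq0.
have [sb [_ hsb]] := root_list ph0.
pose C1 := (size phi).-1; pose C2 := (maxn (size phi) (size sig) * M)%N.
have [K0 hK0] := affine_maps_bound R C1 C2 s.+1.
pose cls := (M.+1 ^ M.+1)%N; pose dh := (size h).-1.
exists (2 + K0 + size sb + cls + M * dh)%N => TA TB TD pa lt zd K pai lti zdi hD hK hB hBA hA hDA.
have [k1 [k2 [k3 [k4 k5]]]] : [/\ 2 <= K, K0 <= K, size sb <= K & cls <= K /\ M * dh <= K]%N /\ True /\ True /\ True /\ True.
  by split=> //; move: hK; move: (M * dh)%N cls (size sb); clear; split; [lia|lia|lia|split; lia].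
case: k1 => K2 KK0 Ksb [Kcls KMd] {k2 k3 k4 k5}.
have K1 : (0 < K)%N by apply: leq_trans K2.
have KX m : (0 < K ^ m)%N by rewrite expn_gt0 K1.
have Kle i j : (i <= j)%N -> (K ^ i <= K ^ j)%N by move=> ij; rewrite leq_exp2l.
pose X := ((K ^ 2) ^ aff_exponent s.+1)%N.
pose good := [set b : TB | phi.[lt b] != 0].
pose cl (b : TB) : {ffun 'I_M.+1 -> 'I_M.+1} := [ffun i : 'I_M.+1 => inord (index (ta (lt b) i) (rs i))].
have cgood : (cls * X < #|good|)%N.
  have h1 : (#|TB| <= #|good| + size sb)%N.
    rewrite -(cardC [pred b | phi.[lt b] != 0]) -cardsE leq_add2l -cardsE.
    by apply: (card_le_seq lti) => b; rewrite !inE negbK => /eqP; apply: hsb.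
  have h2 : (K ^ 2 * X <= K ^ affine_exponent s)%N by rewrite /X -expnM -expnD Kle // addnC.
  have h3 : (cls * X <= K * X)%N by rewrite leq_mul2r Kcls orbT.
  have X0 : (0 < X)%N by rewrite /X !expn_gt0 K1.
  have h4 : (K * X + K < K ^ 2 * X)%N \/ (X <= 1)%N.
    have [|hX] := leqP X 1; [by right|left]; rewrite -mulnn; move: K2 hX; clear; nia.
  case: h4 => [h4|X1].
    by move: h1 h2 h3 h4 hB Ksb; move: #|good| #|TB| (K ^ affine_exponent s)%N (K * X)%N (K ^ 2 * X)%N (cls * X)%N; clear; lia.
  exfalso; move: X1; rewrite leqNgt /X -expnM => /negP; apply.
  by rewrite -[X in (X < _)%N](expn0 K) ltn_exp2l // muln_gt0 /aff_exponent /gain; clear; lia.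
have [y hy] : exists y, (X < #|[set b in good | cl b == y]|)%N.
  apply: contrapT => no; have := @leq_card_fibers _ _ good cl X; rewrite card_ffun !card_ord => hf.
  move: cgood; rewrite ltnNge => /negP; apply; apply: hf => y; rewrite leqNgt; apply/negP => hy.
  by apply: no; exists y.
pose cb b := (phi.[lt b] != 0) && (cl b == y).
pose TB' := {b : TB | cb b}.
have cTB' : (X < #|{: TB'}|)%N.
  rewrite card_sig; apply: leq_trans hy _; rewrite -cardsE; apply: subset_leq_card.
  by apply/subsetP => b; rewrite !inE.
have pb (b : TB') : phi.[lt (val b)] != 0 by have /andP[] := valP b.
have al0 (b : TB') : alp (lt (val b)) != 0.
  by apply: contraNneq (pb b) => e; rewrite -alpM e expr0n eqn0Ngt M0.
have [b0 _] : exists b0 : TB', true by have /card_gt0P [b0 _] := leq_ltn_trans (leq0n _) cTB'; exists b0.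
pose Gam := \poly_(i < M.+1) ta (lt (val b0)) i.
have same (b : TB') (i : 'I_M.+1) : ta (lt (val b)) i = ta (lt (val b0)) i.
  have /andP[p1 /eqP c1] := valP b; have /andP[p2 /eqP c2] := valP b0.
  have := congr1 (fun u : {ffun 'I_M.+1 -> 'I_M.+1} => nat_of_ord (u i)) (etrans c1 (esym c2)).
  rewrite !ffunE !inordK ?ltnS; last 2 first.
  - by apply: leq_trans (hrs i).1; rewrite ltnW // index_mem ta_rs.
  - by apply: leq_trans (hrs i).1; rewrite ltnW // index_mem ta_rs.
  by move=> /(congr1 (nth 0 (rs i))); rewrite !nth_index ?ta_rs.
(* From $M\phi t+\sigma=\alpha^{M-1}(M\alpha t+\sigma/\alpha^{M-1})$ with $\alpha^M=\phi$: within
   one class $M^MG(t,b)$ is the fixed polynomial [Gam] of an affine function of $t$. *)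
pose al (b : TB') := M%:R * alp (lt (val b)).
pose be (b : TB') := sig.[lt (val b)] / alp (lt (val b)) ^+ M.-1.
have GamE (b : TB') t : Gam.[al b * t + be b] = M%:R ^+ M * (fiber G (lt (val b))).[t].
  set c := lt (val b); set u := al b * t + be b; have a0 := al0 b; rewrite -/c in a0.
  have hu : M%:R * phi.[c] * t + sig.[c] = alp c ^+ M.-1 * u.
    rewrite /u /al /be -/c mulrDr [_ * (sig.[c] / _)]mulrCA mulfV ?expf_neq0 // mulr1.
    by rewrite alpS; ring.
  have := fiber_normal M0 t (pb b); rewrite -/M -/phi -/sig -/H -/c hu.
  have sH : (size (fiber H c) <= M.+1)%N by apply: leq_trans (size_fiber _ _) (size_hnorm G).
  rewrite (horner_coef_wide _ sH) => e.
  have az : alp c ^+ (M.-1 * M) != 0 by rewrite expf_neq0.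
  apply: (mulfI az); rewrite (horner_coef_wide _ (size_poly _ _)) mulr_sumr.
  transitivity (\sum_(i < M.+1) (fiber H c)`_i * (alp c ^+ M.-1 * u) ^+ i).
    apply: eq_bigr => i _; rewrite coef_poly ltn_ord coef_fiber -(same b i) /ta -/c exprMn -exprM.
    have -> : (M.-1 * M = M.-1 * (M - i) + M.-1 * i)%N by rewrite -mulnDr subnK // -ltnS.
    by rewrite exprD mulrACA [_ * (_ / _)]mulrC mulfVK // expf_neq0.
  by rewrite e -alpM -exprM [(M * M.-1)%N]mulnC mulrCA mulrA.
have Gam0 c : Gam - c%:P != 0.
  apply/eqP => e; have := congr1 (fun p : {poly C} => p`_M) e.
  rewrite coefB coef_poly ltnSn coefC coef0 gtn_eqF // subr0 /ta HM hornerC subnn muln0 expr0 divr1.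
  by move/eqP; rewrite oner_eq0.
have hlev (z : TD) : exists us : seq C, (size us <= M)%N /\ forall x, Gam.[x] = M%:R ^+ M * zd z -> x \in us.
  have [us [u1 u2]] := root_list (Gam0 (M%:R ^+ M * zd z)); exists us; split.
    apply: leq_trans u1 _; rewrite -subn1 leq_subLR add1n.
    apply: leq_trans (size_polyD _ _) _; rewrite size_polyN geq_max size_poly.
    by apply: leq_trans (size_polyC_leq1 _) _.
  by move=> x hx; apply: u2; rewrite !hornerE hx subrr.
have [us hus] := choice hlev.
pose D := undup (flatten [seq us z | z <- index_enum TD]).
pose s0' := undup [seq h.[pa a] | a <- index_enum TA].
have szD : (size D <= M * #|TD|)%N.
  apply: leq_trans (size_undup _) _; rewrite size_flatten /shape -map_comp sumnE big_map.
  rewrite mulnC -sum_nat_const; apply: leq_sum => z _ /=; exact: (hus z).1.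
have szs : (#|TA| <= dh * size s0')%N.
  have ms a : h.[pa a] \in s0' by rewrite mem_undup; apply/mapP; exists a; rewrite ?mem_index_enum.
  have := @leq_card_fibers _ _ setT (fun a => SeqSub (ms a)) dh.
  rewrite cardsT card_seq_sub ?undup_uniq // mulnC; apply=> w.
  have hw : h - (ssval w)%:P != 0.
    by rewrite -size_poly_gt0 size_polyDl ?size_polyN ?(leq_ltn_trans (size_polyC_leq1 _)) // ltnW.
  have [rr [r1 r2]] := root_list hw.
  apply: (@leq_trans (size rr)).
    apply: (card_le_seq pai) => a; rewrite !inE /= => /eqP e; apply: r2.
    by rewrite hornerD hornerN hornerC -e /= subrr.
  apply: leq_trans r1 _; rewrite /dh size_polyDl // size_polyN.
  by apply: leq_ltn_trans (size_polyC_leq1 _) hh.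
have szs2 : (size s0' <= #|TA|)%N.
  by apply: leq_trans (size_undup _) _; rewrite size_map -sum1_size sum1_card.
have A0 : (0 < #|TA|)%N by apply: leq_trans hBA; apply: leq_trans hB.
have s0pos : (0 < size s0')%N by rewrite lt0n; apply: contraTneq szs => ->; rewrite muln0 -ltnNge.
apply: (hK0 {: TB'}%type al be s0' D (K ^ 2)%N).
- by move=> b; rewrite mulf_neq0.
- move=> c; have [rr [r1 r2]] := root_list (phi_nc ((c / M%:R) ^+ M)).
  have li : injective (fun b : TB' => lt (val b)) by move=> b b' /lti /val_inj.
  apply: leq_trans (_ : size rr <= _)%N.
    apply: (card_le_seq li) => b; rewrite in_set => /eqP e; apply: r2.
    rewrite hornerD hornerN hornerC -e (_ : al b / M%:R = alp (lt (val b))) ?alpM ?subrr //.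
    by rewrite /al mulrC mulKf.
  apply: leq_trans r1 _; rewrite /C1 -subn1 leq_subLR add1n prednK ?size_poly_gt0 //.
  apply: leq_trans (size_polyD _ _) _; rewrite size_polyN geq_max leqnn.
  by apply: leq_trans (size_polyC_leq1 _) _; rewrite size_poly_gt0.
- move=> x u; have nz := no_fixed_point hG indep M0 x (u ^+ M); rewrite -/M -/phi -/sig -subr_eq0 in nz.
  have [rr [r1 r2]] := root_list nz.
  have li : injective (fun b : TB' => lt (val b)) by move=> b b' /lti /val_inj.
  apply: leq_trans (_ : size rr <= _)%N.
    apply: (card_le_seq li) => b; rewrite in_set => /eqP e; apply: r2.
    rewrite hornerD hornerN hornerZ !horner_exp hornerD !hornerM -polyC_natr !hornerC.
    have ez := expf_neq0 M.-1 (al0 b).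
    have -> : M%:R * phi.[lt (val b)] * x + sig.[lt (val b)] = alp (lt (val b)) ^+ M.-1 * u.
      rewrite -e /al /be mulrDr [_ * (sig.[_] / _)]mulrCA mulfV // mulr1.
      by rewrite alpS; ring.
    by rewrite exprMn -exprM mulnC exprM alpM mulrC subrr.
  apply: leq_trans r1 _; rewrite -subn1 leq_subLR add1n.
  apply: leq_trans (size_polyD _ _) _; rewrite size_polyN geq_max; apply/andP; split.
    apply: leq_trans (size_poly_exp_leq _ _) _; rewrite ltnS leq_mul2r; apply/orP; right.
    rewrite -subn1 leq_subLR; apply: leq_trans (size_polyD _ _) _.
    rewrite -polyC_natr mulrAC -polyCM mul_polyC; apply: (@leq_trans (maxn (size phi) (size sig))); last exact: leqnSn.
    by rewrite geq_max !leq_max leqnn orbT andbT size_scale_leq.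
  apply: leq_trans (size_scale_leq _ _) _; apply: leq_trans (size_poly_exp_leq _ _) _.
  by rewrite ltnS leq_mul // ?leq_pred // leq_max -subn1 leq_subr.
- exact: undup_uniq.
- exact: undup_uniq.
- move=> b t; rewrite mem_undup => /mapP[a _ ->]; rewrite mem_undup.
  have [z hz] := hD a (val b); apply/flatten_mapP; exists z; first by rewrite mem_index_enum.
  apply: (hus z).2; rewrite GamE -hz -horner_fiber fE; congr (_ * _).
  have -> : fiber (G \Po h^:P) (lt (val b)) = fiber G (lt (val b)) \Po h.
    by rewrite -[h in RHS](fiber_lift h (lt (val b))) /fiber map_comp_poly.
  by rewrite horner_comp.
- by apply: leq_trans KK0 _; rewrite -mulnn leq_pmull.
- exact: ltnW cTB'.
- exact: s0pos.
- apply: leq_trans szs2 (leq_trans hA _); rewrite -expnM; apply: Kle.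
  have : (s <= aff_exponent s.+1)%N.
    have hl j : (j <= loss j)%N by elim: j => // j IH /=; move: IH; clear; lia.
    rewrite /aff_exponent /gain; apply: (@leq_trans (loss (steps s.+1))); last by clear; lia.
    by apply: leq_trans (hl _); rewrite /steps; clear; lia.
  by rewrite /affine_exponent; move: (aff_exponent _); clear; nia.
- apply: leq_trans szD _; apply: leq_trans (leq_mul (leqnn M) hDA) _.
  apply: leq_trans (leq_mul (leqnn M) (leq_mul (leqnn K) szs)) _.
  rewrite (_ : M * (K * (dh * size s0')) = (M * dh) * K * size s0')%N; last by clear; ring.
  by rewrite -mulnn leq_mul2r leq_mul2r KMd !orbT.
Qed.
End Affine.

From mathcomp Require Import finmap exp.

(** * Choice of parameters and conclusion *)

Lemma floor_root E m : (0 < E)%N -> exists K, (K ^ E <= m < K.+1 ^ E)%N.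
Proof.
move=> E0; elim: m => [|m [K /andP[h1 h2]]]; first by exists 0%N; rewrite exp0n ?exp1n.
have [h3|h3] := leqP (K.+1 ^ E) m.+1; last by exists K; rewrite h3 ltnW.
exists K.+1; rewrite h3 /=; apply: leq_ltn_trans h2 _.
by rewrite ltn_exp2r.
Qed.

Lemma lossE j : (loss j + 2 = 7 * 2 ^ j)%N.
Proof. by elim: j => //= j IH; rewrite expnS; move: IH; move: (2 ^ j)%N (loss j); clear; lia. Qed.

Lemma affine_exponent_le s : (affine_exponent s <= 2 ^ (6 * s + 20))%N.
Proof.
rewrite /affine_exponent /aff_exponent /gain /steps; set t := (6 * s)%N.
have -> : (6 * s.+1 + 3 = t + 9)%N by rewrite /t; clear; lia.
rewrite (_ : t + 20 = t + 9 + 11)%N; last by move: t; clear; lia.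
rewrite (expnD _ (t + 9)); have := lossE (t + 9).
have : (0 < 2 ^ (t + 9))%N by rewrite expn_gt0.
have -> : (2 ^ 11 = 2048)%N by [].
by move: (2 ^ (t + 9))%N (loss _); clear; lia.
Qed.

Lemma inf_exponent_le s : (inf_exponent s <= 2 ^ (6 * s + 20))%N.
Proof.
have h : (s.+1 <= 2 ^ s)%N by apply: ltn_expl.
rewrite (_ : 6 * s + 20 = s * 6 + (10 + 10))%N; last by clear; lia.
have e : (2 ^ 10 = 1024)%N by [].
rewrite (expnD _ (s * 6)) (expnD _ 10) e expnM /inf_exponent; clear e.
move: h; move: (2 ^ s)%N => x h; have x1 : (1 <= x)%N by apply: leq_trans h.
have x3 : (x ^ 3 <= x ^ 6)%N by rewrite leq_pexp2l.
have x2 : (x ^ 2 <= x ^ 3)%N by rewrite leq_pexp2l.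
have x4 : (x ^ 1 <= x ^ 2)%N by rewrite leq_pexp2l.
have s3 : (s ^ 3 <= x ^ 3)%N by rewrite leq_exp2r // ltnW.
have s2 : (s ^ 2 <= x ^ 2)%N by rewrite leq_exp2r // ltnW.
apply: (@leq_trans (9 * s ^ 3 + 12 * s ^ 2 + 14 * s + 22)); first by apply/eq_leq; clear; ring.
rewrite expn1 in x4; move: x1 x2 x3 x4 s2 s3 h.
by move: (x ^ 6)%N (x ^ 2)%N (x ^ 3)%N (s ^ 3)%N (s ^ 2)%N; clear; lia.
Qed.

Section Final.
Local Open Scope fset_scope.
Variable R : realType.
Local Notation C := R[i].

(** The common shape of [affine_bound] and [nonaffine_bound], in which sizes are compared with
    powers of one integer [K]. *)
Definition level_bound (f : {poly {poly C}}) (E s : nat) : Prop :=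
  exists K0 : nat, forall (TA TB TD : finType)
    (pa : TA -> C) (lt : TB -> C) (zd : TD -> C) (K : nat),
  injective pa -> injective lt -> injective zd ->
  (forall a b, exists z, f.[(pa a)%:P].[lt b] = zd z) ->
  (K0 <= K)%N -> (K ^ E <= #|TB|)%N -> (#|TB| <= #|TA|)%N ->
  (#|TA| <= K ^ (E * s))%N -> (#|TD| <= K * #|TA|)%N -> False.

(** Take for [K] the integer part of $|B|^{1/E}$. Then $|A|\le|B|^s<(K+1)^{Es}\le K^{2Es}$, which
    explains the doubled [s], and $|A|^\delta\le K$ because $2Es\delta\le1$. *)
Lemma image_growth (f : {poly {poly C}}) (E s : nat) (eps del : R) :
  (0 < E)%N -> 0 < eps -> 1 <= eps * s%:R -> 0 <= del ->
  (E * s.*2)%:R * del <= 1 -> level_bound f E s.*2 ->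
  exists C0 : R, forall A B : {fset C},
    (#|` B| <= #|` A|)%N -> (#|` A|%:R : R) `^ eps <= #|` B|%:R ->
    C0 <= (#|` A|%:R : R) `^ eps ->
    (#|` A|%:R : R) `^ (1 + del) <= #|` poly_image f A B|%:R.
Proof.
move=> E0 eps0 eps_s del0 Edel [K0 hK0]; exists ((maxn K0 2).+1 ^ E)%N%:R => A B hBA hB hC.
rewrite leNgt; apply/negP => hD.
have [K /andP[K1 K2]] := floor_root (#|` B|) E0.
have hK : (maxn K0 2 <= K)%N.
  suff : ((maxn K0 2).+1 < K.+1)%N by rewrite ltnS => /ltnW.
  by rewrite -(ltn_exp2r _ _ E0); apply: leq_ltn_trans K2; rewrite -(ler_nat R) (le_trans hC).
have [KK0 Kge2] : (K0 <= K)%N /\ (2 <= K)%N by move: hK; rewrite geq_max => /andP.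
have Kpos : (0 < K)%N by apply: ltnW.
have Bpos : (0 < #|` B|)%N by apply: leq_trans K1; rewrite expn_gt0 Kpos.
have Apos : (0 < #|` A|)%N by apply: leq_trans hBA.
have hA : (#|` A| <= K ^ (E * s.*2))%N.
  have hAB : (#|` A| <= #|` B| ^ s)%N.
    rewrite -(ler_nat R) natrX -powR_mulrn ?ler0n //.
    rewrite -[X in X <= _]powRr1 ?ler0n //; apply: le_trans (ler_powR _ eps_s) _; first by rewrite ler1n.
    by rewrite powRrM; apply: ge0_ler_powR hB; rewrite ?nnegrE ?ler0n ?powR_ge0.
  have leq_exp2r' e a b : (a <= b)%N -> (a ^ e <= b ^ e)%N by case: e => // e ab; rewrite leq_exp2r.
  apply: leq_trans hAB _; apply: leq_trans (leq_exp2r' s _ _ (ltnW K2)) _.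
  have kk : (K.+1 <= K ^ 2)%N by rewrite -mulnn; move: Kge2; clear; nia.
  apply: leq_trans (leq_exp2r' s _ _ (leq_exp2r' E _ _ kk)) _.
  by rewrite -!expnM -mul2n mulnCA mulnA.
have hDK : (#|` poly_image f A B| <= K * #|` A|)%N.
  rewrite -(ler_nat R); apply: ltW; apply: lt_le_trans hD _.
  have A0 : (#|` A|%:R : R) != 0 by rewrite pnatr_eq0 -lt0n.
  rewrite powRD; last by rewrite A0 implybT.
  rewrite powRr1 ?ler0n // natrM mulrC ler_wpM2r ?ler0n //.
  apply: (@le_trans _ _ ((K ^ (E * s.*2))%N%:R `^ del)).
    by apply: ge0_ler_powR; rewrite ?nnegrE ?ler0n ?ler_nat.
  rewrite natrX -powR_mulrn ?ler0n // -powRrM -[X in _ <= X]powRr1 ?ler0n //.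
  by apply: ler_powR Edel; rewrite ler1n.
have hf (a : A) (b : B) : exists z : poly_image f A B, f.[(val a)%:P].[val b] = val z.
  have h : f.[(val a)%:P].[val b] \in poly_image f A B by apply: in_imfset2; exact: valP.
  by exists [` h].
by apply: (hK0 A B (poly_image f A B) val val val K val_inj val_inj val_inj hf KK0); rewrite -?cardfE.
Qed.

(** With $s\le2/\varepsilon$, the product $E(2s)\cdot2s$ is at most
    $2^{12s+20}\cdot2^s\le2^{34s}\le2^{68/\varepsilon}$, the origin of 68. *)
Lemma image_growth_scaled (f : {poly {poly C}}) (E : nat -> nat) (eps : R) :
  0 < eps -> eps <= 1 -> (forall s, (0 < E s <= 2 ^ (6 * s + 20))%N) ->
  (forall s, (0 < s)%N -> level_bound f (E s) s) ->
  exists C0 : R, forall A B : {fset C},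
    (#|` B| <= #|` A|)%N -> (#|` A|%:R : R) `^ eps <= #|` B|%:R ->
    C0 <= (#|` A|%:R : R) `^ eps ->
    (#|` A|%:R : R) `^ (1 + 2 `^ (- 68 * eps^-1)) <= #|` poly_image f A B|%:R.
Proof.
move=> eps0 eps1 hE hb; set s := (Num.truncn eps^-1).+1.
have ie1 : 1 <= eps^-1 by rewrite invf_ge1.
have hs : eps^-1 < s%:R by apply: truncnS_gt.
have hs2 : s%:R <= 2 * eps^-1.
  have /andP[h _] := truncn_itv (le_trans ler01 ie1).
  by rewrite /s -natr1; move: h ie1; clear; lra.
apply: (@image_growth _ (E s.*2) s) => //.
- by have /andP[] := hE s.*2.
- by rewrite mulrC -ler_pdivrMr // mul1r ltW.
- exact: powR_ge0.
- have h : (E s.*2 * s.*2 <= 2 ^ (34 * s))%N.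
    have /andP[_ h1] := hE s.*2.
    have h2 : (s.*2 <= 2 ^ s)%N by rewrite -mul2n /s expnS leq_mul2l ltn_expl.
    apply: leq_trans (leq_mul h1 h2) _; rewrite -expnD leq_exp2l // -mul2n.
    by rewrite /s; move: (Num.truncn _); clear; lia.
  have h3 : ((E s.*2 * s.*2)%N%:R : R) <= 2 `^ (34 * s%:R).
    by rewrite -natrM powR_mulrn // -natrX ler_nat.
  apply: le_trans (ler_wpM2r (powR_ge0 _ _) h3) _.
  rewrite -powRD; last by rewrite pnatr_eq0 implybT.
  rewrite -[X in _ <= X](powRr0 2); apply: ler_powR; first by rewrite ler1n.
  by move: hs2; clear; lra.
- exact: hb.
Qed.
End Final.

Local Open Scope fset_scope.

Theorem theorem1p4 (R : realType) :
  exists c : R,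
    forall f : {poly {poly R[i]}},
      ~ additive_poly f -> ~ multiplicative_poly f ->
      forall eps : R, 0 < eps ->
        exists C : R,
          forall A B : {fset R[i]},
            (#|` B| <= #|` A|)%N ->
            (#|` A|%:R : R) `^ eps <= #|` B|%:R ->
            C <= (#|` A|%:R : R) `^ eps ->
            (#|` A|%:R : R) `^ (1 + 2 `^ (- c * eps^-1))
              <= #|` poly_image f A B|%:R.
Proof.
exists 68 => f na nm eps eps0.
have fx : partx f != 0 by apply/eqP => /additive_of_partx0.
have fy : party f != 0 by apply/eqP => /additive_of_party0.
have [eps1|eps1] := leP eps 1.
  have [aff|naff] := EM (affine_type f).
    apply: (image_growth_scaled (E := affine_exponent)) => // [s|s s0].
      by rewrite affine_exponent_le andbT /affine_exponent addn2.
    exact: affine_bound.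
  apply: (image_growth_scaled (E := inf_exponent)) => // [s|s s0].
    by rewrite inf_exponent_le andbT /inf_exponent; clear; lia.
  exact: nonaffine_bound.
(* For $\varepsilon>1$ the hypotheses give $|A|^\varepsilon\le|A|$, impossible for a set of at least
   two points, which the constant 2 guarantees. *)
exists 2 => A B hBA hB hC; exfalso.
have hn : (#|` A|%:R : R) `^ eps <= #|` A|%:R by apply: le_trans hB _; rewrite ler_nat.
have h2 : (1 : R) < #|` A|%:R by apply: lt_le_trans (le_trans hC hn); rewrite ltr1n.
have A0 : (0 : R) < #|` A|%:R by apply: lt_trans h2.
move: hn; rewrite -(mulr_powRB1 (ltW A0) eps0) leNgt -[X in X < _]mulr1 ltr_pM2l // => /negP; apply.
have e1 : (1 : R) `^ (eps - 1) = 1 by apply/eqP; rewrite powR_eq1 eqxx.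
rewrite -[X in X < _]e1; apply: gt0_ltr_powR; rewrite ?nnegrE ?ler01 ?ltW ?subr_gt0 //.
Qed.
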